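(* Let $\mathcal Z:\Sigma\to\mathbb R^3$ be a non totally umbilical minimal immersion with Weierstrass data $(\omega,g)$, and let $h$ be a solution of the ordinary differential equation $$dh=k\,h^2\,\omega-dg\qquad\text{on }\Sigma$$ such that $$\Re\int_\gamma\frac{dg}{h}=0\qquad\text{for any loop }\gamma\text{ on }\Sigma ,$$ where $k$ is a non-zero real constant. If $\widetilde\Sigma=\{p\in\Sigma : h(p)\neq0\}$, then there exists a well-defined minimal immersion $\widetilde{\mathcal Z}:\widetilde\Sigma\to\mathbb R^3$ with Weierstrass data $$\Big(\frac1{k\,h^2}\,dg,\ g+h\Big)$$ such that $(\mathcal Z,\widetilde{\mathcal Z})$ is a Ribaucour integrable pair. Conversely, any minimal Ribaucour integrable pair $(\mathcal Z,\widetilde{\mathcal Z})$ can be obtained in this way.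
   Context: $\Sigma$ is an oriented surface with the conformal (Riemann surface) structure induced by $\mathcal Z$, and $\Re$ denotes the real part. Weierstrass data $(\omega,g)$ of a minimal immersion $\mathcal Z$ with Gauss map $\mathcal N$: $g=\Pi\circ\mathcal N$, where $\Pi:\mathbb S^2\to\mathbb C\cup\{\infty\}$ is stereographic projection, $\omega$ is a complex 1-form, and $\mathcal Z=\Re\int\big(\tfrac12(1-g^2)\omega,\tfrac i2(1+g^2)\omega,g\,\omega\big)$ up to translation; the first fundamental form is $\tfrac14(1+|g|^2)^2|\omega|^2$. A smooth map $\mathcal Z:\Sigma\to\mathbb R^3$ is a frontal if it has a smooth unit normal $\mathcal N:\Sigma\to\mathbb S^2$, i.e. $\langle d\mathcal Z,\mathcal N\rangle=0$. Two frontals $\mathcal Z,\widetilde{\mathcal Z}$ with unit normals $\mathcal N,\widetilde{\mathcal N}$, $\mathcal N\neq\widetilde{\mathcal N}$ everywhere, form a Ribaucour integrable pair $(\mathcal Z,\widetilde{\mathcal Z})$ if they are envelopes of a congruence of spheres (there is a function $\tau$ with $\mathcal Z+\tau\mathcal N=\widetilde{\mathcal Z}+\tau\widetilde{\mathcal N}$, the centers of spheres of radius $\tau$) and $\Re\int_\gamma\frac{d\widetilde{\mathcal G}}{\widetilde{\mathcal G}-\mathcal G}=0$ for any loop $\gamma$ in the domain, where $\mathcal G=\Pi\circ\mathcal N$ and $\widetilde{\mathcal G}=\Pi\circ\widetilde{\mathcal N}$. The pair is called minimal if both $\mathcal Z$ and $\widetilde{\mathcal Z}$ are minimal.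
   Formalization: Z~ is minimal, immersed exactly off the umbilics of Z (dg=0 gives branch points); Σ~ omits points where g and g+h are both infinite; in the converse Z~ (branch points allowed) is assumed conformal for Σ with oriented normal N~, since e.g. a plane or mirror-image partner is a counterexample. *)

(* Defs.v *)
From Stdlib Require Import Reals.
From Coquelicot Require Import Coquelicot.

Set Implicit Arguments.
Unset Strict Implicit.

Open Scope R_scope.

(** * Vectors of R^3 and the extended complex plane *)

Definition R3 : Type := (R * R * R)%type.
Definition X1 (v : R3) : R := fst (fst v).
Definition X2 (v : R3) : R := snd (fst v).
Definition X3 (v : R3) : R := snd v.

Definition add3 (v w : R3) : R3 := (X1 v + X1 w, X2 v + X2 w, X3 v + X3 w).
Definition scal3 (a : R) (v : R3) : R3 := (a * X1 v, a * X2 v, a * X3 v).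
Definition dot (v w : R3) : R := X1 v * X1 w + X2 v * X2 w + X3 v * X3 w.
Definition cross (v w : R3) : R3 :=
  (X2 v * X3 w - X3 v * X2 w,
   X3 v * X1 w - X1 v * X3 w,
   X1 v * X2 w - X2 v * X1 w).
Definition norm3 (v : R3) : R := sqrt (dot v v).

(** [None] is the point at infinity. *)
Definition Chat : Type := option C.
Definition infty : Chat := None.

Definition fin (w : Chat) : C := match w with Some z => z | None => RtoC 0 end.

Definition recip (w : Chat) : Chat :=
  match w with
  | None => Some (RtoC 0)
  | Some z => if Ceq_dec z (RtoC 0) then infty else Some (Cinv z)
  end.

(** Stereographic projection from the north pole (0,0,1); with the Weierstrass
    formula used below this makes the Gauss map the positively oriented normal. *)
Definition stereo (n : R3) : Chat :=
  if Req_EM_T (X3 n) 1 then infty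
  else Some (X1 n / (1 - X3 n), X2 n / (1 - X3 n)).

(** * Riemann surfaces *)

(** Connected Hausdorff surface with a holomorphic atlas.  [par i] is the inverse
    of the coordinate [crd i]; only its values on the image of [dom i] matter.
    The topology is the one for which the charts are homeomorphisms onto open
    sets: [par_dom] says that [crd i] maps [dom i] and its intersections with the
    other chart domains onto open subsets of C.  Second countability is not
    required, being automatic for connected Riemann surfaces (Rado). *)
Record riemann_surface : Type := RiemannSurface {
  point :> Type;
  chart : Type;
  dom : chart -> point -> Prop;
  crd : chart -> point -> C;
  par : chart -> C -> point;
  dom_cover : forall p, exists i, dom i p;
  crdK : forall i p, dom i p -> par i (crd i p) = p;
  par_dom : forall i j p, dom i p -> dom j p ->
    locally (crd i p)
      (fun z => dom i (par i z) /\ crd i (par i z) = z /\ dom j (par i z));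
  transition_holomorphic : forall i j p, dom i p -> dom j p ->
    ex_derive (K := C_AbsRing) (V := C_NormedModule)
      (fun z => crd j (par i z)) (crd i p);
  hausdorff : forall p q, p <> q ->
    exists i j, dom i p /\ dom j q /\
    exists eps : posreal, forall z w,
      ball (crd i p) eps z -> ball (crd j q) eps w -> par i z <> par j w;
  inhabited_surface : exists _ : point, True;
  connected_surface : forall A : point -> Prop,
    (forall p i, A p -> dom i p -> locally (crd i p) (fun z => A (par i z))) ->
    (forall p i, ~ A p -> dom i p -> locally (crd i p) (fun z => ~ A (par i z))) ->
    (exists p, A p) -> forall p, A p
}.

Arguments dom {r}.
Arguments crd {r}.
Arguments par {r}.

Section Surface.

Variable S : riemann_surface.

Implicit Types (p q : S) (i j : chart S) (U : S -> Prop).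

Definition whole : S -> Prop := fun _ => True.

Definition near p (P : S -> Prop) : Prop :=
  forall i, dom i p -> locally (crd i p) (fun z => P (par i z)).

Definition is_open U : Prop := forall p, U p -> near p U.

(** ** Real calculus in a chart, with crd i = x + i y *)

Definition along_x i (f : S -> R) p : R -> R :=
  fun s => f (par i (s, Im (crd i p))).
Definition along_y i (f : S -> R) p : R -> R :=
  fun s => f (par i (Re (crd i p), s)).

Definition dx i (f : S -> R) : S -> R :=
  fun p => Derive (along_x i f p) (Re (crd i p)).
Definition dy i (f : S -> R) : S -> R :=
  fun p => Derive (along_y i f p) (Im (crd i p)).

Fixpoint class_C (n : nat) i U (f : S -> R) : Prop :=
  (forall p, U p -> dom i p ->
     continuous (fun z : C => f (par i z)) (crd i p)) /\
  match n with
  | O => True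
  | Datatypes.S m =>
      (forall p, U p -> dom i p ->
         ex_derive (along_x i f p) (Re (crd i p)) /\
         ex_derive (along_y i f p) (Im (crd i p))) /\
      class_C m i U (dx i f) /\ class_C m i U (dy i f)
  end.

Definition smooth U (f : S -> R) : Prop := forall n i, class_C n i U f.

Definition comp3 (X : R3 -> R) (Z : S -> R3) : S -> R := fun p => X (Z p).

Definition smooth3 U (Z : S -> R3) : Prop :=
  smooth U (comp3 X1 Z) /\ smooth U (comp3 X2 Z) /\ smooth U (comp3 X3 Z).

Definition dx3 i (Z : S -> R3) : S -> R3 :=
  fun p => (dx i (comp3 X1 Z) p, dx i (comp3 X2 Z) p, dx i (comp3 X3 Z) p).
Definition dy3 i (Z : S -> R3) : S -> R3 :=
  fun p => (dy i (comp3 X1 Z) p, dy i (comp3 X2 Z) p, dy i (comp3 X3 Z) p).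

(** ** Frontals and minimal immersions *)

Definition frontal U (Z N : S -> R3) : Prop :=
  is_open U /\ smooth3 U Z /\ smooth3 U N /\
  (forall p, U p -> dot (N p) (N p) = 1) /\
  (forall p i, U p -> dom i p ->
     dot (dx3 i Z p) (N p) = 0 /\ dot (dy3 i Z p) (N p) = 0).

Definition first_E i (Z : S -> R3) p : R := dot (dx3 i Z p) (dx3 i Z p).
Definition first_F i (Z : S -> R3) p : R := dot (dx3 i Z p) (dy3 i Z p).
Definition first_G i (Z : S -> R3) p : R := dot (dy3 i Z p) (dy3 i Z p).

Definition second_e i (Z N : S -> R3) p : R := dot (dx3 i (dx3 i Z) p) (N p).
Definition second_f i (Z N : S -> R3) p : R := dot (dx3 i (dy3 i Z) p) (N p).
Definition second_g i (Z N : S -> R3) p : R := dot (dy3 i (dy3 i Z) p) (N p).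

Definition immersed_at (Z : S -> R3) p : Prop :=
  forall i, dom i p -> cross (dx3 i Z p) (dy3 i Z p) <> (0, 0, 0).

Definition mean_curvature i (Z N : S -> R3) p : R :=
  (second_e i Z N p * first_G i Z p - 2 * (second_f i Z N p * first_F i Z p)
     + second_g i Z N p * first_E i Z p)
  / (2 * (first_E i Z p * first_G i Z p - first_F i Z p ^ 2)).

Definition umbilic_at (Z N : S -> R3) p : Prop :=
  forall i, dom i p -> exists lambda : R,
    second_e i Z N p = lambda * first_E i Z p /\
    second_f i Z N p = lambda * first_F i Z p /\
    second_g i Z N p = lambda * first_G i Z p.

Definition totally_umbilical (Z N : S -> R3) : Prop :=
  forall p, umbilic_at Z N p.

(** The oriented conformal structure of S is the one induced by Z, and N is the
    positively oriented normal.  At the points where Z is not immersed this only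
    says that dZ = 0. *)
Definition oriented_conformal U (Z N : S -> R3) : Prop :=
  forall p i, U p -> dom i p ->
    first_E i Z p = first_G i Z p /\
    first_F i Z p = 0 /\
    cross (dx3 i Z p) (dy3 i Z p)
      = scal3 (norm3 (cross (dx3 i Z p) (dy3 i Z p))) (N p).

(** Minimal surface with Gauss map N, possibly with isolated branch points. *)
Definition minimal U (Z N : S -> R3) : Prop :=
  frontal U Z N /\ oriented_conformal U Z N /\
  (forall p, U p -> near p (fun q => q <> p -> immersed_at Z q)) /\
  (forall p i, U p -> dom i p -> immersed_at Z p -> mean_curvature i Z N p = 0).

Definition minimal_immersion U (Z N : S -> R3) : Prop :=
  minimal U Z N /\ forall p, U p -> immersed_at Z p.

(** ** Meromorphic functions and holomorphic forms *)

Definition dz i (f : S -> C) p : C :=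
  C_derive (fun z => f (par i z)) (crd i p).

Definition holomorphic_at (f : S -> C) p : Prop :=
  forall i, dom i p ->
    ex_derive (K := C_AbsRing) (V := C_NormedModule)
      (fun z => f (par i z)) (crd i p).

Definition finpart (g : S -> Chat) : S -> C := fun p => fin (g p).

Definition meromorphic U (g : S -> Chat) : Prop :=
  forall p, U p ->
    near p (fun q => g q <> infty /\ holomorphic_at (finpart g) q) \/
    (near p (fun q => recip (g q) <> infty /\
                      holomorphic_at (finpart (fun r => recip (g r))) q) /\
     ~ near p (fun q => g q = infty)).

(** A (1,0)-form is given by its coefficients: it reads (w i) d(crd i). *)
Definition form : Type := chart S -> S -> C.

Definition holomorphic_form U (w : form) : Prop :=
  (forall p i, U p -> dom i p ->
     ex_derive (K := C_AbsRing) (V := C_NormedModule)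
       (fun z => w i (par i z)) (crd i p)) /\
  (forall p i j, U p -> dom i p -> dom j p ->
     w i p = Cmult (w j p) (dz i (crd j) p)).

(** ** Weierstrass data *)

Definition weierstrass1 (w a : C) : C :=
  (RtoC (1 / 2) * (RtoC 1 - a * a) * w)%C.
Definition weierstrass2 (w a : C) : C :=
  (Ci * RtoC (1 / 2) * (RtoC 1 + a * a) * w)%C.
Definition weierstrass3 (w a : C) : C := (a * w)%C.

(** df is the real part of the form with coefficient phi in the chart i. *)
Definition real_part_form i p (f : S -> R) (phi : C) : Prop :=
  dx i f p = Re phi /\ dy i f p = - Im phi.

(** The formula for dZ is required where g is finite; the poles of g being
    isolated, it determines dZ on U. *)
Definition weierstrass_data U (Z N : S -> R3) (w : form) (g : S -> Chat) : Prop :=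
  holomorphic_form U w /\ meromorphic U g /\
  (forall p, U p -> g p = stereo (N p)) /\
  (forall p i a, U p -> dom i p -> g p = Some a ->
     real_part_form i p (comp3 X1 Z) (weierstrass1 (w i p) a) /\
     real_part_form i p (comp3 X2 Z) (weierstrass2 (w i p) a) /\
     real_part_form i p (comp3 X3 Z) (weierstrass3 (w i p) a)).

(** ** Periods *)

(** Piecewise C^1 loops in U, parametrized by [0,1]. *)
Definition loop U (c : R -> S) : Prop :=
  c 0 = c 1 /\
  (forall t, 0 <= t <= 1 -> U (c t)) /\
  exists (n : nat) (a : nat -> R), a O = 0 /\ a n = 1 /\
    forall m, (m < n)%nat -> a m < a (Datatypes.S m) /\
      exists (i : chart S) (x y : R -> R),
        (forall t, ex_derive x t /\ continuous (Derive x) t) /\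
        (forall t, ex_derive y t /\ continuous (Derive y) t) /\
        (forall t, a m <= t <= a (Datatypes.S m) ->
           dom i (c t) /\ crd i (c t) = (x t, y t)).

(** Re of the integral of dA / B along c is zero. *)
Definition zero_real_period (A B : S -> C) (c : R -> S) : Prop :=
  is_RInt (fun t => Re (Cdiv (Derive (fun s => Re (A (c s))) t,
                              Derive (fun s => Im (A (c s))) t)
                             (B (c t)))) 0 1 0.

(** ** Ribaucour integrable pairs *)

(** The loops are those in the domain where both Gauss images are finite. *)
Definition ribaucour_integrable_pair U (Z N Zt Nt : S -> R3) : Prop :=
  frontal U Z N /\ frontal U Zt Nt /\
  (forall p, U p -> N p <> Nt p) /\
  (exists tau : S -> R, forall p, U p ->
     add3 (Z p) (scal3 (tau p) (N p)) = add3 (Zt p) (scal3 (tau p) (Nt p))) /\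
  let G := fun p => stereo (N p) in
  let Gt := fun p => stereo (Nt p) in
  forall c, loop (fun p => U p /\ G p <> infty /\ Gt p <> infty) c ->
    zero_real_period (finpart Gt)
      (fun p => Cminus (finpart Gt p) (finpart G p)) c.

(** ** The Riccati equation and the transformed data *)

(** dh = k h^2 w - dg, away from the poles of g and h. *)
Definition riccati (k : R) (w : form) (g h : S -> Chat) : Prop :=
  forall p i a b, dom i p -> g p = Some a -> h p = Some b ->
    dz i (finpart h) p
      = Cminus (Cmult (Cmult (RtoC k) (Cmult b b)) (w i p)) (dz i (finpart g) p).

Definition riccati_periods (g h : S -> Chat) : Prop :=
  forall c,
    loop (fun p => g p <> infty /\ h p <> infty /\ h p <> Some (RtoC 0)) c ->
    zero_real_period (finpart g) (finpart h) c.

Definition riccati_setting (Z N : S -> R3) (w : form) (g : S -> Chat)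
    (k : R) (h : S -> Chat) : Prop :=
  minimal_immersion whole Z N /\ ~ totally_umbilical Z N /\
  weierstrass_data whole Z N w g /\
  k <> 0 /\ meromorphic whole h /\ riccati k w g h /\ riccati_periods g h.

(** gt is the meromorphic function g + h; its values at the poles of g or h are
    determined by meromorphy. *)
Definition meromorphic_sum (g h gt : S -> Chat) : Prop :=
  meromorphic whole gt /\
  forall p a b, g p = Some a -> h p = Some b -> gt p = Some (Cplus a b).

(** The points where h does not vanish.  At a pole of g the function h also has
    a pole, and the condition "h <> 0" must be read as "gt = g + h differs
    from g", i.e. gt is finite there. *)
Definition Sigma_tilde (g h gt : S -> Chat) : S -> Prop :=
  fun p => h p <> Some (RtoC 0) /\ ~ (g p = infty /\ gt p = infty).

(** wt = dg / (k h^2) *)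
Definition transformed_form (U : S -> Prop) (k : R) (g h : S -> Chat) (wt : form)
  : Prop :=
  forall p i a b, U p -> dom i p -> g p = Some a -> h p = Some b ->
    wt i p = Cdiv (dz i (finpart g) p) (Cmult (RtoC k) (Cmult b b)).

Definition has_transformed_data U (k : R) (g h gt : S -> Chat) (Zt Nt : S -> R3)
  : Prop :=
  exists wt : form,
    transformed_form U k g h wt /\ weierstrass_data U Zt Nt wt gt.

End Surface.

(* Main.v *)
Require Import Defs.
From Stdlib Require Import Reals Lra Lia Classical ClassicalEpsilon Nsatz.
From Coquelicot Require Import Coquelicot.

(** In a conformal coordinate [x + i y] a surface [Z] with normal [N] is minimal when
    [Z_y = N x Z_x] and [N_y = - N x N_x].  For a pair enveloping a congruence of spheres, let
    [n = N - Nt], let [R] be the reflection in the plane orthogonal to [n], and let [tau] be the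
    radius, so that [Zt = Z + tau n].  The contact condition amounts to
    [R (dZ + tau dN) = dZt + tau dNt]; conformality separates it into [dZt = tau R dN] and
    [R dZ = tau dNt], and these force [tau |n|^2] to be constant, say [- 1 / k].  In
    stereographic coordinates, with [h = gt - g], the equation [R dZ = tau dNt] reads
    [dgt = k h^2 omega], which is the Riccati equation, and [dZt = tau R dN] says that the first
    Weierstrass datum of [Zt] is [dg / (k h^2)].

    Conversely, a solution [h] defines [gt = g + h], hence [Nt], and [Zt] is given without
    integration by [Zt = Z - n / (k |n|^2)]; thus [Zt] has no periods.  The two period
    conditions differ by [d log |h|], which is exact.

    The poles of [g], [h] and [gt] are isolated, by Cauchy's theorem, and the identities found
    away from them extend by continuity. *)

Open Scope R_scope.

(** * Complex differentiability *)

(** The constant comes from one identity: [R] sends the tangent vector of [Z] with first Weierstrass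
    coefficient [c] to [- 1 / |n|^2] times the tangent vector of the sphere given, in the coordinate
    [gt], by [h^2 c]. So [R dZ = tau dNt] becomes [dgt = k h^2 omega] exactly when
    [tau |n|^2 = - 1 / k], and the constant cannot vanish because [R dZ = 0] is impossible for an
    immersion. The equation [dZt = tau R dN] makes [Zt] branch exactly at the umbilics of [Z]. This
    is why minimal surfaces are handled through the two rotation rules, which keep their meaning at
    branch points, and why the umbilics must be isolated: they are the zeros of a holomorphic
    function, hence isolated unless they fill the connected surface. Complex analysis is forced by
    two demands. Smoothness asks for real derivatives of every order of maps built from [g] and [h],
    and [g + h] needs a value at common poles, where a quotient of holomorphic germs has to be
    factored. *)

Ltac toC :=
  repeat match goal with x : UniformSpace.sort _ |- _ => change C in x end;
  match goal with |- @eq _ ?a ?b => change (@eq C a b) end.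
Ltac cring := toC; ring.
Ltac cfield := toC; field.

Notation cont f z := (continuous (T := C_UniformSpace) (U := C_UniformSpace) f z).
Notation contR f z := (continuous (T := C_UniformSpace) (U := R_UniformSpace) f z).
Notation locC z P := (locally (T := C_UniformSpace) z P).

(** Complex differentiability on the product neighbourhoods of C, the same topology as the one used
    for the real calculus in charts. *)
Definition cder (f : C -> C) (z l : C) : Prop :=
  forall eps : posreal,
    locC z (fun y => Cmod (f y - f z - (y - z) * l)%C <= eps * Cmod (y - z)%C).

Lemma cder_is_derive (f : C -> C) (z l : C) :
  is_derive (K := C_AbsRing) (V := C_NormedModule) f z l <-> cder f z l.
Proof.
split.
- intros [_ H] eps.
  assert (K : is_filter_lim (locally (T := AbsRing_UniformSpace C_AbsRing) z) z)
    by (intros P HP; exact HP).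
  specialize (H z K eps). apply locally_C in H. exact H.
- intros H; split.
  + apply is_linear_scal_l.
  + intros x Hx. apply (@is_filter_lim_locally_unique C_AbsRing (AbsRing_NormedModule C_AbsRing)) in Hx. subst x.
    intros eps. apply locally_C. exact (H eps).
Qed.

Lemma Cmod_le_Rabs (z : C) : Cmod z <= Rabs (Re z) + Rabs (Im z).
Proof.
unfold Cmod. apply Rsqr_incr_0_var.
- rewrite Rsqr_sqrt by nra. unfold Rsqr, Re, Im.
  generalize (Rabs_pos (fst z)) (Rabs_pos (snd z)); intros.
  rewrite <- (pow2_abs (fst z)), <- (pow2_abs (snd z)). nra.
- generalize (Rabs_pos (Re z)) (Rabs_pos (Im z)); lra.
Qed.

Lemma Re_le_Cmod (z : C) : Rabs (Re z) <= Cmod z.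
Proof. eapply Rle_trans; [apply Rmax_l | apply Rmax_Cmod]. Qed.

Lemma Im_le_Cmod (z : C) : Rabs (Im z) <= Cmod z.
Proof. eapply Rle_trans; [apply Rmax_r | apply Rmax_Cmod]. Qed.

Lemma Cmod_box (z y : C) (d : R) : Cmod (y - z)%C < d -> ball (M := C_UniformSpace) z d y.
Proof.
intros H; split; unfold ball; simpl; unfold AbsRing_ball, abs, minus, plus, opp; simpl.
- eapply Rle_lt_trans; [|exact H]. apply (Re_le_Cmod (y - z)%C).
- eapply Rle_lt_trans; [|exact H]. apply (Im_le_Cmod (y - z)%C).
Qed.

Lemma box_Cmod (z y : C) (d : R) : ball (M := C_UniformSpace) z d y -> Cmod (y - z)%C < 2 * d.
Proof.
intros [H1 H2]; unfold ball in *; simpl in *;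
  unfold AbsRing_ball, abs, minus, plus, opp in *; simpl in *.
eapply Rle_lt_trans; [apply Cmod_le_Rabs|].
unfold Re, Im; simpl. unfold Rminus in *. lra.
Qed.

Lemma box_iff (z y : C) (d : R) :
  ball (M := C_UniformSpace) z d y <-> Rabs (Re y - Re z) < d /\ Rabs (Im y - Im z) < d.
Proof. split; intros [H1 H2]; split; assumption. Qed.

Lemma locC_Cmod (z : C) (P : C -> Prop) :
  locC z P <-> exists d, 0 < d /\ forall y, Cmod (y - z)%C < d -> P y.
Proof.
split.
- intros [d H]. exists d; split; [apply cond_pos|]. intros y Hy. apply H, Cmod_box, Hy.
- intros (d & Hd & H). assert (Hd2 : 0 < d / 2) by lra.
  exists (mkposreal _ Hd2). intros y Hy. apply H. apply box_Cmod in Hy. simpl in Hy. lra.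
Qed.

Lemma cont_Cmod (f : C -> C) (z : C) :
  cont f z <->
  forall eps, 0 < eps -> exists d, 0 < d /\
    forall y, Cmod (y - z)%C < d -> Cmod (f y - f z)%C < eps.
Proof.
split.
- intros H eps He. apply (locC_Cmod z (fun y => Cmod (f y - f z)%C < eps)).
  assert (K : locC (f z) (fun w => Cmod (w - f z)%C < eps))
    by (apply locC_Cmod; exists eps; auto).
  exact (H _ K).
- intros H P HP. apply locC_Cmod in HP. destruct HP as (e & He & HP).
  destruct (H e He) as (d & Hd & K). apply (locC_Cmod z (fun y => P (f y))).
  exists d; auto.
Qed.

Lemma cont_pair {T : UniformSpace} (f : T -> C) (x : T) :
  continuous (U := R_UniformSpace) (fun y => Re (f y)) x ->
  continuous (U := R_UniformSpace) (fun y => Im (f y)) x ->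
  continuous (U := C_UniformSpace) f x.
Proof.
intros H1 H2. apply filterlim_locally. intros eps.
apply filterlim_locally with (eps := eps) in H1.
apply filterlim_locally with (eps := eps) in H2.
generalize (filter_and _ _ H1 H2). apply filter_imp. intros y [K1 K2]; split; assumption.
Qed.

Lemma cont_Re {T : UniformSpace} (f : T -> C) (x : T) :
  continuous (U := C_UniformSpace) f x -> continuous (U := R_UniformSpace) (fun y => Re (f y)) x.
Proof. intros H. apply (continuous_comp f fst x H). destruct (f x). apply continuous_fst. Qed.

Lemma cont_Im {T : UniformSpace} (f : T -> C) (x : T) :
  continuous (U := C_UniformSpace) f x -> continuous (U := R_UniformSpace) (fun y => Im (f y)) x.
Proof. intros H. apply (continuous_comp f snd x H). destruct (f x). apply continuous_snd. Qed.

(** * Continuity of algebraic operations *)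

Section RealContinuity.
Context {T : UniformSpace}.
Implicit Types (f g : T -> R) (x : T).
Lemma contr_plus f g x : continuous (U := R_UniformSpace) f x -> continuous (U := R_UniformSpace) g x ->
  continuous (U := R_UniformSpace) (fun y => f y + g y) x.
Proof. apply (continuous_plus (V := R_NormedModule)). Qed.
Lemma contr_minus f g x : continuous (U := R_UniformSpace) f x -> continuous (U := R_UniformSpace) g x ->
  continuous (U := R_UniformSpace) (fun y => f y - g y) x.
Proof. apply (continuous_minus (V := R_NormedModule)). Qed.
Lemma contr_opp f x : continuous (U := R_UniformSpace) f x ->
  continuous (U := R_UniformSpace) (fun y => - f y) x.
Proof. apply (continuous_opp (V := R_NormedModule)). Qed.
Lemma contr_mult f g x : continuous (U := R_UniformSpace) f x -> continuous (U := R_UniformSpace) g x ->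
  continuous (U := R_UniformSpace) (fun y => f y * g y) x.
Proof. apply (continuous_mult (K := R_AbsRing)). Qed.
Lemma contr_inv f x : continuous (U := R_UniformSpace) f x -> f x <> 0 ->
  continuous (U := R_UniformSpace) (fun y => / f y) x.
Proof. intros H H0. apply (continuous_comp f Rinv x H). apply continuous_Rinv, H0. Qed.
Lemma contr_div f g x : continuous (U := R_UniformSpace) f x -> continuous (U := R_UniformSpace) g x ->
  g x <> 0 -> continuous (U := R_UniformSpace) (fun y => f y / g y) x.
Proof. intros; apply contr_mult; auto. apply contr_inv; auto. Qed.

Lemma contc_plus (f g : T -> C) x : continuous (U := C_UniformSpace) f x ->
  continuous (U := C_UniformSpace) g x -> continuous (U := C_UniformSpace) (fun y => f y + g y)%C x.
Proof.
intros H K. apply cont_pair; unfold Cplus; simpl;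
apply contr_plus; (apply (cont_Re f x H) || apply (cont_Re g x K) || apply (cont_Im f x H) || apply (cont_Im g x K)).
Qed.
Lemma contc_opp (f : T -> C) x : continuous (U := C_UniformSpace) f x ->
  continuous (U := C_UniformSpace) (fun y => - f y)%C x.
Proof.
intros H. apply cont_pair; simpl; apply contr_opp; (apply (cont_Re f x H) || apply (cont_Im f x H)).
Qed.
Lemma contc_minus (f g : T -> C) x : continuous (U := C_UniformSpace) f x ->
  continuous (U := C_UniformSpace) g x -> continuous (U := C_UniformSpace) (fun y => f y - g y)%C x.
Proof. intros H K. apply contc_plus; [exact H | apply contc_opp; exact K]. Qed.
Lemma contc_mult (f g : T -> C) x : continuous (U := C_UniformSpace) f x ->
  continuous (U := C_UniformSpace) g x -> continuous (U := C_UniformSpace) (fun y => f y * g y)%C x.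
Proof.
intros H K. generalize (cont_Re f x H) (cont_Im f x H) (cont_Re g x K) (cont_Im g x K); intros.
apply cont_pair; unfold Cmult; simpl; [apply contr_minus | apply contr_plus]; apply contr_mult; assumption.
Qed.
Lemma contc_inv (f : T -> C) x : continuous (U := C_UniformSpace) f x -> f x <> 0%C ->
  continuous (U := C_UniformSpace) (fun y => / f y)%C x.
Proof.
intros H H0. generalize (cont_Re f x H) (cont_Im f x H); intros.
assert (N : fst (f x) * (fst (f x) * 1) + snd (f x) * (snd (f x) * 1) <> 0).
{ intro E. apply H0. destruct (f x) as [a b]; simpl in *.
  assert (a = 0) by nra. assert (b = 0) by nra. subst; reflexivity. }
apply cont_pair; unfold Cinv; simpl.
- apply contr_div; auto. apply contr_plus; apply contr_mult; auto; apply contr_mult; auto; apply continuous_const.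
- apply contr_div; auto. apply contr_opp; auto. apply contr_plus; apply contr_mult; auto; apply contr_mult; auto; apply continuous_const.
Qed.
End RealContinuity.

(** Caratheodory's form of differentiability. *)
Lemma cder_slope (f : C -> C) (z l : C) :
  cder f z l <->
  exists q : C -> C, cont q z /\ q z = l /\ locC z (fun y => f y = f z + q y * (y - z))%C.
Proof.
split.
- intros H.
  set (q := fun y => if Ceq_dec y z then l else ((f y - f z) / (y - z))%C).
  assert (Hz : q z = l) by (unfold q; destruct (Ceq_dec z z); congruence).
  exists q; split; [|split; [exact Hz|]].
  + apply cont_Cmod. intros eps He.
    assert (He2 : 0 < eps / 2) by lra.
    specialize (H (mkposreal _ He2)). apply locC_Cmod in H. destruct H as (d & Hd & H).
    exists d; split; [exact Hd|]. intros y Hy. rewrite Hz. unfold q.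
    destruct (Ceq_dec y z) as [E|E].
    * replace (l - l)%C with (RtoC 0) by ring. rewrite Cmod_0. exact He.
    * assert (E0 : (y - z)%C <> 0%C) by (intro A; apply E; replace y with (y - z + z)%C by ring; rewrite A; ring).
      specialize (H y Hy). simpl in H.
      replace ((f y - f z) / (y - z) - l)%C with ((f y - f z - (y - z) * l) / (y - z))%C by (field; exact E0).
      rewrite Cmod_div by exact E0.
      assert (P : 0 < Cmod (y - z)%C) by (apply Cmod_gt_0; exact E0).
      apply Rmult_lt_reg_r with (1 := P). unfold Rdiv. rewrite Rmult_assoc, Rinv_l by lra. nra.
  + apply filter_forall. intros y. unfold q. destruct (Ceq_dec y z) as [E|E].
    * rewrite E; ring.
    * field. intro A; apply E; replace y with (y - z + z)%C by ring; rewrite A; ring.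
- intros (q & Hc & Hq & Hl) eps.
  apply cont_Cmod with (eps := eps) in Hc; [|apply cond_pos].
  apply (locC_Cmod z (fun y => Cmod (q y - q z)%C < eps)) in Hc.
  generalize (filter_and _ _ Hc Hl). apply filter_imp. intros y [H1 H2].
  rewrite H2. replace (f z + q y * (y - z) - f z - (y - z) * l)%C with ((q y - q z) * (y - z))%C by (rewrite Hq; ring).
  rewrite Cmod_mult. apply Rmult_le_compat_r; [apply Cmod_ge_0 | lra].
Qed.

Lemma cder_cont (f : C -> C) (z l : C) : cder f z l -> cont f z.
Proof.
intros H. apply cder_slope in H. destruct H as (q & Hc & _ & Hl).
apply continuous_ext_loc with (g := fun y => (f z + q y * (y - z))%C).
- revert Hl. apply filter_imp. intros y E; symmetry; exact E.
- apply contc_plus; [apply continuous_const|]. apply contc_mult; [exact Hc|].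
  apply contc_minus; [apply continuous_id | apply continuous_const].
Qed.

Lemma cder_ext_loc (f g : C -> C) (z l : C) :
  locC z (fun y => f y = g y) -> cder f z l -> cder g z l.
Proof.
intros H K eps. generalize (filter_and _ _ H (K eps)). apply filter_imp.
intros y [E A]. rewrite <- E, <- (locally_singleton _ _ H). exact A.
Qed.

Lemma cder_eq (f : C -> C) (z l l' : C) : cder f z l -> l = l' -> cder f z l'.
Proof. intros H E; rewrite <- E; exact H. Qed.

Lemma cder_ext (f g : C -> C) (z l : C) : (forall y, f y = g y) -> cder f z l -> cder g z l.
Proof. intros H. apply cder_ext_loc. apply filter_forall, H. Qed.

Lemma cder_unique (f : C -> C) (z l l' : C) : cder f z l -> cder f z l' -> l = l'.
Proof.
intros H K. apply cder_is_derive in H; apply cder_is_derive in K.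
apply is_C_derive_unique in H; apply is_C_derive_unique in K. congruence.
Qed.

Lemma cder_C_derive (f : C -> C) (z l : C) : cder f z l -> C_derive f z = l.
Proof. intros H. apply is_C_derive_unique, cder_is_derive, H. Qed.

Lemma cder_const (a z : C) : cder (fun _ => a) z 0%C.
Proof.
apply cder_slope. exists (fun _ => RtoC 0); split; [apply continuous_const|split; [reflexivity|]].
apply filter_forall. intros; cring.
Qed.

Lemma cder_id (z : C) : cder (fun y => y) z 1%C.
Proof.
apply cder_slope. exists (fun _ => RtoC 1); split; [apply continuous_const|split; [reflexivity|]].
apply filter_forall. intros; cring.
Qed.

Lemma cder_plus (f g : C -> C) (z a b : C) :
  cder f z a -> cder g z b -> cder (fun y => f y + g y)%C z (a + b)%C.
Proof.
intros H K. apply cder_slope in H; apply cder_slope in K. apply cder_slope.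
destruct H as (q & H1 & H2 & H3), K as (r & K1 & K2 & K3).
exists (fun y => q y + r y)%C. split; [apply contc_plus; assumption|].
split; [congruence|]. generalize (filter_and _ _ H3 K3). apply filter_imp.
intros y [E1 E2]. rewrite E1, E2. cring.
Qed.

Lemma cder_mult (f g : C -> C) (z a b : C) :
  cder f z a -> cder g z b -> cder (fun y => f y * g y)%C z (a * g z + f z * b)%C.
Proof.
intros H K. assert (Kc := cder_cont _ _ _ K).
apply cder_slope in H; apply cder_slope in K. apply cder_slope.
destruct H as (q & H1 & H2 & H3), K as (r & K1 & K2 & K3).
exists (fun y => q y * g y + f z * r y)%C. split.
- apply contc_plus; apply contc_mult; auto; apply continuous_const.
- split; [congruence|]. generalize (filter_and _ _ H3 K3). apply filter_imp.
  intros y [E1 E2]. rewrite E1, E2. cring.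
Qed.

Lemma cder_scal (c : C) (f : C -> C) (z a : C) :
  cder f z a -> cder (fun y => c * f y)%C z (c * a)%C.
Proof.
intros H. replace (c * a)%C with (0 * f z + c * a)%C by cring.
apply (cder_mult (fun _ => c) f); [apply cder_const | exact H].
Qed.

Lemma cder_opp (f : C -> C) (z a : C) : cder f z a -> cder (fun y => - f y)%C z (- a)%C.
Proof.
intros H. replace (- a)%C with (-(1) * a)%C by cring.
apply cder_ext with (f := fun y => (-(1) * f y)%C); [intros; ring|]. apply cder_scal, H.
Qed.

Lemma cder_minus (f g : C -> C) (z a b : C) :
  cder f z a -> cder g z b -> cder (fun y => f y - g y)%C z (a - b)%C.
Proof. intros H K. apply cder_plus; [exact H | apply cder_opp, K]. Qed.

Lemma Cmod_neq0_loc (f : C -> C) (z : C) : cont f z -> f z <> 0%C -> locC z (fun y => f y <> 0%C).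
Proof.
intros H H0. apply Cmod_gt_0 in H0. apply cont_Cmod with (eps := Cmod (f z)) in H; [|exact H0].
apply (locC_Cmod z (fun y => Cmod (f y - f z)%C < Cmod (f z))) in H.
revert H; apply filter_imp. intros y Hy E. rewrite E in Hy.
replace (0 - f z)%C with (- f z)%C in Hy by cring. rewrite Cmod_opp in Hy. lra.
Qed.

Lemma cder_inv (f : C -> C) (z a : C) :
  cder f z a -> f z <> 0%C -> cder (fun y => / f y)%C z (- a / (f z * f z))%C.
Proof.
intros H H0. assert (Hc := cder_cont _ _ _ H). assert (Hn := Cmod_neq0_loc _ _ Hc H0).
apply cder_slope in H. apply cder_slope. destruct H as (q & H1 & H2 & H3).
exists (fun y => - q y * / (f y * f z))%C. split.
- apply contc_mult; [apply contc_opp, H1|]. apply contc_inv.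
  + apply contc_mult; [exact Hc | apply continuous_const].
  + apply Cmult_neq_0; exact H0.
- split; [rewrite H2; reflexivity|].
  generalize (filter_and _ _ Hn H3). apply filter_imp. intros y [E1 E2].
  assert (E3 : (q y * (y - z) = f y - f z)%C) by (rewrite E2; cring).
  replace (- q y * / (f y * f z) * (y - z))%C with (- (q y * (y - z)) * / (f y * f z))%C by cring.
  rewrite E3. cfield. split; assumption.
Qed.

Lemma cder_div (f g : C -> C) (z a b : C) :
  cder f z a -> cder g z b -> g z <> 0%C ->
  cder (fun y => f y / g y)%C z ((a * g z - f z * b) / (g z * g z))%C.
Proof.
intros H K H0.
replace ((a * g z - f z * b) / (g z * g z))%C with (a * / g z + f z * (- b / (g z * g z)))%C by (cfield; exact H0).
apply (cder_mult f (fun y => / g y)%C); [exact H | apply cder_inv; assumption].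
Qed.

Lemma cder_comp (f g : C -> C) (z a b : C) :
  cder f z a -> cder g (f z) b -> cder (fun y => g (f y)) z (b * a)%C.
Proof.
intros H K. assert (Hc := cder_cont _ _ _ H).
apply cder_slope in H; apply cder_slope in K. apply cder_slope.
destruct H as (q & H1 & H2 & H3), K as (r & K1 & K2 & K3).
exists (fun y => r (f y) * q y)%C. split; [|split; [congruence|]].
- apply contc_mult; [|exact H1]. apply (continuous_comp f r z Hc K1).
- specialize (Hc _ K3). unfold filtermap in Hc.
  generalize (filter_and _ _ H3 Hc). apply filter_imp. intros y [E1 E2].
  rewrite E2. rewrite E1 at 2. cring.
Qed.

Definition hol (O : C -> Prop) (f : C -> C) : Prop := forall z, O z -> exists l, cder f z l.

Definition openC (O : C -> Prop) : Prop := forall z, O z -> locC z O.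

Lemma hol_C_derive (O : C -> Prop) (f : C -> C) (z : C) : hol O f -> O z -> cder f z (C_derive f z).
Proof. intros H Hz. destruct (H z Hz) as [l Hl]. rewrite (cder_C_derive _ _ _ Hl). exact Hl. Qed.

Lemma openC_ball (z : C) (r : R) : openC (ball (M := C_UniformSpace) z r).
Proof.
intros y Hy. apply (proj1 (box_iff _ _ _)) in Hy. destruct Hy as [H1 H2].
set (e := Rmin (r - Rabs (Re y - Re z)) (r - Rabs (Im y - Im z))).
assert (He : 0 < e) by (unfold e; apply Rmin_glb_lt; lra).
assert (E1 := Rmin_l (r - Rabs (Re y - Re z)) (r - Rabs (Im y - Im z))).
assert (E2 := Rmin_r (r - Rabs (Re y - Re z)) (r - Rabs (Im y - Im z))).
fold e in E1, E2.
exists (mkposreal e He). intros w Hw. apply (proj1 (box_iff _ _ _)) in Hw. destruct Hw as [K1 K2]. simpl in K1, K2.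
apply (proj2 (box_iff _ _ _)). split.
- replace (Re w - Re z) with ((Re w - Re y) + (Re y - Re z)) by ring.
  eapply Rle_lt_trans; [apply Rabs_triang | lra].
- replace (Im w - Im z) with ((Im w - Im y) + (Im y - Im z)) by ring.
  eapply Rle_lt_trans; [apply Rabs_triang | lra].
Qed.

(** * Goursat's theorem on rectangles *)

(** [rect_int f a b c d] is the real part of the integral of [f] along the
    boundary of [[a,b] x [c,d]]; the imaginary part is that of [- i f]. *)
Definition rect_int (f : C -> C) (a b c d : R) : R :=
  RInt (fun x => Re (f (x, c))) a b - RInt (fun x => Re (f (x, d))) a b
  + RInt (fun y => Im (f (a, y))) c d - RInt (fun y => Im (f (b, y))) c d.

Definition rect (a b c d : R) (z : C) : Prop := a <= Re z <= b /\ c <= Im z <= d.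

Lemma cont_slice_x (f : C -> C) (x y : R) :
  cont f (x, y) -> continuous (fun t => f (t, y) : C_UniformSpace) x.
Proof.
intros H. apply (continuous_comp (U := R_UniformSpace) (V := C_UniformSpace) (fun t => (t, y)) f x).
- apply cont_pair; simpl; [apply continuous_id | apply continuous_const].
- exact H.
Qed.

Lemma cont_slice_y (f : C -> C) (x y : R) :
  cont f (x, y) -> continuous (fun t => f (x, t) : C_UniformSpace) y.
Proof.
intros H. apply (continuous_comp (U := R_UniformSpace) (V := C_UniformSpace) (fun t => (x, t)) f y).
- apply cont_pair; simpl; [apply continuous_const | apply continuous_id].
- exact H.
Qed.

Lemma ex_RInt_slices (f : C -> C) (a b c d x y : R) :
  a <= b -> c <= d -> (forall z, rect a b c d z -> cont f z) -> a <= x <= b -> c <= y <= d ->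
  forall a' b' c' d', a <= a' -> a' <= b' -> b' <= b -> c <= c' -> c' <= d' -> d' <= d ->
  ex_RInt (fun t => Re (f (t, y))) a' b' /\ ex_RInt (fun t => Im (f (x, t))) c' d'.
Proof.
intros Hab Hcd Hf Hx Hy a' b' c' d' H1 H2 H3 H4 H5 H6; split;
  apply (ex_RInt_continuous (V := R_CompleteNormedModule)); intros t; rewrite Rmin_left, Rmax_right by lra; intros Ht.
- apply cont_Re. apply cont_slice_x, Hf. split; simpl; lra.
- apply cont_Im. apply cont_slice_y, Hf. split; simpl; lra.
Qed.

Lemma RInt_Chasles_R (f : R -> R) (a b c : R) :
  ex_RInt f a b -> ex_RInt f b c -> RInt f a c = RInt f a b + RInt f b c.
Proof. intros H K. symmetry. apply (RInt_Chasles (V := R_CompleteNormedModule) f a b c H K). Qed.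

Lemma rect_int_quarters (f : C -> C) (a b c d : R) :
  a <= b -> c <= d -> (forall z, rect a b c d z -> cont f z) ->
  let m := (a + b) / 2 in let n := (c + d) / 2 in
  rect_int f a b c d = rect_int f a m c n + rect_int f m b c n
                       + rect_int f a m n d + rect_int f m b n d.
Proof.
intros Hab Hcd Hf m n. assert (Hm : a <= m <= b) by (unfold m; lra).
assert (Hn : c <= n <= d) by (unfold n; lra).
assert (X : forall y, c <= y <= d ->
  RInt (fun t => Re (f (t, y))) a b = RInt (fun t => Re (f (t, y))) a m + RInt (fun t => Re (f (t, y))) m b).
{ intros y Hy. apply RInt_Chasles_R;
  apply (fun A B C D E F => proj1 (ex_RInt_slices f a b c d a y Hab Hcd Hf (conj (Rle_refl a) Hab) Hy _ _ c d A B C D E F)); lra. }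
assert (Y : forall x, a <= x <= b ->
  RInt (fun t => Im (f (x, t))) c d = RInt (fun t => Im (f (x, t))) c n + RInt (fun t => Im (f (x, t))) n d).
{ intros x Hx. apply RInt_Chasles_R;
  apply (fun A B C D E F => proj2 (ex_RInt_slices f a b c d x c Hab Hcd Hf Hx (conj (Rle_refl c) Hcd) a b _ _ A B C D E F)); lra. }
unfold rect_int. rewrite !X, !Y by lra. ring.
Qed.

Lemma RInt_close (f g : R -> R) (a b K M : R) :
  a <= b -> ex_RInt f a b -> ex_RInt g a b ->
  (forall t, a <= t <= b -> Rabs (f t - g t - K) <= M) ->
  Rabs (RInt f a b - RInt g a b - (b - a) * K) <= (b - a) * M.
Proof.
intros Hab Hf Hg H.
assert (E : RInt (fun t => f t - g t - K) a b = RInt f a b - RInt g a b - (b - a) * K).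
{ apply (is_RInt_unique (V := R_CompleteNormedModule)).
  apply (is_RInt_minus (V := R_NormedModule)).
  - apply (is_RInt_minus (V := R_NormedModule)); apply (RInt_correct (V := R_CompleteNormedModule)); assumption.
  - apply (is_RInt_const (V := R_NormedModule)). }
rewrite <- E. apply abs_RInt_le_const; auto.
apply (ex_RInt_minus (V := R_NormedModule)).
- apply (ex_RInt_minus (V := R_NormedModule)); assumption.
- apply (ex_RInt_const (V := R_NormedModule)).
Qed.

(** Between opposite sides the affine approximation of [f] changes by a constant, and the two pairs
    of sides contribute opposite multiples of [(b - a) * (d - c) * Im l]. Only the error of the
    approximation survives. *)
Lemma rect_int_local (f : C -> C) (a b c d : R) (z l : C) (eps : R) :
  a <= b -> c <= d -> 0 <= eps -> (forall y, rect a b c d y -> cont f y) -> rect a b c d z ->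
  (forall y, rect a b c d y -> Cmod (f y - f z - (y - z) * l)%C <= eps * Cmod (y - z)%C) ->
  Rabs (rect_int f a b c d) <= 2 * eps * ((b - a) + (d - c)) ^ 2.
Proof.
intros Hab Hcd He Hc Hz H.
set (D := (b - a) + (d - c)).
assert (HD : forall y, rect a b c d y -> Cmod (f y - f z - (y - z) * l)%C <= eps * D).
{ intros y Hy. eapply Rle_trans; [apply H, Hy|]. apply Rmult_le_compat_l; [exact He|].
  eapply Rle_trans; [apply Cmod_le_Rabs|]. destruct Hy as [Y1 Y2], Hz as [Z1 Z2].
  unfold Re, Im in *; simpl.
  apply Rplus_le_compat; apply Rabs_le; lra. }
assert (A : Rabs (RInt (fun x => Re (f (x, c))) a b - RInt (fun x => Re (f (x, d))) a b - (b - a) * (- (c - d) * Im l)) <= (b - a) * (2 * (eps * D))).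
{ apply RInt_close; [exact Hab| | |].
  - apply (proj1 (ex_RInt_slices f a b c d a c Hab Hcd Hc ltac:(lra) ltac:(lra) a b c d ltac:(lra) ltac:(lra) ltac:(lra) ltac:(lra) ltac:(lra) ltac:(lra))).
  - apply (proj1 (ex_RInt_slices f a b c d a d Hab Hcd Hc ltac:(lra) ltac:(lra) a b c d ltac:(lra) ltac:(lra) ltac:(lra) ltac:(lra) ltac:(lra) ltac:(lra))).
  - intros t Ht.
    replace (Re (f (t, c)) - Re (f (t, d)) - - (c - d) * Im l)
      with (Re (f (t, c) - f z - ((t, c) - z) * l)%C - Re (f (t, d) - f z - ((t, d) - z) * l)%C)
      by (unfold Re, Im; simpl; ring).
    eapply Rle_trans; [apply Rabs_triang|]. rewrite Rabs_Ropp.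
    assert (U := Re_le_Cmod (f (t, c) - f z - ((t, c) - z) * l)%C).
    assert (V := Re_le_Cmod (f (t, d) - f z - ((t, d) - z) * l)%C).
    assert (U' := HD (t, c) ltac:(split; simpl; lra)).
    assert (V' := HD (t, d) ltac:(split; simpl; lra)). lra. }
assert (B : Rabs (RInt (fun y => Im (f (a, y))) c d - RInt (fun y => Im (f (b, y))) c d - (d - c) * ((a - b) * Im l)) <= (d - c) * (2 * (eps * D))).
{ apply RInt_close; [exact Hcd| | |].
  - apply (proj2 (ex_RInt_slices f a b c d a c Hab Hcd Hc ltac:(lra) ltac:(lra) a b c d ltac:(lra) ltac:(lra) ltac:(lra) ltac:(lra) ltac:(lra) ltac:(lra))).
  - apply (proj2 (ex_RInt_slices f a b c d b c Hab Hcd Hc ltac:(lra) ltac:(lra) a b c d ltac:(lra) ltac:(lra) ltac:(lra) ltac:(lra) ltac:(lra) ltac:(lra))).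
  - intros t Ht.
    replace (Im (f (a, t)) - Im (f (b, t)) - (a - b) * Im l)
      with (Im (f (a, t) - f z - ((a, t) - z) * l)%C - Im (f (b, t) - f z - ((b, t) - z) * l)%C)
      by (unfold Re, Im; simpl; ring).
    eapply Rle_trans; [apply Rabs_triang|]. rewrite Rabs_Ropp.
    assert (U := Im_le_Cmod (f (a, t) - f z - ((a, t) - z) * l)%C).
    assert (V := Im_le_Cmod (f (b, t) - f z - ((b, t) - z) * l)%C).
    assert (U' := HD (a, t) ltac:(split; simpl; lra)).
    assert (V' := HD (b, t) ltac:(split; simpl; lra)). lra. }
unfold rect_int.
match type of A with Rabs ?u <= _ => match type of B with Rabs ?v <= _ =>
  replace (RInt (fun x : R => Re (f (x, c))) a b - RInt (fun x : R => Re (f (x, d))) a b +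
   RInt (fun y : R => Im (f (a, y))) c d - RInt (fun y : R => Im (f (b, y))) c d) with (u + v) by ring
end end.
eapply Rle_trans; [apply Rabs_triang|]. fold D. replace (2 * eps * D ^ 2) with ((b - a) * (2 * (eps * D)) + (d - c) * (2 * (eps * D))) by (unfold D; ring).
lra.
Qed.

(** Dependent choice; the invariant and the transition depend on the stage because the side lengths
    halve at each stage. *)
Lemma dependent_sequence {X : Type} (I : nat -> X -> Prop) (Q : nat -> X -> X -> Prop) (x0 : X) :
  I O x0 -> (forall n x, I n x -> exists y, I (S n) y /\ Q n x y) ->
  exists s : nat -> X, s O = x0 /\ forall n, I n (s n) /\ Q n (s n) (s (S n)).
Proof.
intros H0 Hs.
set (s := fix s n := match n with O => x0
  | S m => epsilon (inhabits x0) (fun y => I (S m) y /\ Q m (s m) y) end).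
assert (HI : forall n, I n (s n)).
{ induction n as [|n IH]; [exact H0|]. simpl. apply (epsilon_spec (inhabits x0) (fun y => I (S n) y /\ Q n (s n) y)), Hs, IH. }
exists s; split; [reflexivity|]. intros n; split; [apply HI|].
simpl. apply (epsilon_spec (inhabits x0) (fun y => I (S n) y /\ Q n (s n) y)), Hs, HI.
Qed.

(** The [s n] are left endpoints of intervals of length [w / 2 ^ n], each the left or the right half
    of the preceding one; [l] is their common point. *)
Lemma nested_limit (s : nat -> R) (w : R) :
  0 <= w -> (forall n, s (S n) = s n \/ s (S n) = s n + w / 2 ^ S n) ->
  exists l, forall n, s n <= l <= s n + w / 2 ^ n.
Proof.
intros Hw Hs.
assert (P : forall n, 0 < 2 ^ n) by (intros; apply pow_lt; lra).
assert (Q : forall n, 0 <= w / 2 ^ n) by (intros; apply Rdiv_le_0_compat; auto).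
assert (E : forall n, w / 2 ^ n = w / 2 ^ S n + w / 2 ^ S n) by (intros; simpl; field; specialize (P n); lra).
assert (I1 : forall n, s n <= s (S n)) by (intros n; destruct (Hs n) as [A|A]; rewrite A; specialize (Q (S n)); lra).
assert (I2 : forall n, s (S n) + w / 2 ^ S n <= s n + w / 2 ^ n).
{ intros n. rewrite (E n). specialize (Q (S n)). destruct (Hs n) as [A|A]; rewrite A; lra. }
assert (M1 : forall n k, s n <= s (n + k)%nat).
{ intros n k; induction k as [|k IH]; [rewrite Nat.add_0_r; lra|]. rewrite Nat.add_succ_r. specialize (I1 (n + k)%nat). lra. }
assert (M2 : forall n k, s (n + k)%nat + w / 2 ^ (n + k) <= s n + w / 2 ^ n).
{ intros n k; induction k as [|k IH]; [rewrite Nat.add_0_r; lra|]. rewrite Nat.add_succ_r. specialize (I2 (n + k)%nat). lra. }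
assert (B : forall n m, s m <= s n + w / 2 ^ n).
{ intros n m. destruct (Nat.le_ge_cases n m) as [L|L].
  - replace m with (n + (m - n))%nat by lia. specialize (M2 n (m - n)%nat). specialize (Q (n + (m - n))%nat). lra.
  - specialize (M1 m (n - m)%nat). replace (m + (n - m))%nat with n in M1 by lia. specialize (Q n). lra. }
destruct (ex_finite_lim_seq_incr s (s O + w / 2 ^ O) I1 (fun n => B O n)) as [l Hl].
exists l. intros n; split.
- apply (is_lim_seq_incr_compare s l Hl I1).
- apply (is_lim_seq_le s (fun _ => s n + w / 2 ^ n) l (s n + w / 2 ^ n)).
  + intros m; apply B.
  + exact Hl.
  + apply is_lim_seq_const.
Qed.

(** At every stage some quarter carries at least a quarter of the integral. At the common point of
    the nested rectangles differentiability bounds the integral of stage [n] by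
    [2 * eps * (w + h) ^ 2 / 4 ^ n], which contradicts the lower bound [M / 4 ^ n] once [eps] is
    small. *)
Theorem Goursat (f : C -> C) (a b c d : R) :
  a <= b -> c <= d -> (forall z, rect a b c d z -> exists l, cder f z l) -> rect_int f a b c d = 0.
Proof.
intros Hab Hcd Hf.
assert (Hc : forall z, rect a b c d z -> cont f z) by (intros z Hz; destruct (Hf z Hz) as [l Hl]; exact (cder_cont _ _ _ Hl)).
set (w := b - a). set (h := d - c).
assert (Hw : 0 <= w) by (unfold w; lra). assert (Hh : 0 <= h) by (unfold h; lra).
assert (P : forall n, 0 < 2 ^ n) by (intros; apply pow_lt; lra).
assert (P4 : forall n, 0 < 4 ^ n) by (intros; apply pow_lt; lra).
set (J := fun n (p : R * R) => rect_int f (fst p) (fst p + w / 2 ^ n) (snd p) (snd p + h / 2 ^ n)).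
set (I := fun n (p : R * R) => a <= fst p /\ fst p + w / 2 ^ n <= b /\ c <= snd p /\ snd p + h / 2 ^ n <= d
   /\ Rabs (rect_int f a b c d) / 4 ^ n <= Rabs (J n p)).
set (Q := fun n (p q : R * R) => (fst q = fst p \/ fst q = fst p + w / 2 ^ S n) /\ (snd q = snd p \/ snd q = snd p + h / 2 ^ S n)).
destruct (dependent_sequence I Q (a, c)) as (s & Hs0 & Hs).
- unfold I, J; simpl. replace (a + w / 1) with b by (unfold w; field). replace (c + h / 1) with d by (unfold h; field).
  replace (Rabs (rect_int f a b c d) / 1) with (Rabs (rect_int f a b c d)) by field. lra.
- intros n [x y] (I1 & I2 & I3 & I4 & I5). simpl fst in *; simpl snd in *.
  assert (W : 0 <= w / 2 ^ S n) by (apply Rdiv_le_0_compat; auto).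
  assert (W' : 0 <= h / 2 ^ S n) by (apply Rdiv_le_0_compat; auto).
  assert (E : w / 2 ^ n = w / 2 ^ S n + w / 2 ^ S n) by (simpl; field; specialize (P n); lra).
  assert (E' : h / 2 ^ n = h / 2 ^ S n + h / 2 ^ S n) by (simpl; field; specialize (P n); lra).
  assert (QT := rect_int_quarters f x (x + w / 2 ^ n) y (y + h / 2 ^ n) ltac:(lra) ltac:(lra)
     (fun z Hz => Hc z ltac:(destruct Hz; split; lra))).
  simpl in QT.
  replace ((x + (x + w / 2 ^ n)) / 2) with (x + w / 2 ^ S n) in QT by lra.
  replace ((y + (y + h / 2 ^ n)) / 2) with (y + h / 2 ^ S n) in QT by lra.
  (* If no quarter inherited the invariant, all four integrals would be smaller than a quarter of
     the whole, against the triangle inequality. *)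
  apply NNPP; intros N.
  assert (N1 : forall x' y', (x' = x \/ x' = x + w / 2 ^ S n) -> (y' = y \/ y' = y + h / 2 ^ S n) ->
    Rabs (rect_int f x' (x' + w / 2 ^ S n) y' (y' + h / 2 ^ S n)) < Rabs (rect_int f a b c d) / 4 ^ S n).
  { intros x' y' Hx' Hy'. apply Rnot_le_lt; intros L. apply N. exists (x', y').
    split; [|split; simpl; assumption]. unfold I, J; simpl fst; simpl snd.
    repeat split; try exact L; destruct Hx', Hy'; subst; lra. }
  assert (A1 := N1 x y ltac:(lra) ltac:(lra)).
  assert (A2 := N1 (x + w / 2 ^ S n) y ltac:(lra) ltac:(lra)).
  assert (A3 := N1 x (y + h / 2 ^ S n) ltac:(lra) ltac:(lra)).
  assert (A4 := N1 (x + w / 2 ^ S n) (y + h / 2 ^ S n) ltac:(lra) ltac:(lra)).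
  replace (x + w / 2 ^ S n + w / 2 ^ S n) with (x + w / 2 ^ n) in * by lra.
  replace (y + h / 2 ^ S n + h / 2 ^ S n) with (y + h / 2 ^ n) in * by lra.
  assert (E4 : Rabs (rect_int f a b c d) / 4 ^ n = 4 * (Rabs (rect_int f a b c d) / 4 ^ S n)) by (simpl; field; specialize (P4 n); lra).
  unfold J in I5; simpl fst in I5; simpl snd in I5. rewrite QT in I5.
  match type of I5 with _ <= Rabs (?p + ?q + ?r + ?t) =>
    assert (T1 := Rabs_triang (p + q + r) t); assert (T2 := Rabs_triang (p + q) r); assert (T3 := Rabs_triang p q) end.
  lra.
- destruct (nested_limit (fun n => fst (s n)) w Hw) as [x Hx]; [intros n; apply (Hs n)|].
  destruct (nested_limit (fun n => snd (s n)) h Hh) as [y Hy]; [intros n; apply (Hs n)|].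
  simpl in Hx, Hy.
  assert (Hz : rect a b c d (x, y)).
  { specialize (Hx O); specialize (Hy O). rewrite Hs0 in *. simpl in *.
    replace (w / 1) with w in * by field. replace (h / 1) with h in * by field. unfold w, h in *. split; simpl; lra. }
  destruct (Hf _ Hz) as [l Hl].
  apply NNPP; intros N. apply Rabs_pos_lt in N. set (M := Rabs (rect_int f a b c d)) in *.
  (* Chosen so that [2 * eps * (w + h) ^ 2 < M]; the [+ 1] covers degenerate rectangles. *)
  set (eps := M / (4 * ((w + h) ^ 2 + 1))).
  assert (W2 : 0 <= (w + h) ^ 2) by (apply pow2_ge_0).
  assert (Heps : 0 < eps) by (unfold eps; apply Rdiv_lt_0_compat; lra).
  specialize (Hl (mkposreal eps Heps)). apply locC_Cmod in Hl. destruct Hl as (r & Hr & Hl). simpl in Hl.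
  assert (Hn : exists n, (w + h) / 2 ^ n < r).
  { destruct (pow_lt_1_zero (/ 2) ltac:(rewrite Rabs_pos_eq; lra) (r / (w + h + 1)) ltac:(apply Rdiv_lt_0_compat; lra)) as [n Hn].
    exists n. specialize (Hn n (Nat.le_refl n)). rewrite Rabs_pos_eq in Hn by (apply pow_le; lra).
    rewrite pow_inv in Hn. unfold Rdiv.
    apply Rmult_lt_compat_r with (r := w + h + 1) in Hn; [|lra].
    replace (r / (w + h + 1) * (w + h + 1)) with r in Hn by (field; lra).
    assert (0 < / 2 ^ n) by (apply Rinv_0_lt_compat, P). nra. }
  destruct Hn as [n Hn].
  destruct (Hs n) as [(I1 & I2 & I3 & I4 & I5) _]. specialize (Hx n); specialize (Hy n).
  assert (W : 0 <= w / 2 ^ n) by (apply Rdiv_le_0_compat; auto).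
  assert (W' : 0 <= h / 2 ^ n) by (apply Rdiv_le_0_compat; auto).
  assert (EE : (w + h) / 2 ^ n = w / 2 ^ n + h / 2 ^ n) by (field; specialize (P n); lra).
  assert (L := rect_int_local f (fst (s n)) (fst (s n) + w / 2 ^ n) (snd (s n)) (snd (s n) + h / 2 ^ n) (x, y) l eps
    ltac:(lra) ltac:(lra) ltac:(lra)).
  assert (L' : Rabs (J n (s n)) <= 2 * eps * ((w + h) / 2 ^ n) ^ 2).
  { unfold J. rewrite EE. replace (w / 2 ^ n + h / 2 ^ n) with ((fst (s n) + w / 2 ^ n - fst (s n)) + (snd (s n) + h / 2 ^ n - snd (s n))) by ring.
    apply L.
    - intros z [Z1 Z2]. apply Hc. split; lra.
    - split; simpl; lra.
    - intros z [Z1 Z2]. apply Hl. eapply Rle_lt_trans; [apply Cmod_le_Rabs|].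
      unfold Re, Im in *; simpl in *.
      assert (Rabs (fst z + - x) <= w / 2 ^ n) by (apply Rabs_le; lra).
      assert (Rabs (snd z + - y) <= h / 2 ^ n) by (apply Rabs_le; lra). lra. }
  assert (F : M / 4 ^ n <= 2 * eps * ((w + h) / 2 ^ n) ^ 2) by lra.
  replace (((w + h) / 2 ^ n) ^ 2) with ((w + h) ^ 2 / 4 ^ n) in F.
  2:{ replace 4 with (2 * 2) by ring. rewrite Rpow_mult_distr. field. specialize (P n); lra. }
  assert (F2 : M <= 2 * eps * (w + h) ^ 2).
  { specialize (P4 n). apply Rmult_le_reg_r with (/ 4 ^ n); [apply Rinv_0_lt_compat, P4|].
    unfold Rdiv in F. lra. }
  assert (F3 : eps * (4 * ((w + h) ^ 2 + 1)) = M) by (unfold eps; field; lra).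
  nra.
Qed.

(** * Primitives *)

Notation box z r := (ball (M := C_UniformSpace) z r).

Lemma RInt_swap_R (f : R -> R) (a b : R) : ex_RInt f a b -> RInt f b a = - RInt f a b.
Proof. intros H. rewrite <- (opp_RInt_swap (V := R_CompleteNormedModule) f a b H). reflexivity. Qed.

(** Primitives are integrated from a centre into any of the four quadrants, so a side may be
    traversed in either direction; a reversal only changes signs. *)
Lemma Goursat_unordered (f : C -> C) (a b c d : R) :
  (forall z, rect (Rmin a b) (Rmax a b) (Rmin c d) (Rmax c d) z -> exists l, cder f z l) ->
  rect_int f a b c d = 0.
Proof.
intros Hf.
assert (Hc : forall z, rect (Rmin a b) (Rmax a b) (Rmin c d) (Rmax c d) z -> cont f z)
  by (intros z Hz; destruct (Hf z Hz) as [l Hl]; exact (cder_cont _ _ _ Hl)).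
assert (X : forall y, Rmin c d <= y <= Rmax c d -> ex_RInt (fun t => Re (f (t, y))) a b).
{ intros y Hy. apply (ex_RInt_continuous (V := R_CompleteNormedModule)). intros t Ht.
  apply cont_Re, cont_slice_x, Hc. split; assumption. }
assert (Y : forall x, Rmin a b <= x <= Rmax a b -> ex_RInt (fun t => Im (f (x, t))) c d).
{ intros x Hx. apply (ex_RInt_continuous (V := R_CompleteNormedModule)). intros t Ht.
  apply cont_Im, cont_slice_y, Hc. split; assumption. }
assert (Xc := X c (conj (Rmin_l _ _) (Rmax_l _ _))). assert (Xd := X d (conj (Rmin_r _ _) (Rmax_r _ _))).
assert (Ya := Y a (conj (Rmin_l _ _) (Rmax_l _ _))). assert (Yb := Y b (conj (Rmin_r _ _) (Rmax_r _ _))).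
assert (G := Goursat f (Rmin a b) (Rmax a b) (Rmin c d) (Rmax c d) ltac:(apply Rmin_Rmax) ltac:(apply Rmin_Rmax) Hf).
clear X Y Hf Hc. unfold rect_int in *.
destruct (Rle_or_lt a b) as [L|L], (Rle_or_lt c d) as [M|M];
  rewrite ?(Rmin_left a b), ?(Rmax_right a b), ?(Rmin_left c d), ?(Rmax_right c d),
    ?(Rmin_right a b), ?(Rmax_left a b), ?(Rmin_right c d), ?(Rmax_left c d) in G by lra;
  rewrite ?(RInt_swap_R _ _ _ Xc), ?(RInt_swap_R _ _ _ Xd), ?(RInt_swap_R _ _ _ Ya), ?(RInt_swap_R _ _ _ Yb) in G;
lra.
Qed.

(** Real part of an integral along a horizontal leg followed by a vertical one; on the latter
    [dz = i dy], whence the imaginary part and the minus sign. *)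
Definition path_int (f : C -> C) (z0 z : C) : R :=
  RInt (fun t => Re (f (t, Im z0))) (Re z0) (Re z) - RInt (fun s => Im (f (Re z, s))) (Im z0) (Im z).

Lemma box_between (z0 z w : C) (r : R) :
  box z0 r z -> Rmin (Re z0) (Re z) <= Re w <= Rmax (Re z0) (Re z) ->
  Rmin (Im z0) (Im z) <= Im w <= Rmax (Im z0) (Im z) -> box z0 r w.
Proof.
intros H H1 H2. apply (proj1 (box_iff _ _ _)) in H. destruct H as [A B]. apply (proj2 (box_iff _ _ _)).
apply Rabs_def2 in A; apply Rabs_def2 in B.
unfold Rmin, Rmax in *.
destruct (Rle_dec (Re z0) (Re z)), (Rle_dec (Im z0) (Im z)); split; apply Rabs_def1; lra.
Qed.

(** Cauchy's theorem on the rectangle allows the vertical leg to come first; in this form the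
    derivative in [Re z] is that of an integral in one variable. *)
Lemma path_int_swap (f : C -> C) (z0 z : C) (r : R) :
  hol (box z0 r) f -> box z0 r z ->
  path_int f z0 z = RInt (fun t => Re (f (t, Im z))) (Re z0) (Re z) - RInt (fun s => Im (f (Re z0, s))) (Im z0) (Im z).
Proof.
intros Hf Hz.
assert (G := Goursat_unordered f (Re z0) (Re z) (Im z0) (Im z)
  (fun w Hw => Hf w (box_between z0 z w r Hz (proj1 Hw) (proj2 Hw)))).
unfold rect_int in G. unfold path_int. lra.
Qed.

Lemma locally_slice_x (z : C) (P : C -> Prop) : locC z P -> locally (Re z) (fun t => P (t, Im z)).
Proof.
intros [d H]. exists d. intros t Ht. apply H. split; [exact Ht | apply ball_center].
Qed.
Lemma locally_slice_y (z : C) (P : C -> Prop) : locC z P -> locally (Im z) (fun t => P (Re z, t)).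
Proof.
intros [d H]. exists d. intros t Ht. apply H. split; [apply ball_center | exact Ht].
Qed.

Lemma C_eta (z : C) : (Re z, Im z) = z.
Proof. destruct z; reflexivity. Qed.

Lemma path_int_derive (f : C -> C) (z0 z : C) (r : R) :
  hol (box z0 r) f -> box z0 r z ->
  is_derive (fun t => path_int f z0 (t, Im z)) (Re z) (Re (f z)) /\
  is_derive (fun t => path_int f z0 (Re z, t)) (Im z) (- Im (f z)).
Proof.
intros Hf Hz.
assert (Hc : forall w, box z0 r w -> cont f w) by (intros w Hw; destruct (Hf w Hw) as [l Hl]; exact (cder_cont _ _ _ Hl)).
assert (Hl := openC_ball z0 r z Hz).
split.
- apply (is_derive_ext_loc (fun t => RInt (fun t' => Re (f (t', Im z))) (Re z0) t - RInt (fun s => Im (f (Re z0, s))) (Im z0) (Im z))).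
  + generalize (locally_slice_x _ _ Hl). apply filter_imp. intros t Ht. symmetry. apply (path_int_swap f z0 (t, Im z) r Hf Ht).
  + replace (Re (f z)) with (Re (f z) - 0) by ring.
    apply (is_derive_minus (V := R_NormedModule)); [|apply (is_derive_const (V := R_NormedModule))].
    replace (Re (f z)) with (Re (f (Re z, Im z))) by (rewrite C_eta; reflexivity).
    apply (is_derive_RInt (V := R_NormedModule) (fun t' => Re (f (t', Im z))) (fun t => RInt (fun t' => Re (f (t', Im z))) (Re z0) t) (Re z0)).
    * generalize (locally_slice_x _ _ Hl). apply filter_imp. intros t Ht.
      apply (RInt_correct (V := R_CompleteNormedModule)).
      apply (ex_RInt_continuous (V := R_CompleteNormedModule)). intros u Hu.
      apply cont_Re, cont_slice_x, Hc. apply (box_between z0 (t, Im z)); [exact Ht | exact Hu |].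
      simpl. split; [apply Rmin_r | apply Rmax_r].
    * apply cont_Re, cont_slice_x. rewrite C_eta. apply Hc, Hz.
- unfold path_int; simpl. replace (- Im (f z)) with (0 - Im (f z)) by ring.
  apply (is_derive_minus (V := R_NormedModule)); [apply (is_derive_const (V := R_NormedModule))|].
  replace (Im (f z)) with (Im (f (Re z, Im z))) by (rewrite C_eta; reflexivity).
  apply (is_derive_RInt (V := R_NormedModule) (fun t' => Im (f (Re z, t'))) (fun t => RInt (fun t' => Im (f (Re z, t'))) (Im z0) t) (Im z0)).
  + generalize (locally_slice_y _ _ Hl). apply filter_imp. intros t Ht.
    apply (RInt_correct (V := R_CompleteNormedModule)).
    apply (ex_RInt_continuous (V := R_CompleteNormedModule)). intros u Hu.
    apply cont_Im, cont_slice_y, Hc. apply (box_between z0 (Re z, t)); [exact Ht | | exact Hu].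
    simpl. split; [apply Rmin_r | apply Rmax_r].
  + apply cont_Im, cont_slice_y. rewrite C_eta. apply Hc, Hz.
Qed.

Lemma is_derive_linear (k t : R) : is_derive (fun u : R => k * u) t k.
Proof. auto_derive; [exact I | ring]. Qed.

(** The increment is split into a horizontal and a vertical leg. On each leg the linear part is
    subtracted, and the derivative of the remainder is smaller than [eps] by continuity of the
    partial derivatives at [z]. *)
Lemma real_differential (U p q : C -> R) (z : C) :
  locC z (fun y => is_derive (fun t => U (t, Im y)) (Re y) (p y) /\
                   is_derive (fun t => U (Re y, t)) (Im y) (q y)) ->
  contR p z -> contR q z ->
  forall eps : posreal, locC z (fun y =>
    Rabs (U y - U z - (p z * (Re y - Re z) + q z * (Im y - Im z))) <= eps * (Rabs (Re y - Re z) + Rabs (Im y - Im z))).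
Proof.
intros H Hp Hq eps.
apply filterlim_locally with (eps := eps) in Hp.
apply filterlim_locally with (eps := eps) in Hq.
destruct (filter_and _ _ H (filter_and _ _ Hp Hq)) as [d Hd]. clear H Hp Hq.
exists d. intros y Hy.
assert (Hy0 := Hy). apply (proj1 (box_iff _ _ _)) in Hy. destruct Hy as [Y1 Y2].
assert (A : Rabs ((U y - p z * Re y) - (U (Re z, Im y) - p z * Re z)) <= eps * Rabs (Re y - Re z)).
{ generalize (bounded_variation (fun t => U (t, Im y) - p z * t) (fun t => p (t, Im y) - p z) eps (Re z) (Re y)); intros B.
  cbv beta in B. rewrite C_eta in B. apply B. intros t Ht.
  destruct (Hd (t, Im y)) as [[D1 D2] [D3 D4]].
  { apply (proj2 (box_iff _ _ _)). split; simpl; [|exact Y2]. eapply Rle_lt_trans; [exact Ht | exact Y1]. }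
  split.
  - apply (is_derive_minus (V := R_NormedModule)); [exact D1|].
    apply is_derive_linear.
  - apply Rlt_le. exact D3. }
assert (B : Rabs ((U (Re z, Im y) - q z * Im y) - (U z - q z * Im z)) <= eps * Rabs (Im y - Im z)).
{ generalize (bounded_variation (fun t => U (Re z, t) - q z * t) (fun t => q (Re z, t) - q z) eps (Im z) (Im y)); intros B.
  cbv beta in B. rewrite C_eta in B. apply B. intros t Ht.
  destruct (Hd (Re z, t)) as [[D1 D2] [D3 D4]].
  { apply (proj2 (box_iff _ _ _)). split; simpl; [rewrite Rminus_diag, Rabs_R0; apply cond_pos|]. eapply Rle_lt_trans; [exact Ht | exact Y2]. }
  split.
  - apply (is_derive_minus (V := R_NormedModule)); [exact D2|].
    apply is_derive_linear.
  - apply Rlt_le. exact D4. }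
match type of A with Rabs ?u <= _ => match type of B with Rabs ?v <= _ =>
  replace (U y - U z - (p z * (Re y - Re z) + q z * (Im y - Im z))) with (u + v) by ring end end.
eapply Rle_trans; [apply Rabs_triang|]. rewrite Rmult_plus_distr_l. apply Rplus_le_compat; assumption.
Qed.

(** The Cauchy-Riemann equations combine the two real differentials into multiplication by [f z]. *)
Lemma partials_cder (F f : C -> C) (z : C) :
  locC z (fun y => (is_derive (fun t => Re (F (t, Im y))) (Re y) (Re (f y)) /\
                    is_derive (fun t => Re (F (Re y, t))) (Im y) (- Im (f y))) /\
                   (is_derive (fun t => Im (F (t, Im y))) (Re y) (Im (f y)) /\
                    is_derive (fun t => Im (F (Re y, t))) (Im y) (Re (f y)))) ->
  cont f z -> cder F z (f z).
Proof.
intros H Hc eps. assert (He : 0 < eps / 4) by (generalize (cond_pos eps); lra).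
assert (CR := cont_Re _ _ Hc). assert (CI := cont_Im _ _ Hc).
assert (A := real_differential (fun y => Re (F y)) (fun y => Re (f y)) (fun y => - Im (f y)) z
  (filter_imp _ _ (fun y K => proj1 K) H) CR (contr_opp _ _ CI) (mkposreal _ He)).
assert (B := real_differential (fun y => Im (F y)) (fun y => Im (f y)) (fun y => Re (f y)) z
  (filter_imp _ _ (fun y K => proj2 K) H) CI CR (mkposreal _ He)).
generalize (filter_and _ _ A B). apply filter_imp. intros y [P Q]. simpl pos in *.
eapply Rle_trans; [apply Cmod_le_Rabs|].
replace (Re (F y - F z - (y - z) * f z)%C) with (Re (F y) - Re (F z) - (Re (f z) * (Re y - Re z) + - Im (f z) * (Im y - Im z)))
  by (unfold Re, Im; simpl; ring).
replace (Im (F y - F z - (y - z) * f z)%C) with (Im (F y) - Im (F z) - (Im (f z) * (Re y - Re z) + Re (f z) * (Im y - Im z)))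
  by (unfold Re, Im; simpl; ring).
assert (R1 := Re_le_Cmod (y - z)%C). assert (R2 := Im_le_Cmod (y - z)%C).
change (Re (y - z)%C) with (Re y - Re z) in R1. change (Im (y - z)%C) with (Im y - Im z) in R2.
assert (0 < eps) by apply cond_pos. nra.
Qed.

Lemma hol_primitive (f : C -> C) (z0 : C) (r : R) :
  hol (box z0 r) f -> exists F, forall z, box z0 r z -> cder F z (f z).
Proof.
intros Hf.
(* [path_int] only yields a real part, so the imaginary part of the primitive is the path integral
   of [- i f], whose real part is [Im f]. *)
set (g := fun z => (- Ci * f z)%C).
assert (Hg : hol (box z0 r) g) by (intros z Hz; destruct (Hf z Hz) as [l Hl]; exists (- Ci * l)%C; apply cder_scal, Hl).
exists (fun z => (path_int f z0 z, path_int g z0 z)). intros z Hz.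
apply partials_cder.
- generalize (openC_ball z0 r z Hz). apply filter_imp. intros y Hy.
  split; [apply (path_int_derive f z0 y r Hf Hy)|].
  destruct (path_int_derive g z0 y r Hg Hy) as [A B].
  assert (E1 : Re (g y) = Im (f y)) by (unfold g, Ci; unfold Re, Im; simpl; ring).
  assert (E2 : - Im (g y) = Re (f y)) by (unfold g, Ci; unfold Re, Im; simpl; ring).
  rewrite E1 in A. rewrite E2 in B. split; assumption.
- destruct (Hf z Hz) as [l Hl]. exact (cder_cont _ _ _ Hl).
Qed.

(** * Curves and the mean value inequality *)

Definition curve_der (c : R -> C) (t : R) (v : C) : Prop :=
  is_derive (fun s => Re (c s)) t (Re v) /\ is_derive (fun s => Im (c s)) t (Im v).

Lemma curve_comp (f : C -> C) (c : R -> C) (t : R) (v l : C) :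
  curve_der c t v -> cder f (c t) l -> curve_der (fun s => f (c s)) t (l * v)%C.
Proof.
intros [H1 H2] K.
assert (K0 : forall eps : posreal, locally t (fun s => Cmod (c s - c t - RtoC (s - t) * v)%C <= eps * Rabs (s - t))).
{ intros eps. assert (He : 0 < eps / 2) by (generalize (cond_pos eps); lra).
  destruct H1 as [_ H1], H2 as [_ H2].
  specialize (H1 t (fun P HP => HP) (mkposreal _ He)). specialize (H2 t (fun P HP => HP) (mkposreal _ He)).
  generalize (filter_and _ _ H1 H2). apply filter_imp. intros s [A B].
  unfold norm, minus, plus, opp, scal in A, B; simpl in A, B. unfold mult, abs in A, B; simpl in A, B.
  eapply Rle_trans; [apply Cmod_le_Rabs|].
  replace (Re (c s - c t - RtoC (s - t) * v)%C) with (Re (c s) + - Re (c t) + - ((s + - t) * Re v)) by (unfold Re, Im; simpl; ring).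
  replace (Im (c s - c t - RtoC (s - t) * v)%C) with (Im (c s) + - Im (c t) + - ((s + - t) * Im v)) by (unfold Re, Im; simpl; ring).
  unfold Rminus. lra. }
assert (Kc : filterlim c (locally t) (locally (T := C_UniformSpace) (c t))).
{ apply (cont_pair c t).
  - apply (ex_derive_continuous (V := R_NormedModule)). eexists; apply H1.
  - apply (ex_derive_continuous (V := R_NormedModule)). eexists; apply H2. }
assert (F : forall eps : posreal, locally t (fun s => Cmod (f (c s) - f (c t) - RtoC (s - t) * (l * v))%C <= eps * Rabs (s - t))).
{ intros eps.
  assert (Pv := Cmod_ge_0 v). assert (Pl := Cmod_ge_0 l). assert (Pe := cond_pos eps).
  assert (E1 : 0 < eps / 2 / (Cmod v + 1)) by (apply Rdiv_lt_0_compat; lra).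
  (* The cap [1] bounds the chord of [c] by [(Cmod v + 1) * Rabs (s - t)]; the two quotients make
     each of the two error terms at most half of [eps]. *)
  assert (E2 : 0 < Rmin 1 (eps / 2 / (Cmod l + 1))) by (apply Rmin_glb_lt; [lra | apply Rdiv_lt_0_compat; lra]).
  specialize (K (mkposreal _ E1)). specialize (Kc _ K). unfold filtermap in Kc.
  specialize (K0 (mkposreal _ E2)). generalize (filter_and _ _ K0 Kc). apply filter_imp.
  intros s [A B]. simpl pos in *.
  assert (M1 := Rmin_l 1 (eps / 2 / (Cmod l + 1))). assert (M2 := Rmin_r 1 (eps / 2 / (Cmod l + 1))).
  set (e2 := Rmin 1 (eps / 2 / (Cmod l + 1))) in *. set (e1 := eps / 2 / (Cmod v + 1)) in *.
  assert (Ps := Rabs_pos (s - t)).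
  assert (D : Cmod (c s - c t)%C <= (Cmod v + 1) * Rabs (s - t)).
  { replace (c s - c t)%C with ((c s - c t - RtoC (s - t) * v) + RtoC (s - t) * v)%C by cring.
    eapply Rle_trans; [apply Cmod_triangle|]. rewrite Cmod_mult, Cmod_R. nra. }
  replace (f (c s) - f (c t) - RtoC (s - t) * (l * v))%C
    with ((f (c s) - f (c t) - (c s - c t) * l) + (c s - c t - RtoC (s - t) * v) * l)%C by cring.
  eapply Rle_trans; [apply Cmod_triangle|]. rewrite Cmod_mult.
  assert (X1 : e1 * (Cmod v + 1) = eps / 2) by (unfold e1; field; lra).
  assert (X2 : eps / 2 / (Cmod l + 1) * (Cmod l + 1) = eps / 2) by (field; lra).
  assert (e1 * Cmod (c s - c t)%C <= eps / 2 * Rabs (s - t)) by (rewrite <- X1; assert (0 < e1) by exact E1; nra).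
  assert (Cmod (c s - c t - RtoC (s - t) * v)%C * Cmod l <= eps / 2 * Rabs (s - t)).
  { apply Rle_trans with (e2 * Rabs (s - t) * Cmod l); [apply Rmult_le_compat_r; assumption|].
    assert (e2 * Cmod l <= eps / 2) by nra. nra. }
  lra. }
split.
- split; [apply is_linear_scal_l|]. intros x Hx. apply (@is_filter_lim_locally_unique R_AbsRing R_NormedModule) in Hx. subst x.
  intros eps. generalize (F eps). apply filter_imp. intros s A.
  unfold norm, minus, plus, opp, scal; simpl. unfold mult, abs; simpl.
  eapply Rle_trans; [|exact A]. eapply Rle_trans; [|apply Re_le_Cmod]. right. f_equal. unfold Re, Im; simpl; ring.
- split; [apply is_linear_scal_l|]. intros x Hx. apply (@is_filter_lim_locally_unique R_AbsRing R_NormedModule) in Hx. subst x.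
  intros eps. generalize (F eps). apply filter_imp. intros s A.
  unfold norm, minus, plus, opp, scal; simpl. unfold mult, abs; simpl.
  eapply Rle_trans; [|exact A]. eapply Rle_trans; [|apply Im_le_Cmod]. right. f_equal. unfold Re, Im; simpl; ring.
Qed.

Lemma curve_affine (a b : C) (t : R) : curve_der (fun s => a + RtoC s * b)%C t b.
Proof.
split; simpl; auto_derive; auto; unfold Re, Im; ring.
Qed.

Lemma cder_partials (f : C -> C) (z l : C) : cder f z l ->
  (is_derive (fun t => Re (f (t, Im z))) (Re z) (Re l) /\ is_derive (fun t => Re (f (Re z, t))) (Im z) (- Im l)) /\
  (is_derive (fun t => Im (f (t, Im z))) (Re z) (Im l) /\ is_derive (fun t => Im (f (Re z, t))) (Im z) (Re l)).
Proof.
intros H.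
assert (X : curve_der (fun t => (t, Im z)) (Re z) 1%C) by (split; simpl; [apply (is_derive_id (K := R_AbsRing)) | apply (is_derive_const (V := R_NormedModule))]).
assert (Y : curve_der (fun t => (Re z, t)) (Im z) Ci) by (split; simpl; [apply (is_derive_const (V := R_NormedModule)) | apply (is_derive_id (K := R_AbsRing))]).
assert (X' := curve_comp f _ _ _ l X). cbv beta in X'. rewrite C_eta in X'. specialize (X' H).
assert (Y' := curve_comp f _ _ _ l Y). cbv beta in Y'. rewrite C_eta in Y'. specialize (Y' H).
destruct X' as [X1 X2], Y' as [Y1 Y2].
replace (Re (l * 1)%C) with (Re l) in X1 by (unfold Re, Im; simpl; ring).
replace (Im (l * 1)%C) with (Im l) in X2 by (unfold Re, Im; simpl; ring).
replace (Re (l * Ci)%C) with (- Im l) in Y1 by (unfold Re, Im; simpl; ring).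
replace (Im (l * Ci)%C) with (Re l) in Y2 by (unfold Re, Im; simpl; ring).
tauto.
Qed.

(** The factor 2 arises because the real mean value theorem is applied to the real and imaginary
    parts separately. *)
Lemma mean_value_ineq (f : C -> C) (z y : C) (M : R) :
  (forall t, 0 <= t <= 1 -> exists l, cder f (z + RtoC t * (y - z))%C l /\ Cmod l <= M) ->
  Cmod (f y - f z)%C <= 2 * M * Cmod (y - z)%C.
Proof.
intros H.
set (d := fun t => C_derive f (z + RtoC t * (y - z))%C).
assert (Hd : forall t, 0 <= t <= 1 -> cder f (z + RtoC t * (y - z))%C (d t) /\ Cmod (d t) <= M).
{ intros t Ht. destruct (H t Ht) as (l & A & B). unfold d. rewrite (cder_C_derive _ _ _ A). split; assumption. }
assert (HM : forall t, 0 <= t <= 1 -> Cmod (d t * (y - z))%C <= M * Cmod (y - z)%C).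
{ intros t Ht. rewrite Cmod_mult. apply Rmult_le_compat_r; [apply Cmod_ge_0 | apply (Hd t Ht)]. }
assert (HD : forall t, 0 <= t <= 1 -> curve_der (fun s => f (z + RtoC s * (y - z))%C) t (d t * (y - z))%C).
{ intros t Ht. apply (curve_comp f (fun s => (z + RtoC s * (y - z))%C)); [apply curve_affine | apply Hd, Ht]. }
assert (T : forall t, Rabs (t - 1 / 2) <= Rabs (1 - 1 / 2) -> 0 <= t <= 1).
{ intros t Ht. rewrite (Rabs_pos_eq (1 - 1 / 2)) in Ht by lra. apply Rabs_le_between in Ht. lra. }
assert (MV : forall (h dh : R -> R) D, (forall t, 0 <= t <= 1 -> is_derive h t (dh t) /\ Rabs (dh t) <= D) -> Rabs (h 1 - h 0) <= D).
{ intros h dh D Hh. replace D with (D * Rabs (1 - 0)) by (rewrite Rminus_0_r, Rabs_R1; ring).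
  destruct (MVT_gen h 0 1 dh) as (c & Hc & E); rewrite ?Rmin_left, ?Rmax_right in * by lra.
  - intros x Hx. apply Hh; lra.
  - intros x Hx. apply continuity_pt_filterlim. apply (ex_derive_continuous (V := R_NormedModule)). eexists; apply Hh; lra.
  - rewrite E, Rabs_mult. apply Rmult_le_compat_r; [apply Rabs_pos | apply Hh; lra]. }
assert (A := MV _ _ (M * Cmod (y - z)%C) (fun t Ht => conj (proj1 (HD t Ht)) (Rle_trans _ _ _ (Re_le_Cmod _) (HM t Ht)))).
assert (B := MV _ _ (M * Cmod (y - z)%C) (fun t Ht => conj (proj2 (HD t Ht)) (Rle_trans _ _ _ (Im_le_Cmod _) (HM t Ht)))).
cbv beta in A, B.
replace (z + RtoC 1 * (y - z))%C with y in A, B by cring.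
replace (z + RtoC 0 * (y - z))%C with z in A, B by cring.
eapply Rle_trans; [apply Cmod_le_Rabs|].
change (Re (f y - f z)%C) with (Re (f y) - Re (f z)). change (Im (f y - f z)%C) with (Im (f y) - Im (f z)). lra.
Qed.

(** * Cauchy's integral formula on circles *)

Notation contRC g t := (continuous (T := R_UniformSpace) (U := C_UniformSpace) g t).

Definition cint (g : R -> C) : C :=
  (RInt (fun t => Re (g t)) 0 (2 * PI), RInt (fun t => Im (g t)) 0 (2 * PI)).

Lemma two_PI_pos : 0 < 2 * PI. Proof. generalize PI_RGT_0; lra. Qed.

Lemma ex_cint (g : R -> C) : (forall t, contRC g t) ->
  ex_RInt (fun t => Re (g t)) 0 (2 * PI) /\ ex_RInt (fun t => Im (g t)) 0 (2 * PI).
Proof.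
intros H; split; apply (ex_RInt_continuous (V := R_CompleteNormedModule)); intros t _.
- apply cont_Re, H.
- apply cont_Im, H.
Qed.

Lemma cint_ext (g h : R -> C) : (forall t, g t = h t) -> cint g = cint h.
Proof. intros H. unfold cint. f_equal; apply (RInt_ext (V := R_CompleteNormedModule)); intros; rewrite H; reflexivity. Qed.

Lemma cint_minus (g h : R -> C) : (forall t, contRC g t) -> (forall t, contRC h t) ->
  cint (fun t => g t - h t)%C = (cint g - cint h)%C.
Proof.
intros Hg Hh. destruct (ex_cint g Hg), (ex_cint h Hh). unfold cint.
apply injective_projections; simpl.
- apply (RInt_minus (V := R_CompleteNormedModule) (fun t => Re (g t)) (fun t => Re (h t))); assumption.
- apply (RInt_minus (V := R_CompleteNormedModule) (fun t => Im (g t)) (fun t => Im (h t))); assumption.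
Qed.

Lemma cint_scal (a : C) (g : R -> C) : (forall t, contRC g t) -> cint (fun t => a * g t)%C = (a * cint g)%C.
Proof.
intros Hg. destruct (ex_cint g Hg) as [A B]. unfold cint.
apply injective_projections; simpl; apply (is_RInt_unique (V := R_CompleteNormedModule)).
- apply (is_RInt_minus (V := R_NormedModule) (fun t => fst a * fst (g t)) (fun t => snd a * snd (g t)));
    apply (is_RInt_scal (V := R_NormedModule)); apply (RInt_correct (V := R_CompleteNormedModule)); assumption.
- apply (is_RInt_plus (V := R_NormedModule) (fun t => fst a * snd (g t)) (fun t => snd a * fst (g t)));
    apply (is_RInt_scal (V := R_NormedModule)); apply (RInt_correct (V := R_CompleteNormedModule)); assumption.
Qed.

(** The constant is [4 * PI] and not [2 * PI] because the two components are bounded separately. *)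
Lemma cint_bound (g : R -> C) (M : R) : (forall t, contRC g t) ->
  (forall t, 0 <= t <= 2 * PI -> Cmod (g t) <= M) -> Cmod (cint g) <= 4 * PI * M.
Proof.
intros Hg HM. destruct (ex_cint g Hg) as [A B]. assert (P := two_PI_pos).
eapply Rle_trans; [apply Cmod_le_Rabs|]. unfold cint; simpl.
assert (U := abs_RInt_le_const (fun t => Re (g t)) 0 (2 * PI) M ltac:(lra) A
  (fun t Ht => Rle_trans _ _ _ (Re_le_Cmod _) (HM t Ht))).
assert (V := abs_RInt_le_const (fun t => Im (g t)) 0 (2 * PI) M ltac:(lra) B
  (fun t Ht => Rle_trans _ _ _ (Im_le_Cmod _) (HM t Ht))).
lra.
Qed.

Lemma cint_derivative (G g : R -> C) : (forall t, curve_der G t (g t)) -> (forall t, contRC g t) ->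
  cint g = (G (2 * PI)%R - G 0)%C.
Proof.
intros H Hg. unfold cint. apply injective_projections; simpl; apply (is_RInt_unique (V := R_CompleteNormedModule)).
- apply (is_RInt_derive (V := R_CompleteNormedModule) (fun t => Re (G t)) (fun t => Re (g t))).
  + intros t _; apply H.
  + intros t _; apply cont_Re, Hg.
- apply (is_RInt_derive (V := R_CompleteNormedModule) (fun t => Im (G t)) (fun t => Im (g t))).
  + intros t _; apply H.
  + intros t _; apply cont_Im, Hg.
Qed.

Lemma curve_der_cont (c : R -> C) (t : R) (v : C) : curve_der c t v -> contRC c t.
Proof.
intros [H K]. apply cont_pair; apply (ex_derive_continuous (V := R_NormedModule)); eexists; eassumption.
Qed.

(** Differentiation under the integral sign; a quadratic remainder uniform in [t] replaces any
    appeal to dominated convergence. *)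
Lemma cint_param (k : C -> R -> C) (k1 : R -> C) (z : C) (d M : R) :
  0 < d -> (forall y t, Cmod (y - z)%C < d -> contRC (k y) t) -> (forall t, contRC k1 t) ->
  (forall y t, Cmod (y - z)%C < d -> 0 <= t <= 2 * PI ->
     Cmod (k y t - k z t - (y - z) * k1 t)%C <= M * (Cmod (y - z)%C * Cmod (y - z)%C)) ->
  cder (fun y => cint (k y)) z (cint k1).
Proof.
intros Hd Hk Hk1 H eps. apply locC_Cmod.
assert (P := two_PI_pos). assert (E := cond_pos eps). assert (MM := Rabs_pos M).
exists (Rmin d (eps / (4 * PI * (Rabs M + 1)))). split.
- apply Rmin_glb_lt; [exact Hd|]. apply Rdiv_lt_0_compat; [exact E|]. nra.
- intros y Hy. assert (Y1 := Rlt_le_trans _ _ _ Hy (Rmin_l _ _)). assert (Y2 := Rlt_le_trans _ _ _ Hy (Rmin_r _ _)).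
  assert (Z : Cmod (z - z)%C < d) by (replace (z - z)%C with (RtoC 0) by cring; rewrite Cmod_0; exact Hd).
  replace (cint (k y) - cint (k z) - (y - z) * cint k1)%C
    with (cint (fun t => (k y t - k z t) - (y - z) * k1 t)%C).
  2:{ rewrite cint_minus, cint_minus, cint_scal; auto.
      - intros t; apply contc_minus; auto.
      - intros t; apply contc_mult; [apply continuous_const | auto]. }
  eapply Rle_trans; [apply cint_bound with (M := M * (Cmod (y - z)%C * Cmod (y - z)%C))|].
  + intros t. apply contc_minus; [apply contc_minus; auto | apply contc_mult; [apply continuous_const | auto]].
  + intros t Ht. apply H; auto.
  + assert (N := Cmod_ge_0 (y - z)%C). set (m := Cmod (y - z)%C) in *.
    assert (F : eps / (4 * PI * (Rabs M + 1)) * (4 * PI * (Rabs M + 1)) = eps) by (field; split; nra).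
    assert (F2 : m * (4 * PI * (Rabs M + 1)) <= eps) by (rewrite <- F; apply Rmult_le_compat_r; [nra | lra]).
    assert (M <= Rabs M + 1) by (generalize (Rle_abs M); lra).
    assert (4 * PI * M * m <= eps).
    { apply Rle_trans with (4 * PI * (Rabs M + 1) * m); [|lra]. apply Rmult_le_compat_r; [exact N|].
      apply Rmult_le_compat_l; lra. }
    replace (4 * PI * (M * (m * m))) with (4 * PI * M * m * m) by ring.
    apply Rmult_le_compat_r; assumption.
Qed.

Definition circ (z0 : C) (r t : R) : C := (Re z0 + r * cos t, Im z0 + r * sin t).
Definition circ' (r t : R) : C := (- (r * sin t), r * cos t).

Lemma circ_der (z0 : C) (r t : R) : curve_der (circ z0 r) t (circ' r t).
Proof. split; simpl; auto_derive; auto; ring. Qed.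

Lemma circ_cont (z0 : C) (r t : R) : contRC (circ z0 r) t.
Proof. eapply curve_der_cont, circ_der. Qed.

Lemma circ'_cont (r t : R) : contRC (circ' r) t.
Proof.
apply curve_der_cont with (v := (- (r * cos t), - (r * sin t))). split; simpl; auto_derive; auto; ring.
Qed.

Lemma circ'_i (z0 : C) (r t : R) : circ' r t = (Ci * (circ z0 r t - z0))%C.
Proof. apply injective_projections; simpl; unfold Re, Im; ring. Qed.

Lemma circ_Cmod (z0 : C) (r t : R) : 0 <= r -> Cmod (circ z0 r t - z0)%C = r.
Proof.
intros Hr. unfold Cmod, circ, Re, Im; simpl.
match goal with |- sqrt ?e = _ => replace e with (r * r * (Rsqr (sin t) + Rsqr (cos t))) by (unfold Rsqr; ring) end.
rewrite sin2_cos2, Rmult_1_r. apply sqrt_square, Hr.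
Qed.

Lemma circ_closed (z0 : C) (r : R) : circ z0 r (2 * PI) = circ z0 r 0.
Proof. unfold circ. rewrite cos_2PI, sin_2PI, cos_0, sin_0. reflexivity. Qed.

Lemma circ_far (z0 z y : C) (r t : R) : 0 <= r ->
  r - Cmod (z - z0)%C - Cmod (y - z)%C <= Cmod (circ z0 r t - y)%C.
Proof.
intros Hr. assert (E := circ_Cmod z0 r t Hr).
replace (circ z0 r t - z0)%C with ((circ z0 r t - y) + ((y - z) + (z - z0)))%C in E by cring.
assert (T1 := Cmod_triangle (circ z0 r t - y)%C ((y - z) + (z - z0))%C).
assert (T2 := Cmod_triangle (y - z)%C (z - z0)%C). lra.
Qed.

Lemma Cmod_pos_neq (w : C) : 0 < Cmod w -> w <> 0%C.
Proof. intros H E. rewrite E, Cmod_0 in H. lra. Qed.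

Lemma RC_bounded (g : R -> C) : (forall t, contRC g t) ->
  exists B, 0 <= B /\ forall t, 0 <= t <= 2 * PI -> Cmod (g t) <= B.
Proof.
intros H.
destruct (continuity_ab_maj (fun t => Rabs (Re (g t)) + Rabs (Im (g t))) 0 (2 * PI)) as (m & Hm & _).
- generalize two_PI_pos; lra.
- intros t _. apply continuity_pt_filterlim. apply (contr_plus (T := R_UniformSpace) (fun t => Rabs (Re (g t))) (fun t => Rabs (Im (g t)))).
  + apply (continuous_comp (fun t => Re (g t)) Rabs); [apply cont_Re, H | exact (continuous_Rabs _)].
  + apply (continuous_comp (fun t => Im (g t)) Rabs); [apply cont_Im, H | exact (continuous_Rabs _)].
- exists (Rabs (Re (g m)) + Rabs (Im (g m))). split.
  + generalize (Rabs_pos (Re (g m))) (Rabs_pos (Im (g m))); lra.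
  + intros t Ht. eapply Rle_trans; [apply Cmod_le_Rabs | apply Hm, Ht].
Qed.

(** * Integrals of Cauchy kernels over a circle *)

Section Kernel.
Variables (z0 : C) (r : R) (phi : R -> C).
Hypothesis Hr : 0 < r.
Hypothesis Hphi : forall t, contRC phi t.

Lemma kernel_cont (z : C) : Cmod (z - z0)%C < r -> forall t,
  contRC (fun t => phi t / (circ z0 r t - z))%C t /\
  contRC (fun t => phi t / ((circ z0 r t - z) * (circ z0 r t - z)))%C t /\
  contRC (fun t => 2 * phi t / ((circ z0 r t - z) * (circ z0 r t - z) * (circ z0 r t - z)))%C t.
Proof.
intros Hz t.
assert (N : (circ z0 r t - z)%C <> 0%C).
{ apply Cmod_pos_neq. assert (F := circ_far z0 z z r t (Rlt_le _ _ Hr)).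
  replace (z - z)%C with (RtoC 0) in F by cring. rewrite Cmod_0 in F. lra. }
assert (K : contRC (fun t => circ z0 r t - z)%C t) by (apply contc_minus; [apply circ_cont | apply continuous_const]).
repeat split.
- apply contc_mult; [apply Hphi | apply contc_inv; assumption].
- apply contc_mult; [apply Hphi | apply contc_inv; [apply contc_mult; exact K | apply Cmult_neq_0; exact N]].
- apply contc_mult; [apply contc_mult; [apply continuous_const | apply Hphi] | apply contc_inv].
  + apply contc_mult; [apply contc_mult; exact K | exact K].
  + apply Cmult_neq_0; [apply Cmult_neq_0; exact N | exact N].
Qed.

(** With [u] and [v] the vectors from [y] and [z] to the point of the circle, the remainder is
    explicit: [1/u - 1/v - (v - u)/v^2 = (v - u)^2 / (u v^2)], and similarly for the squared kernel.
    For [y] within half the distance [rho] from the circle, [1/|u|] and [1/|v|] are at most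
    [2 / rho]. *)
Lemma kernel_cder (z : C) : Cmod (z - z0)%C < r ->
  cder (fun y => cint (fun t => phi t / (circ z0 r t - y))%C) z
       (cint (fun t => phi t / ((circ z0 r t - z) * (circ z0 r t - z)))%C) /\
  cder (fun y => cint (fun t => phi t / ((circ z0 r t - y) * (circ z0 r t - y)))%C) z
       (cint (fun t => 2 * phi t / ((circ z0 r t - z) * (circ z0 r t - z) * (circ z0 r t - z)))%C).
Proof.
intros Hz. destruct (RC_bounded phi Hphi) as (B & HB0 & HB).
set (rho := r - Cmod (z - z0)%C). assert (Hrho : 0 < rho / 2) by (unfold rho; lra).
assert (Y : forall y, Cmod (y - z)%C < rho / 2 -> Cmod (y - z0)%C < r).
{ intros y Hy. replace (y - z0)%C with ((y - z) + (z - z0))%C by cring.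
  eapply Rle_lt_trans; [apply Cmod_triangle|]. unfold rho in *. lra. }
assert (Far : forall y t, Cmod (y - z)%C < rho / 2 -> rho / 2 <= Cmod (circ z0 r t - y)%C).
{ intros y t Hy. assert (F := circ_far z0 z y r t (Rlt_le _ _ Hr)). unfold rho in *. lra. }
assert (Z : Cmod (z - z)%C < rho / 2) by (replace (z - z)%C with (RtoC 0) by cring; rewrite Cmod_0; exact Hrho).
assert (I : forall x, rho / 2 <= x -> / x <= 2 / rho).
{ intros x Hx. replace (2 / rho) with (/ (rho / 2)) by (field; lra). apply Rinv_le_contravar; lra. }
set (q := 2 / rho) in *. assert (Hq : 0 < q) by (unfold q; apply Rdiv_lt_0_compat; lra).
split.
- apply cint_param with (d := rho / 2) (M := B * (q * q * q)); [exact Hrho | | |].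
  + intros y t Hy. apply (kernel_cont y (Y y Hy) t).
  + intros t. apply (kernel_cont z Hz t).
  + intros y t Hy Ht.
    assert (F1 := Far y t Hy). assert (F2 := Far z t Z).
    set (u := (circ z0 r t - y)%C) in *. set (v := (circ z0 r t - z)%C) in *.
    assert (Nu : u <> 0%C) by (apply Cmod_pos_neq; lra). assert (Nv : v <> 0%C) by (apply Cmod_pos_neq; lra).
    replace (y - z)%C with (v - u)%C by (unfold u, v; cring).
    replace (phi t / u - phi t / v - (v - u) * (phi t / (v * v)))%C
      with (phi t * ((v - u) * (v - u)) * (/ u * / v * / v))%C by (cfield; split; assumption).
    rewrite !Cmod_mult, !Cmod_inv by assumption.
    assert (I1 := I _ F1). assert (I2 := I _ F2).
    assert (J1 : 0 < / Cmod u) by (apply Rinv_0_lt_compat; lra). assert (J2 : 0 < / Cmod v) by (apply Rinv_0_lt_compat; lra).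
    assert (/ Cmod u * / Cmod v * / Cmod v <= q * q * q).
    { apply Rmult_le_compat; [nra | lra | apply Rmult_le_compat; lra | lra]. }
    assert (P := Cmod_ge_0 (phi t)). assert (W := Cmod_ge_0 (v - u)%C). specialize (HB t Ht).
    set (m := Cmod (v - u)%C) in *.
    assert (X : Cmod (phi t) * (/ Cmod u * / Cmod v * / Cmod v) <= B * (q * q * q)).
    { apply Rmult_le_compat; [exact P | | exact HB | assumption].
      apply Rlt_le, Rmult_lt_0_compat; [apply Rmult_lt_0_compat; assumption | assumption]. }
    replace (Cmod (phi t) * (m * m) * (/ Cmod u * / Cmod v * / Cmod v)) with (Cmod (phi t) * (/ Cmod u * / Cmod v * / Cmod v) * (m * m)) by ring.
    apply Rmult_le_compat_r; [nra | exact X].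
- apply cint_param with (d := rho / 2) (M := B * (3 * (q * q * q * q))); [exact Hrho | | |].
  + intros y t Hy. apply (kernel_cont y (Y y Hy) t).
  + intros t. apply (kernel_cont z Hz t).
  + intros y t Hy Ht.
    assert (F1 := Far y t Hy). assert (F2 := Far z t Z).
    set (u := (circ z0 r t - y)%C) in *. set (v := (circ z0 r t - z)%C) in *.
    assert (Nu : u <> 0%C) by (apply Cmod_pos_neq; lra). assert (Nv : v <> 0%C) by (apply Cmod_pos_neq; lra).
    replace (y - z)%C with (v - u)%C by (unfold u, v; cring).
    replace (phi t / (u * u) - phi t / (v * v) - (v - u) * (2 * phi t / (v * v * v)))%C
      with (phi t * ((v - u) * (v - u)) * (/ u * / u * / v * / v + / u * / v * / v * / v + / u * / v * / v * / v))%C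
      by (cfield; split; assumption).
    rewrite (Cmod_mult _ (_ + _)%C), !(Cmod_mult (phi t)), !(Cmod_mult (v - u)%C).
    assert (I1 := I _ F1). assert (I2 := I _ F2).
    assert (J1 : 0 < / Cmod u) by (apply Rinv_0_lt_compat; lra). assert (J2 : 0 < / Cmod v) by (apply Rinv_0_lt_compat; lra).
    assert (A1 : Cmod (/ u * / v * / v * / v)%C <= q * q * q * q).
    { rewrite !Cmod_mult, !Cmod_inv by assumption.
      apply Rmult_le_compat; [apply Rlt_le; repeat apply Rmult_lt_0_compat; lra | lra | | lra].
      apply Rmult_le_compat; [nra | lra | apply Rmult_le_compat; lra | lra]. }
    assert (A2 : Cmod (/ u * / u * / v * / v)%C <= q * q * q * q).
    { rewrite !Cmod_mult, !Cmod_inv by assumption.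
      apply Rmult_le_compat; [apply Rlt_le; repeat apply Rmult_lt_0_compat; lra | lra | | lra].
      apply Rmult_le_compat; [nra | lra | apply Rmult_le_compat; lra | lra]. }
    match goal with |- _ * Cmod ?s <= _ => assert (A3 : Cmod s <= 3 * (q * q * q * q)) end.
    { eapply Rle_trans; [apply Cmod_triangle|].
      eapply Rle_trans; [apply Rplus_le_compat_r, Cmod_triangle|]. lra. }
    assert (P := Cmod_ge_0 (phi t)). assert (W := Cmod_ge_0 (v - u)%C). specialize (HB t Ht).
    set (m := Cmod (v - u)%C) in *. match goal with |- _ * ?x <= _ => set (c := x) in * end.
    assert (Hc : 0 <= c) by apply Cmod_ge_0.
    replace (Cmod (phi t) * (m * m) * c) with (Cmod (phi t) * c * (m * m)) by ring.
    apply Rmult_le_compat_r; [nra|]. apply Rmult_le_compat; assumption.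
Qed.
End Kernel.

Lemma is_derive_continuity_pt (f : R -> R) (x l : R) : is_derive f x l -> continuity_pt f x.
Proof.
intros H. apply continuity_pt_filterlim, (ex_derive_continuous (V := R_NormedModule) f x).
exists l; exact H.
Qed.

Lemma cder_affine (a b c y : C) : cder (fun w => a + b * (w - c))%C y b.
Proof.
apply cder_eq with (l := (0 + b * (1 - 0))%C); [|cring].
apply (cder_plus (fun _ => a) (fun w => b * (w - c))%C); [apply cder_const|].
apply (cder_scal b (fun w => w - c)%C).
apply (cder_minus (fun w => w) (fun _ => c)); [apply cder_id | apply cder_const].
Qed.

(** * Cauchy's formula by shrinking the circle to a point *)

Section Cauchy.
Variables (f f' : C -> C) (z0 z : C) (r r' : R).
Hypothesis Hr : 0 < r.
Hypothesis Hr' : r < r'.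
Hypothesis Hf : forall w, Cmod (w - z0)%C < r' -> cder f w (f' w).
Hypothesis Hf' : forall w, Cmod (w - z0)%C < r' -> cont f' w.
Hypothesis Hz : Cmod (z - z0)%C < r.

(** The homotopy joining the point [z], at [s = 0], to the circle, at [s = 1]. *)
Let p (s t : R) : C := (z + RtoC s * (circ z0 r t - z))%C.
Let kap (t : R) : C := (circ' r t / (circ z0 r t - z))%C.

Lemma circ_neq (t : R) : (circ z0 r t - z)%C <> 0%C.
Proof.
apply Cmod_pos_neq. assert (F := circ_far z0 z z r t (Rlt_le _ _ Hr)).
replace (z - z)%C with (RtoC 0) in F by cring. rewrite Cmod_0 in F. lra.
Qed.

(** Differentiating at [s = 0] and [s = 1] needs parameters slightly outside [[0, 1]]. The margin
    suffices because every point of the circle is less than [2 * r] away from [z]. *)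
Lemma homotopy_inside (s : R) : 0 <= s <= 1 ->
  forall u t, Rabs (u - s) < (r' - r) / (2 * r) -> Cmod (p u t - z0)%C < r'.
Proof.
intros Hs u t Hu.
replace (p u t - z0)%C with ((RtoC (1 - s) * (z - z0) + RtoC s * (circ z0 r t - z0)) + RtoC (u - s) * (circ z0 r t - z0 - (z - z0)))%C
  by (unfold p; rewrite !RtoC_minus; cring).
assert (T1 := Cmod_triangle (RtoC (1 - s) * (z - z0) + RtoC s * (circ z0 r t - z0))%C (RtoC (u - s) * (circ z0 r t - z0 - (z - z0)))%C).
assert (T2 := Cmod_triangle (RtoC (1 - s) * (z - z0))%C (RtoC s * (circ z0 r t - z0))%C).
assert (T3 := Cmod_triangle (circ z0 r t - z0)%C (- (z - z0))%C).
rewrite Cmod_opp in T3. change ((circ z0 r t - z0) + - (z - z0))%C with (circ z0 r t - z0 - (z - z0))%C in T3.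
rewrite (Cmod_mult (RtoC (u - s))), Cmod_R in T1. rewrite (Cmod_mult (RtoC (1 - s))), (Cmod_mult (RtoC s)), !Cmod_R in T2.
rewrite circ_Cmod in T2, T3 by lra.
rewrite (Rabs_pos_eq (1 - s)), (Rabs_pos_eq s) in T2 by lra.
assert (P := Rabs_pos (u - s)). assert (Q := Cmod_ge_0 (circ z0 r t - z0 - (z - z0))%C).
assert (E : (r' - r) / (2 * r) * (2 * r) = r' - r) by (field; lra).
assert (Rabs (u - s) * Cmod (circ z0 r t - z0 - (z - z0))%C < r' - r \/ Cmod (circ z0 r t - z0 - (z - z0))%C = 0).
{ destruct (Req_dec (Cmod (circ z0 r t - z0 - (z - z0))%C) 0); [right; assumption | left]. nra. }
destruct H; [|rewrite H in T1]; nra.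
Qed.

Lemma p_cont2 (s t : R) : continuous (T := prod_UniformSpace R_UniformSpace R_UniformSpace) (U := C_UniformSpace) (fun q => p (fst q) (snd q)) (s, t).
Proof.
assert (CF : continuous (T := prod_UniformSpace R_UniformSpace R_UniformSpace) (U := R_UniformSpace) fst (s, t)) by apply continuous_fst.
assert (CS : continuous (T := prod_UniformSpace R_UniformSpace R_UniformSpace) (U := R_UniformSpace) snd (s, t)) by apply continuous_snd.
apply contc_plus; [apply continuous_const|]. apply contc_mult.
- apply cont_pair; simpl; [exact CF | apply continuous_const].
- apply contc_minus; [|apply continuous_const].
  apply (continuous_comp snd (circ z0 r) (s, t) CS). apply circ_cont.
Qed.

Lemma kap_cont (t : R) : contRC kap t.
Proof.
apply contc_mult; [apply circ'_cont|]. apply contc_inv; [|apply circ_neq].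
apply contc_minus; [apply circ_cont | apply continuous_const].
Qed.

Lemma p_cont1 (s t : R) : contRC (p s) t.
Proof.
apply contc_plus; [apply continuous_const|]. apply contc_mult; [apply continuous_const|].
apply contc_minus; [apply circ_cont | apply continuous_const].
Qed.

Lemma p_in (s t : R) : 0 <= s <= 1 -> Cmod (p s t - z0)%C < r'.
Proof.
intros Hs. apply (homotopy_inside s Hs s t). rewrite Rminus_diag, Rabs_R0.
apply Rdiv_lt_0_compat; lra.
Qed.

(** For [s <> 0] the integrand is the derivative of [f (p s t) / s] along a closed curve; for
    [s = 0] it is the constant [f' z] times the velocity of a closed curve. *)
Lemma homotopy_integral (s : R) : 0 <= s <= 1 -> cint (fun t => f' (p s t) * circ' r t)%C = 0%C.
Proof.
intros Hs.
assert (HC : forall t, contRC (fun t => f' (p s t) * circ' r t)%C t).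
{ intros t. apply contc_mult; [|apply circ'_cont].
  apply (continuous_comp (p s) f' t (p_cont1 s t)). apply Hf', p_in, Hs. }
destruct (Req_dec s 0) as [E|E].
- rewrite (cint_ext _ (fun t => f' z * circ' r t)%C).
  2:{ intros t. subst s. unfold p. replace (z + RtoC 0 * (circ z0 r t - z))%C with z by cring. reflexivity. }
  rewrite cint_scal by (intros; apply circ'_cont).
  rewrite (cint_derivative (circ z0 r) (circ' r)) by (intros; first [apply circ_der | apply circ'_cont]).
  rewrite circ_closed. cring.
- assert (NE : RtoC s <> 0%C) by (intro A; apply RtoC_inj in A; auto).
  rewrite (cint_derivative (fun t => / RtoC s * f (p s t))%C).
  + unfold p. rewrite circ_closed. cring.
  + intros t.
    replace (f' (p s t) * circ' r t)%C with (/ RtoC s * f' (p s t) * (RtoC s * circ' r t))%C by (cfield; exact NE).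
    apply (curve_comp (fun w => / RtoC s * f w)%C (p s)).
    * unfold p. apply (curve_comp (fun w => z + RtoC s * (w - z))%C (circ z0 r)); [apply circ_der|].
      apply cder_affine.
    * apply cder_scal, Hf, p_in, Hs.
  + exact HC.
Qed.

(** The factor [circ z0 r t - z] from the chain rule cancels the denominator of [kap], leaving the
    integrand of [homotopy_integral]. *)
Lemma homotopy_cder (u t : R) : Cmod (p u t - z0)%C < r' ->
  curve_der (fun s => f (p s t) * kap t)%C u (f' (p u t) * circ' r t)%C.
Proof.
intros H.
replace (f' (p u t) * circ' r t)%C with (f' (p u t) * kap t * (circ z0 r t - z))%C
  by (unfold kap; cfield; apply circ_neq).
apply (curve_comp (fun w => f w * kap t)%C (fun s => p s t)).
- unfold p. apply curve_affine.
- replace (f' (p u t) * kap t)%C with (f' (p u t) * kap t + f (p u t) * 0)%C by cring.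
  apply (cder_mult f (fun _ => kap t)); [apply Hf, H | apply cder_const].
Qed.

Lemma homotopy_constant_part (pr : C -> R) (s : R) : (pr = Re \/ pr = Im) -> 0 <= s <= 1 ->
  is_derive (fun s => RInt (fun t => pr (f (p s t) * kap t)%C) 0 (2 * PI)) s 0.
Proof.
intros Hpr Hs.
assert (D : 0 < (r' - r) / (2 * r)) by (apply Rdiv_lt_0_compat; lra).
assert (Hd : forall u t, Cmod (p u t - z0)%C < r' ->
  is_derive (fun s => pr (f (p s t) * kap t)%C) u (pr (f' (p u t) * circ' r t)%C)).
{ intros u t H. destruct (homotopy_cder u t H). destruct Hpr; subst pr; assumption. }
assert (Hcp : forall (T : UniformSpace) (g : T -> C) x, continuous (U := C_UniformSpace) g x -> continuous (U := R_UniformSpace) (fun y => pr (g y)) x).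
{ intros T g x H. destruct Hpr; subst pr; [apply cont_Re, H | apply cont_Im, H]. }
assert (E0 : RInt (fun t => Derive (fun u => pr (f (p u t) * kap t)%C) s) 0 (2 * PI) = 0).
{ transitivity (RInt (fun t => pr (f' (p s t) * circ' r t)%C) 0 (2 * PI)).
  - apply (RInt_ext (V := R_CompleteNormedModule)). intros t _. apply is_derive_unique, Hd, p_in, Hs.
  - assert (E := homotopy_integral s Hs). assert (E1 := f_equal fst E). assert (E2 := f_equal snd E). destruct Hpr; subst pr; [exact E1 | exact E2]. }
(* The theorem on integrals with a parameter produces the integral of the partial derivative, which
   [E0] identifies with [0]. *)
refine (eq_rect _ (fun l => is_derive _ s l) _ _ E0).
apply (is_derive_RInt_param (fun s t => pr (f (p s t) * kap t)%C)).
- exists (mkposreal _ D). intros u Hu t _. eexists. apply Hd. apply (homotopy_inside s Hs). exact Hu.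
- intros t _.
    apply continuity_2d_pt_ext_loc with (f := fun u v => pr (f' (p u v) * circ' r v)%C).
  + exists (mkposreal _ D). intros u v Hu Hv. symmetry. apply is_derive_unique, Hd, (homotopy_inside s Hs), Hu.
  + apply continuity_2d_pt_filterlim.
      apply (Hcp (prod_UniformSpace R_UniformSpace R_UniformSpace) (fun q => f' (p (fst q) (snd q)) * circ' r (snd q))%C (s, t)).
      apply contc_mult.
    * apply (continuous_comp (U := prod_UniformSpace R_UniformSpace R_UniformSpace) (V := C_UniformSpace) (fun q => p (fst q) (snd q)) f' (s, t) (p_cont2 s t)).
         apply Hf', p_in, Hs.
    * apply (continuous_comp (U := prod_UniformSpace R_UniformSpace R_UniformSpace) (V := R_UniformSpace) snd (circ' r) (s, t)); [apply continuous_snd | apply circ'_cont].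
- exists (mkposreal _ D). intros u Hu.
    apply (ex_RInt_continuous (V := R_CompleteNormedModule)). intros t _.
    apply (Hcp R_UniformSpace (fun t => f (p u t) * kap t)%C t).
    apply contc_mult; [|apply kap_cont].
    apply (continuous_comp (p u) f t (p_cont1 u t)). eapply cder_cont. apply Hf, (homotopy_inside s Hs), Hu.
Qed.

(** The integral of [f (p s t) * kap t] does not depend on [s]; its values at [s = 1] and [s = 0]
    are the two sides. *)
Lemma homotopy_end : cint (fun t => f (circ z0 r t) * kap t)%C = (f z * cint kap)%C.
Proof.
assert (E : forall pr : C -> R, (pr = Re \/ pr = Im) ->
  RInt (fun t => pr (f (p 1 t) * kap t)%C) 0 (2 * PI) = RInt (fun t => pr (f (p 0 t) * kap t)%C) 0 (2 * PI)).
{ intros pr Hpr.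
  destruct (MVT_gen (fun s => RInt (fun t => pr (f (p s t) * kap t)%C) 0 (2 * PI)) 0 1 (fun _ => 0)) as (c & _ & A);
    rewrite ?Rmin_left, ?Rmax_right in * by lra.
  - intros x Hx. apply homotopy_constant_part; [exact Hpr | lra].
  - intros x Hx. apply is_derive_continuity_pt with (l := 0).
    apply homotopy_constant_part; [exact Hpr | lra].
  - lra. }
assert (P1 : forall t, p 1 t = circ z0 r t) by (intros; unfold p; cring).
assert (P0 : forall t, p 0 t = z) by (intros; unfold p; cring).
rewrite <- cint_scal by (intros; apply kap_cont).
transitivity (cint (fun t => f (p 1 t) * kap t)%C); [apply cint_ext; intros; rewrite P1; reflexivity|].
transitivity (cint (fun t => f (p 0 t) * kap t)%C); [|apply cint_ext; intros; rewrite P0; reflexivity].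
unfold cint. apply injective_projections; simpl; [apply (E Re) | apply (E Im)]; auto.
Qed.

End Cauchy.

Lemma Cmod_segment (z0 z : C) (r t : R) : Cmod (z - z0)%C < r -> 0 <= t <= 1 ->
  Cmod (z0 + RtoC t * (z - z0) - z0)%C < r.
Proof.
intros Hz Ht. replace (z0 + RtoC t * (z - z0) - z0)%C with (RtoC t * (z - z0))%C by cring.
rewrite Cmod_mult, Cmod_R, Rabs_pos_eq by lra. generalize (Cmod_ge_0 (z - z0)%C). nra.
Qed.

(** The derivative in [z] is the integral of an exact derivative along a closed curve, so the value
    is that at the centre, where the integrand is the constant [Ci]. *)
Lemma winding_number (z0 z : C) (r : R) : 0 < r -> Cmod (z - z0)%C < r ->
  cint (fun t => circ' r t / (circ z0 r t - z))%C = (RtoC (2 * PI) * Ci)%C.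
Proof.
intros Hr Hz.
set (W := fun y => cint (fun t => circ' r t / (circ z0 r t - y))%C).
assert (D : forall y, Cmod (y - z0)%C < r -> cder W y 0%C).
{ intros y Hy. replace (RtoC 0) with (cint (fun t => circ' r t / ((circ z0 r t - y) * (circ z0 r t - y)))%C).
  - exact (proj1 (kernel_cder z0 r (circ' r) Hr (circ'_cont r) y Hy)).
  - rewrite (cint_derivative (fun t => - / (circ z0 r t - y))%C).
    + rewrite circ_closed. cring.
    + intros t. assert (N := circ_neq z0 y r Hr Hy t).
      replace (circ' r t / ((circ z0 r t - y) * (circ z0 r t - y)))%C
        with (- (- (1 - 0) / ((circ z0 r t - y) * (circ z0 r t - y))) * circ' r t)%C by (cfield; exact N).
      apply (curve_comp (fun w => - / (w - y))%C (circ z0 r)); [apply circ_der|].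
      apply cder_opp. apply (cder_inv (fun w => w - y)%C); [|exact N].
      apply cder_minus; [apply cder_id | apply cder_const].
    + intros t. exact (proj1 (proj2 (kernel_cont z0 r (circ' r) Hr (circ'_cont r) y Hy t))). }
assert (E : W z = W z0).
{ assert (M := mean_value_ineq W z0 z 0). rewrite Rmult_0_r, Rmult_0_l in M.
  assert (M' : Cmod (W z - W z0)%C <= 0).
  { apply M. intros t Ht. exists 0%C. split; [|rewrite Cmod_0; lra]. apply D, Cmod_segment; assumption. }
  assert (M2 : (W z - W z0)%C = 0%C) by (apply Cmod_eq_0; generalize (Cmod_ge_0 (W z - W z0)%C); lra).
  replace (W z) with (W z - W z0 + W z0)%C by cring. rewrite M2. cring. }
unfold W in E. rewrite E.
assert (N0 : Cmod (z0 - z0)%C < r) by (replace (z0 - z0)%C with (RtoC 0) by cring; rewrite Cmod_0; exact Hr).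
rewrite (cint_ext _ (fun _ => Ci)).
- unfold cint, Ci. apply injective_projections; simpl; rewrite (RInt_const (V := R_CompleteNormedModule));
    unfold scal; simpl; unfold mult; simpl; ring.
- intros t. rewrite (circ'_i z0). cfield. apply (circ_neq z0 z0 r Hr N0).
Qed.

Theorem Cauchy_formula (f f' : C -> C) (z0 z : C) (r r' : R) :
  0 < r -> r < r' ->
  (forall w, Cmod (w - z0)%C < r' -> cder f w (f' w)) ->
  (forall w, Cmod (w - z0)%C < r' -> cont f' w) ->
  Cmod (z - z0)%C < r ->
  (RtoC (2 * PI) * Ci * f z)%C = cint (fun t => f (circ z0 r t) * circ' r t / (circ z0 r t - z))%C.
Proof.
intros Hr Hr' Hf Hf' Hz.
assert (E := homotopy_end f f' z0 z r r' Hr Hr' Hf Hf' Hz).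
rewrite (winding_number z0 z r Hr Hz) in E.
rewrite (cint_ext _ (fun t => f (circ z0 r t) * (circ' r t / (circ z0 r t - z)))%C) by (intros; unfold Cdiv; cring).
rewrite E. cring.
Qed.

Lemma two_pi_i_neq : (RtoC (2 * PI) * Ci)%C <> 0%C.
Proof.
intro E. apply (f_equal snd) in E. simpl in E. generalize two_PI_pos. lra.
Qed.

(** Integrating by parts in the formula for [f'] turns it into Cauchy's formula
    for [f'], so that it can be differentiated twice more. *)
Lemma C1_cder_twice (f f' : C -> C) (z0 : C) (r' : R) :
  0 < r' ->
  (forall w, Cmod (w - z0)%C < r' -> cder f w (f' w)) ->
  (forall w, Cmod (w - z0)%C < r' -> cont f' w) ->
  exists f'' l, locC z0 (fun z => cder f' z (f'' z)) /\ cder f'' z0 l.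
Proof.
intros Hr' Hf Hf'. set (r := r' / 2). assert (Hr : 0 < r) by (unfold r; lra). assert (Hrr : r < r') by (unfold r; lra).
set (phi := fun t => (f (circ z0 r t) * circ' r t)%C).
assert (Hphi : forall t, contRC phi t).
{ intros t. apply contc_mult; [|apply circ'_cont]. apply (continuous_comp (circ z0 r) f t (circ_cont z0 r t)).
  eapply cder_cont. apply Hf. rewrite circ_Cmod; lra. }
assert (A : forall z, Cmod (z - z0)%C < r ->
  f' z = (/ (RtoC (2 * PI) * Ci) * cint (fun t => phi t / ((circ z0 r t - z) * (circ z0 r t - z))))%C).
{ intros z Hz. apply cder_unique with (f := f) (z := z); [apply Hf; lra|].
  apply cder_ext_loc with (f := fun y => (/ (RtoC (2 * PI) * Ci) * cint (fun t => phi t / (circ z0 r t - y)))%C).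
  - apply locC_Cmod. exists (r - Cmod (z - z0)%C). split; [lra|]. intros y Hy.
    assert (Hy0 : Cmod (y - z0)%C < r).
    { replace (y - z0)%C with ((y - z) + (z - z0))%C by cring. eapply Rle_lt_trans; [apply Cmod_triangle | lra]. }
    unfold phi. rewrite <- (Cauchy_formula f f' z0 y r r' Hr Hrr Hf Hf' Hy0). cfield.
    split; [apply Ci_neq_0 || (intro E; apply two_pi_i_neq; rewrite E; cring) | intro E; apply two_pi_i_neq; rewrite E; cring].
  - apply cder_scal. exact (proj1 (kernel_cder z0 r phi Hr Hphi z Hz)). }
set (psi := fun t => (f' (circ z0 r t) * circ' r t)%C).
assert (Hpsi : forall t, contRC psi t).
{ intros t. apply contc_mult; [|apply circ'_cont]. apply (continuous_comp (circ z0 r) f' t (circ_cont z0 r t)).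
  apply Hf'. rewrite circ_Cmod; lra. }
assert (B : forall z, Cmod (z - z0)%C < r ->
  f' z = (/ (RtoC (2 * PI) * Ci) * cint (fun t => psi t / (circ z0 r t - z)))%C).
{ intros z Hz. rewrite (A z Hz). f_equal.
  assert (K1 := fun t => proj1 (proj2 (kernel_cont z0 r phi Hr Hphi z Hz t))).
  assert (K2 := fun t => proj1 (kernel_cont z0 r psi Hr Hpsi z Hz t)).
  assert (E : (cint (fun t => phi t / ((circ z0 r t - z) * (circ z0 r t - z))) - cint (fun t => psi t / (circ z0 r t - z)) = 0)%C).
  { rewrite <- cint_minus by assumption.
    rewrite (cint_derivative (fun t => - (f (circ z0 r t) / (circ z0 r t - z)))%C).
    - rewrite circ_closed. cring.
    - intros t. assert (N := circ_neq z0 z r Hr Hz t).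
      replace (phi t / ((circ z0 r t - z) * (circ z0 r t - z)) - psi t / (circ z0 r t - z))%C
        with (- ((f' (circ z0 r t) * (circ z0 r t - z) - f (circ z0 r t) * (1 - 0)) / ((circ z0 r t - z) * (circ z0 r t - z))) * circ' r t)%C
        by (unfold phi, psi; cfield; exact N).
      apply (curve_comp (fun w => - (f w / (w - z)))%C (circ z0 r)); [apply circ_der|].
      apply cder_opp. apply (cder_div f (fun w => w - z)%C); [|apply cder_minus; [apply cder_id | apply cder_const]|exact N].
      apply Hf. rewrite circ_Cmod; lra.
    - intros t. apply contc_minus; [apply K1 | apply K2]. }
  replace (cint (fun t => phi t / ((circ z0 r t - z) * (circ z0 r t - z)))%C) with
    ((cint (fun t => phi t / ((circ z0 r t - z) * (circ z0 r t - z))) - cint (fun t => psi t / (circ z0 r t - z)))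
      + cint (fun t => psi t / (circ z0 r t - z)))%C by cring.
  rewrite E. cring. }
assert (N0 : Cmod (z0 - z0)%C < r) by (replace (z0 - z0)%C with (RtoC 0) by cring; rewrite Cmod_0; exact Hr).
exists (fun z => / (RtoC (2 * PI) * Ci) * cint (fun t => psi t / ((circ z0 r t - z) * (circ z0 r t - z))))%C.
eexists. split.
- apply locC_Cmod. exists r; split; [exact Hr|]. intros z Hz.
  apply cder_ext_loc with (f := fun y => (/ (RtoC (2 * PI) * Ci) * cint (fun t => psi t / (circ z0 r t - y)))%C).
  + apply locC_Cmod. exists (r - Cmod (z - z0)%C). split; [lra|]. intros y Hy. symmetry. apply B.
    replace (y - z0)%C with ((y - z) + (z - z0))%C by cring. eapply Rle_lt_trans; [apply Cmod_triangle | lra].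
  + apply cder_scal. exact (proj1 (kernel_cder z0 r psi Hr Hpsi z Hz)).
- apply cder_scal. exact (proj2 (kernel_cder z0 r psi Hr Hpsi z0 N0)).
Qed.

Lemma openC_box (O : C -> Prop) (z : C) : openC O -> O z ->
  exists r : posreal, forall w, box z r w -> O w.
Proof. intros H Hz. destruct (H z Hz) as [r Hr]. exists r; exact Hr. Qed.

(** Nothing is known about the continuity of the derivative of [f], but a local primitive [F] has
    the continuous derivative [f], so that Cauchy's formula applies to [F] and differentiates [f]
    twice. *)
Theorem hol_derivative (O : C -> Prop) (f : C -> C) : openC O -> hol O f -> hol O (C_derive f).
Proof.
intros HO Hf z0 Hz0. destruct (openC_box O z0 HO Hz0) as [r Hr].
destruct (hol_primitive f z0 r (fun w Hw => Hf w (Hr w Hw))) as [F HF].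
destruct (C1_cder_twice F f z0 r (cond_pos r)) as (f' & l & H1 & H2).
- intros w Hw. apply HF, Cmod_box, Hw.
- intros w Hw. destruct (Hf w (Hr w (Cmod_box _ _ _ Hw))) as [m Hm]. exact (cder_cont _ _ _ Hm).
- exists l. apply cder_ext_loc with (f := f'); [|exact H2].
  revert H1. apply filter_imp. intros z Hz. symmetry. apply cder_C_derive, Hz.
Qed.

Lemma hol_cont (O : C -> Prop) (f : C -> C) (z : C) : hol O f -> O z -> cont f z.
Proof. intros H Hz. destruct (H z Hz) as [l Hl]. exact (cder_cont _ _ _ Hl). Qed.

(** * Orders of zeros *)

Lemma Cminus_neq (z p : C) : z <> p -> (z - p)%C <> 0%C.
Proof. intros H E. apply H. replace z with (z - p + p)%C by cring. rewrite E. cring. Qed.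

Lemma Cinv_neq_0 (z : C) : z <> 0%C -> (/ z)%C <> 0%C.
Proof. intros H E. apply C1_nz. rewrite <- (Cinv_r z H), E. cring. Qed.

(** Only the point [p] is at issue: the quotient is extended there by [C_derive f p], and its
    derivative at [p] is half the second derivative of [f]. *)
Lemma hol_divide (f : C -> C) (p : C) (r : R) : 0 < r ->
  hol (box p r) f -> f p = 0%C ->
  exists f1, hol (box p r) f1 /\ forall z, f z = ((z - p) * f1 z)%C.
Proof.
intros Hr Hf Hp. assert (Pp : box p r p) by exact (ball_center (M := C_UniformSpace) p (mkposreal r Hr)).
set (f1 := fun z => if Ceq_dec z p then C_derive f p else (f z / (z - p))%C).
assert (E1 : forall z, z <> p -> f1 z = (f z / (z - p))%C) by (intros z Hz; unfold f1; destruct (Ceq_dec z p); [contradiction | reflexivity]).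
assert (E0 : f1 p = C_derive f p) by (unfold f1; destruct (Ceq_dec p p); congruence).
exists f1. split.
- intros z Hz. destruct (classic (z = p)) as [E|E].
  + subst z.
    destruct (hol_derivative _ f (openC_ball p r) Hf p Pp) as [f2 Hf2].
    exists (/ 2 * f2)%C. intros eps.
    assert (He : 0 < eps / 2) by (generalize (cond_pos eps); lra).
    generalize (Hf2 (mkposreal _ He)); intros K. apply locC_Cmod in K. destruct K as (d & Hd & K). simpl in K.
    apply locC_Cmod. exists (Rmin d r). split; [apply Rmin_glb_lt; assumption|]. intros z Hz'.
    assert (Z1 := Rlt_le_trans _ _ _ Hz' (Rmin_l _ _)). assert (Z2 := Rlt_le_trans _ _ _ Hz' (Rmin_r _ _)).
    destruct (classic (z = p)) as [E|E].
    { subst z. replace (f1 p - f1 p - (p - p) * (/ 2 * f2))%C with (RtoC 0) by cring. rewrite Cmod_0.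
      apply Rmult_le_pos; [apply Rlt_le, cond_pos | apply Cmod_ge_0]. }
    rewrite E0, (E1 z E). assert (N := Cminus_neq z p E).
    (* [f] minus its Taylor polynomial of degree 2. The derivative of [k] is [o(w - p)], and the
       mean value inequality turns this into a bound on [k]. *)
    set (k := fun w => (f w - C_derive f p * (w - p) - / 2 * f2 * ((w - p) * (w - p)))%C).
    assert (Hk : Cmod (k z - k p)%C <= 2 * (eps / 2 * Cmod (z - p)%C) * Cmod (z - p)%C).
    { apply mean_value_ineq. intros t Ht. set (w := (p + RtoC t * (z - p))%C).
      assert (Ew : (w - p)%C = (RtoC t * (z - p))%C) by (unfold w; cring).
      assert (Ew' : Cmod (w - p)%C <= Cmod (z - p)%C).
      { rewrite Ew, Cmod_mult, Cmod_R, Rabs_pos_eq by lra. generalize (Cmod_ge_0 (z - p)%C). nra. }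
      exists (C_derive f w - C_derive f p - (w - p) * f2)%C. split.
      - unfold k. apply cder_eq with (l := (C_derive f w - C_derive f p * (1 - 0) - / 2 * f2 * ((1 - 0) * (w - p) + (w - p) * (1 - 0)))%C).
        + assert (A : cder (fun w => w - p)%C w (1 - 0)%C) by (apply (cder_minus (fun w => w) (fun _ => p)); [apply cder_id | apply cder_const]).
          apply (cder_minus (fun w => f w - C_derive f p * (w - p))%C (fun w => / 2 * f2 * ((w - p) * (w - p)))%C).
          * apply (cder_minus f (fun w => C_derive f p * (w - p))%C).
            -- apply (hol_C_derive (box p r)); [exact Hf|]. apply Cmod_box. lra.
            -- apply (cder_scal (C_derive f p) (fun w => w - p)%C), A.
          * apply (cder_scal (/ 2 * f2) (fun w => (w - p) * (w - p))%C). apply (cder_mult (fun w => w - p)%C (fun w => w - p)%C); exact A.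
        + cfield.
      - eapply Rle_trans; [apply K; lra|]. apply Rmult_le_compat_l; lra. }
    assert (Ek : (k z - k p)%C = ((f z / (z - p) - C_derive f p - (z - p) * (/ 2 * f2)) * (z - p))%C).
    { unfold k. rewrite Hp. cfield. exact N. }
    rewrite Ek, Cmod_mult in Hk.
    assert (P : 0 < Cmod (z - p)%C) by (apply Cmod_gt_0, N).
    apply Rmult_le_reg_r with (1 := P). eapply Rle_trans; [exact Hk|]. right; field.
  + destruct (Hf z Hz) as [l Hl]. eexists.
    apply cder_ext_loc with (f := fun w => (f w / (w - p))%C).
    * assert (N := Cminus_neq z p E).
      assert (L : locC z (fun w => (w - p)%C <> 0%C)).
      { apply Cmod_neq0_loc; [|exact N]. apply contc_minus; [apply continuous_id | apply continuous_const]. }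
      revert L; apply filter_imp. intros w Hw. symmetry. apply E1. intro A; apply Hw; rewrite A; cring.
    * apply (cder_div f (fun w => w - p)%C); [exact Hl | | apply Cminus_neq, E].
      apply (cder_minus (fun w => w) (fun _ => p)); [apply cder_id | apply cder_const].
- intros z. destruct (classic (z = p)) as [E|E].
  + subst z. rewrite Hp. cring.
  + rewrite (E1 z E). cfield. apply Cminus_neq, E.
Qed.

(** If [M] bounds [f] on the circle of radius [R], then [g] is at most [M / R ^ n] there. Cauchy's
    formula carries this to half the radius with a factor 4, so that
    [Cmod (f z) <= 4 * M * (/ 2) ^ n] for every [n]. *)
Lemma infinite_order_zero (f : C -> C) (p : C) (r : R) : 0 < r ->
  (forall n, exists g, hol (box p r) g /\ forall z, box p r z -> f z = (Cpow (z - p) n * g z)%C) ->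
  locC p (fun z => f z = 0%C).
Proof.
intros Hr H. set (R := r / 2). assert (HR : 0 < R) by (unfold R; lra).
assert (In : forall t, box p r (circ p R t)) by (intros t; apply Cmod_box; rewrite circ_Cmod; unfold R; lra).
destruct (H O) as (f0 & Hf0 & Ef0).
assert (Cf : forall t, contRC (fun t => f0 (circ p R t)) t).
{ intros t. apply (continuous_comp (circ p R) f0 t (circ_cont p R t)). apply (hol_cont _ _ _ Hf0 (In t)). }
destruct (RC_bounded _ Cf) as (M & HM0 & HM).
assert (PI0 := PI_RGT_0).
apply locC_Cmod. exists (R / 2). split; [lra|]. intros z Hz.
assert (Bd : forall n, Cmod (f z) <= 4 * M * (/ 2) ^ n).
{ intros n. destruct (H n) as (g & Hg & Eg).
  assert (Cg : forall t, contRC (fun t => g (circ p R t)) t).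
  { intros t. apply (continuous_comp (circ p R) g t (circ_cont p R t)). apply (hol_cont _ _ _ Hg (In t)). }
  assert (Bg : forall t, 0 <= t <= 2 * PI -> R ^ n * Cmod (g (circ p R t)) <= M).
  { intros t Ht. specialize (HM t Ht). specialize (Eg _ (In t)). specialize (Ef0 _ (In t)). simpl in Ef0.
    rewrite Eg in Ef0. apply (f_equal Cmod) in Ef0. rewrite !Cmod_mult, Cmod_pow, circ_Cmod, Cmod_1 in Ef0 by lra. lra. }
  assert (CF := Cauchy_formula g (C_derive g) p z R r HR ltac:(unfold R; lra)
    (fun w Hw => hol_C_derive _ _ _ Hg (Cmod_box _ _ _ Hw))
    (fun w Hw => hol_cont _ _ _ (hol_derivative _ _ (openC_ball p r) Hg) (Cmod_box _ _ _ Hw)) ltac:(lra)).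
  apply (f_equal Cmod) in CF. rewrite !Cmod_mult, Cmod_R in CF.
  replace (Cmod Ci) with 1 in CF.
  2:{ unfold Cmod, Ci; simpl. replace (0 * (0 * 1) + 1 * (1 * 1)) with 1 by ring. symmetry; apply sqrt_1. }
  rewrite Rabs_pos_eq in CF by lra.
  assert (Rn : 0 < R ^ n) by (apply pow_lt, HR).
  assert (B2 : Cmod (cint (fun t => g (circ p R t) * circ' R t / (circ p R t - z))%C) <= 4 * PI * (2 * (M / R ^ n))).
  { apply cint_bound.
    - intros t. assert (K := proj1 (kernel_cont p R (fun t => g (circ p R t) * circ' R t)%C HR
        (fun t => contc_mult _ _ _ (Cg t) (circ'_cont R t)) z ltac:(lra) t)). exact K.
    - intros t Ht.
      assert (Fz := circ_far p z z R t (Rlt_le _ _ HR)).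
      replace (z - z)%C with (RtoC 0) in Fz by cring. rewrite Cmod_0 in Fz.
      assert (Nz : (circ p R t - z)%C <> 0%C) by (apply Cmod_pos_neq; lra).
      rewrite Cmod_div, Cmod_mult by exact Nz.
      assert (E : Cmod (circ' R t) = R).
      { rewrite (circ'_i p), Cmod_mult, circ_Cmod by lra. unfold Cmod, Ci; simpl.
        replace (0 * (0 * 1) + 1 * (1 * 1)) with 1 by ring. rewrite sqrt_1. ring. }
      rewrite E. specialize (Bg t Ht).
      assert (G : Cmod (g (circ p R t)) <= M / R ^ n).
      { apply Rmult_le_reg_r with (1 := Rn). unfold Rdiv. rewrite Rmult_assoc, Rinv_l by lra. lra. }
      apply Rmult_le_reg_r with (Cmod (circ p R t - z)%C); [lra|].
      unfold Rdiv at 1. rewrite Rmult_assoc, Rinv_l by lra.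
      assert (Q := Cmod_ge_0 (g (circ p R t))).
      set (x := M / R ^ n) in *. set (y := Cmod (circ p R t - z)%C) in *. nra. }
  assert (G : Cmod (g z) <= 4 * (M / R ^ n)).
  { rewrite <- CF in B2. apply Rmult_le_reg_l with (2 * PI); [lra|]. lra. }
  rewrite (Eg z) by (apply Cmod_box; unfold R in *; lra). rewrite Cmod_mult, Cmod_pow.
  replace (4 * M * (/ 2) ^ n) with ((R / 2) ^ n * (4 * (M / R ^ n))).
  - apply Rmult_le_compat; [apply pow_le, Cmod_ge_0 | apply Cmod_ge_0 | | exact G].
    apply pow_incr. split; [apply Cmod_ge_0 | lra].
  - unfold Rdiv. rewrite Rpow_mult_distr. field. lra. }
apply Cmod_eq_0. apply Rle_antisym; [|apply Cmod_ge_0].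
apply Rnot_lt_le. intros Pz.
destruct (pow_lt_1_zero (/ 2) ltac:(rewrite Rabs_pos_eq; lra) (Cmod (f z) / (4 * M + 1)) ltac:(apply Rdiv_lt_0_compat; lra)) as [n Hn].
specialize (Hn n (Nat.le_refl n)). specialize (Bd n). rewrite Rabs_pos_eq in Hn by (apply pow_le; lra).
apply Rmult_lt_compat_l with (r := 4 * M + 1) in Hn; [|lra].
replace ((4 * M + 1) * (Cmod (f z) / (4 * M + 1))) with (Cmod (f z)) in Hn by (field; lra).
assert (0 < (/ 2) ^ n) by (apply pow_lt; lra). nra.
Qed.

Definition hol_at (f : C -> C) (p : C) : Prop := locC p (fun z => exists l, cder f z l).

Lemma hol_at_box (f : C -> C) (p : C) : hol_at f p <-> exists r, 0 < r /\ hol (box p r) f.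
Proof.
split.
- intros [r Hr]. exists r; split; [apply cond_pos | exact Hr].
- intros (r & H0 & Hr). exists (mkposreal r H0). exact Hr.
Qed.

Lemma hol_at_cont (f : C -> C) (p : C) : hol_at f p -> cont f p.
Proof. intros H. destruct (locally_singleton _ _ H) as [l Hl]. exact (cder_cont _ _ _ Hl). Qed.

Lemma cder_Cpow (p : C) (n : nat) (z : C) : exists l, cder (fun w => Cpow (w - p) n) z l.
Proof.
induction n as [|n [l IH]]; [exists 0%C; apply (cder_const 1%C)|]. eexists.
apply (cder_mult (fun w => w - p)%C (fun w => Cpow (w - p) n)); [|exact IH].
apply (cder_minus (fun w => w) (fun _ => p)); [apply cder_id | apply cder_const].
Qed.

(** Divide by [z - p] as long as the quotient vanishes at [p]. Every division keeps the same box, as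
    [infinite_order_zero] requires when the process never stops. *)
Theorem zero_order (f : C -> C) (p : C) : hol_at f p ->
  locC p (fun z => f z = 0%C) \/
  exists m e, hol_at e p /\ e p <> 0%C /\ locC p (fun z => f z = Cpow (z - p) m * e z)%C.
Proof.
intros H. destruct (classic (exists m e, hol_at e p /\ e p <> 0%C /\ locC p (fun z => f z = Cpow (z - p) m * e z)%C)) as [A|A]; [right; exact A | left].
apply hol_at_box in H. destruct H as (r & Hr & H).
apply infinite_order_zero with (r := r); [exact Hr|].
assert (K : forall n, exists g, hol (box p r) g /\ forall z, f z = (Cpow (z - p) n * g z)%C).
{ induction n as [|n (g & Hg & Eg)].
  - exists f. split; [exact H | intros z; simpl; cring].
  - assert (Gp : g p = 0%C).
    { apply NNPP. intros N. apply A. exists n, g. split; [apply hol_at_box; exists r; auto|]. split; [exact N|].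
      apply filter_forall. exact Eg. }
    destruct (hol_divide g p r Hr Hg Gp) as (g1 & Hg1 & Eg1). exists g1. split; [exact Hg1|].
    intros z. rewrite Eg, Eg1. simpl. cring. }
intros n. destruct (K n) as (g & Hg & Eg). exists g; split; auto.
Qed.

Lemma isolated_zeros (f : C -> C) (p : C) : hol_at f p -> ~ locC p (fun z => f z = 0%C) ->
  locC p (fun z => z <> p -> f z <> 0%C).
Proof.
intros H N. destruct (zero_order f p H) as [A|(m & e & He & Hn & A)]; [contradiction|].
generalize (filter_and _ _ A (Cmod_neq0_loc _ _ (hol_at_cont _ _ He) Hn)). apply filter_imp.
intros z [E Ez] Hz. rewrite E. apply Cmult_neq_0; [apply Cpow_nz, Cminus_neq, Hz | exact Ez].
Qed.

(** Germs of holomorphic functions form a valuation ring. *)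
Theorem hol_quotient (a b : C -> C) (p : C) : hol_at a p -> hol_at b p ->
  ~ locC p (fun z => b z = 0%C) ->
  (exists c, hol_at c p /\ locC p (fun z => a z = b z * c z)%C) \/
  (exists c, hol_at c p /\ c p = 0%C /\ locC p (fun z => z <> p -> c z <> 0%C) /\ locC p (fun z => b z = a z * c z)%C).
Proof.
intros Ha Hb Nb.
destruct (zero_order b p Hb) as [B|(m & e & He & En & B)]; [contradiction|].
destruct (zero_order a p Ha) as [A|(l & d & Hd & Dn & A)].
{ left. exists (fun _ => 0%C). split.
  - unfold hol_at. apply filter_forall. intros z; exists 0%C; apply (cder_const 0%C).
  - revert A; apply filter_imp. intros z E; rewrite E; cring. }
assert (Le := Cmod_neq0_loc _ _ (hol_at_cont _ _ He) En).
assert (Ld := Cmod_neq0_loc _ _ (hol_at_cont _ _ Hd) Dn).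
assert (Hq : forall n u v, hol_at u p -> hol_at v p -> locC p (fun z => v z <> 0%C) -> hol_at (fun z => Cpow (z - p) n * (u z / v z))%C p).
{ intros n u v Hu Hv Hn. unfold hol_at in *. generalize (filter_and _ _ Hn (filter_and _ _ Hu Hv)). apply filter_imp.
  intros z (N & (x & X) & (y & Y)). destruct (cder_Cpow p n z) as [k Hk]. eexists.
  apply (cder_mult (fun w => Cpow (w - p) n) (fun w => u w / v w)%C); [exact Hk|].
  apply (cder_div u v); [exact X | exact Y | exact N]. }
destruct (Nat.le_gt_cases m l) as [L|L].
- left. exists (fun z => Cpow (z - p) (l - m) * (d z / e z))%C. split; [apply Hq; assumption|].
  generalize (filter_and _ _ Le (filter_and _ _ A B)). apply filter_imp. intros z (N & E1 & E2).
  rewrite E1, E2. replace l with (m + (l - m))%nat at 1 by lia. rewrite Cpow_add_r. cfield. exact N.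
- right. exists (fun z => Cpow (z - p) (m - l) * (e z / d z))%C. split; [apply Hq; assumption|]. split; [|split].
  + replace (m - l)%nat with (S (m - l - 1)) by lia. simpl. cring.
  + generalize (filter_and _ _ Le Ld). apply filter_imp. intros z (N1 & N2) Hz.
    apply Cmult_neq_0; [apply Cpow_nz, Cminus_neq, Hz|]. apply Cmult_neq_0; [exact N1|]. apply Cinv_neq_0, N2.
  + generalize (filter_and _ _ Ld (filter_and _ _ A B)). apply filter_imp. intros z (N & E1 & E2).
    rewrite E1, E2. replace m with (l + (m - l))%nat at 1 by lia. rewrite Cpow_add_r. cfield. exact N.
Qed.

(** * Smooth real functions in the plane *)

Definition Dx (F : C -> R) (z : C) : R := Derive (fun t => F (t, Im z)) (Re z).
Definition Dy (F : C -> R) (z : C) : R := Derive (fun t => F (Re z, t)) (Im z).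

(** The planar counterpart of [class_C], taken at a single point so that it only depends on [F] near
    that point. *)
Fixpoint ck (n : nat) (F : C -> R) (z : C) : Prop :=
  contR F z /\
  match n with
  | O => True
  | S m => (ex_derive (fun t => F (t, Im z)) (Re z) /\ ex_derive (fun t => F (Re z, t)) (Im z)) /\
           ck m (Dx F) z /\ ck m (Dy F) z
  end.

Definition sm (O : C -> Prop) (F : C -> R) : Prop := forall n z, O z -> ck n F z.

Lemma ck_cont (n : nat) (F : C -> R) (z : C) : ck n F z -> contR F z.
Proof. destruct n; intros H; apply H. Qed.

Lemma Dx_ext_loc (F G : C -> R) (z : C) : locC z (fun y => F y = G y) -> Dx F z = Dx G z.
Proof. intros H. apply Derive_ext_loc. apply (locally_slice_x z (fun y => F y = G y) H). Qed.

Lemma Dy_ext_loc (F G : C -> R) (z : C) : locC z (fun y => F y = G y) -> Dy F z = Dy G z.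
Proof. intros H. apply Derive_ext_loc. apply (locally_slice_y z (fun y => F y = G y) H). Qed.

Lemma ck_ext_loc (n : nat) : forall (F G : C -> R) (z : C),
  locC z (fun y => F y = G y) -> ck n F z -> ck n G z.
Proof.
induction n as [|n IH]; intros F G z H K.
- split; [|exact I]. destruct K as [K _]. apply continuous_ext_loc with (g := F); [exact H | exact K].
- destruct K as (K0 & (K1 & K2) & K3 & K4). split; [|split; [split|split]].
  + apply continuous_ext_loc with (g := F); [exact H | exact K0].
  + apply ex_derive_ext_loc with (2 := K1). apply (locally_slice_x z (fun y => F y = G y) H).
  + apply ex_derive_ext_loc with (2 := K2). apply (locally_slice_y z (fun y => F y = G y) H).
  + apply IH with (2 := K3). generalize (locally_locally _ _ H). apply filter_imp. intros y Hy. apply Dx_ext_loc, Hy.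
  + apply IH with (2 := K4). generalize (locally_locally _ _ H). apply filter_imp. intros y Hy. apply Dy_ext_loc, Hy.
Qed.

Lemma ck_le (n : nat) : forall (F : C -> R) (z : C), ck (S n) F z -> ck n F z.
Proof.
induction n as [|n IH]; intros F z (H0 & H1 & H2 & H3).
- split; [exact H0 | exact I].
- split; [exact H0|]. split; [exact H1|]. split; apply IH; assumption.
Qed.

Section Smooth.
Variable O : C -> Prop.
Hypothesis HO : openC O.

Lemma loc_of_open (P : C -> Prop) (z : C) : O z -> (forall y, O y -> P y) -> locC z P.
Proof. intros Hz H. generalize (HO z Hz). apply filter_imp, H. Qed.

Lemma sm_ext (F G : C -> R) : (forall z, O z -> F z = G z) -> sm O F -> sm O G.
Proof.
intros H K n z Hz. apply ck_ext_loc with (2 := K n z Hz). apply loc_of_open; assumption.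
Qed.

Lemma sm_cont (F : C -> R) (z : C) : sm O F -> O z -> contR F z.
Proof. intros H Hz. exact (ck_cont _ _ _ (H 0%nat z Hz)). Qed.

Lemma sm_Dx (F : C -> R) : sm O F -> sm O (Dx F).
Proof. intros H n z Hz. apply (H (S n) z Hz). Qed.
Lemma sm_Dy (F : C -> R) : sm O F -> sm O (Dy F).
Proof. intros H n z Hz. apply (H (S n) z Hz). Qed.

Lemma ck_Dx_derive (n : nat) (F : C -> R) (z : C) : ck (S n) F z -> is_derive (fun t => F (t, Im z)) (Re z) (Dx F z).
Proof. intros H. apply Derive_correct, H. Qed.
Lemma ck_Dy_derive (n : nat) (F : C -> R) (z : C) : ck (S n) F z -> is_derive (fun t => F (Re z, t)) (Im z) (Dy F z).
Proof. intros H. apply Derive_correct, H. Qed.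

Lemma sm_Dx_derive (F : C -> R) (z : C) : sm O F -> O z -> is_derive (fun t => F (t, Im z)) (Re z) (Dx F z).
Proof. intros H Hz. exact (ck_Dx_derive 0 _ _ (H 1%nat z Hz)). Qed.
Lemma sm_Dy_derive (F : C -> R) (z : C) : sm O F -> O z -> is_derive (fun t => F (Re z, t)) (Im z) (Dy F z).
Proof. intros H Hz. exact (ck_Dy_derive 0 _ _ (H 1%nat z Hz)). Qed.

(** Replaces [Dx F] and [Dy F] by explicit formulas valid on [O], on which an induction over the
    order can proceed. *)
Lemma ck_S_intro (n : nat) (F F1 F2 : C -> R) (z : C) : O z ->
  contR F z ->
  (forall y, O y -> is_derive (fun t => F (t, Im y)) (Re y) (F1 y)) ->
  (forall y, O y -> is_derive (fun t => F (Re y, t)) (Im y) (F2 y)) ->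
  ck n F1 z -> ck n F2 z -> ck (S n) F z.
Proof.
intros Hz H0 H1 H2 K1 K2. split; [exact H0|]. split; [|split].
- split; eexists; [apply H1 | apply H2]; exact Hz.
- apply ck_ext_loc with (2 := K1). apply loc_of_open; [exact Hz|]. intros y Hy. symmetry. apply is_derive_unique, H1, Hy.
- apply ck_ext_loc with (2 := K2). apply loc_of_open; [exact Hz|]. intros y Hy. symmetry. apply is_derive_unique, H2, Hy.
Qed.

Lemma ck_const (n : nat) : forall (a : R) (z : C), O z -> ck n (fun _ => a) z.
Proof.
induction n as [|n IH]; intros a z Hz.
- split; [apply continuous_const | exact I].
- apply ck_S_intro with (F1 := fun _ => 0) (F2 := fun _ => 0); auto.
  + apply continuous_const.
  + intros; apply (is_derive_const (V := R_NormedModule)).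
  + intros; apply (is_derive_const (V := R_NormedModule)).
Qed.

Lemma ck_plus (n : nat) : forall (F G : C -> R),
  (forall z, O z -> ck n F z) -> (forall z, O z -> ck n G z) -> forall z, O z -> ck n (fun y => F y + G y) z.
Proof.
induction n as [|n IH]; intros F G HF HG z Hz.
- split; [apply contr_plus; [apply (HF z Hz) | apply (HG z Hz)] | exact I].
- apply ck_S_intro with (F1 := fun y => Dx F y + Dx G y) (F2 := fun y => Dy F y + Dy G y); auto.
  + apply contr_plus; [apply (HF z Hz) | apply (HG z Hz)].
  + intros y Hy. apply (is_derive_plus (V := R_NormedModule)); eapply ck_Dx_derive; eauto.
  + intros y Hy. apply (is_derive_plus (V := R_NormedModule)); eapply ck_Dy_derive; eauto.
  + apply IH; auto; intros y Hy; [apply (HF y Hy) | apply (HG y Hy)].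
  + apply IH; auto; intros y Hy; [apply (HF y Hy) | apply (HG y Hy)].
Qed.

Lemma ck_mult (n : nat) : forall (F G : C -> R),
  (forall z, O z -> ck n F z) -> (forall z, O z -> ck n G z) -> forall z, O z -> ck n (fun y => F y * G y) z.
Proof.
induction n as [|n IH]; intros F G HF HG z Hz.
- split; [apply contr_mult; [apply (HF z Hz) | apply (HG z Hz)] | exact I].
- apply ck_S_intro with (F1 := fun y => Dx F y * G y + F y * Dx G y) (F2 := fun y => Dy F y * G y + F y * Dy G y); auto.
  + apply contr_mult; [apply (HF z Hz) | apply (HG z Hz)].
  + intros y Hy. generalize (ck_Dx_derive _ _ _ (HF y Hy)) (ck_Dx_derive _ _ _ (HG y Hy)). intros A B.
    assert (K := Derive.is_derive_mult _ _ _ _ _ A B). cbv beta in K. rewrite C_eta in K. exact K.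
  + intros y Hy. generalize (ck_Dy_derive _ _ _ (HF y Hy)) (ck_Dy_derive _ _ _ (HG y Hy)). intros A B.
    assert (K := Derive.is_derive_mult _ _ _ _ _ A B). cbv beta in K. rewrite C_eta in K. exact K.
  + apply ck_plus; auto; intros y Hy; apply IH; auto; intros w Hw;
      first [apply (HF w Hw) | apply (HG w Hw) | apply ck_le, (HF w Hw) | apply ck_le, (HG w Hw)].
  + apply ck_plus; auto; intros y Hy; apply IH; auto; intros w Hw;
      first [apply (HF w Hw) | apply (HG w Hw) | apply ck_le, (HF w Hw) | apply ck_le, (HG w Hw)].
Qed.

Lemma ck_inv (n : nat) : forall (F : C -> R), (forall z, O z -> F z <> 0) ->
  (forall z, O z -> ck n F z) -> forall z, O z -> ck n (fun y => / F y) z.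
Proof.
induction n as [|n IH]; intros F H0 HF z Hz.
- split; [apply contr_inv; [apply (HF z Hz) | apply H0, Hz] | exact I].
- assert (I : forall y, O y -> ck n (fun w => / F w * / F w) y).
  { intros y Hy. apply ck_mult; auto; intros w Hw; apply IH; auto; intros u Hu; apply ck_le, HF, Hu. }
  apply ck_S_intro with (F1 := fun y => (-1 * Dx F y) * (/ F y * / F y)) (F2 := fun y => (-1 * Dy F y) * (/ F y * / F y)); auto.
  + apply contr_inv; [apply (HF z Hz) | apply H0, Hz].
  + intros y Hy. assert (N : F (Re y, Im y) <> 0) by (rewrite C_eta; apply H0, Hy).
    assert (K := is_derive_inv _ _ _ (ck_Dx_derive _ _ _ (HF y Hy)) N). cbv beta in K. rewrite C_eta in K.
    replace (-1 * Dx F y * (/ F y * / F y)) with (- Dx F y / F y ^ 2); [exact K | field; apply H0, Hy].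
  + intros y Hy. assert (N : F (Re y, Im y) <> 0) by (rewrite C_eta; apply H0, Hy).
    assert (K := is_derive_inv _ _ _ (ck_Dy_derive _ _ _ (HF y Hy)) N). cbv beta in K. rewrite C_eta in K.
    replace (-1 * Dy F y * (/ F y * / F y)) with (- Dy F y / F y ^ 2); [exact K | field; apply H0, Hy].
  + apply ck_mult; auto. intros y Hy. apply ck_mult; auto; intros w Hw; [apply ck_const, Hw | apply (HF w Hw)].
  + apply ck_mult; auto. intros y Hy. apply ck_mult; auto; intros w Hw; [apply ck_const, Hw | apply (HF w Hw)].
Qed.

Lemma sm_const (a : R) : sm O (fun _ => a).
Proof. intros n z Hz. apply ck_const, Hz. Qed.
Lemma sm_plus (F G : C -> R) : sm O F -> sm O G -> sm O (fun y => F y + G y).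
Proof. intros HF HG n z Hz. apply ck_plus; auto. Qed.
Lemma sm_mult (F G : C -> R) : sm O F -> sm O G -> sm O (fun y => F y * G y).
Proof. intros HF HG n z Hz. apply ck_mult; auto. Qed.
Lemma sm_inv (F : C -> R) : (forall z, O z -> F z <> 0) -> sm O F -> sm O (fun y => / F y).
Proof. intros H0 HF n z Hz. apply ck_inv; auto. Qed.
Lemma sm_opp (F : C -> R) : sm O F -> sm O (fun y => - F y).
Proof. intros HF. apply sm_ext with (F := fun y => -1 * F y); [intros; ring|]. apply sm_mult; [apply sm_const | exact HF]. Qed.
Lemma sm_minus (F G : C -> R) : sm O F -> sm O G -> sm O (fun y => F y - G y).
Proof. intros HF HG. apply sm_plus; [exact HF | apply sm_opp, HG]. Qed.
Lemma sm_div (F G : C -> R) : (forall z, O z -> G z <> 0) -> sm O F -> sm O G -> sm O (fun y => F y / G y).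
Proof. intros H0 HF HG. apply sm_mult; [exact HF | apply sm_inv; assumption]. Qed.

(** By the Cauchy-Riemann equations the partial derivatives of both parts are, up to sign, parts of
    [C_derive f], which is again holomorphic. *)
Lemma hol_ck (n : nat) : forall f, hol O f -> forall z, O z -> ck n (fun y => Re (f y)) z /\ ck n (fun y => Im (f y)) z.
Proof.
induction n as [|n IH]; intros f Hf z Hz.
- assert (A := hol_cont _ _ _ Hf Hz). split; (split; [|exact I]); [apply cont_Re, A | apply cont_Im, A].
- assert (A := hol_cont _ _ _ Hf Hz).
  destruct (IH _ (hol_derivative O f HO Hf) z Hz) as [B1 B2].
  assert (K : forall y, O y -> ck n (fun w => - Im (C_derive f w)) y).
  { intros y Hy. apply ck_ext_loc with (F := fun w => -1 * Im (C_derive f w)); [apply filter_forall; intros; ring|].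
    apply ck_mult; auto; intros w Hw; [apply ck_const, Hw | apply (IH _ (hol_derivative O f HO Hf) w Hw)]. }
  split.
  + apply ck_S_intro with (F1 := fun y => Re (C_derive f y)) (F2 := fun y => - Im (C_derive f y)); auto.
    * apply cont_Re, A.
    * intros y Hy. apply (cder_partials _ _ _ (hol_C_derive O f y Hf Hy)).
    * intros y Hy. apply (cder_partials _ _ _ (hol_C_derive O f y Hf Hy)).
  + apply ck_S_intro with (F1 := fun y => Im (C_derive f y)) (F2 := fun y => Re (C_derive f y)); auto.
    * apply cont_Im, A.
    * intros y Hy. apply (cder_partials _ _ _ (hol_C_derive O f y Hf Hy)).
    * intros y Hy. apply (cder_partials _ _ _ (hol_C_derive O f y Hf Hy)).
Qed.

Lemma hol_sm_Re (f : C -> C) : hol O f -> sm O (fun y => Re (f y)).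
Proof. intros H n z Hz. apply (hol_ck n f H z Hz). Qed.
Lemma hol_sm_Im (f : C -> C) : hol O f -> sm O (fun y => Im (f y)).
Proof. intros H n z Hz. apply (hol_ck n f H z Hz). Qed.

Lemma sm_differentiable (F : C -> R) (z : C) : sm O F -> O z ->
  differentiable_pt_lim (fun u v => F (u, v)) (Re z) (Im z) (Dx F z) (Dy F z).
Proof.
intros H Hz eps. assert (He : 0 < eps / 2) by (generalize (cond_pos eps); lra).
assert (K := real_differential F (Dx F) (Dy F) z).
assert (L : locC z (fun y => is_derive (fun t => F (t, Im y)) (Re y) (Dx F y) /\ is_derive (fun t => F (Re y, t)) (Im y) (Dy F y))).
{ apply loc_of_open; [exact Hz|]. intros y Hy. split; [apply sm_Dx_derive | apply sm_Dy_derive]; assumption. }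
specialize (K L (sm_cont _ _ (sm_Dx _ H) Hz) (sm_cont _ _ (sm_Dy _ H) Hz) (mkposreal _ He)).
apply locally_2d_locally. rewrite C_eta. revert K. apply filter_imp. intros y Hy. simpl in Hy.
change (fst y) with (Re y). change (snd y) with (Im y). rewrite !C_eta.
eapply Rle_trans; [exact Hy|].
assert (M1 := Rmax_l (Rabs (Re y - Re z)) (Rabs (Im y - Im z))). assert (M2 := Rmax_r (Rabs (Re y - Re z)) (Rabs (Im y - Im z))).
assert (0 < eps) by apply cond_pos. nra.
Qed.

Lemma sm_curve (F : C -> R) (c : R -> C) (t : R) (v : C) : sm O F -> O (c t) -> curve_der c t v ->
  is_derive (fun s => F (c s)) t (Dx F (c t) * Re v + Dy F (c t) * Im v).
Proof.
intros H Hc [H1 H2]. apply is_derive_Reals in H1; apply is_derive_Reals in H2.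
apply (is_derive_ext (fun s => F (Re (c s), Im (c s)))); [intros; rewrite C_eta; reflexivity|].
apply is_derive_Reals.
apply (derivable_pt_lim_comp_2d (fun u v => F (u, v)) (fun s => Re (c s)) (fun s => Im (c s)));
  [apply sm_differentiable; assumption | exact H1 | exact H2].
Qed.

Lemma sm_Schwarz (F : C -> R) (z : C) : sm O F -> O z -> Dx (Dy F) z = Dy (Dx F) z.
Proof.
intros H Hz.
assert (K := Schwarz (fun u v => F (u, v)) (Re z) (Im z)). symmetry.
change (Dy (Dx F) z) with (Derive (fun w => Derive (fun t => F (t, w)) (Re z)) (Im z)).
change (Dx (Dy F) z) with (Derive (fun w => Derive (fun t => F (w, t)) (Im z)) (Re z)).
symmetry. apply K.
- apply locally_2d_locally. rewrite C_eta. apply loc_of_open; [exact Hz|]. intros y Hy.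
  change (fst y) with (Re y). change (snd y) with (Im y).
  split; [|split; [|split]].
  + eexists; apply (sm_Dx_derive _ _ H Hy).
  + eexists; apply (sm_Dy_derive _ _ H Hy).
  + eexists; apply (sm_Dx_derive _ _ (sm_Dy _ H) Hy).
  + eexists; apply (sm_Dy_derive _ _ (sm_Dx _ H) Hy).
- apply continuity_2d_pt_filterlim. assert (A := sm_cont _ _ (sm_Dx _ (sm_Dy _ H)) Hz). rewrite <- (C_eta z) in A. exact A.
- apply continuity_2d_pt_filterlim. assert (A := sm_cont _ _ (sm_Dy _ (sm_Dx _ H)) Hz). rewrite <- (C_eta z) in A. exact A.
Qed.

Lemma sm_CR_cder (F G : C -> R) (z : C) : sm O F -> sm O G ->
  (forall y, O y -> Dx F y = Dy G y /\ Dy F y = - Dx G y) -> O z ->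
  cder (fun y => (F y, G y)) z (Dx F z, Dx G z).
Proof.
intros HF HG CR Hz.
apply (partials_cder (fun y => (F y, G y)) (fun y => (Dx F y, Dx G y))).
- apply loc_of_open; [exact Hz|]. intros y Hy. destruct (CR y Hy) as [E1 E2]. simpl.
  split; (split; [apply sm_Dx_derive; assumption|]).
  + rewrite <- E2. apply sm_Dy_derive; assumption.
  + rewrite E1. apply sm_Dy_derive; assumption.
- apply cont_pair; [apply (sm_cont _ _ (sm_Dx _ HF) Hz) | apply (sm_cont _ _ (sm_Dx _ HG) Hz)].
Qed.

End Smooth.

Lemma sm_sub (O O' : C -> Prop) (F : C -> R) : (forall z, O' z -> O z) -> sm O F -> sm O' F.
Proof. intros H K n z Hz. apply K, H, Hz. Qed.

Lemma not_loc_neg (z : C) (P : C -> Prop) : locC z (fun y => y <> z -> P y) -> ~ locC z (fun y => ~ P y).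
Proof.
intros H K. generalize (filter_and _ _ H K). intros [d Hd].
assert (Pd := cond_pos d).
destruct (Hd ((Re z + d / 2)%R, Im z)) as [A B].
- apply (proj2 (box_iff _ _ _)). simpl. replace (Re z + d / 2 - Re z) with (d / 2) by ring.
  rewrite Rminus_diag, Rabs_R0, Rabs_pos_eq; lra.
- apply B, A. intro E. apply (f_equal Re) in E. simpl in E. lra.
Qed.

Lemma contR_neq_loc (F : C -> R) (z : C) (a : R) : contR F z -> F z <> a -> locC z (fun y => F y <> a).
Proof.
intros H N. assert (P : 0 < Rabs (F z - a)) by (apply Rabs_pos_lt; lra).
apply filterlim_locally with (eps := mkposreal _ P) in H. revert H; apply filter_imp.
intros y Hy E. unfold ball in Hy; simpl in Hy; unfold AbsRing_ball, abs, minus, plus, opp in Hy; simpl in Hy.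
rewrite E in Hy. replace (a + - F z) with (- (F z - a)) in Hy by ring. rewrite Rabs_Ropp in Hy. lra.
Qed.

(** Carries identities across poles and branch points, with [P] the complement of the single point
    [z]. *)
Lemma cont_eq_dense (F G : C -> R) (z : C) (P : C -> Prop) :
  contR F z -> contR G z -> ~ locC z (fun y => ~ P y) -> locC z (fun y => P y -> F y = G y) -> F z = G z.
Proof.
intros HF HG HP HE. apply NNPP; intros N. apply HP.
assert (K := contR_neq_loc (fun y => F y - G y) z 0 (contr_minus _ _ _ HF HG) ltac:(lra)).
generalize (filter_and _ _ HE K). apply filter_imp. intros y [A B] Py. apply B. rewrite (A Py). ring.
Qed.

(** Seen as a complex function, [F] has complex derivative [0], and the mean value inequality
    applies. *)
Lemma zero_gradient_constant (F : C -> R) (z : C) (r : R) : 0 < r ->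
  (forall w, box z r w -> is_derive (fun t => F (t, Im w)) (Re w) 0 /\ is_derive (fun t => F (Re w, t)) (Im w) 0) ->
  locC z (fun y => F y = F z).
Proof.
intros Hr H.
apply locC_Cmod. exists r. split; [exact Hr|]. intros y Hy.
assert (M := mean_value_ineq (fun w => RtoC (F w)) z y 0).
assert (E : (RtoC (F y) - RtoC (F z) = 0)%C).
{ apply Cmod_eq_0. apply Rle_antisym; [|apply Cmod_ge_0]. rewrite Rmult_0_r, Rmult_0_l in M. apply M.
  intros t Ht. exists 0%C. split; [|rewrite Cmod_0; lra].
  apply (partials_cder (fun w => RtoC (F w)) (fun _ => 0%C)); [|apply continuous_const].
  apply (loc_of_open _ (openC_ball z r)).
  - apply Cmod_box, Cmod_segment; assumption.
  - intros w Hw. destruct (H w Hw) as [A B]. simpl. rewrite Ropp_0. split; split; first [exact A | exact B | apply (is_derive_const (V := R_NormedModule) 0)]. }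
rewrite <- RtoC_minus in E. apply RtoC_inj in E. lra.
Qed.

(** * Vector algebra *)

Ltac unvec := unfold dot, cross, add3, scal3, X1, X2, X3 in *; simpl in *.

Lemma R3_eq (u v : R3) : X1 u = X1 v -> X2 u = X2 v -> X3 u = X3 v -> u = v.
Proof. destruct u as [[a b] c], v as [[a' b'] c']; unfold X1, X2, X3; simpl. intros; subst; reflexivity. Qed.

Lemma dot_pos (v : R3) : 0 <= dot v v.
Proof. unvec. nra. Qed.

Lemma dot_zero (v : R3) : dot v v = 0 -> v = (0, 0, 0).
Proof. intros H. unvec. apply R3_eq; unvec; nra. Qed.

Lemma dot_sym (u v : R3) : dot u v = dot v u.
Proof. unvec. ring. Qed.

Lemma dot_cross_l (u v : R3) : dot (cross u v) u = 0.
Proof. unvec. ring. Qed.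
Lemma dot_cross_r (u v : R3) : dot (cross u v) v = 0.
Proof. unvec. ring. Qed.

Lemma dot_cross_cross (u v s t : R3) : dot (cross u v) (cross s t) = dot u s * dot v t - dot u t * dot v s.
Proof. unvec. ring. Qed.

Lemma cross_cross_l (u v s : R3) : cross (cross u v) s = add3 (scal3 (dot u s) v) (scal3 (- dot v s) u).
Proof. apply R3_eq; unvec; ring. Qed.

(** [cross (cross n x) v] vanishes because [v] is orthogonal to [n] and [x]; Lagrange's identity for
    its square then leaves [dot x x * dot v v = 0]. *)
Lemma orthogonal_frame (n x v : R3) : dot n n = 1 -> dot x n = 0 -> dot x x <> 0 ->
  dot v n = 0 -> dot v x = 0 -> dot v (cross n x) = 0 -> v = (0, 0, 0).
Proof.
intros Hn Hx Hxx H1 H2 H3. apply dot_zero.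
assert (E : cross (cross n x) v = (0, 0, 0)).
{ rewrite cross_cross_l. rewrite (dot_sym n v), (dot_sym x v), H1, H2. apply R3_eq; unvec; ring. }
assert (L : dot (cross (cross n x) v) (cross (cross n x) v) = dot (cross n x) (cross n x) * dot v v - dot (cross n x) v * dot v (cross n x))
  by apply dot_cross_cross.
rewrite E, H3, dot_cross_cross, Hn, (dot_sym n x), Hx in L.
replace (dot (0, 0, 0) (0, 0, 0)) with 0 in L by (unvec; ring).
destruct (Rmult_integral (dot x x) (dot v v)); [lra | contradiction | assumption].
Qed.

(** [y] is recovered from [cross (cross x y) x], and the orientation of [cross x y] fixes the sign.
    For [x = 0] conformality gives [y = 0], so branch points are included. *)
Lemma conformal_rotation (n x y : R3) : dot n n = 1 -> dot x n = 0 -> dot y n = 0 ->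
  dot x x = dot y y -> dot x y = 0 -> cross x y = scal3 (norm3 (cross x y)) n -> y = cross n x.
Proof.
intros Hn Hx Hy HE HF HC.
destruct (Req_dec (dot x x) 0) as [E|E].
- rewrite E in HE. symmetry in HE. apply dot_zero in HE. apply dot_zero in E. subst. apply R3_eq; unvec; ring.
- set (l := norm3 (cross x y)) in *.
  assert (L2 : l * l = dot x x * dot x x).
  { transitivity (dot (cross x y) (cross x y)).
    - unfold l, norm3. apply sqrt_def, dot_pos.
    - rewrite dot_cross_cross, HF, <- HE. ring. }
  assert (L0 : 0 <= l) by apply sqrt_pos. assert (P := dot_pos x).
  assert (L : l = dot x x) by nra.
  assert (A : scal3 (dot x x) y = scal3 (dot x x) (cross n x)).
  { transitivity (cross (cross x y) x).
    - rewrite cross_cross_l, (dot_sym y x), HF. apply R3_eq; unvec; ring.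
    - rewrite HC, L. apply R3_eq; unvec; ring. }
  apply R3_eq; [apply (f_equal X1) in A | apply (f_equal X2) in A | apply (f_equal X3) in A];
    unfold scal3, X1, X2, X3 in A |- *; simpl fst in *; simpl snd in *; apply Rmult_eq_reg_l with (dot x x); assumption.
Qed.

Lemma rotation_conformal (n x : R3) : dot n n = 1 -> dot x n = 0 ->
  let y := cross n x in
  dot y n = 0 /\ dot x x = dot y y /\ dot x y = 0 /\ cross x y = scal3 (dot x x) n /\
  norm3 (cross x y) = dot x x.
Proof.
intros Hn Hx y.
assert (E : cross x y = scal3 (dot x x) n).
{ unfold y. transitivity (add3 (scal3 (dot x x) n) (scal3 (- dot x n) x)); [apply R3_eq; unvec; ring|].
  rewrite Hx. apply R3_eq; unvec; ring. }
repeat split.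
- apply dot_cross_l.
- unfold y. rewrite dot_cross_cross, Hn, (dot_sym n x), Hx. ring.
- unfold y. rewrite dot_sym. apply dot_cross_r.
- exact E.
- rewrite E. unfold norm3. replace (dot (scal3 (dot x x) n) (scal3 (dot x x) n)) with (dot x x * dot x x * dot n n) by (unvec; ring).
  rewrite Hn, Rmult_1_r. apply sqrt_square, dot_pos.
Qed.

Definition refl (n v : R3) : R3 := add3 v (scal3 (- (2 * dot v n / dot n n)) n).

Lemma refl_linear (n u v : R3) (a b : R) :
  refl n (add3 (scal3 a u) (scal3 b v)) = add3 (scal3 a (refl n u)) (scal3 b (refl n v)).
Proof. unfold refl. apply R3_eq; unvec; unfold Rdiv; ring. Qed.

Lemma refl_scal (n u : R3) (a : R) : refl n (scal3 a u) = scal3 a (refl n u).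
Proof. unfold refl. apply R3_eq; unvec; unfold Rdiv; ring. Qed.

Lemma refl_invol (n v : R3) : dot n n <> 0 -> refl n (refl n v) = v.
Proof. intros H. unfold refl. apply R3_eq; unvec; field; exact H. Qed.

Lemma refl_dot (n u v : R3) : dot n n <> 0 -> dot (refl n u) (refl n v) = dot u v.
Proof. intros H. unfold refl. unvec. field. exact H. Qed.

Lemma refl_axis (n v : R3) : dot n n <> 0 -> dot (refl n v) n = - dot v n.
Proof. intros H. unfold refl. unvec. field. exact H. Qed.

Lemma refl_normal (m m' : R3) : dot m m = 1 -> dot m' m' = 1 ->
  let n := add3 m (scal3 (-1) m') in dot n n <> 0 -> refl n m = m'.
Proof.
intros H H' n Hn.
assert (E : 2 * dot m n = dot n n).
{ replace (dot n n) with (dot m m - 2 * dot m m' + dot m' m') by (unfold n; unvec; ring).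
  replace (dot m n) with (dot m m - dot m m') by (unfold n; unvec; ring). lra. }
unfold refl. rewrite E. unfold Rdiv. rewrite Rinv_r by exact Hn. unfold n. apply R3_eq; unvec; ring.
Qed.

(** Freed of its denominator, the reflection becomes polynomial in [n] and [v], hence smooth also
    where [n] vanishes. *)
Lemma refl_expand (n v : R3) : dot n n <> 0 ->
  scal3 (- dot n n) (refl n v) = add3 (scal3 (- dot n n) v) (scal3 (2 * dot v n) n).
Proof. intros H. unfold refl. apply R3_eq; unvec; field; exact H. Qed.

(** The sign expresses that a reflection reverses the orientation. *)
Lemma refl_cross (n u v : R3) : dot n n <> 0 -> refl n (cross u v) = scal3 (-1) (cross (refl n u) (refl n v)).
Proof. intros H. unfold refl. apply R3_eq; unvec; field; exact H. Qed.

(** * Stereographic coordinates *)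

Definition nsq (a : C) : R := Re a * Re a + Im a * Im a.

Lemma nsq_pos (a : C) : 0 <= nsq a.
Proof. unfold nsq; nra. Qed.

Lemma nsq_zero (a : C) : nsq a = 0 -> a = 0%C.
Proof.
unfold nsq. intros H. apply injective_projections; simpl; apply Rsqr_0_uniq; unfold Rsqr; unfold Re, Im in H; nra.
Qed.

Lemma nsq1_neq (a : C) : 1 + nsq a <> 0.
Proof. generalize (nsq_pos a); lra. Qed.

Definition sphere_pt (a : C) : R3 := (2 * Re a / (1 + nsq a), 2 * Im a / (1 + nsq a), (nsq a - 1) / (1 + nsq a)).

(** The differential of [sphere_pt], the inverse stereographic projection, at [b] in the direction
    [v]. *)
Definition sphere_der (b v : C) : R3 :=
  let d := Re b * Re v + Im b * Im v in
  (2 * Re v / (1 + nsq b) - 4 * Re b * d / (1 + nsq b) ^ 2,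
   2 * Im v / (1 + nsq b) - 4 * Im b * d / (1 + nsq b) ^ 2,
   4 * d / (1 + nsq b) ^ 2).

(** The derivative along the real axis of the surface whose Weierstrass data have the coefficient
    [c] and the Gauss map [a]. *)
Definition isotropic_re (a c : C) : R3 := (Re (weierstrass1 c a), Re (weierstrass2 c a), Re (weierstrass3 c a)).

Lemma sphere_pt_unit (a : C) : dot (sphere_pt a) (sphere_pt a) = 1.
Proof. unfold sphere_pt. assert (N := nsq1_neq a). unvec. unfold nsq in *. field. exact N. Qed.

Lemma sphere_pt_dist (a b : C) :
  let n := add3 (sphere_pt a) (scal3 (-1) (sphere_pt b)) in
  dot n n = 4 * nsq (a - b)%C / ((1 + nsq a) * (1 + nsq b)).
Proof.
intros n. unfold n, sphere_pt. assert (N := nsq1_neq a). assert (N' := nsq1_neq b).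
destruct a as [a1 a2], b as [b1 b2]. unvec. unfold nsq, Re, Im in *. simpl in *. field. split; assumption.
Qed.

Lemma sphere_der_scal (b v : C) (k : R) : sphere_der b (RtoC k * v)%C = scal3 k (sphere_der b v).
Proof.
assert (N := nsq1_neq b). destruct b as [b1 b2], v as [v1 v2].
unfold sphere_der. apply R3_eq; unvec; unfold nsq, Re, Im in *; simpl in *; field; exact N.
Qed.

Lemma sphere_der_inj (b u v : C) : sphere_der b u = sphere_der b v -> u = v.
Proof.
intros H. assert (N := nsq1_neq b). set (m := 1 + nsq b) in *.
unfold sphere_der in H. fold m in H. inversion H as [[H1 H2 H3]]. clear H.
set (d := Re b * Re u + Im b * Im u) in *. set (d' := Re b * Re v + Im b * Im v) in *.
assert (E : d = d').
{ unfold Rdiv in H3. apply Rmult_eq_reg_r in H3; [lra|]. apply Rinv_neq_0_compat. apply (pow_nonzero m 2), N. }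
rewrite E in H1, H2.
assert (F : forall x y c, 2 * x / m - c = 2 * y / m - c -> x = y).
{ intros x y c K. assert (K' : 2 * x / m = 2 * y / m) by lra. unfold Rdiv in K'. apply Rmult_eq_reg_r in K'; [lra | apply Rinv_neq_0_compat, N]. }
apply F in H1; apply F in H2. rewrite <- (C_eta u), <- (C_eta v), H1, H2. reflexivity.
Qed.

(** The minus sign reflects that projection from the north pole reverses the orientation given by
    the outward normal. *)
Lemma sphere_der_rot (b v : C) : sphere_der b (Ci * v)%C = scal3 (-1) (cross (sphere_pt b) (sphere_der b v)).
Proof.
assert (N := nsq1_neq b). destruct b as [b1 b2], v as [v1 v2].
unfold sphere_der, sphere_pt. apply R3_eq; unvec; unfold nsq, Re, Im in *; simpl in *; field; exact N.
Qed.

(** The reflection exchanging the normals [sphere_pt a] and [sphere_pt b] maps the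
    tangent plane at [a], parametrized by the Weierstrass formula, to that at [b]. *)
Lemma refl_isotropic (a b c : C) : a <> b ->
  let n := add3 (sphere_pt a) (scal3 (-1) (sphere_pt b)) in
  sphere_der b ((b - a) * (b - a) * c)%C = scal3 (- dot n n) (refl n (isotropic_re a c)).
Proof.
intros Hab n. unfold refl.
assert (P : nsq (a - b)%C <> 0).
{ intro E. apply nsq_zero in E. revert E. apply Cminus_neq, Hab. }
assert (Hn : dot n n <> 0).
{ unfold n. rewrite sphere_pt_dist. unfold Rdiv. apply Rmult_integral_contrapositive. split; [lra|].
  apply Rinv_neq_0_compat, Rmult_integral_contrapositive. split; apply nsq1_neq. }
transitivity (add3 (scal3 (- dot n n) (isotropic_re a c)) (scal3 (2 * dot (isotropic_re a c) n) n)).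
2:{ symmetry. apply refl_expand, Hn. }
unfold n at 1. rewrite sphere_pt_dist. clear Hn P. unfold n; clear n.
assert (N := nsq1_neq a). assert (N' := nsq1_neq b).
destruct a as [a1 a2], b as [b1 b2], c as [c1 c2].
unfold sphere_der, sphere_pt, isotropic_re, weierstrass1, weierstrass2, weierstrass3.
apply R3_eq; unvec; unfold nsq, Re, Im in *; simpl in *; field; split; assumption.
Qed.

(** * Minimal surfaces in a conformal coordinate *)

Definition D3x (Z : C -> R3) (z : C) : R3 :=
  (Dx (fun y => X1 (Z y)) z, Dx (fun y => X2 (Z y)) z, Dx (fun y => X3 (Z y)) z).
Definition D3y (Z : C -> R3) (z : C) : R3 :=
  (Dy (fun y => X1 (Z y)) z, Dy (fun y => X2 (Z y)) z, Dy (fun y => X3 (Z y)) z).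
Definition sm3 (O : C -> Prop) (Z : C -> R3) : Prop :=
  sm O (fun y => X1 (Z y)) /\ sm O (fun y => X2 (Z y)) /\ sm O (fun y => X3 (Z y)).

Section Planar.
Variable O : C -> Prop.
Hypothesis HO : openC O.

Lemma sm3_D3x (Z : C -> R3) : sm3 O Z -> sm3 O (D3x Z).
Proof. intros (H1 & H2 & H3). repeat split; apply (sm_Dx O); assumption. Qed.
Lemma sm3_D3y (Z : C -> R3) : sm3 O Z -> sm3 O (D3y Z).
Proof. intros (H1 & H2 & H3). repeat split; apply (sm_Dy O); assumption. Qed.

Lemma sm3_add (A B : C -> R3) : sm3 O A -> sm3 O B -> sm3 O (fun y => add3 (A y) (B y)).
Proof. intros (H1 & H2 & H3) (K1 & K2 & K3). repeat split; apply sm_plus; assumption. Qed.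
Lemma sm3_scal (a : C -> R) (A : C -> R3) : sm O a -> sm3 O A -> sm3 O (fun y => scal3 (a y) (A y)).
Proof. intros H (H1 & H2 & H3). repeat split; apply (sm_mult O HO a); assumption. Qed.
Lemma sm_dot (A B : C -> R3) : sm3 O A -> sm3 O B -> sm O (fun y => dot (A y) (B y)).
Proof. intros (H1 & H2 & H3) (K1 & K2 & K3). unfold dot. repeat apply sm_plus; try assumption; apply sm_mult; assumption. Qed.
Lemma sm3_cross (A B : C -> R3) : sm3 O A -> sm3 O B -> sm3 O (fun y => cross (A y) (B y)).
Proof.
intros (H1 & H2 & H3) (K1 & K2 & K3).
repeat split; unfold cross, X1, X2, X3 in *; simpl; apply sm_minus; try assumption; apply sm_mult; assumption.
Qed.

Lemma sm3_cont (Z : C -> R3) (z : C) : sm3 O Z -> O z ->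
  contR (fun y => X1 (Z y)) z /\ contR (fun y => X2 (Z y)) z /\ contR (fun y => X3 (Z y)) z.
Proof. intros (H1 & H2 & H3) Hz. repeat split; eapply sm_cont; eassumption. Qed.

Lemma Dx_plus (F G : C -> R) (z : C) : sm O F -> sm O G -> O z -> Dx (fun y => F y + G y) z = Dx F z + Dx G z.
Proof.
intros HF HG Hz. apply is_derive_unique. apply (is_derive_plus (V := R_NormedModule)); eapply sm_Dx_derive; eauto.
Qed.
Lemma Dy_plus (F G : C -> R) (z : C) : sm O F -> sm O G -> O z -> Dy (fun y => F y + G y) z = Dy F z + Dy G z.
Proof.
intros HF HG Hz. apply is_derive_unique. apply (is_derive_plus (V := R_NormedModule)); eapply sm_Dy_derive; eauto.
Qed.
Lemma Dx_mult (F G : C -> R) (z : C) : sm O F -> sm O G -> O z -> Dx (fun y => F y * G y) z = Dx F z * G z + F z * Dx G z.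
Proof.
intros HF HG Hz. apply is_derive_unique.
assert (K := Derive.is_derive_mult _ _ _ _ _ (sm_Dx_derive O F z HF Hz) (sm_Dx_derive O G z HG Hz)).
cbv beta in K. rewrite C_eta in K. exact K.
Qed.
Lemma Dy_mult (F G : C -> R) (z : C) : sm O F -> sm O G -> O z -> Dy (fun y => F y * G y) z = Dy F z * G z + F z * Dy G z.
Proof.
intros HF HG Hz. apply is_derive_unique.
assert (K := Derive.is_derive_mult _ _ _ _ _ (sm_Dy_derive O F z HF Hz) (sm_Dy_derive O G z HG Hz)).
cbv beta in K. rewrite C_eta in K. exact K.
Qed.
Lemma Dx_inv (F : C -> R) (z : C) : sm O F -> O z -> F z <> 0 -> Dx (fun y => / F y) z = - Dx F z / (F z * F z).
Proof.
intros HF Hz N. apply is_derive_unique.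
assert (N' : F (Re z, Im z) <> 0) by (rewrite C_eta; exact N).
assert (K := is_derive_inv _ _ _ (sm_Dx_derive O F z HF Hz) N').
cbv beta in K. rewrite C_eta in K. replace (- Dx F z / (F z * F z)) with (- Dx F z / F z ^ 2); [exact K | field; exact N].
Qed.
Lemma Dy_inv (F : C -> R) (z : C) : sm O F -> O z -> F z <> 0 -> Dy (fun y => / F y) z = - Dy F z / (F z * F z).
Proof.
intros HF Hz N. apply is_derive_unique.
assert (N' : F (Re z, Im z) <> 0) by (rewrite C_eta; exact N).
assert (K := is_derive_inv _ _ _ (sm_Dy_derive O F z HF Hz) N').
cbv beta in K. rewrite C_eta in K. replace (- Dy F z / (F z * F z)) with (- Dy F z / F z ^ 2); [exact K | field; exact N].
Qed.
Lemma Dx_const (a : R) (z : C) : Dx (fun _ => a) z = 0.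
Proof. apply is_derive_unique. apply (is_derive_const (V := R_NormedModule) a). Qed.
Lemma Dy_const (a : R) (z : C) : Dy (fun _ => a) z = 0.
Proof. apply is_derive_unique. apply (is_derive_const (V := R_NormedModule) a). Qed.

Lemma D3x_ext_loc (A B : C -> R3) (z : C) : locC z (fun y => A y = B y) -> D3x A z = D3x B z.
Proof. intros H. unfold D3x. f_equal; [f_equal|]; apply Dx_ext_loc; revert H; apply filter_imp; intros y E; rewrite E; reflexivity. Qed.
Lemma D3y_ext_loc (A B : C -> R3) (z : C) : locC z (fun y => A y = B y) -> D3y A z = D3y B z.
Proof. intros H. unfold D3y. f_equal; [f_equal|]; apply Dy_ext_loc; revert H; apply filter_imp; intros y E; rewrite E; reflexivity. Qed.

Lemma D3x_add (A B : C -> R3) (z : C) : sm3 O A -> sm3 O B -> O z ->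
  D3x (fun y => add3 (A y) (B y)) z = add3 (D3x A z) (D3x B z).
Proof. intros (H1 & H2 & H3) (K1 & K2 & K3) Hz. apply R3_eq; apply Dx_plus; assumption. Qed.
Lemma D3y_add (A B : C -> R3) (z : C) : sm3 O A -> sm3 O B -> O z ->
  D3y (fun y => add3 (A y) (B y)) z = add3 (D3y A z) (D3y B z).
Proof. intros (H1 & H2 & H3) (K1 & K2 & K3) Hz. apply R3_eq; apply Dy_plus; assumption. Qed.
Lemma D3x_scal (a : C -> R) (A : C -> R3) (z : C) : sm O a -> sm3 O A -> O z ->
  D3x (fun y => scal3 (a y) (A y)) z = add3 (scal3 (Dx a z) (A z)) (scal3 (a z) (D3x A z)).
Proof. intros H (H1 & H2 & H3) Hz. apply R3_eq; apply (Dx_mult a); assumption. Qed.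
Lemma D3y_scal (a : C -> R) (A : C -> R3) (z : C) : sm O a -> sm3 O A -> O z ->
  D3y (fun y => scal3 (a y) (A y)) z = add3 (scal3 (Dy a z) (A z)) (scal3 (a z) (D3y A z)).
Proof. intros H (H1 & H2 & H3) Hz. apply R3_eq; apply (Dy_mult a); assumption. Qed.

Lemma D3x_scal_const (a : R) (A : C -> R3) (z : C) : sm3 O A -> O z ->
  D3x (fun y => scal3 a (A y)) z = scal3 a (D3x A z).
Proof.
intros H Hz. rewrite (D3x_scal (fun _ => a) A z (sm_const O HO a) H Hz), Dx_const. apply R3_eq; unvec; ring.
Qed.
Lemma D3y_scal_const (a : R) (A : C -> R3) (z : C) : sm3 O A -> O z ->
  D3y (fun y => scal3 a (A y)) z = scal3 a (D3y A z).
Proof.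
intros H Hz. rewrite (D3y_scal (fun _ => a) A z (sm_const O HO a) H Hz), Dy_const. apply R3_eq; unvec; ring.
Qed.

Lemma Dx_dot (A B : C -> R3) (z : C) : sm3 O A -> sm3 O B -> O z ->
  Dx (fun y => dot (A y) (B y)) z = dot (D3x A z) (B z) + dot (A z) (D3x B z).
Proof.
intros (H1 & H2 & H3) (K1 & K2 & K3) Hz. unfold dot at 1.
rewrite (Dx_plus (fun y => X1 (A y) * X1 (B y) + X2 (A y) * X2 (B y)) (fun y => X3 (A y) * X3 (B y)));
  [|apply sm_plus; try assumption; apply sm_mult; assumption | apply sm_mult; assumption | exact Hz].
rewrite (Dx_plus (fun y => X1 (A y) * X1 (B y)) (fun y => X2 (A y) * X2 (B y)));
  [|apply sm_mult; assumption | apply sm_mult; assumption | exact Hz].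
rewrite !(Dx_mult (fun y => _ (A y)) (fun y => _ (B y))) by assumption.
unfold D3x, dot, X1, X2, X3; simpl. ring.
Qed.
Lemma Dy_dot (A B : C -> R3) (z : C) : sm3 O A -> sm3 O B -> O z ->
  Dy (fun y => dot (A y) (B y)) z = dot (D3y A z) (B z) + dot (A z) (D3y B z).
Proof.
intros (H1 & H2 & H3) (K1 & K2 & K3) Hz. unfold dot at 1.
rewrite (Dy_plus (fun y => X1 (A y) * X1 (B y) + X2 (A y) * X2 (B y)) (fun y => X3 (A y) * X3 (B y)));
  [|apply sm_plus; try assumption; apply sm_mult; assumption | apply sm_mult; assumption | exact Hz].
rewrite (Dy_plus (fun y => X1 (A y) * X1 (B y)) (fun y => X2 (A y) * X2 (B y)));
  [|apply sm_mult; assumption | apply sm_mult; assumption | exact Hz].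
rewrite !(Dy_mult (fun y => _ (A y)) (fun y => _ (B y))) by assumption.
unfold D3y, dot, X1, X2, X3; simpl. ring.
Qed.

Lemma D3x_cross (A B : C -> R3) (z : C) : sm3 O A -> sm3 O B -> O z ->
  D3x (fun y => cross (A y) (B y)) z = add3 (cross (D3x A z) (B z)) (cross (A z) (D3x B z)).
Proof.
intros (H1 & H2 & H3) (K1 & K2 & K3) Hz.
assert (M : forall F G F' G' : C -> R, sm O F -> sm O G -> sm O F' -> sm O G' ->
  Dx (fun y => F y * G y - F' y * G' y) z = Dx F z * G z + F z * Dx G z - (Dx F' z * G' z + F' z * Dx G' z)).
{ intros F G F' G' S1 S2 S3 S4.
  transitivity (Dx (fun y => F y * G y + F' y * (-1 * G' y)) z); [apply Dx_ext_loc, filter_forall; intros; ring|].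
  assert (S5 : sm O (fun y => -1 * G' y)) by (apply (sm_mult O HO (fun _ => -1)); [apply sm_const|]; assumption).
  rewrite (Dx_plus (fun y => F y * G y) (fun y => F' y * (-1 * G' y))); [|apply sm_mult; assumption|apply sm_mult; assumption|exact Hz].
  rewrite (Dx_mult F G), (Dx_mult F' (fun y => -1 * G' y)), (Dx_mult (fun _ => -1) G'), Dx_const by (try assumption; apply sm_const; assumption). ring. }
apply R3_eq; [change (Dx (fun y => X2 (A y) * X3 (B y) - X3 (A y) * X2 (B y)) z = X1 (add3 (cross (D3x A z) (B z)) (cross (A z) (D3x B z))))
 | change (Dx (fun y => X3 (A y) * X1 (B y) - X1 (A y) * X3 (B y)) z = X2 (add3 (cross (D3x A z) (B z)) (cross (A z) (D3x B z))))
 | change (Dx (fun y => X1 (A y) * X2 (B y) - X2 (A y) * X1 (B y)) z = X3 (add3 (cross (D3x A z) (B z)) (cross (A z) (D3x B z)))) ];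
rewrite (M (fun y => _ (A y)) (fun y => _ (B y)) (fun y => _ (A y)) (fun y => _ (B y))) by assumption;
unfold D3x, cross, add3, X1, X2, X3; simpl; ring.
Qed.
Lemma D3y_cross (A B : C -> R3) (z : C) : sm3 O A -> sm3 O B -> O z ->
  D3y (fun y => cross (A y) (B y)) z = add3 (cross (D3y A z) (B z)) (cross (A z) (D3y B z)).
Proof.
intros (H1 & H2 & H3) (K1 & K2 & K3) Hz.
assert (M : forall F G F' G' : C -> R, sm O F -> sm O G -> sm O F' -> sm O G' ->
  Dy (fun y => F y * G y - F' y * G' y) z = Dy F z * G z + F z * Dy G z - (Dy F' z * G' z + F' z * Dy G' z)).
{ intros F G F' G' S1 S2 S3 S4.
  transitivity (Dy (fun y => F y * G y + F' y * (-1 * G' y)) z); [apply Dy_ext_loc, filter_forall; intros; ring|].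
  assert (S5 : sm O (fun y => -1 * G' y)) by (apply (sm_mult O HO (fun _ => -1)); [apply sm_const|]; assumption).
  rewrite (Dy_plus (fun y => F y * G y) (fun y => F' y * (-1 * G' y))); [|apply sm_mult; assumption|apply sm_mult; assumption|exact Hz].
  rewrite (Dy_mult F G), (Dy_mult F' (fun y => -1 * G' y)), (Dy_mult (fun _ => -1) G'), Dy_const by (try assumption; apply sm_const; assumption). ring. }
apply R3_eq; [change (Dy (fun y => X2 (A y) * X3 (B y) - X3 (A y) * X2 (B y)) z = X1 (add3 (cross (D3y A z) (B z)) (cross (A z) (D3y B z))))
 | change (Dy (fun y => X3 (A y) * X1 (B y) - X1 (A y) * X3 (B y)) z = X2 (add3 (cross (D3y A z) (B z)) (cross (A z) (D3y B z))))
 | change (Dy (fun y => X1 (A y) * X2 (B y) - X2 (A y) * X1 (B y)) z = X3 (add3 (cross (D3y A z) (B z)) (cross (A z) (D3y B z)))) ];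
rewrite (M (fun y => _ (A y)) (fun y => _ (B y)) (fun y => _ (A y)) (fun y => _ (B y))) by assumption;
unfold D3y, cross, add3, X1, X2, X3; simpl; ring.
Qed.

Lemma D3_Schwarz (Z : C -> R3) (z : C) : sm3 O Z -> O z -> D3x (D3y Z) z = D3y (D3x Z) z.
Proof.
intros (H1 & H2 & H3) Hz. apply R3_eq;
[apply (sm_Schwarz O HO (fun y => X1 (Z y))) | apply (sm_Schwarz O HO (fun y => X2 (Z y))) | apply (sm_Schwarz O HO (fun y => X3 (Z y)))]; assumption.
Qed.

Lemma Dx_zero_of_const (F : C -> R) (z : C) (a : R) : (forall y, O y -> F y = a) -> O z -> Dx F z = 0.
Proof. intros H Hz. rewrite <- (Dx_const a z). apply Dx_ext_loc, (loc_of_open O HO); assumption. Qed.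
Lemma Dy_zero_of_const (F : C -> R) (z : C) (a : R) : (forall y, O y -> F y = a) -> O z -> Dy F z = 0.
Proof. intros H Hz. rewrite <- (Dy_const a z). apply Dy_ext_loc, (loc_of_open O HO); assumption. Qed.

(** [N] is the Gauss map of the conformal minimal surface [Z], possibly branched:
    rotation by a right angle in the tangent planes is the cross product with [N]. *)
Definition conf_min (Z N : C -> R3) : Prop :=
  sm3 O Z /\ sm3 O N /\ forall z, O z ->
    dot (N z) (N z) = 1 /\ dot (D3x Z z) (N z) = 0 /\
    D3y Z z = cross (N z) (D3x Z z) /\ D3y N z = scal3 (-1) (cross (N z) (D3x N z)).

Lemma normal_derivative (N : C -> R3) (z : C) : sm3 O N -> (forall y, O y -> dot (N y) (N y) = 1) -> O z ->
  dot (D3x N z) (N z) = 0 /\ dot (D3y N z) (N z) = 0.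
Proof.
intros HN H1 Hz.
assert (E := Dx_zero_of_const (fun y => dot (N y) (N y)) z 1 H1 Hz). rewrite Dx_dot, (dot_sym (N z)) in E by assumption.
assert (E' := Dy_zero_of_const (fun y => dot (N y) (N y)) z 1 H1 Hz). rewrite Dy_dot, (dot_sym (N z)) in E' by assumption.
lra.
Qed.

(** Obtained by differentiating the orthogonality of [Z_x] and [Z_y] to [N]; the symmetry of second
    derivatives gives the mixed coefficient two expressions. *)
Lemma shape_forms (Z N : C -> R3) (z : C) : sm3 O Z -> sm3 O N ->
  (forall y, O y -> dot (D3x Z y) (N y) = 0 /\ dot (D3y Z y) (N y) = 0) -> O z ->
  dot (D3x (D3x Z) z) (N z) = - dot (D3x Z z) (D3x N z) /\
  dot (D3x (D3y Z) z) (N z) = - dot (D3y Z z) (D3x N z) /\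
  dot (D3x (D3y Z) z) (N z) = - dot (D3x Z z) (D3y N z) /\
  dot (D3y (D3y Z) z) (N z) = - dot (D3y Z z) (D3y N z).
Proof.
intros HZ HN H Hz.
assert (E1 := Dx_zero_of_const _ z 0 (fun y Hy => proj1 (H y Hy)) Hz). rewrite Dx_dot in E1 by (try assumption; apply sm3_D3x; assumption).
assert (E2 := Dy_zero_of_const _ z 0 (fun y Hy => proj1 (H y Hy)) Hz). rewrite Dy_dot in E2 by (try assumption; apply sm3_D3x; assumption).
assert (E3 := Dx_zero_of_const _ z 0 (fun y Hy => proj2 (H y Hy)) Hz). rewrite Dx_dot in E3 by (try assumption; apply sm3_D3y; assumption).
assert (E4 := Dy_zero_of_const _ z 0 (fun y Hy => proj2 (H y Hy)) Hz). rewrite Dy_dot in E4 by (try assumption; apply sm3_D3y; assumption).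
rewrite <- (D3_Schwarz Z z HZ Hz) in E2. repeat split; lra.
Qed.

(** The vector [N_y + N x N_x] is orthogonal to [N], to [Z_x] by the symmetry of the shape operator,
    and to [Z_y] by the vanishing of its trace. *)
Lemma weingarten (Z N : C -> R3) (z : C) : sm3 O Z -> sm3 O N ->
  (forall y, O y -> dot (N y) (N y) = 1 /\ dot (D3x Z y) (N y) = 0 /\ D3y Z y = cross (N y) (D3x Z y)) -> O z ->
  dot (D3x Z z) (D3x Z z) <> 0 ->
  dot (D3x (D3x Z) z) (N z) + dot (D3y (D3y Z) z) (N z) = 0 ->
  D3y N z = scal3 (-1) (cross (N z) (D3x N z)).
Proof.
intros HZ HN H Hz Hx HM.
assert (Ho : forall y, O y -> dot (D3x Z y) (N y) = 0 /\ dot (D3y Z y) (N y) = 0).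
{ intros y Hy. destruct (H y Hy) as (A & B & E). split; [exact B|]. rewrite E. apply dot_cross_l. }
destruct (shape_forms Z N z HZ HN Ho Hz) as (S1 & S2 & S3 & S4).
destruct (normal_derivative N z HN (fun y Hy => proj1 (H y Hy)) Hz) as [N1 N2].
destruct (H z Hz) as (Hn & Hxn & Hy).
assert (V : add3 (D3y N z) (cross (N z) (D3x N z)) = (0, 0, 0)).
{ apply (orthogonal_frame (N z) (D3x Z z)); try assumption.
  - replace (dot (add3 (D3y N z) (cross (N z) (D3x N z))) (N z)) with (dot (D3y N z) (N z)) by (unvec; ring). exact N2.
  - replace (dot (add3 (D3y N z) (cross (N z) (D3x N z))) (D3x Z z))
      with (dot (D3x Z z) (D3y N z) - dot (cross (N z) (D3x Z z)) (D3x N z)) by (unvec; ring).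
    rewrite <- Hy. lra.
  - replace (dot (add3 (D3y N z) (cross (N z) (D3x N z))) (cross (N z) (D3x Z z)))
      with (dot (cross (N z) (D3x Z z)) (D3y N z) + dot (cross (N z) (D3x N z)) (cross (N z) (D3x Z z))) by (unvec; ring).
    rewrite dot_cross_cross, Hn, N1, <- Hy, (dot_sym (D3x N z)). lra. }
apply R3_eq; [apply (f_equal X1) in V | apply (f_equal X2) in V | apply (f_equal X3) in V];
  unfold add3, scal3, X1, X2, X3 in *; simpl fst in *; simpl snd in *; lra.
Qed.

Section ConfMin.
Variables Z N : C -> R3.
Hypothesis HZN : conf_min Z N.

Lemma cm_smZ : sm3 O Z. Proof. apply HZN. Qed.
Lemma cm_smN : sm3 O N. Proof. apply HZN. Qed.
Lemma cm_unit (z : C) : O z -> dot (N z) (N z) = 1. Proof. intros Hz; apply (proj2 (proj2 HZN) z Hz). Qed.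
Lemma cm_orth_x (z : C) : O z -> dot (D3x Z z) (N z) = 0. Proof. intros Hz; apply (proj2 (proj2 HZN) z Hz). Qed.
Lemma cm_rot (z : C) : O z -> D3y Z z = cross (N z) (D3x Z z). Proof. intros Hz; apply (proj2 (proj2 HZN) z Hz). Qed.
Lemma cm_wein (z : C) : O z -> D3y N z = scal3 (-1) (cross (N z) (D3x N z)). Proof. intros Hz; apply (proj2 (proj2 HZN) z Hz). Qed.
Lemma cm_orth_y (z : C) : O z -> dot (D3y Z z) (N z) = 0.
Proof. intros Hz. rewrite cm_rot by exact Hz. apply dot_cross_l. Qed.
Lemma cm_N_orth (z : C) : O z -> dot (D3x N z) (N z) = 0.
Proof. intros Hz. apply (normal_derivative N z cm_smN cm_unit Hz). Qed.

Lemma cm_forms (z : C) : O z ->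
  dot (D3x (D3x Z) z) (N z) = - dot (D3x Z z) (D3x N z) /\
  dot (D3x (D3y Z) z) (N z) = - dot (D3y Z z) (D3x N z) /\
  dot (D3y (D3y Z) z) (N z) = dot (D3x Z z) (D3x N z).
Proof.
intros Hz. destruct (shape_forms Z N z cm_smZ cm_smN (fun y Hy => conj (cm_orth_x y Hy) (cm_orth_y y Hy)) Hz) as (S1 & S2 & S3 & S4).
split; [exact S1|]. split; [exact S2|]. rewrite S4, cm_rot, cm_wein by exact Hz.
replace (dot (cross (N z) (D3x Z z)) (scal3 (-1) (cross (N z) (D3x N z)))) with (- dot (cross (N z) (D3x Z z)) (cross (N z) (D3x N z))) by (unvec; ring).
rewrite dot_cross_cross, cm_unit, (dot_sym (N z) (D3x N z)), cm_N_orth by exact Hz. ring.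
Qed.

(** [Z_y = N x Z_x] is differentiated in [y], and the mixed derivative that appears is replaced by
    the [x] derivative of the same relation. *)
Lemma cm_harmonic (z : C) : O z -> add3 (D3x (D3x Z) z) (D3y (D3y Z) z) = (0, 0, 0).
Proof.
intros Hz.
assert (Lx : D3x (D3y Z) z = add3 (cross (D3x N z) (D3x Z z)) (cross (N z) (D3x (D3x Z) z))).
{ rewrite <- D3x_cross; [|apply cm_smN | apply sm3_D3x, cm_smZ | exact Hz].
  apply D3x_ext_loc, (loc_of_open O HO); [exact Hz | exact cm_rot]. }
assert (Ly : D3y (D3y Z) z = add3 (cross (D3y N z) (D3x Z z)) (cross (N z) (D3y (D3x Z) z))).
{ rewrite <- D3y_cross; [|apply cm_smN | apply sm3_D3x, cm_smZ | exact Hz].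
  apply D3y_ext_loc, (loc_of_open O HO); [exact Hz | exact cm_rot]. }
rewrite <- (D3_Schwarz Z z cm_smZ Hz), Lx, (cm_wein z Hz) in Ly.
destruct (cm_forms z Hz) as (S1 & _ & _).
assert (Hn := cm_unit z Hz). assert (Hx := cm_orth_x z Hz). assert (Hnx := cm_N_orth z Hz).
rewrite Ly. set (n := N z) in *. set (x := D3x Z z) in *. set (a := D3x N z) in *. set (xx := D3x (D3x Z) z) in *.
(* The sum is written with coefficients that vanish by [Hn], [S1] and [Hnx]. *)
transitivity (add3 (scal3 (1 - dot n n) xx) (add3 (scal3 (dot xx n + dot x a) n) (add3 (scal3 (- dot a n) x) (scal3 0 a)))).
- transitivity (add3 (add3 (scal3 (1 - dot n n) xx) (add3 (scal3 (dot xx n + dot x a) n) (add3 (scal3 (- dot a n) x) (scal3 0 a)))) (scal3 (dot x n - dot x n) a)).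
  + apply R3_eq; unvec; ring.
  + apply R3_eq; unvec; ring.
- rewrite Hn, S1, Hnx. apply R3_eq; unvec; ring.
Qed.

End ConfMin.
End Planar.

(** * Holomorphic data of a minimal surface *)

(** Twice the Wirtinger derivative of [F] in [z]; it is holomorphic when [F] is harmonic, and
    [cgrad2] is then its derivative. *)
Definition cgrad (F : C -> R) (z : C) : C := (Dx F z, - Dy F z).
Definition cgrad2 (F : C -> R) (z : C) : C := (Dx (Dx F) z, - Dx (Dy F) z).

Lemma Dx_opp (F : C -> R) (z : C) : Dx (fun y => - F y) z = - Dx F z.
Proof. apply Derive_opp. Qed.
Lemma Dy_opp (F : C -> R) (z : C) : Dy (fun y => - F y) z = - Dy F z.
Proof. apply Derive_opp. Qed.

Lemma cgrad_cder (O : C -> Prop) (F : C -> R) (z : C) : openC O -> sm O F ->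
  (forall y, O y -> Dx (Dx F) y + Dy (Dy F) y = 0) -> O z -> cder (cgrad F) z (cgrad2 F z).
Proof.
intros HO HF Hh Hz. unfold cgrad, cgrad2.
rewrite <- (Dx_opp (Dy F)).
apply (sm_CR_cder O HO (Dx F) (fun y => - Dy F y)); [apply (sm_Dx O), HF | apply (sm_opp O HO), (sm_Dy O), HF | | exact Hz].
intros y Hy. rewrite Dx_opp, Dy_opp, (sm_Schwarz O HO F y HF Hy). specialize (Hh y Hy). split; lra.
Qed.

Lemma cgrad2_hol (O : C -> Prop) (F : C -> R) : openC O -> sm O F ->
  (forall y, O y -> Dx (Dx F) y + Dy (Dy F) y = 0) -> hol O (cgrad2 F).
Proof.
intros HO HF Hh z Hz.
assert (H : hol O (cgrad F)) by (intros y Hy; eexists; apply (cgrad_cder O); eassumption).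
destruct (hol_derivative O _ HO H z Hz) as [l Hl]. exists l.
apply cder_ext_loc with (2 := Hl). apply (loc_of_open O HO); [exact Hz|]. intros y Hy.
apply cder_C_derive. apply (cgrad_cder O); assumption.
Qed.

Lemma sum_sq_hol (O : C -> Prop) (f g h : C -> C) : hol O f -> hol O g -> hol O h ->
  hol O (fun z => f z * f z + g z * g z + h z * h z)%C.
Proof.
intros Hf Hg Hh z Hz. destruct (Hf z Hz) as [a A], (Hg z Hz) as [b B], (Hh z Hz) as [c D]. eexists.
apply (cder_plus (fun z => f z * f z + g z * g z)%C (fun z => h z * h z)%C).
- apply (cder_plus (fun z => f z * f z)%C (fun z => g z * g z)%C); [apply (cder_mult f f) | apply (cder_mult g g)]; eassumption.
- apply (cder_mult h h); eassumption.
Qed.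

(** Up to a constant factor, the square of the coefficient of the Hopf differential; unlike
    the latter it does not involve the normal. *)
Definition hopf (Z : C -> R3) (z : C) : C :=
  (cgrad2 (fun y => X1 (Z y)) z * cgrad2 (fun y => X1 (Z y)) z
   + cgrad2 (fun y => X2 (Z y)) z * cgrad2 (fun y => X2 (Z y)) z
   + cgrad2 (fun y => X3 (Z y)) z * cgrad2 (fun y => X3 (Z y)) z)%C.

Lemma hopf_vec (Z : C -> R3) (z : C) :
  hopf Z z = (dot (D3x (D3x Z) z) (D3x (D3x Z) z) - dot (D3x (D3y Z) z) (D3x (D3y Z) z),
              - (2 * dot (D3x (D3x Z) z) (D3x (D3y Z) z))).
Proof.
set (F1 := fun y => X1 (Z y)). set (F2 := fun y => X2 (Z y)). set (F3 := fun y => X3 (Z y)).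
change (D3x (D3x Z) z) with ((Dx (Dx F1) z, Dx (Dx F2) z, Dx (Dx F3) z) : R3).
change (D3x (D3y Z) z) with ((Dx (Dy F1) z, Dx (Dy F2) z, Dx (Dy F3) z) : R3).
unfold hopf, cgrad2, dot. fold F1 F2 F3. apply injective_projections; simpl; unfold X1, X2, X3; simpl; ring.
Qed.

(** Parseval's identity for the tangential parts in the orthogonal frame [x], [cross n x],
    multiplied by [dot x x] to avoid a division. *)
Lemma frame_parseval (n x u v : R3) : dot n n = 1 -> dot x n = 0 ->
  dot x x * (dot u v - dot u n * dot v n) = dot u x * dot v x + dot u (cross n x) * dot v (cross n x).
Proof.
intros Hn Hx.
assert (G : dot u (cross n x) * dot v (cross n x) =
  dot u v * (dot n n * dot x x - dot n x * dot n x) - dot u n * (dot n v * dot x x - dot n x * dot x v)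
  + dot u x * (dot n v * dot x n - dot n n * dot x v)) by (unvec; ring).
rewrite G, Hn, (dot_sym n x), Hx, (dot_sym n v), (dot_sym x v). ring.
Qed.

(** The [x] derivatives of the two conformality relations for [Z_x] and [Z_y]. *)
Lemma cm_second (O : C -> Prop) (Z N : C -> R3) (z : C) : openC O -> conf_min O Z N -> O z ->
  dot (D3x (D3x Z) z) (D3x Z z) = dot (D3x (D3y Z) z) (D3y Z z) /\
  dot (D3x (D3y Z) z) (D3x Z z) = - dot (D3x (D3x Z) z) (D3y Z z).
Proof.
intros HO H Hz.
assert (SZ := cm_smZ O Z N H).
assert (E : forall y, O y -> dot (D3x Z y) (D3x Z y) - dot (D3y Z y) (D3y Z y) = 0 /\ dot (D3x Z y) (D3y Z y) = 0).
{ intros y Hy. rewrite (cm_rot O Z N H y Hy).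
  destruct (rotation_conformal (N y) (D3x Z y) (cm_unit O Z N H y Hy) (cm_orth_x O Z N H y Hy)) as (_ & A & B & _). lra. }
assert (S1 := sm3_D3x O Z SZ). assert (S2 := sm3_D3y O Z SZ).
assert (D1 := Dx_zero_of_const O HO (fun y => dot (D3x Z y) (D3x Z y) + (-1) * dot (D3y Z y) (D3y Z y)) z 0
   (fun y Hy => ltac:(destruct (E y Hy); lra)) Hz).
rewrite (Dx_plus O (fun y => dot (D3x Z y) (D3x Z y)) (fun y => (-1) * dot (D3y Z y) (D3y Z y))) in D1;
  [|apply sm_dot; assumption|apply (sm_mult O HO (fun _ => -1)); [apply sm_const, HO | apply sm_dot; assumption]|exact Hz].
rewrite (Dx_mult O (fun _ => -1)) in D1 by first [assumption | apply sm_const, HO | apply sm_dot; assumption].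
rewrite Dx_const, !(Dx_dot O HO) in D1 by assumption.
assert (D2 := Dx_zero_of_const O HO _ z 0 (fun y Hy => proj2 (E y Hy)) Hz). rewrite (Dx_dot O HO) in D2 by assumption.
rewrite (dot_sym (D3x Z z) (D3x (D3x Z) z)), (dot_sym (D3y Z z) (D3x (D3y Z) z)) in D1.
rewrite (dot_sym (D3x Z z) (D3x (D3y Z) z)) in D2. lra.
Qed.

(** Let [e] and [f] be the normal components of [Z_xx] and [Z_xy]. By [cm_second] the tangential
    parts are orthogonal and of equal length, so they drop out and [hopf] equals [(e - i f)^2]. It
    vanishes when [e = f = 0], that is, when [N_x] is orthogonal to the whole frame. *)
Lemma hopf_zero_iff (O : C -> Prop) (Z N : C -> R3) (z : C) : openC O -> conf_min O Z N -> O z ->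
  D3x Z z <> (0, 0, 0) ->
  (hopf Z z = 0%C <-> D3x N z = (0, 0, 0)) /\
  (dot (D3x (D3x Z) z) (N z) = 0 -> dot (D3x (D3y Z) z) (N z) = 0 -> D3x N z = (0, 0, 0)).
Proof.
intros HO H Hz Hx.
assert (Hxx : dot (D3x Z z) (D3x Z z) <> 0) by (intro E; apply Hx, dot_zero, E).
assert (Hn := cm_unit O Z N H z Hz). assert (Hxn := cm_orth_x O Z N H z Hz).
destruct (cm_forms O HO Z N H z Hz) as (S1 & S2 & _).
assert (K : dot (D3x (D3x Z) z) (N z) = 0 -> dot (D3x (D3y Z) z) (N z) = 0 -> D3x N z = (0, 0, 0)).
{ intros E F. apply (orthogonal_frame (N z) (D3x Z z)); try assumption.
  - apply (cm_N_orth O HO Z N H z Hz).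
  - rewrite dot_sym. lra.
  - rewrite <- (cm_rot O Z N H z Hz), dot_sym. lra. }
split; [|exact K]. rewrite hopf_vec.
destruct (cm_second O Z N z HO H Hz) as [C1 C2].
rewrite (cm_rot O Z N H z Hz) in C1, C2.
set (A := D3x (D3x Z) z) in *. set (B := D3x (D3y Z) z) in *.
assert (P1 := frame_parseval (N z) (D3x Z z) A A Hn Hxn).
assert (P2 := frame_parseval (N z) (D3x Z z) B B Hn Hxn).
assert (P3 := frame_parseval (N z) (D3x Z z) A B Hn Hxn).
rewrite <- C1, C2 in P2. rewrite <- C1, C2 in P3.
set (e := dot A (N z)) in *. set (f := dot B (N z)) in *.
assert (Q1 : dot A A - e * e = dot B B - f * f) by (apply Rmult_eq_reg_l with (dot (D3x Z z) (D3x Z z)); [|exact Hxx]; lra).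
assert (Q2 : dot A B = e * f).
{ apply Rminus_diag_uniq. apply Rmult_eq_reg_l with (dot (D3x Z z) (D3x Z z)); [|exact Hxx]. lra. }
split.
- intros E. assert (E1 := f_equal fst E). assert (E2 := f_equal snd E). simpl in E1, E2.
  assert (F1 : e * e = f * f) by lra. assert (F2 : e * f = 0) by lra.
  assert (EF : e = 0 /\ f = 0).
  { destruct (Rmult_integral _ _ F2) as [E0|E0]; rewrite E0 in F1; split; try exact E0; apply Rsqr_0_uniq; unfold Rsqr; lra. }
  apply K; apply EF.
- intros E.
  assert (Ee : e = 0) by (rewrite S1, E; unfold dot, X1, X2, X3; simpl; ring).
  assert (Ef : f = 0) by (rewrite S2, E; unfold dot, X1, X2, X3; simpl; ring).
  rewrite Ee, Ef in *. apply injective_projections; simpl; lra.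
Qed.

Lemma hopf_hol (O : C -> Prop) (Z N : C -> R3) : openC O -> conf_min O Z N -> hol O (hopf Z).
Proof.
intros HO H. destruct (cm_smZ O Z N H) as (S1 & S2 & S3).
apply sum_sq_hol; apply cgrad2_hol; try assumption; intros y Hy;
  assert (E := cm_harmonic O HO Z N H y Hy).
- exact (f_equal X1 E).
- exact (f_equal X2 E).
- exact (f_equal X3 E).
Qed.

(** * The Gauss map in stereographic coordinates *)

Definition stereo_north (n : R3) : C := (X1 n / (1 - X3 n), X2 n / (1 - X3 n)).
(** The coordinate [1 / g] near the north pole; the conjugation built into it keeps the orientation
    of [stereo_north]. *)
Definition stereo_south (n : R3) : C := (X1 n / (1 + X3 n), - X2 n / (1 + X3 n)).

Lemma Dx_div (O : C -> Prop) (F G : C -> R) (z : C) : openC O -> sm O F -> sm O G -> (forall y, O y -> G y <> 0) -> O z ->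
  Dx (fun y => F y / G y) z = (Dx F z * G z - F z * Dx G z) / (G z * G z).
Proof.
intros HO HF HG H0 Hz. unfold Rdiv. rewrite (Dx_mult O F (fun y => / G y)), (Dx_inv O G) by (try assumption; first [apply H0, Hz | apply (sm_inv O HO); assumption]).
field. apply H0, Hz.
Qed.
Lemma Dy_div (O : C -> Prop) (F G : C -> R) (z : C) : openC O -> sm O F -> sm O G -> (forall y, O y -> G y <> 0) -> O z ->
  Dy (fun y => F y / G y) z = (Dy F z * G z - F z * Dy G z) / (G z * G z).
Proof.
intros HO HF HG H0 Hz. unfold Rdiv. rewrite (Dy_mult O F (fun y => / G y)), (Dy_inv O G) by (try assumption; first [apply H0, Hz | apply (sm_inv O HO); assumption]).
field. apply H0, Hz.
Qed.

Section Gauss.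
Variables (O : C -> Prop) (N : C -> R3).
Hypothesis HO : openC O.
Hypothesis HN : sm3 O N.
Hypothesis H1 : forall z, O z -> dot (N z) (N z) = 1.
Hypothesis HW : forall z, O z -> D3y N z = scal3 (-1) (cross (N z) (D3x N z)).

(** Modulo [|N| = 1] and the orthogonality of [N] and [N_x], the rotation rule [HW] yields the
    Cauchy-Riemann equations of the projected map. *)
Lemma stereo_north_hol : (forall z, O z -> X3 (N z) <> 1) -> hol O (fun z => stereo_north (N z)).
Proof.
intros H3 z Hz. destruct HN as (S1 & S2 & S3).
assert (G0 : forall y, O y -> 1 - X3 (N y) <> 0) by (intros y Hy; specialize (H3 y Hy); lra).
assert (SG : sm O (fun y => 1 - X3 (N y))) by (apply (sm_minus O HO (fun _ => 1)); [apply sm_const, HO | exact S3]).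
eexists. apply (sm_CR_cder O HO (fun y => X1 (N y) / (1 - X3 (N y))) (fun y => X2 (N y) / (1 - X3 (N y))));
  [apply (sm_div O HO) | apply (sm_div O HO) | | exact Hz]; try assumption.
intros y Hy.
rewrite !(Dx_div O), !(Dy_div O) by assumption.
rewrite !(Dx_plus O (fun _ => 1) (fun y => - X3 (N y))), !(Dy_plus O (fun _ => 1) (fun y => - X3 (N y))), !Dx_const, !Dy_const, !Dx_opp, !Dy_opp
  by (try assumption; first [apply sm_const, HO | apply (sm_opp O HO); assumption]).
specialize (G0 y Hy). destruct (normal_derivative O HO N y HN H1 Hy) as [Hd _].
assert (E := HW y Hy). assert (E1 := f_equal X1 E). assert (E2 := f_equal X2 E). assert (E3 := f_equal X3 E).
specialize (H1 y Hy).
change (X1 (D3y N y)) with (Dy (fun y => X1 (N y)) y) in E1.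
change (X2 (D3y N y)) with (Dy (fun y => X2 (N y)) y) in E2.
change (X3 (D3y N y)) with (Dy (fun y => X3 (N y)) y) in E3.
rewrite E1, E2, E3. clear E E1 E2 E3.
unfold D3x, dot, cross, scal3, X1, X2, X3 in *; simpl in *.
set (n1 := fst (fst (N y))) in *. set (n2 := snd (fst (N y))) in *. set (n3 := snd (N y)) in *.
set (a1 := Dx (fun y => fst (fst (N y))) y) in *. set (a2 := Dx (fun y => snd (fst (N y))) y) in *. set (a3 := Dx (fun y => snd (N y)) y) in *.
clearbody n1 n2 n3 a1 a2 a3.
split; [|rewrite <- Rdiv_opp_l]; apply Rmult_eq_compat_r.
- generalize (f_equal (Rmult a1) H1) (f_equal (Rmult n1) Hd). lra.
- generalize (f_equal (Rmult a2) H1) (f_equal (Rmult n2) Hd). lra.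
Qed.

Lemma stereo_south_hol : (forall z, O z -> X3 (N z) <> -1) -> hol O (fun z => stereo_south (N z)).
Proof.
intros H3 z Hz. destruct HN as (S1 & S2 & S3).
assert (G0 : forall y, O y -> 1 + X3 (N y) <> 0) by (intros y Hy; specialize (H3 y Hy); lra).
assert (SG : sm O (fun y => 1 + X3 (N y))) by (apply (sm_plus O HO (fun _ => 1)); [apply sm_const, HO | exact S3]).
assert (S2' : sm O (fun y => - X2 (N y))) by (apply (sm_opp O HO), S2).
eexists. apply (sm_CR_cder O HO (fun y => X1 (N y) / (1 + X3 (N y))) (fun y => - X2 (N y) / (1 + X3 (N y))));
  [apply (sm_div O HO) | apply (sm_div O HO) | | exact Hz]; try assumption.
intros y Hy.
rewrite !(Dx_div O _ (fun y => 1 + X3 (N y))), !(Dy_div O _ (fun y => 1 + X3 (N y))) by assumption.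
rewrite !(Dx_plus O (fun _ => 1) (fun y => X3 (N y))), !(Dy_plus O (fun _ => 1) (fun y => X3 (N y))), !Dx_const, !Dy_const, !Dx_opp, !Dy_opp
  by (try assumption; apply sm_const, HO).
specialize (G0 y Hy). destruct (normal_derivative O HO N y HN H1 Hy) as [Hd _].
assert (E := HW y Hy). assert (E1 := f_equal X1 E). assert (E2 := f_equal X2 E). assert (E3 := f_equal X3 E).
specialize (H1 y Hy).
change (X1 (D3y N y)) with (Dy (fun y => X1 (N y)) y) in E1.
change (X2 (D3y N y)) with (Dy (fun y => X2 (N y)) y) in E2.
change (X3 (D3y N y)) with (Dy (fun y => X3 (N y)) y) in E3.
rewrite E1, E2, E3. clear E E1 E2 E3.
unfold D3x, dot, cross, scal3, X1, X2, X3 in *; simpl in *.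
set (n1 := fst (fst (N y))) in *. set (n2 := snd (fst (N y))) in *. set (n3 := snd (N y)) in *.
set (a1 := Dx (fun y => fst (fst (N y))) y) in *. set (a2 := Dx (fun y => snd (fst (N y))) y) in *. set (a3 := Dx (fun y => snd (N y)) y) in *.
clearbody n1 n2 n3 a1 a2 a3.
split; [|rewrite <- Rdiv_opp_l]; apply Rmult_eq_compat_r.
- generalize (f_equal (Rmult a1) H1) (f_equal (Rmult n1) Hd). lra.
- generalize (f_equal (Rmult a2) H1) (f_equal (Rmult n2) Hd). lra.
Qed.
End Gauss.

(** The Weierstrass representation is pointwise algebra: with [y] the rotated [x], the three
    coefficients [X_x - i X_y] are determined by the normal and by [w], the first minus [i] times
    the second. *)
Lemma weierstrass_formula (n x : R3) : dot n n = 1 -> X3 n <> 1 -> dot x n = 0 ->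
  let y := cross n x in
  let phi := fun X : R3 -> R => (X x, - X y) : C in
  let a := stereo_north n in
  let w := (phi X1 - Ci * phi X2)%C in
  phi X1 = weierstrass1 w a /\ phi X2 = weierstrass2 w a /\ phi X3 = weierstrass3 w a.
Proof.
intros Hn H3 Hx y phi a w.
destruct n as [[n1 n2] n3], x as [[x1 x2] x3].
unfold w, a, phi, y, weierstrass1, weierstrass2, weierstrass3, stereo_north, dot, cross, X1, X2, X3 in *; simpl in *.
assert (N : 1 - n3 <> 0) by lra.
(* The two inverses become variables subject to one relation each, which leaves polynomial
   consequences for [nsatz]. *)
set (i := / (1 - n3)). assert (Hi : i * (1 - n3) = 1) by (unfold i; apply Rinv_l, N).
set (h := 1 / 2). assert (Hh : 2 * h = 1) by (unfold h; field).
unfold Rdiv. fold i. clearbody i h.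
repeat split; apply injective_projections; simpl; nsatz.
Qed.

Lemma sphere_curve (c : R -> C) (t : R) (v : C) : curve_der c t v ->
  is_derive (fun s => X1 (sphere_pt (c s))) t (X1 (sphere_der (c t) v)) /\
  is_derive (fun s => X2 (sphere_pt (c s))) t (X2 (sphere_der (c t) v)) /\
  is_derive (fun s => X3 (sphere_pt (c s))) t (X3 (sphere_der (c t) v)).
Proof.
intros [H1 H2].
assert (E1 : ex_derive (fun s => Re (c s)) t) by (eexists; exact H1).
assert (E2 : ex_derive (fun s => Im (c s)) t) by (eexists; exact H2).
apply is_derive_unique in H1; apply is_derive_unique in H2.
assert (N := nsq1_neq (c t)). unfold nsq in N.
assert (D1 : Derive (fun x : R => Re (c x)) t = Re v) by exact H1.
assert (D2 : Derive (fun x : R => Im (c x)) t = Im v) by exact H2.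
unfold sphere_pt, sphere_der, nsq, X1, X2, X3; simpl fst; simpl snd.
set (u := fun s => Re (c s)) in *. set (w := fun s => Im (c s)) in *.
change (Re (c t)) with (u t) in *. change (Im (c t)) with (w t) in *.
split; [|split];
[apply (is_derive_ext (fun s => 2 * u s / (1 + (u s * u s + w s * w s)))); [reflexivity|]
|apply (is_derive_ext (fun s => 2 * w s / (1 + (u s * u s + w s * w s)))); [reflexivity|]
|apply (is_derive_ext (fun s => ((u s * u s + w s * w s) - 1) / (1 + (u s * u s + w s * w s)))); [reflexivity|]];
(auto_derive; [repeat split; assumption|]);
change (Derive (fun x : R => u x) t) with (Derive u t); change (Derive (fun x : R => w x) t) with (Derive w t); rewrite D1, D2; field; exact N.
Qed.

Lemma sphere_cder (G : C -> C) (z l : C) : cder G z l ->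
  D3x (fun y => sphere_pt (G y)) z = sphere_der (G z) l /\
  D3y (fun y => sphere_pt (G y)) z = sphere_der (G z) (Ci * l)%C.
Proof.
intros H. destruct (cder_partials _ _ _ H) as [[A1 A2] [B1 B2]].
assert (Cx : curve_der (fun t => G (t, Im z)) (Re z) l) by (split; assumption).
assert (Cy : curve_der (fun t => G (Re z, t)) (Im z) (Ci * l)%C).
{ split; [replace (Re (Ci * l)%C) with (- Im l) by (unfold Re, Im; simpl; ring) |
   replace (Im (Ci * l)%C) with (Re l) by (unfold Re, Im; simpl; ring)]; assumption. }
apply sphere_curve in Cx; apply sphere_curve in Cy. rewrite C_eta in Cx, Cy.
destruct Cx as (X & X' & X''), Cy as (Y & Y' & Y'').
split; apply R3_eq; apply is_derive_unique; assumption.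
Qed.

(** The point of the sphere at which [1 / g] takes the value [b]. *)
Definition sphere_south (b : C) : R3 := (2 * Re b / (1 + nsq b), - (2 * Im b) / (1 + nsq b), (1 - nsq b) / (1 + nsq b)).

Definition sphere_of (w : Chat) : R3 := match w with Some a => sphere_pt a | None => (0, 0, 1) end.

Lemma sphere_of_unit (w : Chat) : dot (sphere_of w) (sphere_of w) = 1.
Proof. destruct w as [a|]; [apply sphere_pt_unit | unfold sphere_of, dot, X1, X2, X3; simpl; ring]. Qed.

Lemma sphere_pt_not_north (a : C) : X3 (sphere_pt a) <> 1.
Proof.
unfold sphere_pt, X3; simpl. assert (N := nsq1_neq a). intro E.
apply (f_equal (fun t => t * (1 + nsq a))) in E. field_simplify in E; [lra | exact N].
Qed.

Lemma stereo_sphere (w : Chat) : stereo (sphere_of w) = w.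
Proof.
unfold stereo. destruct w as [a|]; simpl sphere_of.
- destruct (Req_EM_T (X3 (sphere_pt a)) 1) as [E|E]; [exfalso; exact (sphere_pt_not_north a E)|].
  f_equal. unfold sphere_pt, X1, X2, X3; simpl. assert (N := nsq1_neq a).
  transitivity (Re a, Im a); [|apply C_eta]. apply injective_projections; simpl; field; split; try exact N; lra.
- destruct (Req_EM_T (X3 (0, 0, 1)) 1) as [E|E]; [reflexivity|]. exfalso; apply E; reflexivity.
Qed.

Lemma unit_north (n : R3) : dot n n = 1 -> X3 n = 1 -> n = (0, 0, 1).
Proof.
intros H E. destruct n as [[a b] c]. unfold dot, X1, X2, X3 in *; simpl in *. subst c.
assert (a = 0) by (apply Rsqr_0_uniq; unfold Rsqr; nra). assert (b = 0) by (apply Rsqr_0_uniq; unfold Rsqr; nra).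
subst; reflexivity.
Qed.

Lemma stereo_north_eq (n : R3) : X3 n <> 1 -> stereo n = Some (stereo_north n).
Proof. intros H. unfold stereo. destruct (Req_EM_T (X3 n) 1); [contradiction | reflexivity]. Qed.

Lemma stereo_infty (n : R3) : stereo n = infty <-> X3 n = 1.
Proof.
unfold stereo. destruct (Req_EM_T (X3 n) 1) as [E|E]; split; intros H; try assumption; try reflexivity; [discriminate | contradiction].
Qed.

Lemma stereo_some (n : R3) (a : C) : stereo n = Some a -> X3 n <> 1 /\ stereo_north n = a.
Proof.
intros H. assert (N : X3 n <> 1) by (intro E; apply stereo_infty in E; rewrite E in H; discriminate).
split; [exact N|]. rewrite (stereo_north_eq n N) in H. injection H as H. exact H.
Qed.

Lemma sphere_stereo (n : R3) : dot n n = 1 -> sphere_of (stereo n) = n.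
Proof.
intros H. unfold stereo. destruct (Req_EM_T (X3 n) 1) as [E|E].
- symmetry. apply unit_north; assumption.
- simpl. destruct n as [[a b] c]. unfold dot, X1, X2, X3 in *; simpl in *.
  assert (N : 1 - c <> 0) by lra.
  assert (Q : nsq (a / (1 - c), b / (1 - c)) = (1 + c) / (1 - c)).
  { unfold nsq; simpl. replace (a / (1 - c) * (a / (1 - c)) + b / (1 - c) * (b / (1 - c))) with ((a * a + b * b) / ((1 - c) * (1 - c))) by (field; exact N).
    replace (a * a + b * b) with ((1 + c) * (1 - c)) by lra. field; exact N. }
  unfold sphere_pt. rewrite Q. unfold Re, Im; simpl.
  apply R3_eq; unfold X1, X2, X3; simpl; field; split; try lra; exact N.
Qed.

Lemma stereo_inj (n m : R3) : dot n n = 1 -> dot m m = 1 -> stereo n = stereo m -> n = m.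
Proof. intros H K E. rewrite <- (sphere_stereo n H), <- (sphere_stereo m K), E. reflexivity. Qed.

Lemma stereo_zero (n : R3) : dot n n = 1 -> X3 n <> -1 -> stereo n <> Some (RtoC 0).
Proof.
intros H N E. apply N. rewrite <- (sphere_stereo n H), E. unfold sphere_of, sphere_pt, nsq, X3; simpl. field.
Qed.

Lemma Cinv_unique (a b : C) : (a * b)%C = 1%C -> (/ a)%C = b.
Proof.
intros H. assert (Ha : a <> 0%C) by (intro E; apply C1_nz; rewrite <- H, E; cring).
transitivity (/ a * (a * b))%C; [rewrite H; cring|]. rewrite Cmult_assoc, Cinv_l by exact Ha. cring.
Qed.

Lemma recip_stereo (n : R3) : dot n n = 1 -> X3 n <> -1 -> recip (stereo n) = Some (stereo_south n).
Proof.
intros H N. assert (Z := stereo_zero n H N).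
unfold stereo in *. destruct (Req_EM_T (X3 n) 1) as [E|E].
- apply (unit_north n H) in E. subst n. unfold recip, stereo_south, X1, X2, X3; simpl. f_equal.
  apply injective_projections; simpl; field.
- unfold recip. destruct (Ceq_dec (X1 n / (1 - X3 n), X2 n / (1 - X3 n)) (RtoC 0)) as [F|F]; [exfalso; apply Z; rewrite F; reflexivity|].
  f_equal.
  destruct n as [[a b] c]. unfold stereo_south, dot, X1, X2, X3 in *; simpl in *.
  apply Cinv_unique.
  assert (N1 : 1 - c <> 0) by lra. assert (N2 : 1 + c <> 0) by lra.
  apply injective_projections; simpl.
  + replace (a / (1 - c) * (a / (1 + c)) - b / (1 - c) * (- b / (1 + c))) with ((a * a + b * b) / ((1 - c) * (1 + c))) by (field; split; assumption).
    replace (a * a + b * b) with ((1 - c) * (1 + c)) by lra. field; split; assumption.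
  + field; split; assumption.
Qed.

Lemma sphere_recip (w : Chat) (b : C) : recip w = Some b -> sphere_of w = sphere_south b.
Proof.
destruct w as [a|]; simpl.
- destruct (Ceq_dec a (RtoC 0)) as [E|E]; [discriminate|]. intros H; injection H as H.
  assert (P : 0 < nsq a).
  { destruct (Rle_lt_or_eq_dec _ _ (nsq_pos a)) as [L|L]; [exact L|]. exfalso; apply E, nsq_zero; symmetry; exact L. }
  subst b. destruct a as [a1 a2]. unfold sphere_pt, sphere_south, nsq, Cinv, Re, Im in *; simpl in *.
  apply R3_eq; unfold X1, X2, X3; simpl; field; repeat split; nra.
- intros H; injection H as H. subst b. unfold sphere_south, nsq, Re, Im; simpl.
  apply R3_eq; unfold X1, X2, X3; simpl; field.
Qed.

Lemma sm_nsq (O : C -> Prop) (G : C -> C) : openC O -> hol O G -> sm O (fun y => 1 + nsq (G y)).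
Proof.
intros HO H. assert (A := hol_sm_Re O HO G H). assert (B := hol_sm_Im O HO G H).
apply (sm_plus O HO (fun _ => 1)); [apply sm_const, HO|]. unfold nsq. apply sm_plus; try assumption; apply sm_mult; assumption.
Qed.

Lemma sphere_pt_sm (O : C -> Prop) (G : C -> C) : openC O -> hol O G -> sm3 O (fun y => sphere_pt (G y)).
Proof.
intros HO H. assert (A := hol_sm_Re O HO G H). assert (B := hol_sm_Im O HO G H). assert (D := sm_nsq O G HO H).
assert (N : forall y, O y -> 1 + nsq (G y) <> 0) by (intros; apply nsq1_neq).
repeat split; unfold sphere_pt, X1, X2, X3; simpl; apply (sm_div O HO); try assumption.
- apply (sm_mult O HO (fun _ => 2)); [apply sm_const, HO | exact A].
- apply (sm_mult O HO (fun _ => 2)); [apply sm_const, HO | exact B].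
- apply sm_ext with (F := fun y => (1 + nsq (G y)) - 2); [exact HO | intros; ring|].
  apply (sm_minus O HO _ (fun _ => 2)); [exact D | apply sm_const, HO].
Qed.

Lemma sphere_south_sm (O : C -> Prop) (G : C -> C) : openC O -> hol O G -> sm3 O (fun y => sphere_south (G y)).
Proof.
intros HO H. assert (A := hol_sm_Re O HO G H). assert (B := hol_sm_Im O HO G H). assert (D := sm_nsq O G HO H).
assert (N : forall y, O y -> 1 + nsq (G y) <> 0) by (intros; apply nsq1_neq).
repeat split; unfold sphere_south, X1, X2, X3; simpl; apply (sm_div O HO); try assumption.
- apply (sm_mult O HO (fun _ => 2)); [apply sm_const, HO | exact A].
- apply (sm_opp O HO), (sm_mult O HO (fun _ => 2)); [apply sm_const, HO | exact B].
- apply sm_ext with (F := fun y => 2 - (1 + nsq (G y))); [exact HO | intros; ring|].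
  apply (sm_minus O HO (fun _ => 2)); [apply sm_const, HO | exact D].
Qed.

(** * Charts *)

Section Charts.
Variable S : riemann_surface.
Implicit Types (p q : S) (i j : chart S) (U : S -> Prop).

Definition lift {T : Type} i (f : S -> T) : C -> T := fun z => f (par i z).

(** [par i] is arbitrary off the image of the chart; the second clause retains genuine coordinates
    only. *)
Definition img i U : C -> Prop := fun z => dom i (par i z) /\ crd i (par i z) = z /\ U (par i z).

Lemma img_crd i U p : U p -> dom i p -> img i U (crd i p).
Proof. intros H K. unfold img. rewrite (crdK K). auto. Qed.

Lemma lift_crd {T : Type} i (f : S -> T) p : dom i p -> lift i f (crd i p) = f p.
Proof. intros H. unfold lift. rewrite (crdK H). reflexivity. Qed.

Lemma dom_loc i p : dom i p -> locC (crd i p) (fun z => dom i (par i z) /\ crd i (par i z) = z).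
Proof. intros H. generalize (par_dom H H). apply filter_imp. tauto. Qed.

(** Transition maps are continuous, so a single chart decides what holds near a point. *)
Lemma near_of_chart i p (P : S -> Prop) : dom i p -> locC (crd i p) (fun z => P (par i z)) -> near p P.
Proof.
intros Hi H j Hj.
assert (T := transition_holomorphic Hj Hi). destruct T as [l T]. apply cder_is_derive, cder_cont in T.
assert (H' : locC (crd i (par j (crd j p))) (fun z => P (par i z))) by (rewrite (crdK Hj); exact H).
specialize (T _ H'). unfold filtermap in T.
generalize (filter_and _ _ T (par_dom Hj Hi)). apply filter_imp.
intros z (A & B & D & E). rewrite (crdK E) in A. exact A.
Qed.

Lemma near_and p (P Q : S -> Prop) : near p P -> near p Q -> near p (fun q => P q /\ Q q).
Proof. intros H K i Hi. apply filter_and; [apply H, Hi | apply K, Hi]. Qed.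

Lemma near_imp p (P Q : S -> Prop) : (forall q, P q -> Q q) -> near p P -> near p Q.
Proof. intros H K i Hi. generalize (K i Hi). apply filter_imp. intros z; apply H. Qed.

Lemma near_self p (P : S -> Prop) : near p P -> P p.
Proof. intros H. destruct (dom_cover p) as [i Hi]. assert (K := locally_singleton _ _ (H i Hi)). simpl in K. rewrite (crdK Hi) in K. exact K. Qed.

Lemma near_near p (P : S -> Prop) : near p P -> near p (fun q => near q P).
Proof.
intros H i Hi. generalize (filter_and _ _ (dom_loc i p Hi) (locally_locally _ _ (H i Hi))). apply filter_imp.
intros z ((A & B) & D). apply (near_of_chart i); [exact A|]. rewrite B. exact D.
Qed.

Lemma near_open p (P : S -> Prop) : near p P -> is_open (fun q => near q P).
Proof. intros _ q Hq. apply near_near, Hq. Qed.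

Lemma img_open i U : is_open U -> openC (img i U).
Proof.
intros HU z (A & B & D). assert (K := HU _ D i A). assert (L := dom_loc i _ A). rewrite B in K, L.
generalize (filter_and _ _ K L). apply filter_imp. intros y (K1 & K2 & K3). split; auto.
Qed.

Lemma open_whole : is_open (@whole S).
Proof. intros p _ i _. apply filter_forall. intros; exact I. Qed.

Lemma lift_Dx i (f : S -> R) z : dom i (par i z) -> crd i (par i z) = z -> lift i (dx i f) z = Dx (lift i f) z.
Proof. intros A B. unfold lift at 1, dx, along_x. rewrite B. reflexivity. Qed.
Lemma lift_Dy i (f : S -> R) z : dom i (par i z) -> crd i (par i z) = z -> lift i (dy i f) z = Dy (lift i f) z.
Proof. intros A B. unfold lift at 1, dy, along_y. rewrite B. reflexivity. Qed.

Lemma lift_Dx_loc i U (f : S -> R) z : is_open U -> img i U z -> locC z (fun y => lift i (dx i f) y = Dx (lift i f) y).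
Proof. intros HU Hz. apply (loc_of_open _ (img_open i U HU)); [exact Hz|]. intros y (A & B & _). apply lift_Dx; assumption. Qed.
Lemma lift_Dy_loc i U (f : S -> R) z : is_open U -> img i U z -> locC z (fun y => lift i (dy i f) y = Dy (lift i f) y).
Proof. intros HU Hz. apply (loc_of_open _ (img_open i U HU)); [exact Hz|]. intros y (A & B & _). apply lift_Dy; assumption. Qed.

(** [dx i f] read in the chart agrees with [Dx] of the lifted function only on the image of the
    chart, so the induction passes through local equality. *)
Lemma class_C_ck (n : nat) : forall i U (f : S -> R), is_open U ->
  (class_C n i U f <-> forall z, img i U z -> ck n (lift i f) z).
Proof.
induction n as [|n IH]; intros i U f HU; split.
- intros [H _] z (A & B & D). split; [|exact I]. specialize (H _ D A). rewrite B in H. exact H.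
- intros H. split; [|exact I]. intros p Hp Hi. apply (H (crd i p) (img_crd i U p Hp Hi)).
- intros (H0 & H1 & H2 & H3) z Hz. assert (Hz' := Hz). destruct Hz as (A & B & D).
  specialize (H0 _ D A). specialize (H1 _ D A). rewrite B in H0.
  unfold along_x, along_y in H1. rewrite B in H1.
  split; [exact H0|]. split; [exact H1|]. split.
  + apply ck_ext_loc with (2 := proj1 (IH i U _ HU) H2 z Hz'). apply (lift_Dx_loc i U); assumption.
  + apply ck_ext_loc with (2 := proj1 (IH i U _ HU) H3 z Hz'). apply (lift_Dy_loc i U); assumption.
- intros H. split; [|split; [|split]].
  + intros p Hp Hi. apply (H (crd i p) (img_crd i U p Hp Hi)).
  + intros p Hp Hi. apply (H (crd i p) (img_crd i U p Hp Hi)).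
  + apply IH; [exact HU|]. intros z Hz. destruct (H z Hz) as (_ & _ & K & _).
    apply ck_ext_loc with (2 := K). generalize (lift_Dx_loc i U f z HU Hz). apply filter_imp. intros; symmetry; assumption.
  + apply IH; [exact HU|]. intros z Hz. destruct (H z Hz) as (_ & _ & _ & K).
    apply ck_ext_loc with (2 := K). generalize (lift_Dy_loc i U f z HU Hz). apply filter_imp. intros; symmetry; assumption.
Qed.

Lemma smooth_sm U (f : S -> R) : is_open U -> (smooth U f <-> forall i, sm (img i U) (lift i f)).
Proof.
intros HU; split.
- intros H i n. apply class_C_ck; [exact HU | apply H].
- intros H n i. apply class_C_ck; [exact HU | intros z; apply H].
Qed.

Lemma smooth3_sm3 U (Z : S -> R3) : is_open U -> (smooth3 U Z <-> forall i, sm3 (img i U) (lift i Z)).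
Proof.
intros HU; split.
- intros (H1 & H2 & H3) i. split; [|split];
  [apply (proj1 (smooth_sm U _ HU) H1 i) | apply (proj1 (smooth_sm U _ HU) H2 i) | apply (proj1 (smooth_sm U _ HU) H3 i)].
- intros H. split; [|split]; apply (smooth_sm U _ HU); intros i; apply (H i).
Qed.

Lemma dx3_D3x i (Z : S -> R3) p : dx3 i Z p = D3x (lift i Z) (crd i p).
Proof. reflexivity. Qed.
Lemma dy3_D3y i (Z : S -> R3) p : dy3 i Z p = D3y (lift i Z) (crd i p).
Proof. reflexivity. Qed.

Lemma lift_D3x_loc i U (Z : S -> R3) z : is_open U -> img i U z -> locC z (fun y => lift i (dx3 i Z) y = D3x (lift i Z) y).
Proof. intros HU Hz. apply (loc_of_open _ (img_open i U HU)); [exact Hz|]. intros y (A & B & _). unfold lift at 1. rewrite dx3_D3x, B. reflexivity. Qed.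
Lemma lift_D3y_loc i U (Z : S -> R3) z : is_open U -> img i U z -> locC z (fun y => lift i (dy3 i Z) y = D3y (lift i Z) y).
Proof. intros HU Hz. apply (loc_of_open _ (img_open i U HU)); [exact Hz|]. intros y (A & B & _). unfold lift at 1. rewrite dy3_D3y, B. reflexivity. Qed.

Lemma second_forms i U (Z N : S -> R3) p : is_open U -> U p -> dom i p ->
  second_e i Z N p = dot (D3x (D3x (lift i Z)) (crd i p)) (N p) /\
  second_f i Z N p = dot (D3x (D3y (lift i Z)) (crd i p)) (N p) /\
  second_g i Z N p = dot (D3y (D3y (lift i Z)) (crd i p)) (N p).
Proof.
intros HU Hp Hi. assert (Hz := img_crd i U p Hp Hi).
unfold second_e, second_f, second_g. rewrite !dx3_D3x, dy3_D3y.
split; [|split]; (apply f_equal2; [|reflexivity]).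
- apply D3x_ext_loc, (lift_D3x_loc i U); assumption.
- apply D3x_ext_loc, (lift_D3y_loc i U); assumption.
- apply D3y_ext_loc, (lift_D3y_loc i U); assumption.
Qed.

(** ** Change of chart *)

(** The chain rule; by the Cauchy-Riemann equations one complex number encodes the Jacobian of the
    transition map. *)
Lemma dx_change U (f : S -> R) i j p : is_open U -> smooth U f -> U p -> dom i p -> dom j p ->
  dx i f p = dx j f p * Re (dz i (crd j) p) + dy j f p * Im (dz i (crd j) p) /\
  dy i f p = dx j f p * - Im (dz i (crd j) p) + dy j f p * Re (dz i (crd j) p).
Proof.
intros HU Hf Hp Hi Hj.
set (T := fun z => crd j (par i z)).
destruct (transition_holomorphic Hi Hj) as [l HT]. apply cder_is_derive in HT.
assert (El : dz i (crd j) p = l) by (apply cder_C_derive, HT). rewrite El.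
assert (ET : T (crd i p) = crd j p) by (unfold T; rewrite (crdK Hi); reflexivity).
assert (SF := proj1 (smooth_sm U f HU) Hf j).
assert (HO : img j U (T (crd i p))) by (rewrite ET; apply img_crd; assumption).
assert (EF : locC (crd i p) (fun z => lift j f (T z) = lift i f z)).
{ generalize (par_dom Hi Hj). apply filter_imp. intros z (_ & _ & D). unfold lift, T. rewrite (crdK D). reflexivity. }
destruct (cder_partials _ _ _ HT) as [[A1 A2] [B1 B2]].
assert (Cx : curve_der (fun t => T (t, Im (crd i p))) (Re (crd i p)) l) by (split; assumption).
assert (Cy : curve_der (fun t => T (Re (crd i p), t)) (Im (crd i p)) (- Im l, Re l)) by (split; assumption).
assert (HOx : img j U (T (Re (crd i p), Im (crd i p)))) by (rewrite C_eta; exact HO).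
assert (Kx := sm_curve (img j U) (img_open j U HU) (lift j f) _ _ _ SF HOx Cx).
assert (Ky := sm_curve (img j U) (img_open j U HU) (lift j f) _ _ _ SF HOx Cy).
cbv beta in Kx, Ky. rewrite C_eta, ET in Kx, Ky. simpl in Ky.
split; apply is_derive_unique.
- apply is_derive_ext_loc with (2 := Kx). apply (locally_slice_x (crd i p) _ EF).
- apply is_derive_ext_loc with (2 := Ky). apply (locally_slice_y (crd i p) _ EF).
Qed.

Lemma dx3_change U (Z : S -> R3) i j p : is_open U -> smooth3 U Z -> U p -> dom i p -> dom j p ->
  dx3 i Z p = add3 (scal3 (Re (dz i (crd j) p)) (dx3 j Z p)) (scal3 (Im (dz i (crd j) p)) (dy3 j Z p)).
Proof.
intros HU (H1 & H2 & H3) Hp Hi Hj.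
apply R3_eq; [destruct (dx_change U _ i j p HU H1 Hp Hi Hj) as [E _] | destruct (dx_change U _ i j p HU H2 Hp Hi Hj) as [E _]
  | destruct (dx_change U _ i j p HU H3 Hp Hi Hj) as [E _]];
match type of E with ?a = _ => match goal with |- ?g = _ => change g with a end end; rewrite E;
unfold add3, scal3, dx3, dy3, X1, X2, X3; simpl; ring.
Qed.

(** ** Minimal surfaces in charts *)

(** Oriented conformality gives the rotation rule for [dZ] everywhere; zero mean curvature gives the
    one for [dN] where [Z] is immersed. Branch points being isolated, the latter extends to them by
    continuity. *)
Lemma minimal_conf_min U (Z N : S -> R3) : minimal U Z N -> forall i, conf_min (img i U) (lift i Z) (lift i N).
Proof.
intros ((HU & HZ & HN & H1 & Hort) & Hoc & Himm & Hmc) i.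
assert (SZ := proj1 (smooth3_sm3 U Z HU) HZ i). assert (SN := proj1 (smooth3_sm3 U N HU) HN i).
assert (HO := img_open i U HU).
assert (B : forall z, img i U z -> dot (lift i N z) (lift i N z) = 1 /\ dot (D3x (lift i Z) z) (lift i N z) = 0 /\
   D3y (lift i Z) z = cross (lift i N z) (D3x (lift i Z) z)).
{ intros z (A & E & D). specialize (H1 _ D). destruct (Hort _ i D A) as [O1 O2]. destruct (Hoc _ i D A) as (C1 & C2 & C3).
  unfold first_E, first_F, first_G in C1, C2. rewrite !dx3_D3x, !dy3_D3y, E in *.
  split; [exact H1|]. split; [exact O1|]. apply conformal_rotation; assumption. }
assert (W : forall z, img i U z -> immersed_at Z (par i z) ->
   D3y (lift i N) z = scal3 (-1) (cross (lift i N z) (D3x (lift i N) z))).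
{ intros z Hz Hi. destruct (B z Hz) as (B1 & B2 & B3). assert (Hz' := Hz). destruct Hz as (A & E & D).
  assert (Hx : dot (D3x (lift i Z) z) (D3x (lift i Z) z) <> 0).
  { intros X. apply (Hi i A). rewrite dx3_D3x, dy3_D3y, E, B3. apply dot_zero in X. rewrite X. apply R3_eq; unvec; ring. }
  apply (weingarten (img i U) HO (lift i Z)); try assumption.
  assert (M := Hmc _ i D A Hi). unfold mean_curvature in M.
  destruct (second_forms i U Z N _ HU D A) as (Ee & _ & Eg). rewrite E in Ee, Eg.
  change (N (par i z)) with (lift i N z) in Ee, Eg. rewrite <- Ee, <- Eg.
  destruct (Hoc _ i D A) as (C1 & C2 & _). rewrite <- C1, C2 in M.
  assert (Ex : first_E i Z (par i z) <> 0) by (unfold first_E; rewrite dx3_D3x, E; exact Hx).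
  set (q := first_E i Z (par i z)) in *. set (e := second_e i Z N (par i z)) in *. set (g := second_g i Z N (par i z)) in *.
  apply Rmult_eq_reg_r with (/ (2 * q)).
  - rewrite Rmult_0_l, <- M. field. exact Ex.
  - apply Rinv_neq_0_compat. lra. }
split; [exact SZ|]. split; [exact SN|]. intros z Hz. destruct (B z Hz) as (B1 & B2 & B3).
split; [exact B1|]. split; [exact B2|]. split; [exact B3|].
assert (Hz' := Hz). destruct Hz as (A & E & D).
assert (L : locC z (fun y => y <> z -> D3y (lift i N) y = scal3 (-1) (cross (lift i N y) (D3x (lift i N) y)))).
{ assert (K := Himm _ D i A). rewrite E in K.
  generalize (filter_and _ _ (HO z Hz') K). apply filter_imp. intros y (Y1 & Y2) Hy. apply W; [exact Y1|].
  apply Y2. intro F. apply Hy. destruct Y1 as (_ & Y & _). rewrite <- Y, F, E. reflexivity. }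
assert (SR := sm3_scal (img i U) HO (fun _ => -1) _ (sm_const _ HO (-1)) (sm3_cross (img i U) HO _ _ SN (sm3_D3x _ _ SN))).
destruct (sm3_cont _ _ z (sm3_D3y _ _ SN) Hz') as (c1 & c2 & c3). destruct (sm3_cont _ _ z SR Hz') as (d1 & d2 & d3).
assert (T : forall X : R3 -> R, contR (fun y => X (D3y (lift i N) y)) z -> contR (fun y => X (scal3 (-1) (cross (lift i N y) (D3x (lift i N) y)))) z ->
  X (D3y (lift i N) z) = X (scal3 (-1) (cross (lift i N z) (D3x (lift i N) z)))).
{ intros X c d. apply (cont_eq_dense _ _ z (fun y => y <> z) c d).
  - apply not_loc_neg. apply filter_forall. auto.
  - revert L. apply filter_imp. intros y Y Hy. rewrite (Y Hy). reflexivity. }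
apply R3_eq; apply T; assumption.
Qed.

Lemma conf_min_minimal U (Z N : S -> R3) : is_open U -> (forall i, conf_min (img i U) (lift i Z) (lift i N)) ->
  (forall p, U p -> near p (fun q => q <> p -> immersed_at Z q)) -> minimal U Z N.
Proof.
intros HU H Himm.
assert (P : forall p i, U p -> dom i p -> dot (N p) (N p) = 1 /\ dot (dx3 i Z p) (N p) = 0 /\
   dy3 i Z p = cross (N p) (dx3 i Z p)).
{ intros p i Hp Hi. destruct (proj2 (proj2 (H i)) _ (img_crd i U p Hp Hi)) as (A & B & D & _).
  rewrite (lift_crd i N p Hi) in A, B, D. auto. }
split; [|split; [|split]].
- split; [exact HU|]. split; [apply (smooth3_sm3 U Z HU); intros i; apply (H i)|].
  split; [apply (smooth3_sm3 U N HU); intros i; apply (H i)|]. split.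
  + intros p Hp. destruct (dom_cover p) as [i Hi]. apply (P p i Hp Hi).
  + intros p i Hp Hi. destruct (P p i Hp Hi) as (A & B & D). split; [exact B|]. rewrite D. apply dot_cross_l.
- intros p i Hp Hi. destruct (P p i Hp Hi) as (A & B & D). unfold first_E, first_F, first_G. rewrite D.
  destruct (rotation_conformal (N p) (dx3 i Z p) A B) as (R1 & R2 & R3' & R4 & R5). rewrite R5. auto.
- exact Himm.
- intros p i Hp Hi _. unfold mean_curvature.
  destruct (second_forms i U Z N p HU Hp Hi) as (Ee & _ & Eg).
  destruct (cm_forms (img i U) (img_open i U HU) _ _ (H i) _ (img_crd i U p Hp Hi)) as (S1 & _ & S3).
  rewrite (lift_crd i N p Hi) in S1, S3. rewrite Ee, Eg, S1, S3.
  destruct (P p i Hp Hi) as (A & B & D). unfold first_E, first_F, first_G. rewrite D.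
  destruct (rotation_conformal (N p) (dx3 i Z p) A B) as (R1 & R2 & R3' & R4 & R5). rewrite <- R2, R3'. unfold Rdiv. ring.
Qed.

(** Here [Z_x x Z_y = |Z_x|^2 N], so that [Z_x] alone detects immersion. *)
Lemma conf_immersed U (Z N : S -> R3) i p : is_open U -> conf_min (img i U) (lift i Z) (lift i N) -> U p -> dom i p ->
  (cross (dx3 i Z p) (dy3 i Z p) = (0, 0, 0) <-> dx3 i Z p = (0, 0, 0)).
Proof.
intros HU H Hp Hi. assert (Hz := img_crd i U p Hp Hi).
rewrite dx3_D3x, dy3_D3y, (cm_rot _ _ _ H _ Hz).
destruct (rotation_conformal _ _ (cm_unit _ _ _ H _ Hz) (cm_orth_x _ _ _ H _ Hz)) as (_ & _ & _ & E & _).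
rewrite E. split; intros F.
- apply dot_zero. apply (f_equal (dot (lift i N (crd i p)))) in F.
  replace (dot (lift i N (crd i p)) (scal3 (dot (D3x (lift i Z) (crd i p)) (D3x (lift i Z) (crd i p))) (lift i N (crd i p))))
    with (dot (D3x (lift i Z) (crd i p)) (D3x (lift i Z) (crd i p)) * dot (lift i N (crd i p)) (lift i N (crd i p))) in F by (unvec; ring).
  rewrite (cm_unit _ _ _ H _ Hz), Rmult_1_r in F. rewrite F. unvec; ring.
- rewrite F. apply R3_eq; unvec; ring.
Qed.

Lemma immersed_dx3 U (Z N : S -> R3) p : is_open U -> (forall i, conf_min (img i U) (lift i Z) (lift i N)) -> U p ->
  (immersed_at Z p <-> forall i, dom i p -> dx3 i Z p <> (0, 0, 0)).
Proof.
intros HU H Hp. split; intros K i Hi E; apply (K i Hi); apply (conf_immersed U Z N i p HU (H i) Hp Hi); exact E.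
Qed.

(** Through the rotation [J] the vanishing of one partial derivative entails that of the whole
    differential, which does not depend on the chart. *)
Lemma dx3_zero_change U (Z : S -> R3) (J : R3 -> R3) i j p : is_open U -> smooth3 U Z -> U p -> dom i p -> dom j p ->
  (J (0, 0, 0) = (0, 0, 0)) -> dy3 j Z p = J (dx3 j Z p) -> dx3 j Z p = (0, 0, 0) -> dx3 i Z p = (0, 0, 0).
Proof.
intros HU HZ Hp Hi Hj HJ HR H0. rewrite (dx3_change U Z i j p HU HZ Hp Hi Hj), HR, H0, HJ. apply R3_eq; unvec; ring.
Qed.

Lemma dx3_zero_N U (Z N : S -> R3) i j p : is_open U -> (forall i, conf_min (img i U) (lift i Z) (lift i N)) -> U p ->
  dom i p -> dom j p -> dx3 j N p = (0, 0, 0) -> dx3 i N p = (0, 0, 0).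
Proof.
intros HU H Hp Hi Hj. apply (dx3_zero_change U N (fun v => scal3 (-1) (cross (N p) v))); try assumption.
- apply (smooth3_sm3 U N HU). intros l; apply (H l).
- apply R3_eq; unvec; ring.
- assert (E := cm_wein _ _ _ (H j) _ (img_crd j U p Hp Hj)). rewrite (lift_crd j N p Hj) in E. exact E.
Qed.

(** The second fundamental form is trace free, so being proportional to the first forces it to be
    zero. *)
Lemma umbilic_iff U (Z N : S -> R3) p : is_open U -> (forall i, conf_min (img i U) (lift i Z) (lift i N)) -> U p ->
  immersed_at Z p -> (umbilic_at Z N p <-> forall i, dom i p -> dx3 i N p = (0, 0, 0)).
Proof.
intros HU H Hp Himm.
assert (K : forall i, dom i p -> (dx3 i N p = (0, 0, 0) -> second_e i Z N p = 0 /\ second_f i Z N p = 0 /\ second_g i Z N p = 0) /\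
   (second_e i Z N p = 0 -> second_f i Z N p = 0 -> dx3 i N p = (0, 0, 0)) /\
   first_E i Z p = first_G i Z p /\ first_F i Z p = 0 /\ first_E i Z p <> 0 /\ second_e i Z N p + second_g i Z N p = 0).
{ intros i Hi. assert (Hz := img_crd i U p Hp Hi).
  destruct (second_forms i U Z N p HU Hp Hi) as (Ee & Ef & Eg).
  destruct (cm_forms _ (img_open i U HU) _ _ (H i) _ Hz) as (S1 & S2 & S3).
  assert (Hx : D3x (lift i Z) (crd i p) <> (0, 0, 0)) by (apply (proj1 (immersed_dx3 U Z N p HU H Hp) Himm i Hi)).
  assert (Q := proj2 (hopf_zero_iff _ _ _ _ (img_open i U HU) (H i) Hz Hx)).
  rewrite (lift_crd i N p Hi) in S1, S2, S3, Q. rewrite <- Ee in S1, Q. rewrite <- Ef in S2, Q. rewrite <- Eg in S3.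
  split; [|split; [|split; [|split; [|split]]]].
  - intros E. rewrite dx3_D3x in E. rewrite E in S1, S2, S3. rewrite S1, S2, S3.
    unfold dot, X1, X2, X3; simpl. repeat split; ring.
  - exact Q.
  - unfold first_E, first_G. rewrite dx3_D3x, dy3_D3y, (cm_rot _ _ _ (H i) _ Hz).
    apply (rotation_conformal _ _ (cm_unit _ _ _ (H i) _ Hz) (cm_orth_x _ _ _ (H i) _ Hz)).
  - unfold first_F. rewrite dx3_D3x, dy3_D3y, (cm_rot _ _ _ (H i) _ Hz).
    apply (rotation_conformal _ _ (cm_unit _ _ _ (H i) _ Hz) (cm_orth_x _ _ _ (H i) _ Hz)).
  - unfold first_E. intro F. apply Hx, dot_zero, F.
  - lra. }
split.
- intros Hu i Hi. destruct (K i Hi) as (_ & K2 & K3 & K4 & K5 & K6). destruct (Hu i Hi) as (l & L1 & L2 & L3).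
  rewrite K4 in L2. rewrite <- K3 in L3.
  assert (l * first_E i Z p = 0) by lra.
  apply K2; lra.
- intros Hn i Hi. destruct (K i Hi) as (K1 & _ & K3 & K4 & _). destruct (K1 (Hn i Hi)) as (E1 & E2 & E3).
  exists 0. lra.
Qed.

(** ** Weierstrass data of a minimal surface *)

(** The first Weierstrass datum recovered from the surface, as the first isotropic coefficient minus
    [i] times the second. *)
Definition wform (Z : S -> R3) : form S := fun i p =>
  (cgrad (lift i (comp3 X1 Z)) (crd i p) - Ci * cgrad (lift i (comp3 X2 Z)) (crd i p))%C.

Lemma wform_holomorphic U (Z N : S -> R3) : is_open U -> (forall i, conf_min (img i U) (lift i Z) (lift i N)) ->
  holomorphic_form U (wform Z).
Proof.
intros HU H.
assert (HZ : smooth3 U Z) by (apply (smooth3_sm3 U Z HU); intros i; apply (H i)).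
split.
- intros p i Hp Hi. assert (Hz := img_crd i U p Hp Hi). assert (HO := img_open i U HU).
  assert (Hh : forall y, img i U y -> _) by exact (cm_harmonic _ HO _ _ (H i)).
  destruct (cm_smZ _ _ _ (H i)) as (S1 & S2 & _).
  assert (A := cgrad_cder (img i U) _ (crd i p) HO S1 (fun y Hy => f_equal X1 (Hh y Hy)) Hz).
  assert (B := cgrad_cder (img i U) _ (crd i p) HO S2 (fun y Hy => f_equal X2 (Hh y Hy)) Hz).
  eexists. apply cder_is_derive.
  apply cder_ext_loc with (2 := cder_minus _ _ _ _ _ A (cder_scal Ci _ _ _ B)).
  apply (loc_of_open _ HO); [exact Hz|]. intros y (Y1 & Y2 & _). unfold wform. rewrite Y2. reflexivity.
- intros p i j Hp Hi Hj. destruct HZ as (Z1 & Z2 & _).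
  destruct (dx_change U _ i j p HU Z1 Hp Hi Hj) as [A1 A2]. destruct (dx_change U _ i j p HU Z2 Hp Hi Hj) as [B1 B2].
  unfold wform, cgrad.
  change (Dx (lift i (comp3 X1 Z)) (crd i p)) with (dx i (comp3 X1 Z) p). change (Dy (lift i (comp3 X1 Z)) (crd i p)) with (dy i (comp3 X1 Z) p).
  change (Dx (lift i (comp3 X2 Z)) (crd i p)) with (dx i (comp3 X2 Z) p). change (Dy (lift i (comp3 X2 Z)) (crd i p)) with (dy i (comp3 X2 Z) p).
  change (Dx (lift j (comp3 X1 Z)) (crd j p)) with (dx j (comp3 X1 Z) p). change (Dy (lift j (comp3 X1 Z)) (crd j p)) with (dy j (comp3 X1 Z) p).
  change (Dx (lift j (comp3 X2 Z)) (crd j p)) with (dx j (comp3 X2 Z) p). change (Dy (lift j (comp3 X2 Z)) (crd j p)) with (dy j (comp3 X2 Z) p).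
  rewrite A1, A2, B1, B2. apply injective_projections; unfold Re, Im; simpl; ring.
Qed.

Lemma wform_weierstrass U (Z N : S -> R3) i p a : is_open U -> conf_min (img i U) (lift i Z) (lift i N) -> U p -> dom i p ->
  stereo (N p) = Some a ->
  real_part_form i p (comp3 X1 Z) (weierstrass1 (wform Z i p) a) /\
  real_part_form i p (comp3 X2 Z) (weierstrass2 (wform Z i p) a) /\
  real_part_form i p (comp3 X3 Z) (weierstrass3 (wform Z i p) a).
Proof.
intros HU H Hp Hi Ha. assert (Hz := img_crd i U p Hp Hi). apply stereo_some in Ha. destruct Ha as [N1 Ha].
assert (K1 := cm_unit _ _ _ H _ Hz). assert (K2 := cm_orth_x _ _ _ H _ Hz). assert (K3 := cm_rot _ _ _ H _ Hz).
rewrite (lift_crd i N p Hi) in K1, K2, K3.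
destruct (weierstrass_formula (N p) _ K1 N1 K2) as (W1 & W2 & W3).
rewrite <- K3, Ha in W1, W2, W3.
assert (F : forall (X : S -> R) (u v : R) c, ((u, - v) : C) = c -> dx i X p = u -> dy i X p = v -> real_part_form i p X c).
{ intros X u v c E E1 E2. subst c. split; simpl; lra. }
split; [|split].
- apply (F _ _ _ _ W1); reflexivity.
- apply (F _ _ _ _ W2); reflexivity.
- apply (F _ _ _ _ W3); reflexivity.
Qed.

Lemma hol_holomorphic_at i U (f : S -> C) (F : C -> C) p : is_open U -> U p -> dom i p ->
  hol (img i U) F -> (forall z, img i U z -> f (par i z) = F z) -> holomorphic_at f p.
Proof.
intros HU Hp Hi HF E j Hj.
assert (Hz := img_crd i U p Hp Hi). destruct (HF _ Hz) as [l Hl].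
destruct (transition_holomorphic Hj Hi) as [m Hm]. apply cder_is_derive in Hm.
exists (l * m)%C. apply cder_is_derive.
assert (Hl' : cder F (crd i (par j (crd j p))) l) by (rewrite (crdK Hj); exact Hl).
apply cder_ext_loc with (2 := cder_comp _ F _ _ _ Hm Hl').
generalize (filter_and _ _ (par_dom Hj Hi) (HU p Hp j Hj)). apply filter_imp.
intros z ((A & B & D) & G). rewrite <- E; [rewrite (crdK D); reflexivity|].
unfold img. rewrite (crdK D). auto.
Qed.

(** Off the north pole the coordinate is [stereo_north], at the north pole its reciprocal is
    [stereo_south]. The last hypothesis rules out a Gauss map that is infinite on an open set. *)
Lemma gauss_meromorphic U (Z N : S -> R3) : is_open U -> (forall i, conf_min (img i U) (lift i Z) (lift i N)) ->
  (forall p, U p -> ~ near p (fun q => stereo (N q) = infty)) -> meromorphic U (fun p => stereo (N p)).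
Proof.
intros HU H Hnc p Hp. destruct (dom_cover p) as [i Hi]. assert (Hz := img_crd i U p Hp Hi).
assert (cN : forall a, X3 (N p) <> a -> near p (fun q => X3 (N q) <> a)).
{ intros a Ha. apply (near_of_chart i); [exact Hi|].
  destruct (cm_smN _ _ _ (H i)) as (_ & _ & S3). assert (K := sm_cont _ _ _ S3 Hz).
  apply (contR_neq_loc _ _ a K). unfold lift. rewrite (crdK Hi). exact Ha. }
assert (Q : forall a (P : S -> Prop), X3 (N p) <> a ->
  (forall q, near q (fun r => U r /\ X3 (N r) <> a) -> P q) -> near p P).
{ intros a P Ha HP. apply near_imp with (1 := HP). apply near_near. apply near_and; [exact (HU p Hp) | exact (cN a Ha)]. }
assert (V : forall a q, near q (fun r => U r /\ X3 (N r) <> a) ->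
   let V := fun r => near r (fun s => U s /\ X3 (N s) <> a) in
   is_open V /\ V q /\ forall i, openC (img i V) /\ sm3 (img i V) (lift i N) /\
     (forall z, img i V z -> dot (lift i N z) (lift i N z) = 1) /\
     (forall z, img i V z -> D3y (lift i N) z = scal3 (-1) (cross (lift i N z) (D3x (lift i N) z))) /\
     (forall z, img i V z -> X3 (lift i N z) <> a)).
{ intros a q Hq V. assert (HV : is_open V) by (apply (near_open q), Hq).
  split; [exact HV|]. split; [exact Hq|]. intros l.
  assert (Sub : forall z, img l V z -> img l U z /\ X3 (lift l N z) <> a).
  { intros z (A & B & D). apply near_self in D. destruct D. split; [split; auto|]. assumption. }
  split; [apply img_open, HV|]. destruct (H l) as ((A1 & A2 & A3) & (B1 & B2 & B3) & K).
  split; [split; [|split]; apply (sm_sub (img l U)); auto; intros z Hz'; apply (Sub z Hz')|].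
  split; [|split]; intros z Hz'; destruct (Sub z Hz') as [U1 U2]; [apply (K z U1) | apply (K z U1) | exact U2]. }
destruct (Req_dec (X3 (N p)) 1) as [E|E].
- right. split; [|apply Hnc, Hp].
  assert (unit : forall q, U q -> dot (N q) (N q) = 1).
  { intros q Hq. destruct (dom_cover q) as [l Hl]. assert (T := cm_unit _ _ _ (H l) _ (img_crd l U q Hq Hl)).
    rewrite (lift_crd l N q Hl) in T. exact T. }
  apply (Q (-1)); [lra|]. intros q Hq. assert (Hq0 := near_self _ _ Hq). destruct Hq0 as [Uq Nq].
  split; [rewrite (recip_stereo _ (unit q Uq) Nq); discriminate|].
  destruct (V (-1) q Hq) as (HV & Vq & K). destruct (dom_cover q) as [l Hl]. destruct (K l) as (K1 & K2 & K3 & K4 & K5).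
  apply (hol_holomorphic_at l _ _ (fun z => stereo_south (lift l N z)) q HV Vq Hl).
  + apply stereo_south_hol; assumption.
  + intros z (A & B & D). apply near_self in D. destruct D as [D1 D2]. unfold finpart. rewrite (recip_stereo _ (unit _ D1) D2). reflexivity.
- left. apply (Q 1); [exact E|]. intros q Hq. assert (Hq0 := near_self _ _ Hq). destruct Hq0 as [Uq Nq].
  split; [rewrite (stereo_north_eq _ Nq); discriminate|].
  destruct (V 1 q Hq) as (HV & Vq & K). destruct (dom_cover q) as [l Hl]. destruct (K l) as (K1 & K2 & K3 & K4 & K5).
  apply (hol_holomorphic_at l _ _ (fun z => stereo_north (lift l N z)) q HV Vq Hl).
  + apply stereo_north_hol; assumption.
  + intros z (A & B & D). apply near_self in D. destruct D as [D1 D2]. unfold finpart. rewrite (stereo_north_eq _ D2). reflexivity.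
Qed.

End Charts.

Arguments lift {S T} i f z.
Arguments img {S} i U z.
Arguments wform {S} Z i p.

(** * Periods *)

Lemma RC_continuous_comp (f : C -> C) (x y : R -> R) (t : R) :
  cont f (x t, y t) -> continuous x t -> continuous y t -> contRC (fun s => f (x s, y s)) t.
Proof.
intros Hf Hx Hy. apply (continuous_comp (U := R_UniformSpace) (V := C_UniformSpace) (fun s => (x s, y s)) f t); [|exact Hf].
apply cont_pair; assumption.
Qed.

Section Periods.
Variables (S : riemann_surface) (U : S -> Prop) (A B H : S -> C).
Hypothesis HU : is_open U.
Hypothesis HA : forall p, U p -> holomorphic_at A p.
Hypothesis HB : forall p, U p -> holomorphic_at B p.
Hypothesis HH : forall p, U p -> H p = (B p - A p)%C /\ H p <> 0%C.

Lemma hol_lift (f : S -> C) (i : chart S) : (forall p, U p -> holomorphic_at f p) -> hol (img i U) (lift i f).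
Proof.
intros Hf z (D & E & Uz). destruct (Hf _ Uz i D) as [l Hl]. apply cder_is_derive in Hl. rewrite E in Hl. exists l; exact Hl.
Qed.

Definition log_form (f : S -> C) (c : R -> S) (t : R) : R :=
  Re (Cdiv (Derive (fun s => Re (f (c s))) t, Derive (fun s => Im (f (c s))) t) (H (c t))).

Lemma piece_integral (c : R -> S) (i : chart S) (x y : R -> R) (a b : R) : a < b ->
  (forall t, ex_derive x t /\ continuous (Derive x) t) ->
  (forall t, ex_derive y t /\ continuous (Derive y) t) ->
  (forall t, a <= t <= b -> U (c t) /\ dom i (c t) /\ crd i (c t) = (x t, y t)) ->
  is_RInt (fun t => log_form B c t - log_form A c t) a b
    (/ 2 * ln (nsq (H (c b))) - / 2 * ln (nsq (H (c a)))).
Proof.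
intros Hab Hx Hy Hc.
assert (HO := img_open S i U HU).
assert (holA := hol_lift A i HA). assert (holB := hol_lift B i HB).
set (F := fun z => (lift i B z - lift i A z)%C).
assert (holF : hol (img i U) F).
{ intros z Hz. destruct (holA z Hz) as [l L], (holB z Hz) as [m M]. eexists. apply cder_minus; eassumption. }
assert (In : forall t, a <= t <= b -> img i U (x t, y t) /\ par i (x t, y t) = c t).
{ intros t Ht. destruct (Hc t Ht) as (C1 & C2 & C3). rewrite <- C3. split; [apply img_crd; assumption | apply crdK, C2]. }
set (v := fun t => (Derive x t, Derive y t) : C).
assert (Hv : forall t, curve_der (fun s => (x s, y s)) t (v t)).
{ intros t. split; simpl; apply Derive_correct; [apply Hx | apply Hy]. }
set (L := fun t => / 2 * ln (nsq (F (x t, y t)))).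
set (F' := fun t => (C_derive F (x t, y t) * v t)%C).
set (dL := fun t => (Re (F (x t, y t)) * Re (F' t) + Im (F (x t, y t)) * Im (F' t)) / nsq (F (x t, y t))).
assert (EF : forall t, a <= t <= b -> F (x t, y t) = H (c t)).
{ intros t Ht. destruct (In t Ht) as [_ E]. unfold F, lift. rewrite E. symmetry. apply HH, Hc, Ht. }
assert (NF : forall t, a <= t <= b -> 0 < nsq (F (x t, y t))).
{ intros t Ht. destruct (Rle_lt_or_eq_dec _ _ (nsq_pos (F (x t, y t)))) as [P|P]; [exact P|].
  exfalso. symmetry in P. apply nsq_zero in P. rewrite (EF t Ht) in P. revert P. apply HH, Hc, Ht. }
assert (DF : forall t, a <= t <= b -> curve_der (fun s => F (x s, y s)) t (F' t)).
{ intros t Ht. apply (curve_comp F (fun s => (x s, y s))); [apply Hv|]. apply (hol_C_derive (img i U)); [exact holF | apply In, Ht]. }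
assert (I1 : is_RInt dL a b (L b - L a)).
{ apply (is_RInt_derive (V := R_CompleteNormedModule) L dL); rewrite Rmin_left, Rmax_right by lra; intros t Ht.
  - destruct (DF t Ht) as [D1 D2]. specialize (NF t Ht). unfold L, dL.
    set (u := fun s => Re (F (x s, y s))) in *. set (w := fun s => Im (F (x s, y s))) in *.
    assert (E1 : ex_derive u t) by (eexists; exact D1). assert (E2 : ex_derive w t) by (eexists; exact D2).
    assert (E1' : Derive u t = Re (F' t)) by (apply is_derive_unique; exact D1).
    assert (E2' : Derive w t = Im (F' t)) by (apply is_derive_unique; exact D2).
    change (nsq (F (x t, y t))) with (u t * u t + w t * w t) in *.
    change (Re (F (x t, y t))) with (u t). change (Im (F (x t, y t))) with (w t).
    apply (is_derive_ext (fun s => / 2 * ln (u s * u s + w s * w s))); [reflexivity|].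
    auto_derive; [split; [|split; [|split]]; auto|].
    change (Derive (fun x : R => u x) t) with (Derive u t). change (Derive (fun x : R => w x) t) with (Derive w t).
    rewrite E1', E2'. field. lra.
  - assert (CF : contRC (fun s => F (x s, y s)) t) by (eapply curve_der_cont, DF, Ht).
    assert (CF' : contRC F' t).
    { apply contc_mult; [|apply cont_pair; [apply Hx | apply Hy]].
      apply (RC_continuous_comp (C_derive F)).
      - apply (hol_cont (img i U)); [apply hol_derivative; assumption | apply In, Ht].
      - apply (ex_derive_continuous (V := R_NormedModule)), Hx.
      - apply (ex_derive_continuous (V := R_NormedModule)), Hy. }
    apply contr_div.
    + apply contr_plus; apply contr_mult; first [apply (cont_Re _ _ CF) | apply (cont_Re _ _ CF') | apply (cont_Im _ _ CF) | apply (cont_Im _ _ CF')].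
    + unfold nsq. apply contr_plus; apply contr_mult; first [apply (cont_Re _ _ CF) | apply (cont_Im _ _ CF)].
    + specialize (NF t Ht). lra. }
replace (/ 2 * ln (nsq (H (c b))) - / 2 * ln (nsq (H (c a)))) with (L b - L a)
  by (unfold L; rewrite !EF by lra; reflexivity).
apply (is_RInt_ext (V := R_NormedModule)) with (f := dL); [|exact I1].
rewrite Rmin_left, Rmax_right by lra. intros t Ht.
assert (Ht' : a <= t <= b) by lra. destruct (In t Ht') as [Hz Ez].
(* The curve agrees with its coordinate expression on [[a, b]] only, so its derivatives are computed
   at interior points, which suffices for the integral. *)
assert (Ec : locally t (fun s => par i (x s, y s) = c s)).
{ assert (P : 0 < Rmin (t - a) (b - t)) by (apply Rmin_glb_lt; lra).
  exists (mkposreal _ P). intros s Hs. apply In.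
  unfold ball in Hs; simpl in Hs; unfold AbsRing_ball, abs, minus, plus, opp in Hs; simpl in Hs.
  assert (M1 := Rmin_l (t - a) (b - t)). assert (M2 := Rmin_r (t - a) (b - t)). apply Rabs_def2 in Hs. lra. }
assert (Df : forall f : S -> C, hol (img i U) (lift i f) ->
  (Derive (fun s => Re (f (c s))) t, Derive (fun s => Im (f (c s))) t) = (C_derive (lift i f) (x t, y t) * v t)%C).
{ intros f Hf.
  assert (K := curve_comp (lift i f) _ t _ _ (Hv t) (hol_C_derive _ _ _ Hf Hz)). destruct K as [K1 K2].
  apply injective_projections; simpl fst; simpl snd; apply is_derive_unique.
  - apply is_derive_ext_loc with (2 := K1). revert Ec; apply filter_imp. intros s E. unfold lift. rewrite E. reflexivity.
  - apply is_derive_ext_loc with (2 := K2). revert Ec; apply filter_imp. intros s E. unfold lift. rewrite E. reflexivity. }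
unfold log_form. rewrite (Df A holA), (Df B holB), <- (EF t Ht').
assert (ED : C_derive F (x t, y t) = (C_derive (lift i B) (x t, y t) - C_derive (lift i A) (x t, y t))%C).
{ apply cder_C_derive, cder_minus; apply (hol_C_derive (img i U)); assumption. }
specialize (NF t Ht'). unfold dL, F'. rewrite ED.
set (p := C_derive (lift i A) (x t, y t)). set (q := C_derive (lift i B) (x t, y t)). set (f := F (x t, y t)) in *.
set (u := v t). destruct p as [p1 p2], q as [q1 q2], f as [f1 f2], u as [u1 u2].
unfold nsq, Re, Im in *; simpl in *. field. nra.
Qed.

Lemma loop_integral (c : R -> S) : loop U c ->
  is_RInt (fun t => log_form B c t - log_form A c t) 0 1 0.
Proof.
intros (Hc & HcU & n & a & Ha0 & Han & Hp).
assert (Mono : forall m k, (m + k <= n)%nat -> a m <= a (m + k)%nat).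
{ intros m k; induction k as [|k IH]; intros Hk; [rewrite Nat.add_0_r; lra|].
  rewrite Nat.add_succ_r in *. destruct (Hp (m + k)%nat ltac:(lia)) as [L _]. specialize (IH ltac:(lia)). lra. }
assert (Rng : forall m, (m <= n)%nat -> 0 <= a m <= 1).
{ intros m Hm. split.
  - rewrite <- Ha0. apply (Mono 0%nat m). lia.
  - rewrite <- Han. replace n with (m + (n - m))%nat by lia. apply Mono. lia. }
assert (K : forall m, (m <= n)%nat -> is_RInt (fun t => log_form B c t - log_form A c t) 0 (a m)
   (/ 2 * ln (nsq (H (c (a m)))) - / 2 * ln (nsq (H (c 0))))).
{ induction m as [|m IH]; intros Hm.
  - rewrite Ha0, Rminus_diag. apply (is_RInt_point (V := R_NormedModule)).
  - destruct (Hp m ltac:(lia)) as (L & i & x & y & Hx & Hy & Hxy).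
    assert (P := piece_integral c i x y _ _ L Hx Hy).
    assert (Hr := Rng m ltac:(lia)). assert (Hr' := Rng (Datatypes.S m) Hm).
    assert (Q := is_RInt_Chasles (V := R_NormedModule) _ _ _ _ _ _ (IH ltac:(lia))
      (P (fun t Ht => conj (HcU t ltac:(lra)) (Hxy t Ht)))).
    unfold plus in Q; simpl in Q.
    match type of Q with is_RInt _ _ _ ?l => match goal with |- is_RInt _ _ _ ?r => replace r with l by ring end end.
    exact Q. }
specialize (K n (Nat.le_refl n)). rewrite Han, <- Hc, Rminus_diag in K. exact K.
Qed.

(** [dB / H - dA / H = dH / H] has the exact real part [d log |H|]. *)
Lemma period_equiv (c : R -> S) : loop U c -> (zero_real_period A H c <-> zero_real_period B H c).
Proof.
intros Hc. assert (D := loop_integral c Hc). split; intros K.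
- assert (Q := is_RInt_plus (V := R_NormedModule) _ _ _ _ _ _ K D). unfold plus in Q; simpl in Q.
  rewrite Rplus_0_r in Q. apply (is_RInt_ext (V := R_NormedModule)) with (2 := Q). intros t _. unfold log_form. simpl. ring.
- assert (Q := is_RInt_minus (V := R_NormedModule) _ _ _ _ _ _ K D). unfold minus, plus, opp in Q; simpl in Q.
  replace (0 + - 0) with 0 in Q by ring. apply (is_RInt_ext (V := R_NormedModule)) with (2 := Q). intros t _. unfold log_form. simpl. ring.
Qed.
End Periods.

Lemma zero_real_period_ext (S : riemann_surface) (A A' B B' : S -> C) (c : R -> S) :
  c 0 = c 1 ->
  (forall p, A p = A' p) -> (forall t, 0 <= t <= 1 -> B (c t) = B' (c t)) -> zero_real_period A B c -> zero_real_period A' B' c.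
Proof.
intros _ EA EB H. apply (is_RInt_ext (V := R_NormedModule)) with (2 := H). rewrite Rmin_left, Rmax_right by lra.
intros t Ht. rewrite EB by lra. f_equal. f_equal. f_equal; apply Derive_ext; intros; rewrite EA; reflexivity.
Qed.

(** * Pairs of minimal surfaces enveloping a congruence of spheres *)

Definition ndiff (m m' : R3) : R3 := add3 m (scal3 (-1) m').

Lemma ndiff_facts (m m' : R3) : dot m m = 1 -> dot m' m' = 1 ->
  dot (ndiff m m') m' = - (dot (ndiff m m') (ndiff m m') / 2) /\
  dot (ndiff m m') m = dot (ndiff m m') (ndiff m m') / 2 /\
  dot (ndiff m m') (ndiff m m') = 2 * (1 - dot m m').
Proof.
intros H H'.
assert (E : dot (ndiff m m') (ndiff m m') = dot m m - 2 * dot m m' + dot m' m') by (unfold ndiff; unvec; ring).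
assert (E1 : dot (ndiff m m') m' = dot m m' - dot m' m') by (unfold ndiff; unvec; ring).
assert (E2 : dot (ndiff m m') m = dot m m - dot m m') by (unfold ndiff; unvec; ring).
rewrite H, H' in *. lra.
Qed.

Lemma ndiff_neq (m m' : R3) : dot m m = 1 -> dot m' m' = 1 -> m <> m' -> dot (ndiff m m') (ndiff m m') <> 0.
Proof.
intros H H' N E. apply N. apply dot_zero in E. unfold ndiff in E.
apply R3_eq; [apply (f_equal X1) in E | apply (f_equal X2) in E | apply (f_equal X3) in E];
  unfold add3, scal3, X1, X2, X3 in *; simpl fst in *; simpl snd in *; lra.
Qed.

Lemma refl_orth (m m' v : R3) : dot m m = 1 -> dot m' m' = 1 -> dot (ndiff m m') (ndiff m m') <> 0 ->
  dot v m = 0 -> dot (refl (ndiff m m') v) m' = 0.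
Proof.
intros H H' N E. rewrite <- (refl_normal m m' H H' N) at 2. fold (ndiff m m'). rewrite refl_dot; assumption.
Qed.

(** Pairing with [m'] determines the only multiple of [n] that moves [a] from the plane orthogonal
    to [m] into the one orthogonal to [m'], and the reflection does just that. *)
Lemma refl_unique (m m' a : R3) (s : R) : dot m m = 1 -> dot m' m' = 1 ->
  let n := ndiff m m' in dot n n <> 0 ->
  dot a m = 0 -> dot (add3 a (scal3 s n)) m' = 0 ->
  add3 a (scal3 s n) = refl n a /\ s * dot n n = - 2 * dot a n.
Proof.
intros H H' n Hn Ha Hs. destruct (ndiff_facts m m' H H') as (F1 & F2 & _). fold n in F1, F2.
assert (E1 : dot a m' + s * dot n m' = 0) by (rewrite <- Hs; unvec; ring).
assert (E2 : dot a n = dot a m - dot a m') by (unfold n, ndiff; unvec; ring).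
assert (E : s * dot n n = - 2 * dot a n) by (rewrite F1 in E1; lra).
split; [|exact E]. unfold refl. f_equal. f_equal.
apply Rmult_eq_reg_r with (dot n n); [|exact Hn]. rewrite E. field. exact Hn.
Qed.

Lemma cross_orth_zero (n v : R3) : dot n n = 1 -> dot v n = 0 -> cross n v = (0, 0, 0) -> v = (0, 0, 0).
Proof.
intros Hn Hv E. apply dot_zero.
assert (L := dot_cross_cross n v n v). rewrite E, Hn, (dot_sym n v), Hv in L.
replace (dot (0, 0, 0) (0, 0, 0)) with 0 in L by (unvec; ring). lra.
Qed.

Lemma scal3_cancel (a : R) (u v : R3) : a <> 0 -> scal3 a u = scal3 a v -> u = v.
Proof.
intros Ha E. apply R3_eq; [apply (f_equal X1) in E | apply (f_equal X2) in E | apply (f_equal X3) in E];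
  unfold scal3, X1, X2, X3 in E |- *; simpl fst in *; simpl snd in *; apply Rmult_eq_reg_l with a; assumption.
Qed.

Section Congruence.
Variables (O : C -> Prop) (Z N Zt Nt : C -> R3) (T : C -> R).
Hypothesis HO : openC O.
Hypothesis SZ : sm3 O Z.
Hypothesis SN : sm3 O N.
Hypothesis SNt : sm3 O Nt.
Hypothesis HT : sm O T.
Hypothesis HE : forall y, O y -> Zt y = add3 (Z y) (scal3 (T y) (ndiff (N y) (Nt y))).
Let n (y : C) : R3 := ndiff (N y) (Nt y).

Lemma ndiff_sm : sm3 O n.
Proof.
unfold n, ndiff. apply sm3_add; [exact HO | exact SN|].
apply (sm3_scal O HO (fun _ => -1)); [apply sm_const, HO | exact SNt].
Qed.

Lemma ndiff_derivatives (z : C) : O z -> D3x n z = ndiff (D3x N z) (D3x Nt z) /\ D3y n z = ndiff (D3y N z) (D3y Nt z).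
Proof.
intros Hz.
assert (S3 : sm3 O (fun y => scal3 (-1) (Nt y))) by (apply (sm3_scal O HO (fun _ => -1)); [apply sm_const, HO | exact SNt]).
unfold n, ndiff. rewrite (D3x_add O N (fun y => scal3 (-1) (Nt y))), (D3y_add O N (fun y => scal3 (-1) (Nt y))) by assumption.
rewrite (D3x_scal_const O HO), (D3y_scal_const O HO) by assumption. split; reflexivity.
Qed.

Lemma congruence_derivatives (z : C) : O z ->
  D3x Zt z = add3 (D3x Z z) (add3 (scal3 (Dx T z) (n z)) (scal3 (T z) (ndiff (D3x N z) (D3x Nt z)))) /\
  D3y Zt z = add3 (D3y Z z) (add3 (scal3 (Dy T z) (n z)) (scal3 (T z) (ndiff (D3y N z) (D3y Nt z)))).
Proof.
intros Hz. assert (S2 := ndiff_sm).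
assert (S3 : sm3 O (fun y => scal3 (T y) (n y))) by (apply (sm3_scal O HO T); assumption).
destruct (ndiff_derivatives z Hz) as [E1 E2].
assert (L : locC z (fun y => Zt y = add3 (Z y) (scal3 (T y) (n y)))) by (apply (loc_of_open O HO); assumption).
rewrite (D3x_ext_loc _ _ _ L), (D3y_ext_loc _ _ _ L).
rewrite (D3x_add O Z (fun y => scal3 (T y) (n y))), (D3y_add O Z (fun y => scal3 (T y) (n y))) by assumption.
rewrite (D3x_scal O T n), (D3y_scal O T n), E1, E2 by assumption. split; reflexivity.
Qed.

Lemma power_derivatives (z : C) : O z ->
  Dx (fun y => T y * dot (n y) (n y)) z = Dx T z * dot (n z) (n z) + 2 * T z * dot (n z) (ndiff (D3x N z) (D3x Nt z)) /\
  Dy (fun y => T y * dot (n y) (n y)) z = Dy T z * dot (n z) (n z) + 2 * T z * dot (n z) (ndiff (D3y N z) (D3y Nt z)).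
Proof.
intros Hz. assert (S2 := ndiff_sm). destruct (ndiff_derivatives z Hz) as [E1 E2].
rewrite (Dx_mult O T (fun y => dot (n y) (n y))), (Dx_dot O HO), (Dy_mult O T (fun y => dot (n y) (n y))), (Dy_dot O HO)
  by (try assumption; apply sm_dot; assumption).
rewrite E1, E2, (dot_sym (ndiff (D3x N z) (D3x Nt z))), (dot_sym (ndiff (D3y N z) (D3y Nt z))). split; ring.
Qed.
End Congruence.

Section Envelope.
Variables (O : C -> Prop) (Z N Zt Nt : C -> R3) (T : C -> R).
Hypothesis HO : openC O.
Hypothesis H : conf_min O Z N.
Hypothesis Ht : conf_min O Zt Nt.
Let n (y : C) : R3 := ndiff (N y) (Nt y).
Hypothesis Hn : forall y, O y -> dot (n y) (n y) <> 0.
Hypothesis HT : sm O T.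
Hypothesis HE : forall y, O y -> Zt y = add3 (Z y) (scal3 (T y) (n y)).

(** The reflection reverses the orientation, and the rotation by a right angle commutes with
    [dZ] and anticommutes with [dN]; this splits the contact condition into two equations. *)
Theorem envelope (z : C) : O z ->
  D3x Zt z = scal3 (T z) (refl (n z) (D3x N z)) /\
  refl (n z) (D3x Z z) = scal3 (T z) (D3x Nt z) /\
  Dx (fun y => T y * dot (n y) (n y)) z = 0 /\ Dy (fun y => T y * dot (n y) (n y)) z = 0.
Proof.
intros Hz.
assert (Hm := cm_unit _ _ _ H z Hz). assert (Hm' := cm_unit _ _ _ Ht z Hz). assert (Hnz := Hn z Hz).
assert (Zx := cm_orth_x _ _ _ H z Hz). assert (Zy := cm_orth_y _ _ _ H z Hz). assert (Nx := cm_N_orth _ HO _ _ H z Hz).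
assert (Zx' := cm_orth_x _ _ _ Ht z Hz). assert (Zy' := cm_orth_y _ _ _ Ht z Hz). assert (Nx' := cm_N_orth _ HO _ _ Ht z Hz).
destruct (normal_derivative O HO N z (cm_smN _ _ _ H) (cm_unit _ _ _ H) Hz) as [_ Ny].
destruct (normal_derivative O HO Nt z (cm_smN _ _ _ Ht) (cm_unit _ _ _ Ht) Hz) as [_ Ny'].
assert (RZ := cm_rot _ _ _ H z Hz). assert (RZ' := cm_rot _ _ _ Ht z Hz).
assert (RN := cm_wein _ _ _ H z Hz). assert (RN' := cm_wein _ _ _ Ht z Hz).
destruct (congruence_derivatives O Z N Zt Nt T HO (cm_smZ _ _ _ H) (cm_smN _ _ _ H) (cm_smN _ _ _ Ht) HT HE z Hz) as [Ex Ey].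
destruct (power_derivatives O N Nt T HO (cm_smN _ _ _ H) (cm_smN _ _ _ Ht) HT z Hz) as [Rx Ry].
unfold n. rewrite Rx, Ry. clear Rx Ry.
unfold n in *. set (m := N z) in *. set (m' := Nt z) in *. set (k := ndiff m m') in *.
set (t := T z) in *. set (zx := D3x Z z) in *. set (zy := D3y Z z) in *. set (nx := D3x N z) in *. set (ny := D3y N z) in *.
set (zx' := D3x Zt z) in *. set (zy' := D3y Zt z) in *. set (nx' := D3x Nt z) in *. set (ny' := D3y Nt z) in *.
set (tx := Dx T z) in *. set (ty := Dy T z) in *.
set (a := add3 zx (scal3 t nx)). set (b := add3 zy (scal3 t ny)).
(* Two expressions for the derivative of the centre, [Z + T N = Zt + T Nt], from which [tx m'] has
   been subtracted. *)
assert (Ea : add3 a (scal3 tx k) = add3 zx' (scal3 t nx')) by (unfold a; rewrite Ex; unfold ndiff; apply R3_eq; unvec; ring).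
assert (Eb : add3 b (scal3 ty k) = add3 zy' (scal3 t ny')) by (unfold b; rewrite Ey; unfold ndiff; apply R3_eq; unvec; ring).
assert (Lin : forall u v w : R3, dot u w = 0 -> dot v w = 0 -> dot (add3 u (scal3 t v)) w = 0).
{ intros u v w A B. replace (dot (add3 u (scal3 t v)) w) with (dot u w + t * dot v w) by (unvec; ring). rewrite A, B. ring. }
destruct (refl_unique m m' a tx Hm Hm' Hnz) as [A1 A2]; [apply Lin; assumption | fold k; rewrite Ea; apply Lin; assumption |].
destruct (refl_unique m m' b ty Hm Hm' Hnz) as [B1 B2]; [apply Lin; assumption | fold k; rewrite Eb; apply Lin; assumption |].
fold k in A1, A2, B1, B2. rewrite Ea in A1. rewrite Eb in B1.
assert (Lr : forall u v, refl k (add3 u (scal3 t v)) = add3 (refl k u) (scal3 t (refl k v))).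
{ intros u v. assert (E := refl_linear k u v 1 t).
  replace (scal3 1 u) with u in E by (apply R3_eq; unvec; ring).
  replace (scal3 1 (refl k u)) with (refl k u) in E by (apply R3_eq; unvec; ring). exact E. }
unfold a in A1. rewrite Lr in A1. unfold b in B1. rewrite Lr in B1.
assert (Rm : refl k m = m') by (apply (refl_normal m m'); assumption).
assert (Jz : refl k zy = scal3 (-1) (cross m' (refl k zx))) by (rewrite RZ, refl_cross, Rm by exact Hnz; reflexivity).
assert (Jn : refl k ny = cross m' (refl k nx)).
{ rewrite RN, refl_scal, refl_cross, Rm by exact Hnz. apply R3_eq; unvec; ring. }
assert (Ox : dot (refl k zx) m' = 0) by (apply (refl_orth m m'); assumption).
assert (On : dot (refl k nx) m' = 0) by (apply (refl_orth m m'); assumption).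
rewrite Jz, Jn, RZ', RN' in B1.
(* [B1] says that the cross product of [m'] with this tangent vector is zero. Adding [V] to [A1] and
   subtracting it yields the two separate equations. *)
assert (V : add3 (add3 (refl k zx) (scal3 (- t) (refl k nx))) (add3 zx' (scal3 (- t) nx')) = (0, 0, 0)).
{ apply (cross_orth_zero m'); [exact Hm' | |].
  - replace (dot (add3 (add3 (refl k zx) (scal3 (- t) (refl k nx))) (add3 zx' (scal3 (- t) nx'))) m')
      with (dot (refl k zx) m' - t * dot (refl k nx) m' + (dot zx' m' - t * dot nx' m')) by (unvec; ring).
    rewrite Ox, On, Zx', Nx'. ring.
  - apply R3_eq; [apply (f_equal X1) in B1 | apply (f_equal X2) in B1 | apply (f_equal X3) in B1];
      unfold add3, scal3, cross, X1, X2, X3 in B1 |- *; simpl fst in *; simpl snd in *; lra. }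
assert (G1 : refl k zx = scal3 t nx').
{ apply R3_eq; [apply (f_equal X1) in A1; apply (f_equal X1) in V | apply (f_equal X2) in A1; apply (f_equal X2) in V
   | apply (f_equal X3) in A1; apply (f_equal X3) in V];
  unfold add3, scal3, X1, X2, X3 in A1, V |- *; simpl fst in *; simpl snd in *; lra. }
assert (G2 : zx' = scal3 t (refl k nx)).
{ apply R3_eq; [apply (f_equal X1) in A1; apply (f_equal X1) in V | apply (f_equal X2) in A1; apply (f_equal X2) in V
   | apply (f_equal X3) in A1; apply (f_equal X3) in V];
  unfold add3, scal3, X1, X2, X3 in A1, V |- *; simpl fst in *; simpl snd in *; lra. }
assert (G3 : refl k zy = scal3 t ny').
{ rewrite Jz, G1, RN'. apply R3_eq; unvec; ring. }
split; [exact G2|]. split; [exact G1|].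
(* Paired with the axis, the mirrored equations express [dNt] by [dZ]; with [A2] and [B2] for [dT],
   the derivatives of [T |n|^2] cancel. *)
assert (Q1 := refl_axis k zx Hnz). rewrite G1 in Q1. assert (Q2 := refl_axis k zy Hnz). rewrite G3 in Q2.
split.
- rewrite A2. unfold a.
  replace (dot k (ndiff nx nx')) with (dot nx k - dot nx' k) by (unfold ndiff; unvec; ring).
  replace (dot (add3 zx (scal3 t nx)) k) with (dot zx k + t * dot nx k) by (unvec; ring).
  replace (dot (scal3 t nx') k) with (t * dot nx' k) in Q1 by (unvec; ring). lra.
- rewrite B2. unfold b.
  replace (dot k (ndiff ny ny')) with (dot ny k - dot ny' k) by (unfold ndiff; unvec; ring).
  replace (dot (add3 zy (scal3 t ny)) k) with (dot zy k + t * dot ny k) by (unvec; ring).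
  replace (dot (scal3 t ny') k) with (t * dot ny' k) in Q2 by (unvec; ring). lra.
Qed.
End Envelope.

(** A reflection ignores the sign of its axis, so identities for the pair may be read with the two
    surfaces exchanged. *)
Lemma ndiff_swap (m m' v : R3) : refl (ndiff m' m) v = refl (ndiff m m') v /\
  dot (ndiff m' m) (ndiff m' m) = dot (ndiff m m') (ndiff m m').
Proof.
assert (E : ndiff m' m = scal3 (-1) (ndiff m m')) by (unfold ndiff; apply R3_eq; unvec; ring).
assert (D : dot (ndiff m' m) (ndiff m' m) = dot (ndiff m m') (ndiff m m')) by (unfold ndiff; unvec; ring).
split; [|exact D]. unfold refl. rewrite D, E.
set (k := ndiff m m'). unfold Rdiv. set (q := / dot k k). apply R3_eq; unvec; ring.
Qed.

Lemma refl_zero (n : R3) : refl n (0, 0, 0) = (0, 0, 0).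
Proof. unfold refl. apply R3_eq; unvec; unfold Rdiv; ring. Qed.

(** The factor [- dot n n] of [refl_isotropic] equals [1 / (k * t)]; the coefficients are then
    compared by the injectivity of [sphere_der b]. *)
Lemma pair_identity (a b v w : C) (t k : R) : a <> b -> k <> 0 ->
  let n := ndiff (sphere_pt a) (sphere_pt b) in
  t * dot n n = - / k -> refl n (isotropic_re a w) = scal3 t (sphere_der b v) ->
  v = (RtoC k * ((b - a) * (b - a)) * w)%C.
Proof.
intros Hab Hk n Ht E. apply (sphere_der_inj b).
replace (RtoC k * ((b - a) * (b - a)) * w)%C with (RtoC k * ((b - a) * (b - a) * w))%C by cring.
rewrite sphere_der_scal, (refl_isotropic a b w Hab). fold (ndiff (sphere_pt a) (sphere_pt b)). fold n. rewrite E.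
set (d := dot n n) in *. set (u := sphere_der b v).
assert (K : k * (- d) * t = 1) by (replace (k * - d * t) with (- k * (t * d)) by ring; rewrite Ht; field; exact Hk).
clearbody d u.
symmetry. transitivity (scal3 (k * - d * t) u); [apply R3_eq; unvec; ring|].
rewrite K. apply R3_eq; unvec; ring.
Qed.

(** * Meromorphic functions and Gauss maps on the surface *)

Section Meromorphic.
Variable S : riemann_surface.
Implicit Types (p q : S) (i j : chart S) (U : S -> Prop) (g : S -> Chat).

Lemma holomorphic_near_neq (f : S -> C) p (a : C) : holomorphic_at f p -> f p <> a -> near p (fun q => f q <> a).
Proof.
intros H N. destruct (dom_cover p) as [i Hi]. destruct (H i Hi) as [l Hl]. apply cder_is_derive, cder_cont in Hl.
apply (near_of_chart S i); [exact Hi|].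
assert (K := Cmod_neq0_loc (fun z => f (par i z) - a)%C (crd i p) (contc_minus _ _ _ Hl (continuous_const _ _))).
cbv beta in K. rewrite (crdK Hi) in K. specialize (K (Cminus_neq _ _ N)).
revert K; apply filter_imp. intros z Hz E. apply Hz. rewrite E. cring.
Qed.

Lemma holomorphic_at_inv (f f' : S -> C) p : holomorphic_at f p -> f p <> 0%C -> near p (fun q => f' q = (/ f q)%C) -> holomorphic_at f' p.
Proof.
intros H N E i Hi. destruct (H i Hi) as [l Hl]. apply cder_is_derive in Hl.
eexists. apply cder_is_derive.
apply cder_ext_loc with (f := fun z => (/ f (par i z))%C).
- generalize (E i Hi). apply filter_imp. intros z K. symmetry; exact K.
- apply cder_inv; [exact Hl|]. rewrite (crdK Hi). exact N.
Qed.

Lemma recip_some (w : Chat) (b : C) : recip w = Some b -> b <> 0%C -> w = Some (/ b)%C.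
Proof.
destruct w as [a|]; simpl.
- destruct (Ceq_dec a (RtoC 0)) as [E|E]; [discriminate|]. intros H _; injection H as H. subst b.
  f_equal. symmetry. apply Cinv_unique, Cinv_l, E.
- intros H N. injection H as H. subst b. contradiction.
Qed.

(** If the alternative with the reciprocal is the one that holds, that reciprocal does not vanish at
    [p] and can be inverted back. *)
Lemma mero_finite U g p : meromorphic U g -> U p -> g p <> infty ->
  near p (fun q => g q <> infty /\ holomorphic_at (finpart g) q).
Proof.
intros H Hp Ha. destruct (H p Hp) as [A|[A _]]; [exact A|].
set (r := finpart (fun q => recip (g q))) in *.
assert (A0 := near_self _ _ _ A). destruct A0 as [A1 A2].
assert (R0 : r p <> 0%C).
{ unfold r, finpart. destruct (g p) as [a|]; [|exfalso; apply Ha; reflexivity]. simpl in A1 |- *.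
  destruct (Ceq_dec a (RtoC 0)); [exfalso; apply A1; reflexivity|]. simpl. apply Cinv_neq_0; assumption. }
assert (B := near_and _ _ _ _ A (holomorphic_near_neq r p 0%C A2 R0)).
apply near_imp with (2 := near_near _ _ _ B). intros q Hq. assert (Hq0 := near_self _ _ _ Hq). destruct Hq0 as ((B1 & B2) & B3).
assert (K : forall s, recip (g s) <> infty -> r s <> 0%C -> g s = Some (/ r s)%C).
{ intros s S1 S2. unfold r, finpart in *. destruct (recip (g s)) as [b|] eqn:E; [|exfalso; apply S1; reflexivity].
  simpl in *. apply recip_some; assumption. }
split; [rewrite (K q B1 B3); discriminate|].
apply (holomorphic_at_inv r); [exact B2 | exact B3|].
apply near_imp with (2 := Hq). intros s ((S1 & S2) & S3). unfold finpart. rewrite (K s S1 S3). reflexivity.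
Qed.

Lemma mero_pole U g p : meromorphic U g -> U p -> g p = infty ->
  near p (fun q => recip (g q) <> infty /\ holomorphic_at (finpart (fun r => recip (g r))) q) /\ ~ near p (fun q => g q = infty).
Proof.
intros H Hp Ha. destruct (H p Hp) as [A|A]; [|exact A].
apply near_self in A. destruct A as [A _]. contradiction.
Qed.

Lemma finite_normal (N : S -> R3) g p i a : near p (fun q => N q = sphere_of (g q)) -> g p = Some a ->
  near p (fun q => g q <> infty) -> holomorphic_at (finpart g) p -> dom i p ->
  dx3 i N p = sphere_der a (dz i (finpart g) p) /\ dy3 i N p = sphere_der a (Ci * dz i (finpart g) p)%C.
Proof.
intros HN Ha Hf Hh Hi. destruct (Hh i Hi) as [l Hl]. apply cder_is_derive in Hl.
assert (El : dz i (finpart g) p = l) by (apply cder_C_derive, Hl). rewrite El.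
destruct (sphere_cder _ _ _ Hl) as [E1 E2].
assert (Ea : finpart g (par i (crd i p)) = a) by (rewrite (crdK Hi); unfold finpart; rewrite Ha; reflexivity).
rewrite Ea in E1, E2. rewrite <- E1, <- E2, dx3_D3x, dy3_D3y.
assert (L : locC (crd i p) (fun z => lift i N z = sphere_pt (finpart g (par i z)))).
{ generalize (near_and _ _ _ _ HN Hf i Hi). apply filter_imp. intros z (A & B). unfold lift. rewrite A. unfold finpart.
  destruct (g (par i z)); [reflexivity | exfalso; apply B; reflexivity]. }
split; [apply D3x_ext_loc, L | apply D3y_ext_loc, L].
Qed.

Lemma dx3_isotropic U (Z N : S -> R3) i p a : is_open U -> conf_min (img i U) (lift i Z) (lift i N) -> U p -> dom i p ->
  stereo (N p) = Some a -> dx3 i Z p = isotropic_re a (wform Z i p).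
Proof.
intros HU H Hp Hi Ha. destruct (wform_weierstrass S U Z N i p a HU H Hp Hi Ha) as ((A & _) & (B & _) & (D & _)).
unfold isotropic_re. rewrite <- A, <- B, <- D. reflexivity.
Qed.

Lemma unit_on U (Z N : S -> R3) p : is_open U -> (forall i, conf_min (img i U) (lift i Z) (lift i N)) -> U p -> dot (N p) (N p) = 1.
Proof.
intros HU H Hp. destruct (dom_cover p) as [l Hl]. assert (T := cm_unit _ _ _ (H l) _ (img_crd S l U p Hp Hl)).
rewrite (lift_crd S l N p Hl) in T. exact T.
Qed.

Lemma punctured_near p (P : S -> Prop) : near p (fun q => q <> p -> P q) -> ~ near p (fun q => ~ P q).
Proof.
intros H K. destruct (dom_cover p) as [i Hi].
apply (not_loc_neg (crd i p) (fun z => P (par i z))); [|exact (K i Hi)].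
generalize (filter_and _ _ (dom_loc S i p Hi) (H i Hi)). apply filter_imp. intros z ((A & B) & D) Hz. apply D.
intro E. apply Hz. rewrite <- B, E. reflexivity.
Qed.

(** A Gauss map equal to the north pole near [p] would have zero differential there. *)
Lemma not_locally_north U (Z N : S -> R3) p : is_open U -> (forall i, conf_min (img i U) (lift i Z) (lift i N)) -> U p ->
  near p (fun q => q <> p -> forall i, dom i q -> dx3 i N q <> (0, 0, 0)) -> ~ near p (fun q => stereo (N q) = infty).
Proof.
intros HU H Hp Hx K. apply (punctured_near p _ Hx).
apply near_imp with (2 := near_near _ _ _ (near_and _ _ _ _ (HU p Hp) K)). intros q Hq F.
destruct (dom_cover q) as [i Hi]. apply (F i Hi). rewrite dx3_D3x.
transitivity (D3x (fun _ : C => (0, 0, 1) : R3) (crd i q)).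
- apply D3x_ext_loc. generalize (Hq i Hi). apply filter_imp. intros z (A & B). unfold lift.
  apply unit_north; [apply (unit_on U Z N); assumption | apply stereo_infty, B].
- apply R3_eq; [exact (Dx_const 0 _) | exact (Dx_const 0 _) | exact (Dx_const 1 _)].
Qed.

(** ** From the pair to the Riccati equation *)

Section Converse.
Variables Z N Zt Nt : S -> R3.
Hypothesis HZ : minimal_immersion (@whole S) Z N.
Hypothesis HZt : minimal (@whole S) Zt Nt.
Hypothesis HP : ribaucour_integrable_pair (@whole S) Z N Zt Nt.

Let W := open_whole S.
Let cm : forall i, conf_min (img i (@whole S)) (lift i Z) (lift i N) := minimal_conf_min S _ Z N (proj1 HZ).
Let cmt : forall i, conf_min (img i (@whole S)) (lift i Zt) (lift i Nt) := minimal_conf_min S _ Zt Nt HZt.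

Lemma converse_N_unit p : dot (N p) (N p) = 1.
Proof. exact (unit_on _ Z N p W cm I). Qed.
Lemma converse_Nt_unit p : dot (Nt p) (Nt p) = 1.
Proof. exact (unit_on _ Zt Nt p W cmt I). Qed.

Lemma converse_normals_neq p : dot (ndiff (N p) (Nt p)) (ndiff (N p) (Nt p)) <> 0.
Proof. apply ndiff_neq; [apply converse_N_unit | apply converse_Nt_unit | apply (proj1 (proj2 (proj2 HP)) p I)]. Qed.

Lemma converse_envelope : exists tau : S -> R,
  (forall p i, dom i p -> dx3 i Zt p = scal3 (tau p) (refl (ndiff (N p) (Nt p)) (dx3 i N p)) /\
      refl (ndiff (N p) (Nt p)) (dx3 i Z p) = scal3 (tau p) (dx3 i Nt p)) /\
  exists k : R, k <> 0 /\ forall p, tau p * dot (ndiff (N p) (Nt p)) (ndiff (N p) (Nt p)) = - / k.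
Proof.
destruct HP as (_ & _ & _ & (tau & Htau) & _).
exists tau.
set (n := fun p => ndiff (N p) (Nt p)).
assert (E : forall p, Zt p = add3 (Z p) (scal3 (tau p) (n p))).
{ intros p. specialize (Htau p I). unfold n, ndiff.
  apply R3_eq; [apply (f_equal X1) in Htau | apply (f_equal X2) in Htau | apply (f_equal X3) in Htau];
    unfold add3, scal3, X1, X2, X3 in Htau |- *; simpl fst in *; simpl snd in *; lra. }
(* The radius comes as a bare function; solving [Zt - Z = tau n] for it shows that it is smooth. *)
assert (Et : forall p, tau p = dot (add3 (Zt p) (scal3 (-1) (Z p))) (n p) / dot (n p) (n p)).
{ intros p. rewrite E. replace (dot (add3 (add3 (Z p) (scal3 (tau p) (n p))) (scal3 (-1) (Z p))) (n p)) with (tau p * dot (n p) (n p)) by (unvec; ring).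
  field. apply converse_normals_neq. }
assert (ST : forall i, sm (img i (@whole S)) (lift i tau)).
{ intros i. assert (HO := img_open S i _ W).
  assert (Sn := ndiff_sm _ _ _ HO (cm_smN _ _ _ (cm i)) (cm_smN _ _ _ (cmt i))).
  apply sm_ext with (F := fun z => dot (add3 (lift i Zt z) (scal3 (-1) (lift i Z z))) (ndiff (lift i N z) (lift i Nt z)) / dot (ndiff (lift i N z) (lift i Nt z)) (ndiff (lift i N z) (lift i Nt z))).
  - exact HO.
  - intros z _. symmetry. apply Et.
  - apply (sm_div _ HO).
    + intros z _. apply converse_normals_neq.
    + apply sm_dot; [exact HO| |exact Sn]. apply sm3_add; [exact HO | apply (cm_smZ _ _ _ (cmt i))|].
      apply (sm3_scal _ HO (fun _ => -1)); [apply sm_const, HO | apply (cm_smZ _ _ _ (cm i))].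
    + apply sm_dot; assumption. }
assert (V : forall i z, img i (@whole S) z -> _) by
  exact (fun i => envelope _ (lift i Z) (lift i N) (lift i Zt) (lift i Nt) (lift i tau) (img_open S i _ W) (cm i) (cmt i)
    (fun y _ => converse_normals_neq (par i y)) (ST i) (fun y _ => E (par i y))).
split.
- intros p i Hi. destruct (V i _ (img_crd S i _ p I Hi)) as (V1 & V2 & _).
  rewrite !(lift_crd S i _ p Hi) in V1, V2. split; [exact V1 | exact V2].
- set (rho := fun p => tau p * dot (n p) (n p)).
  assert (Lc : forall p, near p (fun q => rho q = rho p)).
  { intros p. destruct (dom_cover p) as [i Hi]. apply (near_of_chart S i); [exact Hi|].
    assert (HO := img_open S i _ W).
    assert (Hz := img_crd S i (@whole S) p I Hi). destruct (openC_box _ _ HO Hz) as [r Hr].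
    assert (Srho : sm (img i (@whole S)) (lift i rho)).
    { assert (Sn := ndiff_sm _ _ _ HO (cm_smN _ _ _ (cm i)) (cm_smN _ _ _ (cmt i))).
      apply (sm_mult _ HO (lift i tau)); [apply ST | apply (sm_dot _ HO _ _ Sn Sn)]. }
    assert (K := zero_gradient_constant (lift i rho) (crd i p) r (cond_pos r)).
    rewrite (lift_crd S i rho p Hi) in K. apply K. intros w Hw. destruct (V i w (Hr w Hw)) as (_ & _ & V3 & V4).
    split.
    - change 0 with (0 : R_NormedModule). rewrite <- V3. apply (sm_Dx_derive _ _ _ Srho (Hr w Hw)).
    - change 0 with (0 : R_NormedModule). rewrite <- V4. apply (sm_Dy_derive _ _ _ Srho (Hr w Hw)). }
  destruct (inhabited_surface S) as [p0 _].
  assert (Gc : forall p, rho p = rho p0).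
  { apply (@connected_surface S (fun p => rho p = rho p0)).
    - intros p i Hp Hi. generalize (Lc p i Hi). apply filter_imp. intros z Hz. rewrite Hz. exact Hp.
    - intros p i Hp Hi. generalize (Lc p i Hi). apply filter_imp. intros z Hz. rewrite Hz. exact Hp.
    - exists p0. reflexivity. }
  (* A zero constant would give [tau = 0] at [p0], hence [R dZ = tau dNt = 0], against the immersion
     of [Z]. *)
  assert (R0 : rho p0 <> 0).
  { intro E0. unfold rho in E0. apply Rmult_integral in E0. destruct E0 as [E0|E0]; [|revert E0; apply converse_normals_neq].
    destruct (dom_cover p0) as [i Hi]. destruct (V i _ (img_crd S i _ p0 I Hi)) as (_ & V2 & _).
    rewrite !(lift_crd S i _ p0 Hi), E0 in V2.
    apply (proj1 (immersed_dx3 S _ Z N p0 W cm I) (proj2 HZ p0 I) i Hi). rewrite dx3_D3x.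
    rewrite <- (refl_invol (ndiff (N p0) (Nt p0)) (D3x (lift i Z) (crd i p0)) (converse_normals_neq p0)), V2.
    rewrite refl_scal. apply R3_eq; unvec; ring. }
  exists (- / rho p0). split.
  + apply Ropp_neq_0_compat, Rinv_neq_0_compat, R0.
  + intros p. change (rho p = - / (- / rho p0)). rewrite (Gc p). field. exact R0.
Qed.

Lemma converse : exists (w : form S) (g : S -> Chat) (k : R) (h gt : S -> Chat),
  riccati_setting Z N w g k h /\ meromorphic_sum g h gt /\ (forall p, Sigma_tilde g h gt p) /\
  has_transformed_data (@whole S) k g h gt Zt Nt.
Proof.
destruct converse_envelope as (tau & HV & k & Hk & Hrho).
set (g := fun p => stereo (N p)). set (gt := fun p => stereo (Nt p)).
(* The Gauss maps never coincide, so at most one of them is infinite at a point, and [h] then has a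
   genuine pole. *)
set (h := fun p => match g p, gt p with Some a, Some b => Some (b - a)%C | _, _ => infty end).
assert (Hgg : forall p, g p <> gt p).
{ intros p E. apply (proj1 (proj2 (proj2 HP)) p I). apply stereo_inj; [apply converse_N_unit | apply converse_Nt_unit | exact E]. }
(* Since [dZt = tau R dN], zeros of [dN] are branch points of [Zt], which are isolated. This
   excludes a locally infinite [g] as well as a totally umbilical [Z]. *)
assert (Nx : forall p, near p (fun q => q <> p -> forall i, dom i q -> dx3 i N q <> (0, 0, 0))).
{ intros p. apply near_imp with (2 := proj1 (proj2 (proj2 HZt)) p I). intros q Hq Hqp i Hi E.
  apply (proj1 (immersed_dx3 S _ Zt Nt q W cmt I) (Hq Hqp) i Hi). rewrite (proj1 (HV q i Hi)), E.
  rewrite refl_zero. apply R3_eq; unvec; ring. }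
assert (Ntx : forall p i, dom i p -> dx3 i Nt p <> (0, 0, 0)).
{ intros p i Hi E. apply (proj1 (immersed_dx3 S _ Z N p W cm I) (proj2 HZ p I) i Hi).
  rewrite <- (refl_invol (ndiff (N p) (Nt p)) (dx3 i Z p) (converse_normals_neq p)), (proj2 (HV p i Hi)), E, refl_scal.
  rewrite refl_zero. apply R3_eq; unvec; ring. }
assert (Mg : meromorphic (@whole S) g).
{ apply (gauss_meromorphic S _ Z N W cm). intros p _. apply (not_locally_north _ Z N p W cm I), Nx. }
assert (Mgt : meromorphic (@whole S) gt).
{ apply (gauss_meromorphic S _ Zt Nt W cmt). intros p _. apply (not_locally_north _ Zt Nt p W cmt I).
  intros i Hi. apply filter_forall. intros z _ j Hj. apply Ntx, Hj. }
assert (Sg : forall p, N p = sphere_of (g p)) by (intros p; symmetry; apply sphere_stereo, converse_N_unit).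
assert (Sgt : forall p, Nt p = sphere_of (gt p)) by (intros p; symmetry; apply sphere_stereo, converse_Nt_unit).
assert (Hfin : forall p, h p <> infty -> g p <> infty /\ gt p <> infty).
{ intros p. unfold h. destruct (g p), (gt p); intros A; split; try discriminate; intros _; apply A; reflexivity. }
assert (Hval : forall p, g p <> infty -> gt p <> infty -> h p = Some (finpart gt p - finpart g p)%C).
{ intros p. unfold h, finpart. destruct (g p), (gt p); intros A B; try reflexivity; exfalso; (apply A; reflexivity) || (apply B; reflexivity). }
assert (Mh : meromorphic (@whole S) h).
{ assert (Pole : forall f f' : S -> Chat, meromorphic (@whole S) f -> meromorphic (@whole S) f' ->
     (exists s : C, (s * s = 1)%C /\ forall q, h q = match f q, f' q with Some a, Some b => Some (s * (b - a))%C | _, _ => infty end) ->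
     forall p, f p = infty -> f' p <> infty ->
     near p (fun q => recip (h q) <> infty /\ holomorphic_at (finpart (fun r => recip (h r))) q) /\ ~ near p (fun q => h q = infty)).
  { intros f f' Mf Mf' (s & Hs & Hh) p Hp Hp'.
    assert (Ns : s <> 0%C) by (intro E; rewrite E in Hs; apply C1_nz; rewrite <- Hs; cring).
    destruct (mero_pole _ f p Mf I Hp) as [A B]. assert (A' := mero_finite _ f' p Mf' I Hp').
    split.
    - set (v := finpart (fun r => recip (f r))) in *.
      (* With [v = 1 / f] one has [1 / h = v / (s * (v * f' - 1))], and at the pole [v * f' - 1]
         equals [-1]. *)
      assert (Fv : near p (fun q => (v q * finpart f' q - 1)%C <> 0%C)).
      { assert (A0 := near_self _ _ _ A). assert (A0' := near_self _ _ _ A').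
        destruct (dom_cover p) as [i Hi]. destruct A0 as [_ Av], A0' as [_ Bv].
        apply (holomorphic_near_neq (fun q => v q * finpart f' q - 1)%C).
        - intros j Hj. destruct (Av j Hj) as [l Hl], (Bv j Hj) as [m Hm]. apply cder_is_derive in Hl. apply cder_is_derive in Hm.
          eexists. apply cder_is_derive.
          apply (cder_minus (fun z => v (par j z) * finpart f' (par j z))%C (fun _ => 1%C)); [|apply cder_const].
          apply (cder_mult (fun z => v (par j z)) (fun z => finpart f' (par j z))); eassumption.
        - unfold v, finpart at 1. rewrite Hp. simpl. intro E. apply C1_nz.
          replace (RtoC 1) with (0 - (0 * finpart f' p - 1))%C by cring. rewrite E. cring. }
      apply near_imp with (2 := near_near _ _ _ (near_and _ _ _ _ (near_and _ _ _ _ A A') Fv)).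
      intros q Hq.
      assert (K : forall r, (recip (f r) <> infty /\ holomorphic_at v r) /\ f' r <> infty /\ holomorphic_at (finpart f') r ->
        (v r * finpart f' r - 1)%C <> 0%C ->
        recip (h r) = Some (v r / (s * (v r * finpart f' r - 1)))%C).
      { intros r ((R1 & _) & R2 & _) R3. rewrite Hh. unfold v, finpart in *.
        destruct (f r) as [a|].
        - destruct (f' r) as [b|]; [|exfalso; apply R2; reflexivity]. simpl in R1, R3 |- *.
          destruct (Ceq_dec a (RtoC 0)) as [Ea|Ea]; [exfalso; apply R1; reflexivity|]. simpl in R3 |- *.
          assert (D : (b - a)%C <> 0%C).
          { intro D. apply R3. replace b with (b - a + a)%C by cring. rewrite D. cfield. exact Ea. }
          destruct (Ceq_dec (s * (b - a))%C (RtoC 0)) as [E0|E0]; [exfalso; revert E0; apply Cmult_neq_0; assumption|].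
          f_equal. cfield. split; [exact Ea | split; assumption].
        - destruct (f' r) as [b|]; [|exfalso; apply R2; reflexivity]. simpl. f_equal. unfold Cdiv. cring. }
      assert (Hq0 := near_self _ _ _ Hq). destruct Hq0 as [Q1 Q2].
      split; [rewrite (K q Q1 Q2); discriminate|].
      intros j Hj. destruct Q1 as ((_ & Av) & _ & Bv). destruct (Av j Hj) as [l Hl], (Bv j Hj) as [m Hm].
      apply cder_is_derive in Hl. apply cder_is_derive in Hm.
      eexists. apply cder_is_derive.
      apply cder_ext_loc with (f := fun z => (v (par j z) / (s * (v (par j z) * finpart f' (par j z) - 1)))%C).
      + generalize (Hq j Hj). apply filter_imp. intros z (Z1 & Z2). unfold finpart at 2. rewrite (K _ Z1 Z2). reflexivity.
      + apply (cder_div (fun z => v (par j z)) (fun z => s * (v (par j z) * finpart f' (par j z) - 1))%C); [exact Hl | |].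
        * apply (cder_scal s (fun z => v (par j z) * finpart f' (par j z) - 1)%C).
          apply (cder_minus (fun z => v (par j z) * finpart f' (par j z))%C (fun _ => 1%C)); [|apply cder_const].
          apply (cder_mult (fun z => v (par j z)) (fun z => finpart f' (par j z))); eassumption.
        * rewrite (crdK Hj). apply Cmult_neq_0; assumption.
    - intros K. apply B. apply near_imp with (2 := near_and _ _ _ _ K A'). intros q (K1 & K2 & _).
      rewrite Hh in K1. destruct (f q); [|reflexivity]. destruct (f' q); [discriminate | exfalso; apply K2; reflexivity]. }
  intros p _.
  destruct (g p) as [a|] eqn:Ea.
  - destruct (gt p) as [b|] eqn:Eb.
    + left. assert (A := mero_finite _ g p Mg I ltac:(rewrite Ea; discriminate)). assert (B := mero_finite _ gt p Mgt I ltac:(rewrite Eb; discriminate)).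
      apply near_imp with (2 := near_near _ _ _ (near_and _ _ _ _ A B)). intros q Hq.
      assert (Hq0 := near_self _ _ _ Hq). destruct Hq0 as ((A1 & A2) & B1 & B2).
      split; [rewrite (Hval q A1 B1); discriminate|].
      intros j Hj. destruct (A2 j Hj) as [l Hl], (B2 j Hj) as [m Hm]. apply cder_is_derive in Hl. apply cder_is_derive in Hm.
      eexists. apply cder_is_derive.
      apply cder_ext_loc with (f := fun z => (finpart gt (par j z) - finpart g (par j z))%C).
      * generalize (Hq j Hj). apply filter_imp. intros z ((Z1 & _) & Z2 & _). unfold finpart at 3. rewrite (Hval _ Z1 Z2). reflexivity.
      * apply cder_minus; eassumption.
    + right. apply (Pole gt g Mgt Mg); [|exact Eb | rewrite Ea; discriminate].
      exists (- (1))%C. split; [cring|]. intros q. unfold h. destruct (g q), (gt q); try reflexivity. f_equal; cring.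
  - right. apply (Pole g gt Mg Mgt); [|exact Ea | intro E; apply (Hgg p); rewrite Ea, E; reflexivity].
    exists 1%C. split; [cring|]. intros q. unfold h. destruct (g q), (gt q); try reflexivity. f_equal; cring. }
(* The two envelope equations in stereographic coordinates; the one for [g] is [pair_identity] with
   the surfaces exchanged. *)
assert (Key : forall p i, dom i p -> g p <> infty -> gt p <> infty ->
  dz i (finpart gt) p = (RtoC k * ((finpart gt p - finpart g p) * (finpart gt p - finpart g p)) * wform Z i p)%C /\
  dz i (finpart g) p = (RtoC k * ((finpart gt p - finpart g p) * (finpart gt p - finpart g p)) * wform Zt i p)%C /\
  (finpart gt p - finpart g p)%C <> 0%C).
{ intros p i Hi Ha Hb.
  destruct (HV p i Hi) as [V1 V2].
  assert (A := mero_finite _ g p Mg I Ha). assert (B := mero_finite _ gt p Mgt I Hb).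
  specialize (Hgg p). unfold finpart in *.
  destruct (g p) as [a|] eqn:Ea; [|exfalso; apply Ha; reflexivity]. destruct (gt p) as [b|] eqn:Eb; [|exfalso; apply Hb; reflexivity].
  fold (finpart g) in *. fold (finpart gt) in *. simpl fin.
  assert (Hab : a <> b) by (intro E; apply Hgg; rewrite E; reflexivity).
  destruct (finite_normal N g p i a) as [F1 _]; try assumption.
  { intros j Hj. apply filter_forall. intros z; apply Sg. }
  { apply near_imp with (2 := A). tauto. }
  { apply (near_self _ _ _ A). }
  destruct (finite_normal Nt gt p i b) as [F2 _]; try assumption.
  { intros j Hj. apply filter_forall. intros z; apply Sgt. }
  { apply near_imp with (2 := B). tauto. }
  { apply (near_self _ _ _ B). }
  rewrite (dx3_isotropic _ Z N i p a W (cm i) I Hi Ea), F2 in V2.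
  rewrite (dx3_isotropic _ Zt Nt i p b W (cmt i) I Hi Eb), F1 in V1.
  specialize (Hrho p). assert (Hnn := converse_normals_neq p). rewrite (Sg p), (Sgt p), Ea, Eb in V1, V2, Hrho, Hnn. simpl sphere_of in *.
  split; [|split].
  - exact (pair_identity a b _ _ (tau p) k Hab Hk Hrho V2).
  - apply (f_equal (refl (ndiff (sphere_pt a) (sphere_pt b)))) in V1.
    rewrite refl_scal, refl_invol in V1 by exact Hnn.
    destruct (ndiff_swap (sphere_pt a) (sphere_pt b) (isotropic_re b (wform Zt i p))) as [N1 N2].
    rewrite <- N1 in V1. rewrite <- N2 in Hrho.
    rewrite (pair_identity b a _ _ (tau p) k (fun E => Hab (eq_sym E)) Hk Hrho V1). cring.
  - apply Cminus_neq. intro E; apply Hab; symmetry; exact E. }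
assert (hfin : forall p b, h p = Some b -> g p <> infty /\ gt p <> infty /\ b = (finpart gt p - finpart g p)%C).
{ intros p b E. destruct (Hfin p) as [A B]; [rewrite E; discriminate|]. split; [exact A|]. split; [exact B|].
  rewrite (Hval p A B) in E. injection E as E. symmetry; exact E. }
exists (wform Z), g, k, h, gt. split; [|split; [|split]].
- split; [exact HZ|]. split; [|split; [|split; [exact Hk|split; [exact Mh|split]]]].
  + intros Tu. destruct (inhabited_surface S) as [p0 _].
    apply (punctured_near p0 _ (Nx p0)). intros i Hi. apply filter_forall. intros z F.
    destruct (dom_cover (par i z)) as [j Hj]. apply (F j Hj).
    apply (proj1 (umbilic_iff S _ Z N _ W cm I (proj2 HZ _ I)) (Tu _) j Hj).
  + split; [apply (wform_holomorphic S _ Z N W cm)|]. split; [exact Mg|]. split; [reflexivity|].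
    intros p i a _ Hi Ha. apply (wform_weierstrass S (@whole S) Z N i p a W (cm i) I Hi Ha).
  + intros p i a b Hi Ha Hb. destruct (hfin p b Hb) as (A & B & E).
    destruct (Key p i Hi A B) as (K1 & _ & _).
    assert (A' := mero_finite _ g p Mg I A). assert (B' := mero_finite _ gt p Mgt I B).
    rewrite E, <- K1.
    destruct (near_self _ _ _ A') as [_ A2]. destruct (near_self _ _ _ B') as [_ B2].
    destruct (A2 i Hi) as [l Hl], (B2 i Hi) as [m Hm]. apply cder_is_derive in Hl. apply cder_is_derive in Hm.
    assert (El : dz i (finpart g) p = l) by (apply cder_C_derive, Hl).
    assert (Em : dz i (finpart gt) p = m) by (apply cder_C_derive, Hm). rewrite El, Em.
    apply cder_C_derive. apply cder_ext_loc with (2 := cder_minus _ _ _ _ _ Hm Hl).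
    generalize (near_and _ _ _ _ A' B' i Hi). apply filter_imp. intros z ((Z1 & _) & Z2 & _).
    unfold finpart at 3. rewrite (Hval _ Z1 Z2). reflexivity.
  + intros c Hc.
    set (U := fun p => g p <> infty /\ h p <> infty /\ h p <> Some (RtoC 0)) in *.
    assert (HU : forall p, U p -> near p (fun q => g q <> infty /\ gt q <> infty)).
    { intros p (A & B & _). destruct (Hfin p B) as [_ B'].
      apply near_imp with (2 := near_and _ _ _ _ (mero_finite _ g p Mg I A) (mero_finite _ gt p Mgt I B')). tauto. }
    assert (U2 : forall q, g q <> infty -> gt q <> infty -> U q).
    { intros q A B. split; [exact A|]. rewrite (Hval q A B). split; [discriminate|].
      destruct (dom_cover q) as [i Hi]. destruct (Key q i Hi A B) as (_ & _ & K). intro E. apply K. exact (f_equal fin E). }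
    assert (HUo : is_open U).
    { intros p Hp. apply near_imp with (2 := HU p Hp). intros q (A & B). apply U2; assumption. }
    (* The pair controls the periods of [dgt / h], whereas the Riccati setting asks for those of
       [dg / h]. *)
    apply (period_equiv S U (finpart g) (finpart gt) (finpart h) HUo); try assumption.
    * intros p (A & _). apply (near_self _ _ _ (mero_finite _ g p Mg I A)).
    * intros p (A & B & _). destruct (Hfin p B) as [_ B']. apply (near_self _ _ _ (mero_finite _ gt p Mgt I B')).
    * intros p (A & B & D). destruct (Hfin p B) as [_ B']. rewrite (Hval p A B') in D. unfold finpart at 1 4.
      rewrite (Hval p A B'). split; [reflexivity|]. simpl. intro E; apply D; rewrite E; reflexivity.
    * assert (L : loop (fun p => @whole S p /\ stereo (N p) <> infty /\ stereo (Nt p) <> infty) c).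
      { destruct Hc as (C1 & C2 & C3). split; [exact C1|]. split; [|exact C3]. intros t Ht. destruct (C2 t Ht) as (A & B & _).
        destruct (Hfin _ B) as [_ B']. split; [exact I|]. split; assumption. }
      assert (Q := proj2 (proj2 (proj2 (proj2 HP))) c L). destruct Hc as (C1 & C2 & _).
      apply (zero_real_period_ext S (finpart gt) _ (fun p => Cminus (finpart gt p) (finpart g p)) _ c C1); [reflexivity| |exact Q].
      intros t Ht. destruct (C2 t Ht) as (A & B & _). destruct (Hfin _ B) as [_ B']. unfold finpart at 3. rewrite (Hval _ A B'). reflexivity.
- split; [exact Mgt|]. intros p a b Ha Hb. destruct (hfin p b Hb) as (A & B & E).
  rewrite E. unfold finpart. rewrite Ha. destruct (gt p); [|exfalso; apply B; reflexivity]. simpl. f_equal. cring.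
- intros p. split.
  + intros E. destruct (hfin p _ E) as (A & B & D). destruct (dom_cover p) as [i Hi]. destruct (Key p i Hi A B) as (_ & _ & K).
    apply K. symmetry; exact D.
  + intros [A B]. apply (Hgg p). rewrite A, B. reflexivity.
- exists (wform Zt). split.
  + intros p i a b _ Hi Ha Hb. destruct (hfin p b Hb) as (A & B & E). destruct (Key p i Hi A B) as (_ & K1 & K2).
    rewrite K1, <- E. rewrite <- E in K2. cfield. split; [exact K2|]. intro F. apply RtoC_inj in F. contradiction.
  + split; [apply (wform_holomorphic S _ Zt Nt W cmt)|]. split; [exact Mgt|]. split; [reflexivity|].
    intros p i a _ Hi Ha. apply (wform_weierstrass S (@whole S) Zt Nt i p a W (cmt i) I Hi Ha).
Qed.
End Converse.
End Meromorphic.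

(** * The transform of a minimal surface *)

Section Transform.
Variables (O : C -> Prop) (Z N Zt Nt : C -> R3) (T : C -> R) (k : R).
Hypothesis HO : openC O.
Hypothesis H : conf_min O Z N.
Hypothesis Hk : k <> 0.
Hypothesis SNt : sm3 O Nt.
Hypothesis H1 : forall z, O z -> dot (Nt z) (Nt z) = 1.
Hypothesis HW : forall z, O z -> D3y Nt z = scal3 (-1) (cross (Nt z) (D3x Nt z)).
Let n (y : C) : R3 := ndiff (N y) (Nt y).
Hypothesis Hn : forall y, O y -> dot (n y) (n y) <> 0.
Hypothesis HR : forall z, O z -> D3x Nt z = scal3 (- k * dot (n z) (n z)) (refl (n z) (D3x Z z)).
Hypothesis HT : forall z, O z -> T z = - / (k * dot (n z) (n z)).
Hypothesis HE : forall y, O y -> Zt y = add3 (Z y) (scal3 (T y) (n y)).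

Lemma T_sm : sm O T.
Proof.
assert (Sn := ndiff_sm O N Nt HO (cm_smN _ _ _ H) SNt).
apply sm_ext with (F := fun z => - / (k * dot (n z) (n z))); [exact HO | intros z Hz; symmetry; apply HT, Hz|].
apply (sm_opp O HO), (sm_inv O HO).
- intros z Hz. apply Rmult_integral_contrapositive. split; [exact Hk | apply Hn, Hz].
- apply (sm_mult O HO (fun _ => k)); [apply sm_const, HO | apply (sm_dot O HO n n); exact Sn].
Qed.

(** One directional derivative of the transform: [x], [a], [a'], [t'] stand for the derivatives of
    [Z], [N], [Nt], [T]. The term [t a'] is the mirror image of [x], and the constancy of [t |m|^2]
    gives [t'] the value that completes [a] to its mirror image. *)
Lemma mirror_step (m x a a' : R3) (t t' : R) : dot m m <> 0 -> t * dot m m = - / k ->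
  a' = scal3 (- k * dot m m) (refl m x) -> t' * dot m m + 2 * t * dot m (ndiff a a') = 0 ->
  add3 x (add3 (scal3 t' m) (scal3 t (ndiff a a'))) = scal3 t (refl m a).
Proof.
intros Hm Ht Ea Et.
assert (K : t * (- k * dot m m) = 1) by (replace (t * (- k * dot m m)) with (- k * (t * dot m m)) by ring; rewrite Ht; field; exact Hk).
assert (Ta : scal3 t a' = refl m x).
{ rewrite Ea. transitivity (scal3 (t * (- k * dot m m)) (refl m x)); [apply R3_eq; unvec; ring|].
  rewrite K. apply R3_eq; unvec; ring. }
assert (Dm : t * dot m (ndiff a a') = t * dot a m + dot x m).
{ replace (t * dot m (ndiff a a')) with (t * dot a m - dot (scal3 t a') m) by (unfold ndiff; unvec; ring).
  rewrite Ta, refl_axis by exact Hm. ring. }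
assert (Ht' : t' = - (2 * (t * dot a m + dot x m) / dot m m)).
{ apply Rmult_eq_reg_r with (dot m m); [|exact Hm]. rewrite <- Dm in *.
  replace (- (2 * (t * dot m (ndiff a a')) / dot m m) * dot m m) with (- (2 * (t * dot m (ndiff a a')))) by (field; exact Hm). lra. }
transitivity (add3 (add3 x (scal3 (-1) (scal3 t a'))) (add3 (scal3 t' m) (scal3 t a))); [unfold ndiff; apply R3_eq; unvec; ring|].
rewrite Ta, Ht'. unfold refl. set (d := dot m m) in *. set (p := dot a m). set (q := dot x m).
clearbody d p q. apply R3_eq; unfold add3, scal3, X1, X2, X3; simpl; field; exact Hm.
Qed.

Lemma transform_derivatives (z : C) : O z ->
  D3x Zt z = scal3 (T z) (refl (n z) (D3x N z)) /\ D3y Zt z = scal3 (T z) (refl (n z) (D3y N z)).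
Proof.
intros Hz. assert (ST := T_sm). assert (Hnz := Hn z Hz).
destruct (congruence_derivatives O Z N Zt Nt T HO (cm_smZ _ _ _ H) (cm_smN _ _ _ H) SNt ST HE z Hz) as [Ex Ey].
destruct (power_derivatives O N Nt T HO (cm_smN _ _ _ H) SNt ST z Hz) as [Rx Ry].
assert (Kc : forall y, O y -> T y * dot (ndiff (N y) (Nt y)) (ndiff (N y) (Nt y)) = - / k).
{ intros y Hy. rewrite (HT y Hy). unfold n. field. split; [exact Hk | apply (Hn y Hy)]. }
rewrite (Dx_zero_of_const O HO _ z _ Kc Hz) in Rx. rewrite (Dy_zero_of_const O HO _ z _ Kc Hz) in Ry.
assert (Rm : refl (n z) (N z) = Nt z) by (apply refl_normal; [apply (cm_unit _ _ _ H z Hz) | apply H1, Hz | exact Hnz]).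
rewrite Ex, Ey. split.
- apply mirror_step; [exact Hnz | apply Kc, Hz | apply HR, Hz | symmetry; exact Rx].
- apply mirror_step; [exact Hnz | apply Kc, Hz | | symmetry; exact Ry].
  (* The relation in [y] follows from that in [x]: the sign in the rotation rule for [dNt] matches
     the one due to the reversed orientation. *)
  rewrite (HW z Hz), (HR z Hz), (cm_rot _ _ _ H z Hz). fold (n z). rewrite refl_cross, Rm by exact Hnz. apply R3_eq; unvec; ring.
Qed.

(** The rule for [dZt] is the reflected rule for [dN], whose minus sign is absorbed by the reversal
    of orientation. *)
Lemma transform_conf_min : conf_min O Zt Nt.
Proof.
assert (Sn := ndiff_sm O N Nt HO (cm_smN _ _ _ H) SNt).
split; [|split; [exact SNt|]].
- assert (K : sm3 O (fun y => add3 (Z y) (scal3 (T y) (n y)))).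
  { apply sm3_add; [exact HO | apply (cm_smZ _ _ _ H)|]. apply (sm3_scal O HO T n); [exact T_sm | exact Sn]. }
  destruct K as (K1 & K2 & K3). split; [|split]; [refine (sm_ext O HO _ _ _ K1) | refine (sm_ext O HO _ _ _ K2) | refine (sm_ext O HO _ _ _ K3)];
    intros y Hy; rewrite (HE y Hy); reflexivity.
- intros z Hz. destruct (transform_derivatives z Hz) as [Ex Ey]. assert (Hnz := Hn z Hz).
  assert (Rm : refl (n z) (N z) = Nt z) by (apply refl_normal; [apply (cm_unit _ _ _ H z Hz) | apply H1, Hz | exact Hnz]).
  split; [apply H1, Hz|]. split; [|split; [|apply HW, Hz]].
  + rewrite Ex. replace (dot (scal3 (T z) (refl (n z) (D3x N z))) (Nt z)) with (T z * dot (refl (n z) (D3x N z)) (Nt z)) by (unvec; ring).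
    rewrite <- Rm, refl_dot by exact Hnz. rewrite (cm_N_orth _ HO _ _ H z Hz). ring.
  + rewrite Ey, Ex, (cm_wein _ _ _ H z Hz), refl_scal, refl_cross, Rm by exact Hnz. apply R3_eq; unvec; ring.
Qed.
End Transform.

(** * Isolated poles, sums of meromorphic functions, isolated umbilics *)

Section Forward.
Variable S : riemann_surface.
Implicit Types (p q : S) (i j : chart S) (U : S -> Prop) (g h : S -> Chat).

Lemma holomorphic_at_chart (f : S -> C) i q l : dom i q -> cder (lift i f) (crd i q) l -> holomorphic_at f q.
Proof.
intros Hi Hl j Hj.
destruct (transition_holomorphic Hj Hi) as [m Hm]. apply cder_is_derive in Hm.
exists (l * m)%C. apply cder_is_derive.
assert (Hl' : cder (lift i f) (crd i (par j (crd j q))) l) by (rewrite (crdK Hj); exact Hl).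
apply cder_ext_loc with (2 := cder_comp _ _ _ _ _ Hm Hl').
generalize (par_dom Hj Hi). apply filter_imp. intros z (A & B & D). unfold lift. rewrite (crdK D). reflexivity.
Qed.

Lemma hol_at_near (f : S -> C) i p (c : C -> C) : dom i p -> hol_at c (crd i p) ->
  locC (crd i p) (fun z => lift i f z = c z) -> near p (holomorphic_at f).
Proof.
intros Hi Hc E. apply (near_of_chart S i); [exact Hi|].
generalize (filter_and _ _ (dom_loc S i p Hi) (filter_and _ _ Hc (locally_locally _ _ E))). apply filter_imp.
intros z ((A & B) & (l & Hl) & E'). apply (holomorphic_at_chart f i _ l A). rewrite B.
apply cder_ext_loc with (2 := Hl). revert E'. apply filter_imp. intros y Y; symmetry; exact Y.
Qed.

Lemma holomorphic_hol_at (f : S -> C) i p : dom i p -> near p (holomorphic_at f) -> hol_at (lift i f) (crd i p).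
Proof.
intros Hi H. unfold hol_at. generalize (filter_and _ _ (dom_loc S i p Hi) (H i Hi)). apply filter_imp.
intros z ((A & B) & K). destruct (K i A) as [l Hl]. apply cder_is_derive in Hl. rewrite B in Hl. exists l; exact Hl.
Qed.

Lemma near_punctured i p (P : S -> Prop) : dom i p -> locC (crd i p) (fun z => z <> crd i p -> P (par i z)) -> near p (fun q => q <> p -> P q).
Proof.
intros Hi H. apply (near_of_chart S i); [exact Hi|]. revert H. apply filter_imp. intros z K F. apply K. intro E. apply F. rewrite E. apply crdK, Hi.
Qed.

Lemma punctured_chart i p (P : S -> Prop) : dom i p -> near p (fun q => q <> p -> P q) -> locC (crd i p) (fun z => z <> crd i p -> P (par i z)).
Proof.
intros Hi H. generalize (filter_and _ _ (dom_loc S i p Hi) (H i Hi)). apply filter_imp. intros z ((A & B) & K) F. apply K.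
intro E. apply F. rewrite <- B, E. reflexivity.
Qed.

Lemma recip_zero (w : Chat) : recip w <> infty -> fin (recip w) = 0%C -> w = infty.
Proof.
destruct w as [a|]; [|reflexivity]. simpl. destruct (Ceq_dec a (RtoC 0)) as [E|E]; [intros F; exfalso; apply F; reflexivity|].
simpl. intros _ F. exfalso. revert F. apply Cinv_neq_0, E.
Qed.

(** Near a pole, the poles are the zeros of the holomorphic reciprocal, which does not vanish
    identically. *)
Lemma mero_isolated_poles g p : meromorphic (@whole S) g -> near p (fun q => q <> p -> g q <> infty).
Proof.
intros H. destruct (g p) as [a|] eqn:Ea.
- apply near_imp with (2 := mero_finite _ _ g p H I ltac:(rewrite Ea; discriminate)). tauto.
- destruct (mero_pole _ _ g p H I Ea) as [A B]. destruct (dom_cover p) as [i Hi].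
  set (v := finpart (fun r => recip (g r))) in *.
  assert (Hv := holomorphic_hol_at v i p Hi (near_imp _ _ _ _ (fun q K => proj2 K) A)).
  apply (near_punctured i p (fun q => g q <> infty) Hi).
  assert (Nv : ~ locC (crd i p) (fun z => lift i v z = 0%C)).
  { intros K. apply B. apply (near_of_chart S i); [exact Hi|]. generalize (filter_and _ _ K (A i Hi)). apply filter_imp.
    intros z (K1 & K2 & _). apply recip_zero; assumption. }
  generalize (isolated_zeros _ _ Hv Nv). apply filter_imp. intros z K F E. apply (K F). unfold lift, v, finpart. rewrite E. reflexivity.
Qed.

(** Treats regular points, with denominator [1], and poles, with numerator [1], uniformly, so that
    sums need no case distinction. *)
Lemma mero_fraction g i p : meromorphic (@whole S) g -> dom i p -> exists a b : C -> C,
  hol_at a (crd i p) /\ hol_at b (crd i p) /\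
  locC (crd i p) (fun z => z <> crd i p -> b z <> 0%C /\ g (par i z) = Some (a z / b z)%C).
Proof.
intros H Hi. assert (P := punctured_chart i p _ Hi (mero_isolated_poles g p H)).
assert (Hc : forall c z, hol_at (fun _ => c) z) by (intros c z; unfold hol_at; apply filter_forall; intros y; eexists; apply cder_const).
destruct (g p) as [a|] eqn:Ea.
- assert (A := mero_finite _ _ g p H I ltac:(rewrite Ea; discriminate)).
  exists (lift i (finpart g)), (fun _ => 1%C). split; [|split; [apply Hc|]].
  + apply holomorphic_hol_at; [exact Hi|]. apply near_imp with (2 := A). tauto.
  + revert P. apply filter_imp. intros z K F. split; [apply C1_nz|]. specialize (K F). unfold lift, finpart.
    destruct (g (par i z)) as [b|]; [|exfalso; apply K; reflexivity]. simpl. f_equal. cfield.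
- destruct (mero_pole _ _ g p H I Ea) as [A _].
  exists (fun _ => 1%C), (lift i (finpart (fun r => recip (g r)))). split; [apply Hc|]. split.
  + apply holomorphic_hol_at; [exact Hi|]. apply near_imp with (2 := A). tauto.
  + generalize (filter_and _ _ P (A i Hi)). apply filter_imp. intros z (K & K1 & _) F. specialize (K F). unfold lift, finpart.
    destruct (g (par i z)) as [b|]; [|exfalso; apply K; reflexivity]. simpl in K1 |- *.
    destruct (Ceq_dec b (RtoC 0)) as [E|E]; [exfalso; apply K1; reflexivity|]. simpl. split; [apply Cinv_neq_0, E|].
    f_equal. cfield. exact E.
Qed.

Definition meromorphic_at (f : S -> Chat) p : Prop :=
  near p (fun q => f q <> infty /\ holomorphic_at (finpart f) q) \/
  (near p (fun q => recip (f q) <> infty /\ holomorphic_at (finpart (fun r => recip (f r))) q) /\ ~ near p (fun q => f q = infty)).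

(** At a common pole the polar parts may cancel and this value be wrong; [patch] corrects it at the
    point concerned. *)
Definition chat_sum (u v : Chat) : Chat := match u, v with Some a, Some b => Some (a + b)%C | _, _ => infty end.

Definition patch (f : S -> Chat) p (L : Chat) : S -> Chat := fun q => if excluded_middle_informative (q = p) then L else f q.

Lemma patch_at f p L : patch f p L p = L.
Proof. unfold patch. destruct (excluded_middle_informative (p = p)); [reflexivity | contradiction]. Qed.
Lemma patch_off f p L q : q <> p -> patch f p L q = f q.
Proof. intros H. unfold patch. destruct (excluded_middle_informative (q = p)); [contradiction | reflexivity]. Qed.

Lemma patch_chart f p L i (P : C -> Chat) : dom i p -> P (crd i p) = L ->
  locC (crd i p) (fun z => z <> crd i p -> f (par i z) = P z) -> locC (crd i p) (fun z => patch f p L (par i z) = P z).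
Proof.
intros Hi E K. generalize (filter_and _ _ (dom_loc S i p Hi) K). apply filter_imp. intros z ((A & B) & D).
destruct (classic (z = crd i p)) as [F|F].
- rewrite F, (crdK Hi), patch_at. symmetry; exact E.
- rewrite patch_off; [apply D, F|]. intro X. apply F. rewrite <- B, X. reflexivity.
Qed.

(** If a summand is infinite at [p], the sum near [p] is a quotient [A / B] of germs. By
    [hol_quotient] either it extends holomorphically or its reciprocal does with value [0], and [L]
    is accordingly finite or infinite. *)
Lemma sum_extends g h p : meromorphic (@whole S) g -> meromorphic (@whole S) h ->
  exists L, meromorphic_at (patch (fun q => chat_sum (g q) (h q)) p L) p /\
    (g p <> infty -> h p <> infty -> L = chat_sum (g p) (h p)).
Proof.
intros Hg Hh. destruct (dom_cover p) as [i Hi]. set (z0 := crd i p).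
set (f := fun q => chat_sum (g q) (h q)).
destruct (classic (g p <> infty /\ h p <> infty)) as [[A B]|Nf].
- exists (f p). split; [|reflexivity]. left.
  assert (A' := mero_finite _ _ g p Hg I A). assert (B' := mero_finite _ _ h p Hh I B).
  assert (E : forall q, patch f p (f p) q = f q).
  { intros q. destruct (classic (q = p)) as [F|F]; [rewrite F, patch_at | rewrite patch_off by exact F]; reflexivity. }
  assert (Fin : forall q, g q <> infty -> h q <> infty -> f q = Some (finpart g q + finpart h q)%C).
  { intros q. unfold f, finpart. destruct (g q), (h q); intros X Y; try reflexivity; exfalso; (apply X; reflexivity) || (apply Y; reflexivity). }
  apply near_imp with (2 := near_near _ _ _ (near_and _ _ _ _ A' B')). intros q Hq.
  destruct (near_self _ _ _ Hq) as ((A1 & A2) & B1 & B2). rewrite E, (Fin q A1 B1). split; [discriminate|].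
  intros j Hj. destruct (A2 j Hj) as [l Hl], (B2 j Hj) as [m Hm]. apply cder_is_derive in Hl. apply cder_is_derive in Hm.
  eexists. apply cder_is_derive. apply cder_ext_loc with (2 := cder_plus _ _ _ _ _ Hl Hm).
  generalize (Hq j Hj). apply filter_imp. intros z ((Z1 & _) & Z2 & _). unfold finpart at 3. rewrite E, (Fin _ Z1 Z2). reflexivity.
- assert (HL : exists L, meromorphic_at (patch f p L) p).
  { destruct (mero_fraction g i p Hg Hi) as (a & b & Ha & Hb & Eg). destruct (mero_fraction h i p Hh Hi) as (a' & b' & Ha' & Hb' & Eh).
    assert (Hm : forall u v, hol_at u z0 -> hol_at v z0 -> hol_at (fun z => u z * v z)%C z0).
    { intros u v Hu Hv. unfold hol_at in *. generalize (filter_and _ _ Hu Hv). apply filter_imp. intros z ((l & L1) & (m & M1)). eexists. apply cder_mult; eassumption. }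
    set (A := fun z => (a z * b' z + a' z * b z)%C). set (B := fun z => (b z * b' z)%C).
    assert (HA : hol_at A z0).
    { unfold hol_at in *. generalize (filter_and _ _ (Hm _ _ Ha Hb') (Hm _ _ Ha' Hb)). apply filter_imp. intros z ((l & L1) & (m & M1)). eexists.
      apply (cder_plus (fun z => a z * b' z)%C (fun z => a' z * b z)%C); eassumption. }
    assert (HB : hol_at B z0) by exact (Hm _ _ Hb Hb').
    assert (Ef : locC z0 (fun z => z <> z0 -> B z <> 0%C /\ f (par i z) = Some (A z / B z)%C)).
    { generalize (filter_and _ _ Eg Eh). apply filter_imp. intros z (K & K') F. destruct (K F) as [K1 K2], (K' F) as [K1' K2'].
      split; [apply Cmult_neq_0; assumption|]. unfold f. rewrite K2, K2'. simpl. f_equal. unfold A, B. cfield. split; assumption. }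
    assert (NB : ~ locC z0 (fun z => B z = 0%C)).
    { intros K. apply (not_loc_neg z0 (fun z => B z <> 0%C)).
      - revert Ef. apply filter_imp. intros z E F. apply (E F).
      - revert K. apply filter_imp. intros z E F. apply F, E. }
    destruct (hol_quotient A B z0 HA HB NB) as [(c & Hc & Ec)|(c & Hc & C0 & Cn & Ec)].
    - exists (Some (c z0)). left.
      assert (Ep : locC z0 (fun z => patch f p (Some (c z0)) (par i z) = Some (c z))).
      { apply (patch_chart f p (Some (c z0)) i (fun z => Some (c z)) Hi); [reflexivity|].
        generalize (filter_and _ _ Ef Ec). apply filter_imp. intros z (E1 & E2) F. destruct (E1 F) as [E3 E4].
        rewrite E4, E2. f_equal. cfield. exact E3. }
      apply near_and.
      + apply (near_of_chart S i); [exact Hi|]. revert Ep. apply filter_imp. intros z E. rewrite E. discriminate.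
      + apply (hol_at_near _ i p c Hi Hc). revert Ep. apply filter_imp. intros z E. unfold lift, finpart. rewrite E. reflexivity.
    - exists infty. right.
      assert (Ep : locC z0 (fun z => recip (patch f p infty (par i z)) = Some (c z))).
      { set (P := fun z => if Ceq_dec z z0 then infty else f (par i z)).
        assert (K : locC z0 (fun z => patch f p infty (par i z) = P z)).
        { apply (patch_chart f p infty i P Hi).
          - unfold P. destruct (Ceq_dec (crd i p) z0) as [F|F]; [reflexivity | exfalso; apply F; reflexivity].
          - apply filter_forall. intros z F. unfold P. destruct (Ceq_dec z z0) as [X|X]; [contradiction | reflexivity]. }
        generalize (filter_and _ _ K (filter_and _ _ (filter_and _ _ Ef Ec) Cn)). apply filter_imp. intros z (E0 & (E1 & E2) & E3).
        rewrite E0. unfold P. destruct (Ceq_dec z z0) as [F|F].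
        - simpl. rewrite F, C0. reflexivity.
        - destruct (E1 F) as [E4 E5]. rewrite E5. specialize (E3 F).
          assert (NA : A z <> 0%C) by (intro X; apply E4; rewrite E2, X; cring).
          simpl. destruct (Ceq_dec (A z / B z)%C (RtoC 0)) as [X|X].
          + exfalso. revert X. apply Cmult_neq_0; [exact NA | apply Cinv_neq_0, E4].
          + f_equal. rewrite E2. cfield. split; [exact E3 | exact NA]. }
      split; [apply near_and|].
      + apply (near_of_chart S i); [exact Hi|]. revert Ep. apply filter_imp. intros z E. rewrite E. discriminate.
      + apply (hol_at_near _ i p c Hi Hc). revert Ep. apply filter_imp. intros z E. unfold lift, finpart. rewrite E. reflexivity.
      + intros K. apply (punctured_near S p (fun q => patch f p infty q <> infty)).
        * apply (near_punctured i p _ Hi). generalize (filter_and _ _ Ep Cn). apply filter_imp. intros z (E1 & E2) F X.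
          rewrite X in E1. simpl in E1. apply (E2 F). assert (E3 := f_equal fin E1). simpl in E3. symmetry; exact E3.
        * apply near_imp with (2 := K). intros q E F. apply F, E. }
  destruct HL as [L HL]. exists L. split; [exact HL|]. intros A B. exfalso. apply Nf. split; assumption.
Qed.

Lemma meromorphic_at_ext (f f' : S -> Chat) p : near p (fun q => f q = f' q) -> meromorphic_at f p -> meromorphic_at f' p.
Proof.
intros E. assert (E' := near_near _ _ _ E).
assert (X : forall (u u' : S -> C) q, near q (fun r => u r = u' r) -> holomorphic_at u q -> holomorphic_at u' q).
{ intros u u' q L A i Hi. destruct (A i Hi) as [l Hl]. exists l. apply cder_is_derive. apply cder_is_derive in Hl.
  apply cder_ext_loc with (2 := Hl). apply L, Hi. }
intros [A|[A B]]; [left | right; split].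
- apply near_imp with (2 := near_and _ _ _ _ E' A). intros q (L & A1 & A2). rewrite <- (near_self _ _ _ L). split; [exact A1|].
  apply X with (2 := A2). apply near_imp with (2 := L). intros r Hr. unfold finpart. rewrite Hr. reflexivity.
- apply near_imp with (2 := near_and _ _ _ _ E' A). intros q (L & A1 & A2). rewrite <- (near_self _ _ _ L). split; [exact A1|].
  apply X with (2 := A2). apply near_imp with (2 := L). intros r Hr. unfold finpart. rewrite Hr. reflexivity.
- intros K. apply B. apply near_imp with (2 := near_and _ _ _ _ E K). intros q (L & K1). rewrite L. exact K1.
Qed.

(** The value is chosen at each point independently. Poles being isolated, near [p] all other
    choices are the ordinary sum, so they fit together. *)
Lemma meromorphic_sum_exists g h : meromorphic (@whole S) g -> meromorphic (@whole S) h -> exists gt, meromorphic_sum g h gt.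
Proof.
intros Hg Hh.
assert (Ch : forall p, {L | meromorphic_at (patch (fun q => chat_sum (g q) (h q)) p L) p /\ (g p <> infty -> h p <> infty -> L = chat_sum (g p) (h p))})
  by (intros p; apply constructive_indefinite_description, sum_extends; assumption).
exists (fun p => proj1_sig (Ch p)). split.
- intros p _. destruct (proj2_sig (Ch p)) as [A _].
  apply (meromorphic_at_ext (patch (fun q => chat_sum (g q) (h q)) p (proj1_sig (Ch p)))); [|exact A].
  apply near_imp with (2 := near_and _ _ _ _ (mero_isolated_poles g p Hg) (mero_isolated_poles h p Hh)).
  intros q (K1 & K2). destruct (classic (q = p)) as [E|E].
  + rewrite E, patch_at. reflexivity.
  + rewrite patch_off by exact E. symmetry. apply (proj2 (proj2_sig (Ch q))); auto.
- intros p a b Ha Hb. rewrite (proj2 (proj2_sig (Ch p))); [|rewrite Ha; discriminate|rewrite Hb; discriminate]. rewrite Ha, Hb. reflexivity.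
Qed.

(** With [v = 1 / f], the continuous product [v * (A - B)] would be [1] around [p] and [0] at
    [p]. *)
Lemma pole_not_regular (f : S -> Chat) (A B : S -> C) p : meromorphic (@whole S) f -> f p = infty ->
  holomorphic_at A p -> holomorphic_at B p -> near p (fun q => q <> p -> f q = Some (A q - B q)%C) -> False.
Proof.
intros Hf Ep HA HB E. destruct (mero_pole _ _ f p Hf I Ep) as [K _]. set (v := finpart (fun r => recip (f r))) in *.
destruct (near_self _ _ _ K) as [_ Hv]. destruct (dom_cover p) as [i Hi].
destruct (Hv i Hi) as [l Hl], (HA i Hi) as [a Ha], (HB i Hi) as [b Hb].
apply cder_is_derive, cder_cont in Hl. apply cder_is_derive, cder_cont in Ha. apply cder_is_derive, cder_cont in Hb.
assert (Hc := contc_mult _ _ _ Hl (contc_minus _ _ _ Ha Hb)).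
assert (Q := cont_eq_dense (fun z => Re (v (par i z) * (A (par i z) - B (par i z)))%C) (fun _ => 1) (crd i p) (fun z => z <> crd i p)
  (cont_Re _ _ Hc) (continuous_const _ _)).
cbv beta in Q. rewrite (crdK Hi) in Q.
assert (V0 : v p = 0%C) by (unfold v, finpart; rewrite Ep; reflexivity).
rewrite V0 in Q. replace (Re (0 * (A p - B p))%C) with 0 in Q by (unfold Re, Im; simpl; ring).
apply R1_neq_R0. symmetry. apply Q.
- apply not_loc_neg, filter_forall. auto.
- generalize (filter_and _ _ (punctured_chart i p _ Hi E) (K i Hi)). apply filter_imp. intros z (K1 & K2 & _) F.
  specialize (K1 F). assert (X : (A (par i z) - B (par i z))%C <> 0%C).
  { intro X. apply K2. rewrite K1. simpl. destruct (Ceq_dec (A (par i z) - B (par i z))%C (RtoC 0)); [reflexivity | contradiction]. }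
  assert (V : v (par i z) = (/ (A (par i z) - B (par i z)))%C).
  { unfold v, finpart. rewrite K1. simpl. destruct (Ceq_dec (A (par i z) - B (par i z))%C (RtoC 0)); [contradiction | reflexivity]. }
  rewrite V, Cinv_l by exact X. reflexivity.
Qed.

(** Umbilics are the zeros of the holomorphic function [hopf], so at each point they are isolated or
    fill a neighbourhood; connectedness spreads the second case over the whole surface. *)
Lemma isolated_umbilics (Z N : S -> R3) p : minimal_immersion (@whole S) Z N -> ~ totally_umbilical Z N ->
  near p (fun q => q <> p -> forall i, dom i q -> dx3 i N q <> (0, 0, 0)).
Proof.
intros HZ Hu. assert (W := open_whole S). assert (cm := minimal_conf_min S _ Z N (proj1 HZ)).
set (flat := fun q => forall i, dom i q -> dx3 i N q = (0, 0, 0)).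
assert (F1 : forall q i, dom i q -> (dx3 i N q = (0, 0, 0) <-> flat q)).
{ intros q i Hi. split; [|auto]. intros E j Hj. apply (dx3_zero_N S _ Z N j i q W cm I Hj Hi E). }
assert (Im : forall q i, dom i q -> dx3 i Z q <> (0, 0, 0)) by (intros q i Hi; apply (proj1 (immersed_dx3 S _ Z N q W cm I) (proj2 HZ q I) i Hi)).
assert (D : forall q, near q flat \/ near q (fun r => r <> q -> ~ flat r)).
{ intros q. destruct (dom_cover q) as [i Hi]. assert (HO := img_open S i _ W).
  assert (Hz := img_crd S i (@whole S) q I Hi).
  assert (Hh := hopf_hol _ _ _ HO (cm i)).
  assert (Hha : hol_at (hopf (lift i Z)) (crd i q)) by (unfold hol_at; generalize (HO _ Hz); apply filter_imp; exact Hh).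
  assert (Q : locC (crd i q) (fun z => hopf (lift i Z) z = 0%C <-> flat (par i z))).
  { generalize (HO _ Hz). apply filter_imp. intros z Hz'. assert (Hz'' := Hz'). destruct Hz' as (A & B & _).
    assert (Iz := Im _ i A). rewrite dx3_D3x, B in Iz.
    rewrite (proj1 (hopf_zero_iff _ _ _ _ HO (cm i) Hz'' Iz)), <- (F1 _ i A), dx3_D3x, B. reflexivity. }
  destruct (classic (locC (crd i q) (fun z => hopf (lift i Z) z = 0%C))) as [A|A].
  - left. apply (near_of_chart S i); [exact Hi|]. generalize (filter_and _ _ A Q). apply filter_imp. intros z (A1 & A2). apply A2, A1.
  - right. apply (near_punctured i q _ Hi). generalize (filter_and _ _ (isolated_zeros _ _ Hha A) Q). apply filter_imp.
    intros z (A1 & A2) F X. apply (A1 F), A2, X. }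
destruct (D p) as [A|A].
- exfalso. apply Hu.
  assert (All : forall q, near q flat).
  { apply (@connected_surface S (fun q => near q flat)).
    - intros q i Hq Hi. exact (near_near _ _ _ Hq i Hi).
    - intros q i Hq Hi. destruct (D q) as [B|B]; [contradiction|].
      generalize (filter_and _ _ (dom_loc S i q Hi) (B i Hi)). apply filter_imp. intros z ((Z1 & Z2) & K) X.
      destruct (classic (par i z = q)) as [Y|Y]; [rewrite Y in X; contradiction|]. apply (K Y). apply (near_self _ _ _ X).
    - exists p. exact A. }
  intros q. apply (umbilic_iff S _ Z N q W cm I (proj2 HZ q I)). exact (near_self _ _ _ (All q)).
- apply near_imp with (2 := A). intros q K F i Hi E. apply (K F). apply (F1 q i Hi), E.
Qed.
End Forward.

(** * The transformed surface and its properties *)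

Section Existence.
Variable S : riemann_surface.
Implicit Types (p q : S) (i j : chart S).
Variables (Z N : S -> R3) (w : form S) (g : S -> Chat) (k : R) (h gt : S -> Chat).
Hypothesis HR : riccati_setting Z N w g k h.
Hypothesis Hgt : meromorphic_sum g h gt.

Let W := open_whole S.
Let HZ : minimal_immersion (@whole S) Z N := proj1 HR.
Let cm : forall i, conf_min (img i (@whole S)) (lift i Z) (lift i N) := minimal_conf_min S _ Z N (proj1 HZ).
Let U := Sigma_tilde g h gt.
Let Nt p := sphere_of (gt p).
Let n p := ndiff (N p) (Nt p).
Let T p := - / (k * dot (n p) (n p)).
Let Zt p := add3 (Z p) (scal3 (T p) (n p)).

Lemma ratio_neq0 : k <> 0. Proof. apply HR. Qed.
Lemma g_meromorphic : meromorphic (@whole S) g. Proof. apply HR. Qed.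
Lemma h_meromorphic : meromorphic (@whole S) h. Proof. apply HR. Qed.
Lemma gt_meromorphic : meromorphic (@whole S) gt. Proof. apply Hgt. Qed.
Lemma g_stereo p : g p = stereo (N p). Proof. apply HR; exact I. Qed.
Lemma N_unit p : dot (N p) (N p) = 1. Proof. exact (unit_on S _ Z N p W cm I). Qed.
Lemma N_sphere p : N p = sphere_of (g p). Proof. rewrite g_stereo. symmetry. apply sphere_stereo, N_unit. Qed.

Lemma finite_punctured p : near p (fun q => q <> p -> g q <> infty /\ h q <> infty).
Proof.
apply near_imp with (2 := near_and _ _ _ _ (mero_isolated_poles S g p g_meromorphic) (mero_isolated_poles S h p h_meromorphic)).
intros q (A & B) F. split; [apply A, F | apply B, F].
Qed.

Lemma gt_finite p : g p <> infty -> h p <> infty -> gt p = Some (finpart g p + finpart h p)%C.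
Proof.
intros A B. unfold finpart. destruct (g p) as [a|] eqn:Ea; [|exfalso; apply A; reflexivity].
destruct (h p) as [b|] eqn:Eb; [|exfalso; apply B; reflexivity]. apply (proj2 Hgt); assumption.
Qed.

(** Otherwise [h = gt - g] would be regular at its own pole. *)
Lemma gt_pole_of_h p : g p <> infty -> h p = infty -> gt p = infty.
Proof.
intros A B. destruct (gt p) as [c|] eqn:E; [exfalso | reflexivity].
assert (A' := mero_finite _ _ g p g_meromorphic I A).
assert (E' := mero_finite _ _ gt p gt_meromorphic I ltac:(rewrite E; discriminate)).
apply (pole_not_regular S h (finpart gt) (finpart g) p h_meromorphic B); [apply (near_self _ _ _ E') | apply (near_self _ _ _ A')|].
apply near_imp with (2 := finite_punctured p). intros q K F. destruct (K F) as [K1 K2].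
assert (Q := gt_finite q K1 K2). unfold finpart at 1. rewrite Q. simpl.
destruct (h q) as [b|] eqn:Eb; [|exfalso; apply K2; reflexivity]. f_equal. unfold finpart at 2. rewrite Eb. simpl. cring.
Qed.

Lemma gt_pole_of_g p : g p = infty -> h p <> infty -> gt p = infty.
Proof.
intros A B. destruct (gt p) as [c|] eqn:E; [exfalso | reflexivity].
assert (B' := mero_finite _ _ h p h_meromorphic I B).
assert (E' := mero_finite _ _ gt p gt_meromorphic I ltac:(rewrite E; discriminate)).
apply (pole_not_regular S g (finpart gt) (finpart h) p g_meromorphic A); [apply (near_self _ _ _ E') | apply (near_self _ _ _ B')|].
apply near_imp with (2 := finite_punctured p). intros q K F. destruct (K F) as [K1 K2].
assert (Q := gt_finite q K1 K2). unfold finpart at 1. rewrite Q. simpl.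
destruct (g q) as [b|] eqn:Eb; [|exfalso; apply K1; reflexivity]. f_equal. unfold finpart at 1. rewrite Eb. simpl. cring.
Qed.

(** Where at most one of [g] and [h] is infinite, [gt] is known from them; at a common pole the
    clause of [Sigma_tilde] on [gt] decides. *)
Lemma tilde_iff_gauss_neq p : U p <-> g p <> gt p.
Proof.
unfold U, Sigma_tilde. destruct (classic (g p = infty)) as [A|A], (classic (h p = infty)) as [B|B].
- rewrite A, B. split.
  + intros [_ K] E. apply K. split; [reflexivity | symmetry; exact E].
  + intros K. split; [discriminate|]. intros [_ E]. apply K. symmetry; exact E.
- rewrite (gt_pole_of_g p A B), A. split; [intros [_ K]; exfalso; apply K; split; reflexivity | intros K; exfalso; apply K; reflexivity].
- rewrite (gt_pole_of_h p A B), B. split; [intros _; exact A | intros _; split; [discriminate | intros [E _]; contradiction]].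
- rewrite (gt_finite p A B). destruct (g p) as [a|] eqn:Ea; [|exfalso; apply A; reflexivity].
  destruct (h p) as [b|] eqn:Eb; [|exfalso; apply B; reflexivity].
  assert (Fa : finpart g p = a) by (unfold finpart; rewrite Ea; reflexivity).
  assert (Fb : finpart h p = b) by (unfold finpart; rewrite Eb; reflexivity).
  rewrite Fa, Fb. split.
  + intros [K _] E. apply K. apply (f_equal fin) in E. simpl in E. f_equal.
    replace b with (a + b - a)%C by cring. rewrite <- E. cring.
  + intros K. split; [|intros [E _]; discriminate]. intros E. apply (f_equal fin) in E. simpl in E. apply K. rewrite E. f_equal. cring.
Qed.

Lemma Nt_unit p : dot (Nt p) (Nt p) = 1.
Proof. apply sphere_of_unit. Qed.

Lemma tilde_iff_normals_neq p : U p <-> N p <> Nt p.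
Proof.
rewrite tilde_iff_gauss_neq. rewrite N_sphere. unfold Nt. split; intros A E; apply A; [|rewrite E; reflexivity].
rewrite <- (stereo_sphere (g p)), E. apply stereo_sphere.
Qed.

Lemma normal_difference_neq0 p : U p -> dot (n p) (n p) <> 0.
Proof. intros Hp. apply ndiff_neq; [apply N_unit | apply Nt_unit | apply tilde_iff_normals_neq, Hp]. Qed.

(** Locally [Nt] is an explicit smooth function of [gt] or, around a pole, of [1 / gt]. *)
Lemma Nt_smooth i : sm3 (img i (@whole S)) (lift i Nt).
Proof.
assert (K : forall z, img i (@whole S) z -> exists O' V, openC O' /\ O' z /\ sm3 O' V /\ locC z (fun y => V y = lift i Nt y)).
{ intros z (A & B & _). set (p := par i z) in *.
  assert (Hol : forall f : S -> C, near p (holomorphic_at f) -> exists r : posreal, hol (box z r) (lift i f)).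
  { intros f Hf. destruct (filter_and _ _ (dom_loc S i p A) (Hf i A)) as [r Hr]. rewrite B in Hr. exists r.
    intros y Hy. destruct (Hr y Hy) as ((Y1 & Y2) & Y3). destruct (Y3 i Y1) as [l Hl]. apply cder_is_derive in Hl.
    rewrite Y2 in Hl. exists l; exact Hl. }
  destruct (classic (gt p = infty)) as [E|E].
  - destruct (mero_pole _ _ gt p gt_meromorphic I E) as [M _].
    destruct (Hol _ (near_imp _ _ _ _ (fun q Q => proj2 Q) M)) as [r Hr].
    exists (box z r), (fun y => sphere_south (lift i (finpart (fun q => recip (gt q))) y)).
    split; [apply openC_ball|]. split; [apply ball_center|]. split; [apply sphere_south_sm; [apply openC_ball | exact Hr]|].
    assert (L := M i A). rewrite B in L. revert L. apply filter_imp. intros y (Y & _). symmetry. apply sphere_recip.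
    unfold lift, finpart. destruct (recip (gt (par i y))); [reflexivity | exfalso; apply Y; reflexivity].
  - assert (M := mero_finite _ _ gt p gt_meromorphic I E).
    destruct (Hol _ (near_imp _ _ _ _ (fun q Q => proj2 Q) M)) as [r Hr].
    exists (box z r), (fun y => sphere_pt (lift i (finpart gt) y)).
    split; [apply openC_ball|]. split; [apply ball_center|]. split; [apply sphere_pt_sm; [apply openC_ball | exact Hr]|].
    assert (L := M i A). rewrite B in L. revert L. apply filter_imp. intros y (Y & _).
    unfold lift, finpart, Nt. destruct (gt (par i y)); [reflexivity | exfalso; apply Y; reflexivity]. }
split; [|split]; intros m z Hz; destruct (K z Hz) as (O' & V & _ & Oz & (V1 & V2 & V3) & E);
  [apply ck_ext_loc with (2 := V1 m z Oz) | apply ck_ext_loc with (2 := V2 m z Oz) | apply ck_ext_loc with (2 := V3 m z Oz)];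
  revert E; apply filter_imp; intros y Y; rewrite Y; reflexivity.
Qed.

Lemma tilde_open : is_open U.
Proof.
intros p Hp. assert (Hn := normal_difference_neq0 p Hp). destruct (dom_cover p) as [i Hi]. apply (near_of_chart S i); [exact Hi|].
assert (HO := img_open S i _ W). assert (Hz := img_crd S i (@whole S) p I Hi).
assert (Sn := ndiff_sm _ _ _ HO (cm_smN _ _ _ (cm i)) (Nt_smooth i)).
assert (Sd := sm_dot _ HO _ _ Sn Sn).
assert (K := contR_neq_loc _ _ 0 (sm_cont _ _ _ Sd Hz)). cbv beta in K.
rewrite !(lift_crd S i _ p Hi) in K. specialize (K Hn). revert K. apply filter_imp. intros z A.
apply tilde_iff_normals_neq. intros E. apply A. unfold lift. rewrite E. unfold ndiff. unvec; ring.
Qed.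

Lemma Nt_derivative i p b : gt p = Some b -> dom i p ->
  dx3 i Nt p = sphere_der b (dz i (finpart gt) p) /\ dy3 i Nt p = sphere_der b (Ci * dz i (finpart gt) p)%C.
Proof.
intros Eb Hi. assert (M := mero_finite _ _ gt p gt_meromorphic I ltac:(rewrite Eb; discriminate)).
apply (finite_normal S Nt gt p i b); [| exact Eb | apply near_imp with (2 := M); tauto | apply (near_self _ _ _ M) | exact Hi].
intros j Hj. apply filter_forall. reflexivity.
Qed.

(** Both sides being continuous, they may be compared away from the poles of [g] and [h]. *)
Lemma eq_across_poles i z (A B : C -> R3) : img i (@whole S) z ->
  contR (fun y => X1 (A y)) z /\ contR (fun y => X2 (A y)) z /\ contR (fun y => X3 (A y)) z ->
  contR (fun y => X1 (B y)) z /\ contR (fun y => X2 (B y)) z /\ contR (fun y => X3 (B y)) z ->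
  (forall y, img i (@whole S) y -> g (par i y) <> infty -> h (par i y) <> infty -> (U (par i z) -> U (par i y)) -> A y = B y) ->
  A z = B z.
Proof.
intros Hz (A1 & A2 & A3) (B1 & B2 & B3) HE. assert (D := proj1 Hz). assert (E := proj1 (proj2 Hz)).
assert (L : locC z (fun y => y <> z -> A y = B y)).
{ assert (K1 := punctured_chart S i (par i z) _ D (finite_punctured (par i z))).
  assert (K2 : locC z (fun y => U (par i z) -> U (par i y))).
  { destruct (classic (U (par i z))) as [Y|Y].
    - assert (Q := tilde_open _ Y i D). rewrite E in Q. revert Q. apply filter_imp. auto.
    - apply filter_forall. intros y X. contradiction. }
  rewrite E in K1.
  generalize (filter_and _ _ (img_open S i _ W z Hz) (filter_and _ _ K1 K2)). apply filter_imp.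
  intros y (Y1 & Y2 & Y3) F. destruct (Y2 F) as [G1 G2]. apply HE; auto. }
assert (Tt : forall X : R3 -> R, contR (fun y => X (A y)) z -> contR (fun y => X (B y)) z -> X (A z) = X (B z)).
{ intros X c d. apply (cont_eq_dense _ _ z (fun y => y <> z) c d).
  - apply not_loc_neg. apply filter_forall. auto.
  - revert L. apply filter_imp. intros y Y Hy. rewrite (Y Hy). reflexivity. }
apply R3_eq; apply Tt; assumption.
Qed.

(** Where [g] and [h] are finite this is the conformality of [sphere_pt] composed with a holomorphic
    map. *)
Lemma Nt_weingarten i z : img i (@whole S) z -> D3y (lift i Nt) z = scal3 (-1) (cross (lift i Nt z) (D3x (lift i Nt) z)).
Proof.
intros Hz. assert (HO := img_open S i _ W). assert (SN := Nt_smooth i).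
apply (eq_across_poles i z (D3y (lift i Nt)) (fun y => scal3 (-1) (cross (lift i Nt y) (D3x (lift i Nt) y))) Hz).
- exact (sm3_cont _ _ z (sm3_D3y _ _ SN) Hz).
- exact (sm3_cont _ _ z (sm3_scal _ HO (fun _ => -1) _ (sm_const _ HO (-1)) (sm3_cross _ HO _ _ SN (sm3_D3x _ _ SN))) Hz).
- intros y (Y1 & Y2 & _) A B _.
  destruct (Nt_derivative i _ _ (gt_finite _ A B) Y1) as [E1 E2]. rewrite dx3_D3x, Y2 in E1. rewrite dy3_D3y, Y2 in E2.
  rewrite E1, E2, sphere_der_rot. unfold lift, Nt. rewrite (gt_finite _ A B). reflexivity.
Qed.

Lemma dx3_Z_isotropic i p a : dom i p -> g p = Some a -> dx3 i Z p = isotropic_re a (w i p).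
Proof.
intros Hi Ha. assert (HW := proj2 (proj2 (proj2 (proj1 (proj2 (proj2 HR)))))).
destruct (HW p i a I Hi Ha) as ((A & _) & (B & _) & (D & _)).
unfold isotropic_re. rewrite <- A, <- B, <- D. reflexivity.
Qed.

Lemma dz_gt i p a b : dom i p -> g p = Some a -> h p = Some b ->
  dz i (finpart gt) p = (RtoC k * (b * b) * w i p)%C.
Proof.
intros Hi Ha Hb. assert (Ri : riccati k w g h) by apply HR. specialize (Ri p i a b Hi Ha Hb).
assert (A := mero_finite _ _ g p g_meromorphic I ltac:(rewrite Ha; discriminate)).
assert (B := mero_finite _ _ h p h_meromorphic I ltac:(rewrite Hb; discriminate)).
destruct (near_self _ _ _ A) as [_ A2]. destruct (near_self _ _ _ B) as [_ B2].
destruct (A2 i Hi) as [l Hl], (B2 i Hi) as [m Hm]. apply cder_is_derive in Hl. apply cder_is_derive in Hm.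
assert (El : dz i (finpart g) p = l) by (apply cder_C_derive, Hl).
assert (Em : dz i (finpart h) p = m) by (apply cder_C_derive, Hm). rewrite El, Em in Ri.
transitivity (l + m)%C; [|rewrite Ri; cring].
apply cder_C_derive. apply cder_ext_loc with (2 := cder_plus _ _ _ _ _ Hl Hm).
generalize (near_and _ _ _ _ A B i Hi). apply filter_imp. intros z ((Z1 & _) & Z2 & _).
unfold finpart at 3. rewrite (gt_finite _ Z1 Z2). reflexivity.
Qed.

(** Where [g] and [h] are finite the Riccati equation reads [dgt = k h^2 w], which [refl_isotropic]
    turns into this relation. *)
Lemma dNt_mirror_dZ i z : img i U z ->
  D3x (lift i Nt) z = scal3 (- k * dot (lift i n z) (lift i n z)) (refl (lift i n z) (D3x (lift i Z) z)).
Proof.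
intros (D & E & Uz). assert (Hz : img i (@whole S) z) by (split; [exact D | split; [exact E | exact I]]).
assert (HO := img_open S i _ W). assert (SN := Nt_smooth i).
assert (Sn : sm3 (img i (@whole S)) (lift i n)) by exact (ndiff_sm _ _ _ HO (cm_smN _ _ _ (cm i)) SN).
assert (SZ := cm_smZ _ _ _ (cm i)).
(* The right-hand side without division, smooth on the whole chart. *)
set (Rhs := fun y => scal3 k (add3 (scal3 (- dot (lift i n y) (lift i n y)) (D3x (lift i Z) y)) (scal3 (2 * dot (D3x (lift i Z) y) (lift i n y)) (lift i n y)))).
assert (ER : forall y, U (par i y) -> Rhs y = scal3 (- k * dot (lift i n y) (lift i n y)) (refl (lift i n y) (D3x (lift i Z) y))).
{ intros y Uy. unfold Rhs. rewrite <- refl_expand by (apply normal_difference_neq0, Uy). apply R3_eq; unfold scal3, X1, X2, X3; simpl; ring. }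
rewrite <- (ER z Uz).
apply (eq_across_poles i z (D3x (lift i Nt)) Rhs Hz).
- exact (sm3_cont _ _ z (sm3_D3x _ _ SN) Hz).
- assert (Sdd := sm_dot _ HO _ _ Sn Sn). assert (Szd := sm_dot _ HO _ _ (sm3_D3x _ _ SZ) Sn).
  apply (sm3_cont (img i (@whole S)) Rhs z); [|exact Hz]. unfold Rhs.
  apply (sm3_scal _ HO (fun _ => k)); [apply sm_const, HO|]. apply sm3_add; [exact HO | |].
  + apply (sm3_scal _ HO (fun y => - dot (lift i n y) (lift i n y))); [apply (sm_opp _ HO), Sdd | apply sm3_D3x, SZ].
  + apply (sm3_scal _ HO (fun y => 2 * dot (D3x (lift i Z) y) (lift i n y))); [|exact Sn].
    apply (sm_mult _ HO (fun _ => 2)); [apply sm_const, HO | exact Szd].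
- intros y (Y1 & Y2 & _) A B Uy. specialize (Uy Uz). rewrite (ER y Uy).
  destruct (g (par i y)) as [a|] eqn:Ea; [|exfalso; apply A; reflexivity]. destruct (h (par i y)) as [b|] eqn:Eb; [|exfalso; apply B; reflexivity].
  assert (Eg := proj2 Hgt _ _ _ Ea Eb).
  destruct (Nt_derivative i _ _ Eg Y1) as [E1 _]. rewrite (dz_gt i _ a b Y1 Ea Eb) in E1.
  assert (E2 := dx3_Z_isotropic i _ a Y1 Ea). rewrite dx3_D3x, Y2 in E1, E2. rewrite E1, E2.
  assert (Hab : a <> (a + b)%C).
  { intro X. apply (proj1 (tilde_iff_gauss_neq _) Uy). rewrite Ea, Eg, <- X. reflexivity. }
  assert (En : lift i n y = ndiff (sphere_pt a) (sphere_pt (a + b)%C)) by (unfold lift, n, Nt; rewrite N_sphere, Ea, Eg; reflexivity).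
  rewrite En.
  replace (RtoC k * (b * b) * w i (par i y))%C with (RtoC k * ((a + b - a) * (a + b - a) * w i (par i y)))%C by cring.
  rewrite sphere_der_scal, (refl_isotropic a (a + b)%C _ Hab). fold (ndiff (sphere_pt a) (sphere_pt (a + b)%C)).
  set (m := ndiff (sphere_pt a) (sphere_pt (a + b)%C)). apply R3_eq; unfold scal3, X1, X2, X3; simpl; ring.
Qed.

Lemma img_tilde_whole i z : img i U z -> img i (@whole S) z.
Proof. intros (A & B & _). split; [exact A | split; [exact B | exact I]]. Qed.

Lemma sm3_restrict i (V : C -> R3) : sm3 (img i (@whole S)) V -> sm3 (img i U) V.
Proof. intros (A & B & D). split; [|split]; (eapply sm_sub; [exact (img_tilde_whole i) | assumption]). Qed.

Lemma Z_conf_min i : conf_min (img i U) (lift i Z) (lift i N).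
Proof.
destruct (cm i) as (A & B & D). split; [apply sm3_restrict, A|]. split; [apply sm3_restrict, B|].
intros z Hz. apply D, img_tilde_whole, Hz.
Qed.

Lemma Zt_conf_min i : conf_min (img i U) (lift i Zt) (lift i Nt) /\
  forall z, img i U z -> D3x (lift i Zt) z = scal3 (lift i T z) (refl (lift i n z) (D3x (lift i N) z)).
Proof.
assert (HO := img_open S i U tilde_open).
assert (SNt := sm3_restrict i _ (Nt_smooth i)).
assert (H1 : forall z, img i U z -> dot (lift i Nt z) (lift i Nt z) = 1) by (intros z _; apply Nt_unit).
assert (HWt : forall z, img i U z -> D3y (lift i Nt) z = scal3 (-1) (cross (lift i Nt z) (D3x (lift i Nt) z))) by (intros z Hz; apply Nt_weingarten, img_tilde_whole, Hz).
assert (Hn : forall z, img i U z -> dot (lift i n z) (lift i n z) <> 0) by (intros z (_ & _ & Uz); apply normal_difference_neq0, Uz).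
split.
- apply (transform_conf_min _ (lift i Z) (lift i N) (lift i Zt) (lift i Nt) (lift i T) k HO (Z_conf_min i) ratio_neq0 SNt H1 HWt Hn (dNt_mirror_dZ i));
    intros z Hz; reflexivity.
- intros z Hz.
  apply (transform_derivatives _ (lift i Z) (lift i N) (lift i Zt) (lift i Nt) (lift i T) k HO (Z_conf_min i) ratio_neq0 SNt H1 HWt Hn (dNt_mirror_dZ i));
    [intros y Hy; reflexivity | intros y Hy; reflexivity | exact Hz].
Qed.

Lemma offset_power p : U p -> T p <> 0 /\ T p * dot (n p) (n p) = - / k.
Proof.
intros Hp. assert (Hn := normal_difference_neq0 p Hp). assert (K := ratio_neq0). unfold T. split.
- apply Ropp_neq_0_compat, Rinv_neq_0_compat, Rmult_integral_contrapositive. split; assumption.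
- field. split; assumption.
Qed.

Lemma dZt_mirror_dN p i : U p -> dom i p -> dx3 i Zt p = scal3 (T p) (refl (n p) (dx3 i N p)).
Proof.
intros Hp Hi. assert (E := proj2 (Zt_conf_min i) _ (img_crd S i U p Hp Hi)). rewrite !(lift_crd S i _ p Hi) in E. exact E.
Qed.

Lemma dZt_zero_iff p i : U p -> dom i p -> (dx3 i Zt p = (0, 0, 0) <-> dx3 i N p = (0, 0, 0)).
Proof.
intros Hp Hi. rewrite (dZt_mirror_dN p i Hp Hi). destruct (offset_power p Hp) as [T0 _]. split; intros E.
- rewrite <- (refl_invol (n p) (dx3 i N p) (normal_difference_neq0 p Hp)).
  rewrite (scal3_cancel (T p) (refl (n p) (dx3 i N p)) (0, 0, 0) T0); [apply refl_zero|].
  rewrite E. apply R3_eq; unvec; ring.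
- rewrite E, refl_zero. apply R3_eq; unvec; ring.
Qed.

Lemma Zt_minimal : minimal U Zt Nt.
Proof.
apply (conf_min_minimal S U Zt Nt tilde_open (fun i => proj1 (Zt_conf_min i))).
intros p Hp. apply near_imp with (2 := near_and _ _ _ _ (tilde_open p Hp) (isolated_umbilics S Z N p HZ (proj1 (proj2 HR)))).
intros q (Uq & K) F. apply (immersed_dx3 S U Zt Nt q tilde_open (fun i => proj1 (Zt_conf_min i)) Uq).
intros i Hi E. apply (K F i Hi). apply (dZt_zero_iff q i Uq Hi), E.
Qed.

(** [dZt = T R dN] with [T] nonzero, and [dN] vanishes exactly at the umbilics. *)
Lemma Zt_immersed_iff p : U p -> (immersed_at Zt p <-> ~ umbilic_at Z N p).
Proof.
intros Hp. rewrite (immersed_dx3 S U Zt Nt p tilde_open (fun i => proj1 (Zt_conf_min i)) Hp).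
rewrite (umbilic_iff S _ Z N p W cm I (proj2 HZ p I)). split.
- intros K F. destruct (dom_cover p) as [i Hi]. apply (K i Hi). apply (dZt_zero_iff p i Hp Hi), F, Hi.
- intros K i Hi E. apply K. intros j Hj. apply (dx3_zero_N S _ Z N j i p W cm I Hj Hi). apply (dZt_zero_iff p i Hp Hi), E.
Qed.

Lemma Zt_data : has_transformed_data U k g h gt Zt Nt.
Proof.
assert (St : forall p, gt p = stereo (Nt p)) by (intros p; unfold Nt; symmetry; apply stereo_sphere).
exists (wform Zt). split.
- intros p i a b Hp Hi Ha Hb.
  assert (Eg := proj2 Hgt _ _ _ Ha Hb).
  assert (Hab : a <> (a + b)%C) by (intro X; apply (proj1 (tilde_iff_gauss_neq _) Hp); rewrite Ha, Eg, <- X; reflexivity).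
  assert (Hb0 : b <> 0%C) by (intro X; apply Hab; rewrite X; cring).
  assert (A := mero_finite _ _ g p g_meromorphic I ltac:(rewrite Ha; discriminate)).
  destruct (finite_normal S N g p i a) as [F1 _]; try assumption.
  { intros j Hj. apply filter_forall. intros z; apply N_sphere. }
  { apply near_imp with (2 := A). tauto. }
  { apply (near_self _ _ _ A). }
  assert (V := dZt_mirror_dN p i Hp Hi). rewrite F1 in V.
  rewrite (dx3_isotropic S U Zt Nt i p (a + b)%C tilde_open (proj1 (Zt_conf_min i)) Hp Hi) in V by (rewrite <- St; exact Eg).
  apply (f_equal (refl (n p))) in V. rewrite refl_scal, refl_invol in V by (apply normal_difference_neq0, Hp).
  assert (En : n p = ndiff (sphere_pt a) (sphere_pt (a + b)%C)) by (unfold n, Nt; rewrite N_sphere, Ha, Eg; reflexivity).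
  destruct (offset_power p Hp) as [_ Tn]. rewrite En in V, Tn.
  destruct (ndiff_swap (sphere_pt a) (sphere_pt (a + b)%C) (isotropic_re (a + b)%C (wform Zt i p))) as [N1 N2].
  rewrite <- N1 in V. rewrite <- N2 in Tn.
  (* Reflecting [dZt = T R dN] back exchanges the two surfaces, which gives [dg = k h^2] times the
     form of [Zt]. *)
  rewrite (pair_identity (a + b)%C a _ _ (T p) k (fun E => Hab (eq_sym E)) ratio_neq0 Tn V).
  cfield. split; [exact Hb0|]. intro F. apply RtoC_inj in F. exact (ratio_neq0 F).
- split; [apply (wform_holomorphic S U Zt Nt tilde_open (fun i => proj1 (Zt_conf_min i)))|].
  split; [intros p _; apply gt_meromorphic; exact I|]. split; [intros p _; apply St|].
  intros p i a Hp Hi Ha. apply (wform_weierstrass S U Zt Nt i p a tilde_open (proj1 (Zt_conf_min i)) Hp Hi). rewrite <- St. exact Ha.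
Qed.

Lemma Zt_pair : ribaucour_integrable_pair U Z N Zt Nt.
Proof.
split; [|split; [|split; [|split]]].
- destruct (conf_min_minimal S (@whole S) Z N W cm) as ((_ & A & B & D & E) & _).
  { intros p _. apply (proj1 (proj2 (proj2 (proj1 HZ))) p I). }
  split; [exact tilde_open|]. split; [|split; [|split]].
  + apply (smooth3_sm3 S U Z tilde_open). intros i. apply (Z_conf_min i).
  + apply (smooth3_sm3 S U N tilde_open). intros i. apply (Z_conf_min i).
  + intros p _. apply N_unit.
  + intros p i _ Hi. apply (E p i I Hi).
- apply Zt_minimal.
- intros p Hp. apply tilde_iff_normals_neq, Hp.
- exists T. intros p _. unfold Zt, n, ndiff. apply R3_eq; unfold add3, scal3, X1, X2, X3; simpl; ring.
- intros G Gt c Hc.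
  assert (EG : forall p, G p = g p) by (intros p; symmetry; apply g_stereo).
  assert (EGt : forall p, Gt p = gt p) by (intros p; unfold Gt, Nt; apply stereo_sphere).
  set (V := fun p => U p /\ G p <> infty /\ Gt p <> infty) in *.
  assert (HV : forall p, V p -> g p <> infty /\ gt p <> infty /\ h p <> infty /\ h p <> Some (RtoC 0)).
  { intros p (A & B & D). rewrite EG in B. rewrite EGt in D. split; [exact B|]. split; [exact D|]. split; [|apply A].
    intros E. apply D. apply gt_pole_of_h; assumption. }
  assert (HVo : is_open V).
  { intros p Hp. assert (Up := proj1 Hp). destruct (HV p Hp) as (A & B & _).
    apply near_imp with (2 := near_and _ _ _ _ (tilde_open p Up) (near_and _ _ _ _ (mero_finite _ _ g p g_meromorphic I A) (mero_finite _ _ gt p gt_meromorphic I B))).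
    intros q (K1 & (K2 & _) & K3 & _). split; [exact K1|]. rewrite EG, EGt. split; assumption. }
  assert (Hh : forall p, V p -> finpart h p = (finpart gt p - finpart g p)%C /\ finpart h p <> 0%C).
  { intros p Hp. destruct (HV p Hp) as (A & B & D & E). split.
    - assert (Q : finpart gt p = (finpart g p + finpart h p)%C) by (unfold finpart at 1; rewrite (gt_finite p A D); reflexivity).
      rewrite Q. generalize (finpart g p), (finpart h p). intros x y. cring.
    - unfold finpart. destruct (h p) as [b|]; [|exfalso; apply D; reflexivity]. simpl. intro X. apply E. rewrite X. reflexivity. }
  assert (Eg : forall p, finpart G p = finpart g p) by (intros p; unfold finpart; rewrite EG; reflexivity).
  assert (Egt : forall p, finpart Gt p = finpart gt p) by (intros p; unfold finpart; rewrite EGt; reflexivity).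
  assert (Q : zero_real_period (finpart gt) (finpart h) c).
  { assert (FA : forall p, V p -> holomorphic_at (finpart g) p).
    { intros p Hp. exact (proj2 (near_self _ _ _ (mero_finite _ _ g p g_meromorphic I (proj1 (HV p Hp))))). }
    assert (FB : forall p, V p -> holomorphic_at (finpart gt) p).
    { intros p Hp. exact (proj2 (near_self _ _ _ (mero_finite _ _ gt p gt_meromorphic I (proj1 (proj2 (HV p Hp)))))). }
    (* Passes from the periods of [dg / h], known from the Riccati setting, to those of
       [dgt / h]. *)
    apply (proj1 (period_equiv S V (finpart g) (finpart gt) (finpart h) HVo FA FB Hh c Hc)).
    assert (RP : riccati_periods g h) by apply HR. apply RP. destruct Hc as (C1 & C2 & C3).
    split; [exact C1|]. split; [|exact C3]. intros t Ht. destruct (HV _ (C2 t Ht)) as (A & _ & B & D). auto. }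
  destruct Hc as (C1 & C2 & _).
  apply (zero_real_period_ext S (finpart gt) _ (finpart h) _ c C1); [intros p; symmetry; apply Egt | | exact Q].
  intros t Ht. rewrite Eg, Egt. apply Hh, C2, Ht.
Qed.

Lemma transform_exists : exists Zt Nt : S -> R3,
  minimal (Sigma_tilde g h gt) Zt Nt /\
  (forall p, Sigma_tilde g h gt p -> (immersed_at Zt p <-> ~ umbilic_at Z N p)) /\
  has_transformed_data (Sigma_tilde g h gt) k g h gt Zt Nt /\
  ribaucour_integrable_pair (Sigma_tilde g h gt) Z N Zt Nt.
Proof.
exists Zt, Nt. split; [exact Zt_minimal|]. split; [exact Zt_immersed_iff|]. split; [exact Zt_data | exact Zt_pair].
Qed.
End Existence.

Theorem corollary3p4 (S : riemann_surface) :
  (forall (Z N : S -> R3) (w : form S) (g : S -> Chat) (k : R) (h : S -> Chat),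
     riccati_setting Z N w g k h ->
     exists gt : S -> Chat, meromorphic_sum g h gt /\
     exists Zt Nt : S -> R3,
       minimal (Sigma_tilde g h gt) Zt Nt /\
       (forall p, Sigma_tilde g h gt p ->
          (immersed_at Zt p <-> ~ umbilic_at Z N p)) /\
       has_transformed_data (Sigma_tilde g h gt) k g h gt Zt Nt /\
       ribaucour_integrable_pair (Sigma_tilde g h gt) Z N Zt Nt)
  /\
  (forall Z N Zt Nt : S -> R3,
     minimal_immersion (@whole S) Z N ->
     minimal (@whole S) Zt Nt ->
     ribaucour_integrable_pair (@whole S) Z N Zt Nt ->
     exists (w : form S) (g : S -> Chat) (k : R) (h gt : S -> Chat),
       riccati_setting Z N w g k h /\
       meromorphic_sum g h gt /\
       (forall p, Sigma_tilde g h gt p) /\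
       has_transformed_data (@whole S) k g h gt Zt Nt).
Proof.
split.
- intros Z N w g k h HR.
  destruct (meromorphic_sum_exists S g h) as [gt Hgt]; [apply HR | apply HR |].
  exists gt. split; [exact Hgt|]. exact (transform_exists S Z N w g k h gt HR Hgt).
- intros Z N Zt Nt HZ HZt HP. exact (converse S Z N Zt Nt HZ HZt HP).
Qed.
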